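(* Let $\{b_n\}$ be a sequence of vector fields on $(0,T)\times\mathbb{R}^N$, each satisfying the growth condition that $b_n(s,x)/(1+|x|)$ is the sum of a function in $L^1((0,T);L^1(\mathbb{R}^N))$ and a function in $L^1((0,T);L^\infty(\mathbb{R}^N))$, converging in $L^1_{\rm loc}([0,T]\times\mathbb{R}^N)$ to a vector field $b$ which satisfies the following three conditions: $\frac{b(s,x)}{1+|x|}=\tilde b_1(s,x)+\tilde b_2(s,x)$ with $\tilde b_1\in L^1((0,T);L^1(\mathbb{R}^N))$, $\tilde b_2\in L^1((0,T);L^\infty(\mathbb{R}^N))$; for every $i,j=1,\dots,N$, $\partial_jb^i=\sum_{k=1}^mS^i_{jk}g^i_{jk}$ in $\mathcal{D}'((0,T)\times\mathbb{R}^N)$, where $S^i_{jk}$ are singular integral operators of fundamental type in $\mathbb{R}^N$ (acting in $x$ only, independently of time) and $g^i_{jk}\in L^1((0,T)\times\mathbb{R}^N)$; and $b\in L^p_{\rm loc}([0,T]\times\mathbb{R}^N)$ for some $p>1$. Let $\mathcal{T}\subset[0,T)$ be a nonempty set of initial times (possibly a single time). Assume that for each $t\in\mathcal{T}$ there exist regular Lagrangian flows $X_n(\cdot,t,\cdot)$ and $X(\cdot,t,\cdot)$ starting at time $t$ associated to $b_n$ and to $b$ respectively, with compression constants $L_n$ and $L$ (not depending on $t\in\mathcal{T}$). Suppose that: - for some decomposition $b_n/(1+|x|)=\tilde b_{n,1}+\tilde b_{n,2}$ with $\tilde b_{n,1}\in L^1((0,T);L^1(\mathbb{R}^N))$ and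 $\tilde b_{n,2}\in L^1((0,T);L^\infty(\mathbb{R}^N))$, $\|\tilde b_{n,1}\|_{L^1(L^1)}+\|\tilde b_{n,2}\|_{L^1(L^\infty)}$ is equi-bounded in $n$; - the sequence $\{L_n\}$ is equi-bounded. Then $\{X_n\}$ converges to $X$ locally in measure in $\mathbb{R}^N$, uniformly with respect to $s$ and $t$; that is, for every $r>0$ and $\gamma>0$, $$\sup_{t\in\mathcal{T}}\ \sup_{s\in[t,T]}\mathscr{L}^N\big(\{x\in B_r:|X_n(s,t,x)-X(s,t,x)|>\gamma\}\big)\longrightarrow0\qquad\text{as }n\to\infty.$$
   Context: $\mathscr{L}^N$ is Lebesgue measure; $B_R$ is the ball of radius $R$ centered at the origin; $L^p_{\rm loc}([0,T]\times\mathbb{R}^N)$ means $L^p((0,T)\times B_R)$ for all $R>0$; $L^1(L^q)=L^1((0,T);L^q(\mathbb{R}^N))$. Singular integral operators of fundamental type: a singular kernel of fundamental type is $K\in\mathscr{S}'(\mathbb{R}^N)$ with $\widehat K\in L^\infty$, $K|_{\mathbb{R}^N\setminus\{0\}}\in C^1(\mathbb{R}^N\setminus\{0\})$, and constants $C_0,C_1,A_2\ge0$ with $|K(x)|\le C_0|x|^{-N}$, $|\nabla K(x)|\le C_1|x|^{-N-1}$ for $x\ne0$, and $|\int_{R_1<|x|<R_2}K\,dx|\le A_2$ for all $0<R_1<R_2<\infty$. The associated operator $S$ is $\widehat{Su}=\widehat K\widehat u$ (Fourier transform normalized so that $\widehat{K*u}=\widehat K\widehat u$), which for $u\in L^1$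 is a tempered distribution. Assumptions on a (measurable) vector field $b:(0,T)\times\mathbb{R}^N\to\mathbb{R}^N$: (R1) $\frac{b(s,x)}{1+|x|}=\tilde b_1(s,x)+\tilde b_2(s,x)$ with $\tilde b_1\in L^1((0,T);L^1(\mathbb{R}^N))$, $\tilde b_2\in L^1((0,T);L^\infty(\mathbb{R}^N))$. (R2) For every $i,j=1,\dots,N$, $\partial_jb^i=\sum_{k=1}^mS^i_{jk}g^i_{jk}$ in $\mathcal{D}'((0,T)\times\mathbb{R}^N)$, where $S^i_{jk}$ are singular integral operators of fundamental type in $\mathbb{R}^N$ (acting in $x$ only, independently of time) and $g^i_{jk}\in L^1((0,T)\times\mathbb{R}^N)$. (R3) $b\in L^p_{\rm loc}([0,T]\times\mathbb{R}^N)$ for some $p>1$. Function spaces: $L^0_{\rm loc}(\mathbb{R}^N)$ is the space of measurable functions (mod a.e. equality; here possibly $\mathbb{R}^N$-valued) with local convergence in measure ($u_n\to u$ iff $\mathscr{L}^N(\{x\in B_r:|u_n-u|>\gamma\})\to0$ for all $\gamma,r>0$); $\log L_{\rm loc}$ is the space of measurable $u$ with $\int_{B_r}\log(1+|u|)\,dx<\infty$ for all $r$; $\mathcal{B}(E,F)$ denotes bounded functions from $E$ to $F$ (for $F=\log L_{\rm loc}$: $\int_{B_r}\log(1+|u|)\,dx$ bounded uniformly on $E$ for each $r$). Regular Lagrangian flow relative to $b$ starting at time $t\in[0,T)$ ($b$ satisfying (R1)): a map $X\in C([t,T]_s;L^0_{\rm loc}(\mathbb{R}^N_x))\cap\mathcal{B}([t,T]_s;\log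 L_{\rm loc}(\mathbb{R}^N_x))$, $\mathbb{R}^N$-valued, such that (i) $\partial_s(\beta(X(s,x)))=\beta'(X(s,x))\,b(s,X(s,x))$ in $\mathcal{D}'((t,T)\times\mathbb{R}^N)$ for every $\beta\in C^1(\mathbb{R}^N;\mathbb{R})$ with $|\beta(z)|\le C(1+\log(1+|z|))$ and $|\beta'(z)|\le\frac{C}{1+|z|}$ for all $z$, for some constant $C$; (ii) $X(t,x)=x$ for a.e. $x$; (iii) there is $L\ge0$ (a compression constant of $X$) such that for every $s\in[t,T]$, $\mathscr{L}^N(\{x:X(s,x)\in B\})\le L\,\mathscr{L}^N(B)$ for every Borel $B\subset\mathbb{R}^N$. The value at time $s$ of the flow starting at time $t$ is written $X(s,t,x)$. *)

(* Defs.v *)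
From HB Require Import structures.
From mathcomp Require Import all_boot all_order all_algebra.
From mathcomp Require Import all_classical all_reals all_analysis.
From mathcomp Require Import ess_sup_inf measurable_realfun complex.
Set Implicit Arguments.
Unset Strict Implicit.
Unset Printing Implicit Defensive.
Import Order.TTheory GRing.Theory Num.Theory.
Import numFieldNormedType.Exports.
Local Open Scope classical_set_scope.
Local Open Scope ring_scope.

Definition rV_display : measure_display.
Proof. exact: default_measure_display. Qed.

Section rV_measurable.
Context {R : realType} {n : nat}.

Let coord (i : 'I_n) (x : 'rV[R]_n) : R := x ord0 i.

Let rV_set0 : g_sigma_preimage coord set0.
Proof. exact: sigma_algebra0. Qed.

Let rV_setC A : g_sigma_preimage coord A -> g_sigma_preimage coord (~` A).
Proof. exact: sigma_algebraC. Qed.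

Let rV_bigcup (F : _^nat) : (forall i, g_sigma_preimage coord (F i)) ->
  g_sigma_preimage coord (\bigcup_i (F i)).
Proof. exact: sigma_algebra_bigcup. Qed.

(* The product sigma-algebra; it is the Borel one, see [measurable_rV_borel]. *)
HB.instance Definition _ := @isMeasurable.Build rV_display
  'rV[R]_n (g_sigma_preimage coord) rV_set0 rV_setC rV_bigcup.

Lemma measurable_coord (i : 'I_n) :
  measurable_fun [set: 'rV[R]_n] (fun x : 'rV[R]_n => x ord0 i).
Proof.
move=> _ Y mY; rewrite setTI; apply: sub_sigma_algebra => /=.
rewrite -bigcup_seq/=; exists i => /=; first by rewrite mem_index_enum.
by exists Y => //; rewrite setTI.
Qed.

Lemma measurable_fun_coordP d (T : measurableType d) (f : T -> 'rV[R]_n) :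
  (forall i, measurable_fun [set: T] (fun t => f t ord0 i)) ->
  measurable_fun [set: T] f.
Proof.
move=> mf _ A mA; rewrite setTI.
have : preimage_set_system [set: T] f (g_sigma_preimage coord) `<=` measurable.
  rewrite -g_sigma_preimage_comp.
  apply: smallest_sub; first exact: sigma_algebra_measurable.
  rewrite -bigcup_seq; apply: bigcup_sub => i _ B [C mC <-]; exact: mf.
by apply; exists A => //; rewrite setTI.
Qed.

Lemma measurable_rV_borel : @measurable _ 'rV[R]_n = <<s @open 'rV[R]_n >>.
Proof.
apply/seteqP; split.
  apply: smallest_sub; first exact: smallest_sigma_algebra.
  rewrite -bigcup_seq; apply: bigcup_sub => i _ B [C mC <-].
  rewrite setTI.
  suff : @measurable _ R `<=` [set C | <<s @open 'rV[R]_n >> (coord i @^-1` C)].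
    exact.
  rewrite [X in X `<=` _](RGenOInfty.measurableE R).
  apply: smallest_sub.
    split => /=.
    - rewrite preimage_set0; exact: sigma_algebra0.
    - move=> A mA; rewrite setTD -preimage_setC; exact: sigma_algebraC.
    - move=> F mF; rewrite preimage_bigcup; exact: sigma_algebra_bigcup.
  move=> _ [a ->]; apply: sub_sigma_algebra.
  apply: open_comp; first by move=> x _; exact: coord_continuous.
  exact: interval_open.
apply: smallest_sub; first exact: sigma_algebra_measurable.
move=> U oU.
pose B (p : 'rV[rat]_n * nat) : set 'rV[R]_n :=
  \bigcap_(i in [set: 'I_n])
    coord i @^-1` ball (ratr (p.1 ord0 i) : R) p.2.+1%:R^-1.
have mB p : measurable (B p).
  rewrite /B bigcap_mkcond; apply: fin_bigcap_measurable => // i _.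
  rewrite mem_set//= -[X in measurable X]setTI; apply: measurable_coord => //.
  exact: measurable_ball.
have -> : U = \bigcup_(p in [set p | B p `<=` U]) B p.
  apply/seteqP; split => [x Ux|x [p /= pU]]; last exact: pU.
  have [e e0 eU] : exists2 e : R, 0 < e & ball x e `<=` U.
    by move: oU; rewrite openE => /(_ _ Ux) /nbhs_ballP[e /= e0 eU]; exists e.
  have [k ke] : exists k : nat, k.+1%:R^-1 < e / 2.
    have e20 : 0 < e / 2 by rewrite divr_gt0.
    have [k _ /(_ _ (leqnn _))] := near_infty_natSinv_lt (PosNum e20).
    by exists k.
  have /choice[q hq] : forall i, exists q : rat,
      ball (ratr q : R) k.+1%:R^-1 (x ord0 i).
    move=> i.
    have [] := @dense_rat R (ball (x ord0 i) k.+1%:R^-1).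
    - by exists (x ord0 i); apply: ballxx.
    - exact: ball_open.
    by move=> z [bq [q _ qE]]; exists q; rewrite qE; exact: ball_sym.
  exists (\row_i q i, k) => /=; last by move=> i _ /=; rewrite mxE.
  move=> y By; apply: eU; split => // i j; rewrite (ord1 i).
  have := By j Logic.I; rewrite /= mxE => yq.
  apply: le_ball (ball_triangle (ball_sym (hq j)) yq).
  by rewrite [leRHS]splitr lerD// ltW.
rewrite bigcup_mkcond; apply: countable_bigcupT_measurable => [//|p].
by case: ifP => _; [exact: mB|exact: measurable0].
Qed.

End rV_measurable.

Section lebesgue_rV.
Context {R : realType}.

Definition cons_rV n (p : R * 'rV[R]_n) : 'rV[R]_n.+1 :=
  row_mx (\row_(i < 1) p.1) p.2.

Definition uncons_rV n (x : 'rV[R]_n.+1) : R * 'rV[R]_n :=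
  (x ord0 ord0, \row_j x ord0 (lift ord0 j)).

Lemma cons_rVK n : cancel (@cons_rV n) (@uncons_rV n).
Proof.
move=> [a x]; rewrite /uncons_rV /cons_rV; congr pair.
  transitivity (row_mx (\row_(i < 1) a) x ord0 (lshift n (ord0 : 'I_1))).
    by congr (row_mx _ _ _ _); exact/val_inj.
  by rewrite row_mxEl mxE.
apply/rowP => j; rewrite mxE.
transitivity (row_mx (\row_(i < 1) a) x ord0 (rshift 1 j)).
  by congr (row_mx _ _ _ _); exact/val_inj.
by rewrite row_mxEr.
Qed.

Lemma measurable_cons_rV n :
  measurable_fun [set: R * 'rV[R]_n] (@cons_rV n).
Proof.
apply: measurable_fun_coordP => i; rewrite /cons_rV.
case: (@split_ordP 1 n i) => j ->.
  rewrite (_ : (fun t => _) = (fun t => t.1)); first exact: measurable_fst.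
  by apply: funext => t; apply: etrans (row_mxEl _ _ _ _) _; rewrite mxE.
rewrite (_ : (fun t => _) = (fun t : R * 'rV[R]_n => t.2 ord0 j)).
  by apply: (measurableT_comp (measurable_coord j)).
by apply: funext => t; exact: row_mxEr.
Qed.

Lemma measurable_uncons_rV n :
  measurable_fun [set: 'rV[R]_n.+1] (@uncons_rV n).
Proof.
apply/measurable_fun_pairP; split; first exact: measurable_coord.
apply: measurable_fun_coordP => i.
rewrite (_ : (fun t => _) = (fun t : 'rV[R]_n.+1 => t ord0 (lift ord0 i))).
  exact: measurable_coord.
by apply: funext => t /=; rewrite mxE.
Qed.

Section cons_measure.
Context {n : nat} (m : {sigma_finite_measure set 'rV[R]_n -> \bar R}).

Definition cons_measure : set 'rV[R]_n.+1 -> \bar R :=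
  pushforward (@lebesgue_measure R \x m)%E (@cons_rV n).

HB.instance Definition _ := Measure.copy cons_measure
  (measure_function_pushforward__canonical__measure_function_Measure
    (@lebesgue_measure R \x m)%E (@measurable_cons_rV n)).

Let cons_measure_sigma_finite : sigma_finite setT cons_measure.
Proof.
have /sigma_finiteP[F [TF ndF Foo]] := sigma_finiteT (@lebesgue_measure R).
have /sigma_finiteP[G [TG ndG Goo]] := sigma_finiteT m.
exists (fun k => @uncons_rV n @^-1` (F k `*` G k)).
  apply/esym; rewrite -subTset => x _ /=.
  have [k _ Fk] : (\bigcup_k F k) (uncons_rV x).1 by rewrite -TF.
  have [l _ Gl] : (\bigcup_k G k) (uncons_rV x).2 by rewrite -TG.
  exists (maxn k l) => //; split => /=.
  - by move: Fk; exact/subsetPset/ndF/leq_maxl.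
  - by move: Gl; exact/subsetPset/ndG/leq_maxr.
move=> k; have [mF Fk] := Foo k; have [mG Gk] := Goo k; split.
  rewrite -[X in measurable X]setTI; apply: measurable_uncons_rV => //.
  exact: measurableX.
rewrite /cons_measure /pushforward -comp_preimage.
rewrite (_ : _ \o _ = id); last by apply: funext => p /=; rewrite cons_rVK.
by rewrite preimage_id product_measure1E// lte_mul_pinfty// ge0_fin_numE.
Qed.

HB.instance Definition _ := @Measure_isSigmaFinite.Build _ _ _
  cons_measure cons_measure_sigma_finite.

End cons_measure.

(* [dirac 0] on the one-point space, then products with the one-dimensional
   Lebesgue measure, transported along [cons_rV]. *)
Fixpoint lebesgue_rV n : {sigma_finite_measure set 'rV[R]_n -> \bar R} :=
  match n with
  | 0 => \d_(0 : 'rV[R]_0)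
  | k.+1 => cons_measure (lebesgue_rV k)
  end.

End lebesgue_rV.

Section euclidean.
Context {R : realType} {n : nat}.
Implicit Types x y : 'rV[R]_n.

Definition dotp x y : R := \sum_i x ord0 i * y ord0 i.

(* The library norm on ['rV[R]_n] is the sup norm. *)
Definition enorm x : R := Num.sqrt (dotp x x).

Definition eball (r : R) : set 'rV[R]_n := [set x | enorm x < r].

Definition grad (f : 'rV[R]_n -> R) x : 'rV[R]_n := \row_j 'D_('e_j) f x.

End euclidean.

Section smoothness.
Context {R : realType} {V : normedModType R}.
Implicit Types (f : V -> R) (D : set V) (l : seq V).

Definition C1_on D f := forall x, D x ->
  differentiable f x /\ forall v, {for x, continuous ('D_v f)}.

Definition iterD l f : V -> R := foldr (fun v g => 'D_v g) f l.

(* C^oo: differentiability of every iterated derivative gives the continuity of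
   those of lower order. *)
Definition smooth f := forall l x, differentiable (iterD l f) x.

Definition compactly_supported_in (W : zmodType) D (f : V -> W) :=
  exists A : set V, [/\ compact A, A `<=` D & forall x, ~ A x -> f x = 0].

Definition test_function D f := smooth f /\ compactly_supported_in D f.

End smoothness.

Section complex_integral.
Context d (X : measurableType d) {R : realType}.
Variable mu : {measure set X -> \bar R}.
Implicit Types (D : set X) (f : X -> R[i]).

Definition cmeasurable D f :=
  measurable_fun D (fun x => complex.Re (f x)) /\
  measurable_fun D (fun x => complex.Im (f x)).

Definition cintegrable D f :=
  mu.-integrable D (fun x => (complex.Re (f x))%:E) /\
  mu.-integrable D (fun x => (complex.Im (f x))%:E).

Definition cint D f : R[i] :=
  Complex (\int[mu]_(x in D) complex.Re (f x))
          (\int[mu]_(x in D) complex.Im (f x)).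

End complex_integral.

Section tempered_distributions.
Context {R : realType} {n : nat}.
Local Notation E := 'rV[R]_n.
Local Notation C := R[i].
Local Notation leb := (@lebesgue_rV R n).
Implicit Types (f psi u : E -> C) (S : (E -> C) -> C).

Definition csmooth psi :=
  smooth (fun x => complex.Re (psi x)) /\ smooth (fun x => complex.Im (psi x)).

Definition citerD (l : seq E) psi (x : E) : C :=
  Complex (iterD l (fun y => complex.Re (psi y)) x)
          (iterD l (fun y => complex.Im (psi y)) x).

Definition schwartz psi := csmooth psi /\
  forall (m : nat) (l : seq E), exists M : R,
    forall x, (1 + enorm x) ^+ m * Normc.normc (citerD l psi x) <= M.

(* Distributions are functionals on all functions, of which only the values on
   test functions are meaningful. *)
Definition distribution := (E -> C) -> C.

(* Linearity on the Schwartz space, and continuity as domination by one of the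
   seminorms [max_(|alpha| <= m) sup_x (1 + |x|)^m |d^alpha psi x|], of which
   [M] is an arbitrary upper bound. *)
Definition tempered (S : distribution) :=
  (forall (a : C) f psi, schwartz f -> schwartz psi ->
     S (fun x => a * f x + psi x) = a * S f + S psi) /\
  exists (c : R) (m : nat), forall psi (M : R), schwartz psi ->
    (forall (l : seq 'I_n) x, (size l <= m)%N ->
       (1 + enorm x) ^+ m *
         Normc.normc (citerD [seq 'e_j | j <- l] psi x) <= M) ->
    Normc.normc (S psi) <= c * M.

(* No normalizing factor, so that [K * u] is mapped to the product of the
   transforms of [K] and [u]. *)
Definition fourier f (xi : E) : C :=
  cint leb setT (fun x => f x * Complex (cos (dotp x xi)) (- sin (dotp x xi))).

Definition fourier_dist (S : distribution) : distribution :=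
  fun psi => S (fourier psi).

Definition dist_of_fun f : distribution :=
  fun psi => cint leb setT (fun x => f x * psi x).

Definition Linfty f := cmeasurable setT f /\
  (ess_sup leb (fun x => (Normc.normc (f x))%:E) < +oo)%E.

(* [Khat] is the Fourier transform of [K], and [k] is its restriction to the
   complement of the origin. *)
Definition fundamental_kernel (K : distribution) (Khat : E -> C) :=
  [/\ tempered K,
      Linfty Khat /\
        (forall psi, schwartz psi ->
           fourier_dist K psi = dist_of_fun Khat psi) &
      exists k : E -> C,
      [/\ forall psi, csmooth psi ->
            compactly_supported_in (~` [set 0]) psi -> K psi = dist_of_fun k psi,
          C1_on (~` [set 0]) (fun x => complex.Re (k x)),
          C1_on (~` [set 0]) (fun x => complex.Im (k x)) &
          exists C0 C1 A2 : R, [/\ 0 <= C0, 0 <= C1, 0 <= A2,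
            forall x, x != 0 ->
              Normc.normc (k x) <= C0 / enorm x ^+ n /\
              Num.sqrt (enorm (grad (fun y => complex.Re (k y)) x) ^+ 2 +
                        enorm (grad (fun y => complex.Im (k y)) x) ^+ 2)
                <= C1 / enorm x ^+ n.+1 &
            forall R1 R2 : R, 0 < R1 -> R1 < R2 ->
              Normc.normc (cint leb [set x | R1 < enorm x < R2] k) <= A2]]].

Definition singular_integral_operator (S : (E -> C) -> distribution) :=
  exists K Khat, fundamental_kernel K Khat /\
    forall u, cintegrable leb setT u ->
      tempered (S u) /\
      forall psi, schwartz psi ->
        fourier_dist (S u) psi =
        dist_of_fun (fun xi => Khat xi * fourier u xi) psi.

End tempered_distributions.

Section vector_fields.
Context {R : realType} {n : nat}.
Local Notation E := 'rV[R]_n.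
Local Notation C := R[i].
Local Notation leb := (@lebesgue_rV R n).
Variable T : R.
Implicit Types b c : R -> E -> E.

Definition spacetime_measure :
    {measure set (measurableTypeR R * E) -> \bar R} :=
  (@lebesgue_measure R \x leb)%E.

Definition slab (t0 t1 : R) : set (R * E) := `]t0, t1[ `*` setT.

Definition measurable_field b :=
  measurable_fun (slab 0 T : set (measurableTypeR R * E))
    (fun z => b z.1 z.2).

Definition norm_L1L1 b : \bar R :=
  (\int[@lebesgue_measure R]_(s in `]0%R, T[)
     \int[leb]_x (enorm (b s x))%:E)%E.

Definition norm_L1Linfty b : \bar R :=
  (\int[@lebesgue_measure R]_(s in `]0%R, T[)
     ess_sup leb (fun x => (enorm (b s x))%:E))%E.

Definition growth_decomposition b b1 b2 :=
  [/\ measurable_field b1, (norm_L1L1 b1 < +oo)%E,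
      measurable_field b2, (norm_L1Linfty b2 < +oo)%E &
      {ae spacetime_measure, forall z, slab 0 T z ->
         (1 + enorm z.2)^-1 *: b z.1 z.2 = b1 z.1 z.2 + b2 z.1 z.2}].

Definition cond_R1 b := exists b1 b2, growth_decomposition b b1 b2.

(* The operators act on [g s] for each time [s]; the right-hand side is
   [\sum_k \int_0^T <S (g s), phi s> ds]. *)
Definition cond_R2 b :=
  exists (m : nat) (S : 'I_n -> 'I_n -> 'I_m -> (E -> C) -> distribution)
         (g : 'I_n -> 'I_n -> 'I_m -> R -> E -> R),
    (forall i j k, singular_integral_operator (S i j k) /\
       spacetime_measure.-integrable (slab 0 T)
         (fun z => (g i j k z.1 z.2)%:E)) /\
    forall i j (phi : R * E -> R), test_function (slab 0 T) phi ->
      real_complex R (- \int[spacetime_measure]_(z in slab 0 T)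
           (b z.1 z.2 ord0 i * 'D_(0, 'e_j) phi z)) =
      \sum_(k < m) cint (@lebesgue_measure R) `]0, T[
        (fun s => S i j k (fun x => real_complex R (g i j k s x))
                          (fun x => real_complex R (phi (s, x)))).

Definition cond_R3 b := exists p : R, 1 < p /\ forall r : R, 0 < r ->
  (\int[spacetime_measure]_(z in (`]0%R, T[ `*` eball r))
     (enorm (b z.1 z.2) `^ p)%:E < +oo)%E.

Definition cvg_L1loc (bn : nat -> R -> E -> E) b := forall r : R, 0 < r ->
  (\int[spacetime_measure]_(z in (`]0%R, T[ `*` eball r))
     (enorm (bn k z.1 z.2 - b z.1 z.2))%:E)%E @[k --> \oo] --> 0%E.

End vector_fields.

Section flows.
Context {R : realType} {n : nat}.
Local Notation E := 'rV[R]_n.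
Local Notation leb := (@lebesgue_rV R n).
Variable T : R.
Implicit Types (b X : R -> E -> E) (t : R).

Definition exceeds_in (r gamma : R) (u v : E -> E) : set E :=
  [set x | eball r x /\ gamma < enorm (u x - v x)].

Definition continuous_L0loc t X :=
  (forall s, s \in `[t, T] -> measurable_fun setT (X s)) /\
  forall s0, s0 \in `[t, T] -> forall r gamma : R, 0 < r -> 0 < gamma ->
    leb (exceeds_in r gamma (X s) (X s0)) @[s --> within `[t, T] (nbhs s0)]
      --> 0%E.

Definition bounded_logLloc t X := forall r : R, 0 < r ->
  exists M : R, forall s, s \in `[t, T] ->
    (\int[leb]_(x in eball r) (ln (1 + enorm (X s x)))%:E <= M%:E)%E.

Definition log_renormalization (beta : E -> R) :=
  C1_on setT beta /\
  exists c : R, forall z, `|beta z| <= c * (1 + ln (1 + enorm z)) /\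
                          enorm (grad beta z) <= c / (1 + enorm z).

(* Iterated integrals only depend on the class of each [X s] modulo a.e.
   equality; no joint measurability of [X] is required. *)
Definition renormalized_ODE b t X :=
  forall beta, log_renormalization beta ->
  forall phi : R * E -> R, test_function (slab t T) phi ->
    - (\int[@lebesgue_measure R]_(s in `]t, T[)
         (\int[leb]_x (beta (X s x) * 'D_(1, 0) phi (s, x)))) =
    \int[@lebesgue_measure R]_(s in `]t, T[)
        (\int[leb]_x (dotp (grad beta (X s x)) (b s (X s x)) * phi (s, x))).

Definition compression_constant t X (L : R) := 0 <= L /\
  forall s, s \in `[t, T] -> forall B : set E, measurable B ->
    (leb (X s @^-1` B) <= L%:E * leb B)%E.

Definition regular_lagrangian_flow b t X :=
  [/\ continuous_L0loc t X, bounded_logLloc t X, renormalized_ODE b t X,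
      {ae leb, forall x, X t x = x} &
      exists L, compression_constant t X L].

End flows.

(* Main.v *)
Require Import Defs.
From HB Require Import structures.
From mathcomp Require Import all_boot all_order all_algebra.
From mathcomp Require Import all_classical all_reals all_analysis.
From mathcomp Require Import ess_sup_inf measurable_realfun complex ring lra.
Set Implicit Arguments.
Unset Strict Implicit.
Unset Printing Implicit Defensive.
Import Order.TTheory GRing.Theory Num.Theory.
Import numFieldNormedType.Exports.
Local Open Scope classical_set_scope.
Local Open Scope ring_scope.

(* The singular integrals are never estimated on their own, so that no Calderon-Zygmund theory
   is needed. For a test function [phi] the action of a fundamental kernel on [phi((. - x) / rho)]
   is at most [C rho^N / (rho + |x - y|)^N]: near the diagonal by boundedness of the symbol, away
   from it by the size of the kernel. Approximating the densities [g] in [L^1] by smooth functions,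
   on which the operators are bounded, the gradients of the mollifications of [b] at scales at
   least [2^-m] are controlled by a small part, which loses only [\int_(|y| < Lam) dy / (2^-m + |y|)^N],
   of order [m], and a bounded part. Chaining along dyadic scales gives, for every [eps],
     [|b s x - b s y| <= (|x - y| + 2^-m) (W s x + W s y)]
   with [W] of integral at most [eps m + C_eps] over [(0, T) x B_Lam].
   Along two flows consider
     [\int_(B_r) (2 - p(X_n) - p(X) + k q(X_n) q(X) ln (1 + (|X_n - X|^2 / 4^-m)^2)) dx],
   where [p] and [q] are cutoffs in the variable [ln (1 + |x|^2)], so that [|x| |grad q|] is small,
   and [k] is of order [1 / m]. Where the flows differ by more than [gam] the integrand is at
   least 1, whereas its time derivative is bounded by the cutoff errors, by [2^m |b_n - b|] and by
   [(eps m + C_eps) / m]; let the cutoff scale, then [m], and finally [n] grow. *)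

(** * The Lebesgue measure of row vectors *)

(** The equation of a flow is available only after composition with functions of at most logarithmic
    growth, so the difference of the two flows cannot be differentiated directly: the functional is
    assembled from bounded functions of each flow, cut coordinates included. Its three nested levels
    [lam], [2 * lam], [4 * lam] make each function uncut on the support of the preceding one. The
    cutoffs live in a logarithmic variable because along a trajectory only [|b| / (1 + |x|)] is
    integrable, so their gradients must decay like [1 / (lam (1 + |x|))]. Compression constants turn
    integrals along the flows into integrals over space, and enlarging the time interval to [(0, T)]
    makes the bounds independent of the initial time. A flow is given time slice by time slice,
    without joint measurability; hence a jointly measurable representative is built, and some
    integrals are compared without measurability. The estimate on [b] holds for all pairs of points
    at almost every time: the chain of scales is finite and the error of its last mollification is
    itself a summand of [W], so no limit at individual points is taken. *)

Section change_of_variables.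
Context {R : realType}.
Local Notation mu := (@lebesgue_measure R).

Lemma ge0_integral_comp_scaling d (X : measurableType d)
    (m : {measure set X -> \bar R}) (phi : X -> X) (k : R) (f : X -> \bar R) :
  0 <= k -> measurable_fun setT phi ->
  (forall B, measurable B -> m (phi @^-1` B) = (k%:E * m B)%E) ->
  measurable_fun setT f -> (forall x, (0 <= f x)%E) ->
  (\int[m]_x f (phi x) = k%:E * \int[m]_x f x)%E.
Proof.
move=> k0 mphi mk mf f0.
have -> : (\int[m]_x f (phi x) = \int[pushforward m phi]_x f x)%E.
  by rewrite ge0_integral_pushforward// preimage_setT.
rewrite -(ge0_integral_mscale m measurableT (NngNum k0))//.
by apply: eq_measure_integral => B mB _; exact: mk.
Qed.

(** [|c|] times the push-forward agrees with the Lebesgue measure on the intervals []u, v]], which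
    determine it. For [c < 0] the preimage is closed on the left instead, which changes no
    length. *)
Lemma lebesgue_measure_aff (c a : R) (B : set R) : c != 0 -> measurable B ->
  mu ((fun x => c * x + a) @^-1` B) = (`|c|^-1%:E * mu B)%E.
Proof.
move=> c0 mB.
have mphi : measurable_fun setT (fun x : measurableTypeR R => c * x + a : measurableTypeR R).
  by apply: measurable_funD => //; exact: measurable_funM.
have k0 : 0 <= `|c| by [].
pose phi := fun x : measurableTypeR R => c * x + a : measurableTypeR R.
pose pm : {measure set (measurableTypeR R) -> \bar R} :=
  measure_function_pushforward__canonical__measure_function_Measure mu mphi.
pose nu : {measure set (measurableTypeR R) -> \bar R} := mscale (NngNum k0) pm.
have -> : mu B = nu B.
  apply: lebesgue_measure_unique => //.
  move=> _ [[u v]] _ <-.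
  have -> : nu `]u, v]%classic = (`|c|%:E * pm `]u, v]%classic)%E by [].
  have [cgt0|cle0|c00] := ltgtP 0 c; last by rewrite -c00 eqxx in c0.
  - have E : pm `]u, v]%classic = mu `](u - a) / c, (v - a) / c]%classic.
      congr (mu _); apply/seteqP; split => x /=; rewrite !in_itv/= /phi;
        by rewrite ltr_pdivrMr// ler_pdivlMr// ltrBlDr lerBrDr mulrC.
    rewrite E !lebesgue_measure_itv/= !lte_fin ltr_pM2r ?invr_gt0// ltrD2r.
    case: ifP => _; last by rewrite mule0.
    rewrite -!EFinB -EFinM; congr EFin; rewrite gtr0_norm//; field.
    by rewrite gt_eqF.
  - have cN : 0 < - c by rewrite oppr_gt0.
    have E : pm `]u, v]%classic = mu `[(v - a) / c, (u - a) / c[%classic.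
      congr (mu _); apply/seteqP; split => x /=; rewrite !in_itv/= /phi.
        move=> /andP[h1 h2]; rewrite ler_ndivrMr// ltr_ndivlMr//.
        by rewrite (mulrC x) ltrBlDr lerBrDr h1 h2.
      rewrite ler_ndivrMr// ltr_ndivlMr// (mulrC x) ltrBlDr lerBrDr => /andP[-> ->] //.
    rewrite E !lebesgue_measure_itv/= !lte_fin ltr_nM2r ?invr_lt0// ltrD2r.
    case: ifP => _; last by rewrite mule0.
    rewrite -!EFinB -EFinM; congr EFin; rewrite ltr0_norm//; field.
    by rewrite lt_eqF.
rewrite /nu /mscale /= muleA -EFinM mulVf ?normr_eq0// mul1e.
by [].
Qed.

Lemma measurable_aff n (c : R) (a : 'rV[R]_n) :
  measurable_fun setT (fun x : 'rV[R]_n => c *: x + a).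
Proof.
apply: measurable_fun_coordP => i.
rewrite (_ : (fun t => _) = (fun t : 'rV[R]_n => c * t ord0 i + a ord0 i)).
  apply: measurable_funD => //; apply: measurable_funM => //.
  exact: measurable_coord.
by apply: funext => t; rewrite !mxE.
Qed.

Lemma cons_rV_ord0 n (p : R * 'rV[R]_n) : cons_rV p ord0 ord0 = p.1.
Proof. by rewrite -[in RHS](cons_rVK p). Qed.

Lemma cons_rV_lift n (p : R * 'rV[R]_n) j :
  cons_rV p ord0 (lift ord0 j) = p.2 ord0 j.
Proof. by rewrite -[in RHS](cons_rVK p) [in RHS]mxE. Qed.

(** Induction on the dimension: the sections of the affine preimage are affine preimages, one
    dimension lower, of the sections of [B] at the moved first coordinate, which itself contributes
    one more factor [|c|^-1]. In dimension zero both sides are a Dirac mass at the only point. *)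
Lemma lebesgue_rV_aff n (c : R) (a : 'rV[R]_n) (B : set 'rV[R]_n) :
  c != 0 -> measurable B ->
  lebesgue_rV n ((fun x => c *: x + a) @^-1` B) =
  ((`|c|^-1 ^+ n)%:E * lebesgue_rV n B)%E.
Proof.
move=> c0; elim: n a B => [|n IH] a B mB.
  rewrite expr0 mul1e /= !diracE; congr ((_ _)%:R)%:E.
  apply/idP/idP; rewrite !inE /=; first by rewrite (_ : _ + _ = 0)//; exact: thinmx0.
  by rewrite (_ : c *: 0 + a = 0)//; exact: thinmx0.
have mcB : measurable (@cons_rV R n @^-1` B).
  by rewrite -[X in measurable X]setTI; exact: measurable_cons_rV.
pose h s : \bar R := lebesgue_rV n (xsection (@cons_rV R n @^-1` B) s).
have mh : measurable_fun setT h by exact: measurable_fun_xsection.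
rewrite /= /cons_measure /pushforward /product_measure1 /=.
pose a0 := a ord0 ord0; pose a' : 'rV[R]_n := \row_j a ord0 (lift ord0 j).
have affE s x : cons_rV (c * s + a0, c *: x + a') = c *: cons_rV (s, x) + a.
  apply/rowP => i; rewrite [RHS]mxE [X in _ = X + _]mxE.
  have [j ->|->] := unliftP ord0 i; last by rewrite !cons_rV_ord0.
  by rewrite !cons_rV_lift /= !mxE.
have step (s : R) : lebesgue_rV n (xsection (@cons_rV R n @^-1`
    ((fun x => c *: x + a) @^-1` B)) s)
    = ((`|c|^-1 ^+ n)%:E * h (c * s + a0)%R)%E.
  rewrite /h -(IH a'); last exact: measurable_xsection.
  congr (lebesgue_rV n _); apply/seteqP.
  by split=> x; rewrite /xsection /= !inE /= affE.
under eq_integral do rewrite step.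
rewrite ge0_integralZl//; last first.
  by apply: (@measurableT_comp _ _ _ _ _ _ h) => //;
    apply: measurable_funD => //; exact: measurable_funM.
rewrite (@ge0_integral_comp_scaling _ _ mu (fun s => c * s + a0) `|c|^-1 h)//.
  by rewrite muleA -EFinM -exprSr.
  by apply: measurable_funD => //; exact: measurable_funM.
by move=> A mA; exact: lebesgue_measure_aff.
Qed.

End change_of_variables.

(** * The sup norm and the Euclidean norm *)

Section rV_norms.
Context {R : realType} {n : nat}.
Local Notation E := 'rV[R]_n.
Local Notation leb := (@lebesgue_rV R n).

Lemma continuous_measurable_rV (f : E -> R) :
  continuous f -> measurable_fun setT f.
Proof.
move=> cf; apply: (measurability _ (RGenOpens.measurableE R)) => _ [_ [a [b ->] <-]].
rewrite setTI measurable_rV_borel; apply: sub_sigma_algebra.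
by apply: open_comp; [move=> x _; exact: cf|exact: interval_open].
Qed.

Lemma measurable_norm_rV : measurable_fun setT (fun x : E => `|x|).
Proof. by apply: continuous_measurable_rV => x; exact: norm_continuous. Qed.

Lemma rV_normE (x : E) : `|x| = \big[Num.max/0]_ij `|x ij.1 ij.2|.
Proof. exact: mx_normrE. Qed.

Lemma rV_norm_ltP (x : E) (r : R) :
  0 < r -> `|x| < r <-> forall i, `|x ord0 i| < r.
Proof.
move=> r0; rewrite rV_normE; split => [/bigmax_ltP[_ h] i|h].
  exact: (h (ord0, i)).
by apply/bigmax_ltP; split => // -[i j] _ /=; rewrite ord1.
Qed.

Lemma coord_le_norm (x : E) i : `|x ord0 i| <= `|x|.
Proof.
rewrite rV_normE.
exact: (@le_bigmax _ _ _ _ (fun ij : 'I_1 * 'I_n => `|x ij.1 ij.2|) (ord0, i)).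
Qed.

Lemma rV_norm_leP (x : E) (r : R) :
  0 <= r -> `|x| <= r <-> forall i, `|x ord0 i| <= r.
Proof.
move=> r0; split => [h i|h]; first exact: le_trans (coord_le_norm x i) h.
rewrite rV_normE; apply/bigmax_leP; split => // -[i j] _ /=.
by rewrite ord1.
Qed.

Lemma norm_le_enorm (x : E) : `|x| <= enorm x.
Proof.
apply/rV_norm_leP => [|i]; first exact: sqrtr_ge0.
rewrite -(ler_pXn2r (ltn0Sn 1)) ?nnegrE ?sqrtr_ge0//.
rewrite /enorm /dotp sqr_sqrtr; last by apply: sumr_ge0 => j _; rewrite -expr2 sqr_ge0.
rewrite real_normK ?num_real// (bigD1 i)//= -expr2 lerDl.
by apply: sumr_ge0 => j _; rewrite -expr2 sqr_ge0.
Qed.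

Lemma enorm_le_norm (x : E) : enorm x <= n%:R * `|x|.
Proof.
have h0 : 0 <= n%:R * `|x| by rewrite mulr_ge0.
rewrite -(ler_pXn2r (ltn0Sn 1)) ?nnegrE ?sqrtr_ge0//.
rewrite /enorm /dotp sqr_sqrtr; last by apply: sumr_ge0 => j _; rewrite -expr2 sqr_ge0.
have : \sum_i x ord0 i * x ord0 i <= \sum_(i < n) `|x| ^+ 2.
  apply: ler_sum => i _; rewrite -expr2 -real_normK ?num_real//.
  by rewrite ler_pXn2r ?nnegrE//; exact: coord_le_norm.
move/le_trans; apply; rewrite sumr_const card_ord exprMn -[leLHS]mulr_natl.
rewrite ler_wpM2r ?sqr_ge0//.
by rewrite -natrX ler_nat; case: (n) => // k; rewrite expnS leq_pmulr// expn_gt0.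
Qed.

Lemma enorm_le_sum (x : E) : enorm x <= \sum_i `|x ord0 i|.
Proof.
have h0 : 0 <= \sum_i `|x ord0 i| by apply: sumr_ge0.
rewrite -(ler_pXn2r (ltn0Sn 1)) ?nnegrE ?sqrtr_ge0//.
rewrite /enorm /dotp sqr_sqrtr; last by apply: sumr_ge0 => j _; rewrite -expr2 sqr_ge0.
rewrite expr2 mulr_suml; apply: ler_sum => i _.
rewrite -expr2 -real_normK ?num_real// expr2 ler_wpM2l//.
by rewrite (bigD1 i)//= lerDl sumr_ge0.
Qed.

Lemma enorm_ge0 (x : E) : 0 <= enorm x.
Proof. exact: sqrtr_ge0. Qed.

Lemma enorm_sq (x : E) : enorm x ^+ 2 = dotp x x.
Proof.
by rewrite /enorm sqr_sqrtr// sumr_ge0// => j _; rewrite -expr2 sqr_ge0.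
Qed.

Lemma dotpC (x y : E) : dotp x y = dotp y x.
Proof. by apply: eq_bigr => i _; rewrite mulrC. Qed.

Lemma dotpDl (x y z : E) : dotp (x + y) z = dotp x z + dotp y z.
Proof.
by rewrite /dotp -big_split; apply: eq_bigr => i _ /=; rewrite mxE mulrDl.
Qed.

Lemma dotpZl (c : R) (x z : E) : dotp (c *: x) z = c * dotp x z.
Proof.
by rewrite /dotp mulr_sumr; apply: eq_bigr => i _ /=; rewrite mxE mulrA.
Qed.

Lemma dotpDr (x y z : E) : dotp x (y + z) = dotp x y + dotp x z.
Proof. by rewrite dotpC dotpDl !(dotpC _ x). Qed.

Lemma dotpZr (c : R) (x z : E) : dotp x (c *: z) = c * dotp x z.
Proof. by rewrite dotpC dotpZl (dotpC _ x). Qed.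

(** The squared length of [(y.y) x - (x.y) y] is [(y.y) ((x.x) (y.y) - (x.y)^2)]. If [y.y = 0],
    every coordinate of [y] vanishes. *)
Lemma dotp_CS (x y : E) : `|dotp x y| <= enorm x * enorm y.
Proof.
have h0 : 0 <= enorm x * enorm y by rewrite mulr_ge0 ?enorm_ge0.
rewrite -(ler_pXn2r (ltn0Sn 1)) ?nnegrE// real_normK ?num_real//.
rewrite exprMn !enorm_sq.
have [y0|y0] := eqVneq (dotp y y) 0.
  suff -> : dotp x y = 0 by rewrite expr0n y0 mulr0.
  rewrite /dotp big1// => i _.
  have /eqP := y0; rewrite psumr_eq0; last by move=> j _; rewrite -expr2 sqr_ge0.
  by move=> /allP/(_ i); rewrite mem_index_enum => /(_ isT)/implyP/(_ isT)/eqP/eqP;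
    rewrite mulf_eq0 orbb => /eqP ->; rewrite mulr0.
have yp : 0 < dotp y y by rewrite lt0r y0 -enorm_sq sqr_ge0.
have : 0 <= dotp (dotp y y *: x - dotp x y *: y) (dotp y y *: x - dotp x y *: y).
  by rewrite -enorm_sq sqr_ge0.
rewrite -scaleNr dotpDl !dotpDr !dotpZl !dotpZr (dotpC y x).
set a := dotp x x; set b := dotp x y; set c := dotp y y.
rewrite (_ : _ + _ = c * (a * c - b ^+ 2)); last by ring.
by rewrite pmulr_rge0// subr_ge0.
Qed.

Lemma enormD (x y : E) : enorm (x + y) <= enorm x + enorm y.
Proof.
rewrite -(ler_pXn2r (ltn0Sn 1)) ?nnegrE ?addr_ge0 ?enorm_ge0//.
rewrite enorm_sq dotpDl !dotpDr (dotpC y x) sqrrD !enorm_sq.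
have := le_trans (ler_norm _) (dotp_CS x y); lra.
Qed.

Lemma enormZ (c : R) (x : E) : enorm (c *: x) = `|c| * enorm x.
Proof.
rewrite /enorm dotpZl dotpZr mulrA -expr2 sqrtrM ?sqr_ge0//.
by rewrite sqrtr_sqr.
Qed.

Lemma enormN (x : E) : enorm (- x) = enorm x.
Proof. by rewrite -scaleN1r enormZ normrN1 mul1r. Qed.

Lemma enorm0 : enorm (0 : E) = 0.
Proof. by rewrite -(scale0r (0 : E)) enormZ normr0 mul0r. Qed.

Lemma measurable_dotp d (T : measurableType d) (f g : T -> E) :
  measurable_fun setT f -> measurable_fun setT g ->
  measurable_fun setT (fun t => dotp (f t) (g t)).
Proof.
move=> mf mg; apply: measurable_sum => i; apply: measurable_funM.
  exact: (measurableT_comp (measurable_coord i)).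
exact: (measurableT_comp (measurable_coord i)).
Qed.

Lemma measurable_enorm : measurable_fun setT (@enorm R n).
Proof.
have ms : measurable_fun [set: R] (@Num.sqrt R).
  by apply: continuous_measurable_fun; exact: sqrt_continuous.
rewrite (_ : @enorm R n = Num.sqrt \o (fun x => dotp x x))//.
by apply: measurableT_comp => //; exact: measurable_dotp.
Qed.

Lemma measurable_lt_norm (r : R) : measurable [set x : E | `|x| < r].
Proof.
rewrite -[X in measurable X]setTI; have -> : [set x : E | `|x| < r] =
   (fun x : E => `|x|) @^-1` `]-oo, r[ by apply/seteqP; split => x /=; rewrite in_itv.
exact: measurable_norm_rV.
Qed.

End rV_norms.

Section cube_measure.
Context {R : realType}.

Lemma lebesgue_cube n (r : R) : 0 < r ->
  lebesgue_rV n [set x : 'rV[R]_n | `|x| < r] = ((2 * r) ^+ n)%:E.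
Proof.
move=> r0; elim: n => [|n IH].
  rewrite expr0 /= diracE mem_set//=; apply/rV_norm_ltP => // -[] //.
rewrite /= /cons_measure /pushforward.
have -> : (@cons_rV R n) @^-1` [set x | `|x| < r] =
    ball (0 : R) r `*` [set x : 'rV[R]_n | `|x| < r].
  apply/seteqP; split => -[s x] /=.
    move=> /(rV_norm_ltP _ r0) h; split.
      by have := h ord0; rewrite cons_rV_ord0 /ball /= sub0r normrN.
    by apply/rV_norm_ltP => // i; have := h (lift ord0 i); rewrite cons_rV_lift.
  rewrite /ball/= sub0r normrN => -[h1 /(rV_norm_ltP _ r0) h2].
  apply/rV_norm_ltP => // i; have [j ->|->] := unliftP ord0 i.
    by rewrite cons_rV_lift; exact: h2.
  by rewrite cons_rV_ord0.
rewrite product_measure1E//; [|exact: measurable_ball|exact: measurable_lt_norm].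
rewrite [X in (X * _)%E](lebesgue_measure_ball 0 (ltW r0)).
rewrite [X in (_ * X)%E]IH -EFinM exprS.
by congr (_ * _)%:E; rewrite mulr_natl.
Qed.

End cube_measure.

Section integral_aff.
Context {R : realType} {n : nat}.
Local Notation E := 'rV[R]_n.
Local Notation leb := (@lebesgue_rV R n).

Lemma ge0_integral_aff (c : R) (a : E) (f : E -> \bar R) : c != 0 ->
  measurable_fun setT f -> (forall x, 0 <= f x)%E ->
  (\int[leb]_x f (c *: x + a)%R = (`|c|^-1 ^+ n)%:E * \int[leb]_x f x)%E.
Proof.
move=> c0 mf f0.
apply: (@ge0_integral_comp_scaling _ _ _ leb (fun x => c *: x + a)) => //.
- exact: measurable_aff.
- by move=> B mB; exact: lebesgue_rV_aff.
Qed.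

Lemma integrable_aff (c : R) (a : E) (f : E -> \bar R) : c != 0 ->
  leb.-integrable setT f -> leb.-integrable setT (fun x => f (c *: x + a)).
Proof.
move=> c0 /integrableP[mf foo]; apply/integrableP; split.
  by apply: (measurableT_comp mf); exact: measurable_aff.
rewrite (@ge0_integral_aff c a (fun x => `|f x|%E))//.
  by rewrite lte_mul_pinfty// ?lee_fin ?exprn_ge0.
exact: measurableT_comp.
Qed.

Lemma integral_aff (c : R) (a : E) (f : E -> \bar R) : c != 0 ->
  leb.-integrable setT f ->
  (\int[leb]_x f (c *: x + a)%R = (`|c|^-1 ^+ n)%:E * \int[leb]_x f x)%E.
Proof.
move=> c0 intf; have [mf foo] := integrableP _ _ _ intf.
have k0 : (0 <= (`|c|^-1 ^+ n)%:E)%E :> bool by rewrite lee_fin exprn_ge0.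
rewrite [LHS]integralE [in RHS]integralE.
have E1 : (\int[leb]_x (fun y => f (c *: y + a)%R)^\+%E x =
    (`|c|^-1 ^+ n)%:E * \int[leb]_x f^\+%E x)%E.
  rewrite -(ge0_integral_aff a c0 (measurable_funepos mf)); last first.
    by move=> x; exact: funepos_ge0.
  by rewrite !unlock.
have E2 : (\int[leb]_x (fun y => f (c *: y + a)%R)^\-%E x =
    (`|c|^-1 ^+ n)%:E * \int[leb]_x f^\-%E x)%E.
  rewrite -(ge0_integral_aff a c0 (measurable_funeneg mf)); last first.
    by move=> x; exact: funeneg_ge0.
  by rewrite !unlock.
by rewrite E1 E2 [RHS]muleBr//; exact: integrable_add_def.
Qed.

Lemma Rintegral_aff (c : R) (a : E) (f : E -> R) : c != 0 ->
  leb.-integrable setT (EFin \o f) ->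
  \int[leb]_x f (c *: x + a) = `|c|^-1 ^+ n * \int[leb]_x f x.
Proof.
move=> c0 intf; rewrite /Rintegral (@integral_aff c a (EFin \o f))//.
by rewrite fineM//; exact: integrable_fin_num.
Qed.

Lemma Rintegral_shift (a : E) (f : E -> R) :
  leb.-integrable setT (EFin \o f) ->
  \int[leb]_x f (x + a) = \int[leb]_x f x.
Proof.
move=> intf; have := Rintegral_aff a (oner_neq0 R) intf.
rewrite normr1 invr1 expr1n mul1r => <-.
by apply: eq_Rintegral => x _; rewrite scale1r.
Qed.

End integral_aff.

(** * The truncated kernel and its integral over cubes *)

Section kappa.
Context {R : realType} {n : nat}.
Local Notation E := 'rV[R]_n.
Local Notation leb := (@lebesgue_rV R n).

(** The size of a kernel of fundamental type, regularized at scale [d]. The sup norm is used so that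
    its level sets are cubes, whose measure is known exactly. *)
Definition kappa (d : R) (z : E) : R := ((d + `|z|) ^+ n)^-1.

Lemma kappa_ge0 d z : 0 <= d -> 0 <= kappa d z.
Proof. by move=> d0; rewrite invr_ge0 exprn_ge0// addr_ge0. Qed.

(** If [2^(k-1) d <= t < 2^k d], then [(d + t)^-n <= 2^n (2^k d)^-n], so that the term of index [k]
    alone dominates; for [t < d] the first term does. *)
Lemma kappa_le_dyadic (d t : R) (m : nat) : 0 < d -> 0 <= t -> t < 2 ^+ m * d ->
  ((d + t) ^+ n)^-1 <=
  \sum_(k < m.+1) 2 ^+ n * ((2 ^+ k * d) ^+ n)^-1 * (t < 2 ^+ k * d)%R%:R.
Proof.
move=> d0 t0; elim: m => [|m IH] tm.
  rewrite big_ord1 expr0 mul1r -[X in t < X]mul1r -(expr0 2) tm mulr1.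
  rewrite -[leLHS]mul1r ler_pM ?invr_ge0 ?exprn_ge0 ?addr_ge0 ?(ltW d0)//.
    by rewrite exprn_ege1// ler1n.
  by rewrite lef_pV2 ?posrE ?exprn_gt0 ?ltr_wpDr// lerXn2r ?nnegrE ?addr_ge0 ?(ltW d0)// lerDl.
rewrite big_ord_recr/=; have [h|h] := ltP t (2 ^+ m * d).
  rewrite -[leLHS]addr0 lerD ?IH//.
  by rewrite !mulr_ge0 ?exprn_ge0// invr_ge0 exprn_ge0// mulr_ge0 ?exprn_ge0 ?(ltW d0).
rewrite -[leLHS]add0r lerD//.
  apply: sumr_ge0 => k _.
  by rewrite !mulr_ge0 ?exprn_ge0// invr_ge0 exprn_ge0// mulr_ge0 ?exprn_ge0 ?(ltW d0).
rewrite tm mulr1 exprS -mulrA exprMn invfM mulrA divff ?mul1r; last first.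
  by rewrite expf_neq0// pnatr_eq0.
have p0 : 0 < 2 ^+ m * d by rewrite mulr_gt0 ?exprn_gt0.
rewrite lef_pV2 ?posrE ?exprn_gt0 ?ltr_wpDr//.
rewrite lerXn2r ?nnegrE ?addr_ge0 ?(ltW d0) ?(ltW p0)//.
by rewrite (le_trans h)// lerDr ltW.
Qed.

Lemma measurable_fun_invr_gt0 d (T : measurableType d) (f : T -> R) :
  (forall x, 0 < f x) -> measurable_fun setT f ->
  measurable_fun setT (fun x => (f x)^-1).
Proof.
move=> f0 mf; rewrite (_ : (fun x => _) = (fun x => expR (- ln (f x)))).
  apply: (measurableT_comp (@measurable_expR R)).
  by apply: measurable_funN; apply: (measurableT_comp (@measurable_ln R)).
by apply/funext => x; rewrite expRN lnK// posrE.
Qed.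

Lemma measurable_kappa d (z : E) : 0 < d -> measurable_fun setT (fun x : E => kappa d (x - z)).
Proof.
move=> d0; apply: measurable_fun_invr_gt0.
  by move=> x; rewrite exprn_gt0// ltr_wpDr.
have m1 : measurable_fun setT (fun x : E => (d + `|x - z|) ^+ n).
  apply: measurable_funX; apply: measurable_funD => //.
  apply: (measurableT_comp measurable_norm_rV).
  have := measurable_aff 1 (- z); apply: eq_measurable_fun => x _.
  by rewrite scale1r.
exact: m1.
Qed.

Lemma lebesgue_cube_at (z : E) (r : R) : 0 < r ->
  leb [set x | `|x - z| < r] = ((2 * r) ^+ n)%:E.
Proof.
move=> r0; have := @lebesgue_rV_aff R n 1 (- z) [set x | `|x| < r] (oner_neq0 R) (measurable_lt_norm r).
rewrite normr1 invr1 expr1n mul1e (lebesgue_cube n r0) => <-.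
by congr (leb _); apply/seteqP; split => x /=; rewrite scale1r.
Qed.

Lemma measurable_cube_at (z : E) (r : R) : measurable [set x | `|x - z| < r].
Proof.
have -> : [set x | `|x - z| < r] = (fun x => 1 *: x + - z) @^-1` [set x | `|x| < r].
  by apply/seteqP; split => x /=; rewrite scale1r.
rewrite -[X in measurable X]setTI; apply: measurable_aff => //.
exact: measurable_lt_norm.
Qed.

(** Each of the [m + 1] dyadic cubes contributes at most [2^n p^-n (2 p)^n = 4^n], where [p] is its
    half side; at distance one and beyond, the kernel is at most one and contributes at most the
    measure of the domain. This linear growth in [m] is what the logarithmic estimate rests on. *)
Lemma integral_kappa (m : nat) (r : R) (z : E) : 0 < r ->
  (\int[leb]_(x in [set x : E | (`|x| < r)%R]) (kappa (2 ^- m) (x - z))%:E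
    <= (4 ^+ n * m.+1%:R + (2 * r) ^+ n)%:E)%E.
Proof.
move=> r0; have d0 : 0 < 2 ^- m :> R by rewrite invr_gt0 exprn_gt0.
set D := [set x : E | `|x| < r].
have mD : measurable D by exact: measurable_lt_norm.
pose A k := [set x : E | `|x - z| < 2 ^+ k * 2 ^- m].
pose c k : R := 2 ^+ n * ((2 ^+ k * 2 ^- m) ^+ n)^-1.
have c0 k : 0 <= c k.
  by rewrite mulr_ge0 ?exprn_ge0// invr_ge0 exprn_ge0// mulr_ge0 ?exprn_ge0 ?(ltW d0).
have kap x : kappa (2 ^- m) (x - z) <= \sum_(k < m.+1) c k * \1_(A k) x + 1.
  have [h|h] := ltP `|x - z| (2 ^+ m * 2 ^- m).
    apply: le_trans (kappa_le_dyadic d0 (normr_ge0 _) h) _.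
    rewrite -[leLHS]addr0 lerD//; apply: ler_sum => k _.
    rewrite -/(c k) ler_wpM2l// indicE.
    by have [h'|h'] := boolP (`|x - z| < _); [rewrite mem_set|].
  rewrite -[leLHS]add0r lerD//.
    by apply: sumr_ge0 => k _; rewrite mulr_ge0.
  move: h; rewrite divff ?expf_neq0 ?pnatr_eq0// => h.
  rewrite /kappa invf_le1 ?exprn_gt0 ?ltr_wpDr//.
  by rewrite exprn_ege1// (le_trans h)// lerDr ltW.
apply: (@le_trans _ _ (\int[leb]_(x in D) (\sum_(k < m.+1) (c k * \1_(A k) x)%:E + 1))%E).
  apply: ge0_le_integral => //.
  - by move=> x _; rewrite lee_fin kappa_ge0// ltW.
  - by apply/measurable_EFinP/measurable_funTS; exact: measurable_kappa.
  - apply: emeasurable_funD => //; apply: emeasurable_sum => k.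
    apply/measurable_EFinP/measurable_funM => //; apply: measurable_funTS.
    by apply: measurable_indic; exact: measurable_cube_at.
  - by move=> x _; rewrite sumEFin -EFinD lee_fin kap.
have mA k : measurable (A k) by exact: measurable_cube_at.
have mi k : measurable_fun D (fun x => (\1_(A k) x : R)).
  by apply: measurable_funTS; exact: measurable_indic.
have mk k : measurable_fun D (fun x => (c k * \1_(A k) x)%:E).
  by apply/measurable_EFinP; apply: measurable_funM.
have k0 k x : D x -> (0 <= (c k * \1_(A k) x)%:E)%E.
  by move=> _; rewrite lee_fin mulr_ge0.
have mS : measurable_fun D (fun x => \sum_(k < m.+1) (c k * \1_(A k) x)%:E)%E.
  exact: emeasurable_sum.
have nS x : D x -> (0 <= \sum_(k < m.+1) (c k * \1_(A k) x)%:E)%E.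
  by move=> Dx; rewrite sume_ge0// => k _; exact: k0.
rewrite ge0_integralD//.
rewrite integral_cst// mul1e [X in (_ + X)%E](lebesgue_cube n r0) EFinD leeD2r//.
rewrite ge0_integral_sum//; last by move=> i x; exact: k0.
rewrite mulr_natr -[m.+1 in leRHS]card_ord -sumr_const -sumEFin.
apply: lee_sum => k _.
under eq_integral do rewrite EFinM.
have mi' : measurable_fun D (fun x => (\1_(A k) x : R)%:E) by apply/measurable_EFinP; exact: mi.
rewrite ge0_integralZl ?lee_fin//.
rewrite integral_indic//.
have p0 : 0 < 2 ^+ k * 2 ^- m :> R by rewrite mulr_gt0 ?exprn_gt0.
apply: (@le_trans _ _ ((c k)%:E * leb (A k))%E).
  rewrite lee_wpmul2l ?lee_fin//; apply: le_measure; rewrite ?inE//.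
  exact: measurableI.
rewrite lebesgue_cube_at// -EFinM lee_fin /c; set p := 2 ^+ k * 2 ^- m.
rewrite [(2 * p) ^+ n]exprMn mulrACA mulVf ?expf_neq0 ?gt_eqF//.
by rewrite mulr1 -exprMn -natrM.
Qed.

End kappa.

(** * Real-valued integrals: domination, sums, Fubini *)

Section real_integrals.
Context d (T : measurableType d) (R : realType) (mu : {measure set T -> \bar R}).
Context (D : set T).
Context (mD : measurable D).
Implicit Types f g p w : T -> R.

Lemma integrable_dominated f g : measurable_fun D f -> (forall x, D x -> `|f x| <= g x) ->
  mu.-integrable D (EFin \o g) -> mu.-integrable D (EFin \o f).
Proof.
move=> mf fg ig; apply: (le_integrable mD _ _ ig).
  exact/measurable_EFinP.
by move=> x Dx /=; rewrite lee_fin (le_trans (fg x Dx))// ler_norm.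
Qed.

Lemma integrable_measurable f : mu.-integrable D (EFin \o f) -> measurable_fun D f.
Proof. by move=> /integrableP[/measurable_EFinP]. Qed.

Lemma integrable_Mbounded p w (K : R) : measurable_fun D w ->
  (forall x, D x -> `|w x| <= K) -> mu.-integrable D (EFin \o p) ->
  mu.-integrable D (EFin \o (fun x => p x * w x)).
Proof.
move=> mw wK ip; apply: (@integrable_dominated _ (fun x => `|p x| * K)).
- by apply: measurable_funM => //; exact: integrable_measurable.
- by move=> x Dx; rewrite normrM ler_wpM2l// wK.
- rewrite (_ : EFin \o _ = fun x => (K%:E * (EFin \o (fun x => `|p x|%R)) x)%E).
    by apply: integrableZl => //; exact: (integrable_norm ip).
  by apply/funext => x /=; rewrite -EFinM mulrC.
Qed.

Lemma Rintegral_dct (f_ : nat -> T -> R) f g :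
  (forall k, measurable_fun D (f_ k)) ->
  (forall x, D x -> f_ k x @[k --> \oo] --> f x) ->
  (forall k x, D x -> `|f_ k x| <= g x) -> mu.-integrable D (EFin \o g) ->
  \int[mu]_(x in D) f_ k x @[k --> \oo] --> \int[mu]_(x in D) f x.
Proof.
move=> mf_ f_f f_g ig.
have mf : measurable_fun D f by exact: (measurable_fun_cvg mf_).
have [] := @dominated_convergence _ _ _ mu D mD (fun k => EFin \o f_ k) (EFin \o f) (EFin \o g).
- by move=> k; exact/measurable_EFinP.
- exact/measurable_EFinP.
- by apply/aeW => x Dx; apply: cvg_EFin; [exact: nearW|exact: f_f].
- exact: ig.
- by apply/aeW => x k Dx; rewrite lee_fin f_g.
move=> intf _ cv; apply: fine_cvg.
rewrite fineK; last exact: (integrable_fin_num mD intf).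
exact: cv.
Qed.

Lemma integrable_Rsum (I : Type) (s : seq I) (F : I -> T -> R) :
  (forall i, mu.-integrable D (EFin \o F i)) ->
  mu.-integrable D (EFin \o (fun x => \sum_(i <- s) F i x)).
Proof.
move=> iF; rewrite (_ : EFin \o _ = fun x => (\sum_(i <- s) (EFin \o F i) x)%E).
  exact: integrable_sum.
by apply/funext => x /=; rewrite sumEFin.
Qed.

Lemma Rintegral_sum (I : Type) (s : seq I) (F : I -> T -> R) :
  (forall i, mu.-integrable D (EFin \o F i)) ->
  \int[mu]_(x in D) (\sum_(i <- s) F i x) = \sum_(i <- s) \int[mu]_(x in D) F i x.
Proof.
move=> iF; elim: s => [|i s IH].
  under eq_Rintegral do rewrite big_nil.
  by rewrite big_nil Rintegral_cst// mul0r.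
under eq_Rintegral do rewrite big_cons.
by rewrite RintegralD ?big_cons ?IH//; exact: integrable_Rsum.
Qed.

Lemma integrable_Zl f (c : R) : mu.-integrable D (EFin \o f) ->
  mu.-integrable D (EFin \o (fun x => c * f x)).
Proof.
move=> intf; rewrite (_ : EFin \o _ = fun x => (c%:E * (EFin \o f) x)%E).
  exact: integrableZl.
by apply/funext => x /=; rewrite -EFinM.
Qed.

Lemma integrable_B f g : mu.-integrable D (EFin \o f) -> mu.-integrable D (EFin \o g) ->
  mu.-integrable D (EFin \o (fun x => f x - g x)).
Proof.
move=> intf ig; rewrite (_ : EFin \o _ = (EFin \o f) \- (EFin \o g))%E; first exact: integrableB.
by apply/funext => x /=; rewrite EFinB.
Qed.

Lemma integrable_D f g : mu.-integrable D (EFin \o f) -> mu.-integrable D (EFin \o g) ->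
  mu.-integrable D (EFin \o (fun x => f x + g x)).
Proof.
move=> intf ig; rewrite (_ : EFin \o _ = (EFin \o f) \+ (EFin \o g))%E; first exact: integrableD.
by apply/funext => x /=; rewrite EFinD.
Qed.

End real_integrals.

Section fubini_kernel.
Context d1 d2 (T1 : measurableType d1) (T2 : measurableType d2) (R : realType).
Context (m1 : {sigma_finite_measure set T1 -> \bar R})
          (m2 : {sigma_finite_measure set T2 -> \bar R}).
Implicit Types (p : T1 -> R) (q : T2 -> R) (w : T1 * T2 -> R).

Lemma integrable_prod_kernel p q w (K : R) :
  m1.-integrable setT (EFin \o p) -> m2.-integrable setT (EFin \o q) ->
  measurable_fun setT w -> (forall z, `|w z| <= K) ->
  (m1 \x m2)%E.-integrable setT (EFin \o (fun z => p z.1 * q z.2 * w z)).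
Proof.
move=> ip iq mw wK.
have mp := integrable_measurable ip; have mq := integrable_measurable iq.
have mpq : measurable_fun setT (fun z : T1 * T2 => p z.1 * q z.2).
  by apply: measurable_funM; apply: measurableT_comp.
have K0 (z : T1 * T2) : 0 <= K by apply: le_trans (wK z).
apply: (@integrable_Mbounded _ _ _ (m1 \x m2)%E setT measurableT (fun z => p z.1 * q z.2) w K) => //.
apply/integrable12ltyP; first exact/measurable_EFinP.
under eq_integral => x _.
  under eq_integral => y _ do rewrite /= normrM EFinM.
  rewrite ge0_integralZl//; last by apply/measurable_EFinP; exact: measurableT_comp.
  over.
rewrite ge0_integralZr//.
- apply: lte_mul_pinfty; first exact: integral_ge0.
    by apply: integrable_fin_num => //; exact: (integrable_norm ip).
  by have /integrableP[_] := iq.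
- by apply/measurable_EFinP; exact: measurableT_comp.
- exact: integral_ge0.
Qed.

(** [Rintegral] is [fine] of the difference of the integrals of the positive and negative parts,
    both measurable by Tonelli, whether or not the sections are integrable. *)
Lemma measurable_Rintegral_section w : measurable_fun setT w ->
  measurable_fun setT (fun x => \int[m2]_y w (x, y)).
Proof.
move=> mw.
have mE : measurable_fun setT (EFin \o w) by exact/measurable_EFinP.
rewrite /Rintegral; apply: (measurableT_comp (@fine_measurable R setT measurableT)) => //=.
rewrite (_ : (fun x => _) = (fun x => (\int[m2]_y (EFin \o w)^\+ (x, y)) -
   (\int[m2]_y (EFin \o w)^\- (x, y)))%E); last first.
  apply/funext => x; rewrite integralE; congr (_ - _)%E; apply: eq_integral => y _;
    by rewrite !unlock.
apply: emeasurable_funB.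
  apply: measurable_fun_fubini_tonelli_F; [exact: measurable_funepos|exact: funepos_ge0].
apply: measurable_fun_fubini_tonelli_F; [exact: measurable_funeneg|exact: funeneg_ge0].
Qed.

Lemma Fubini_kernel p q w (K : R) :
  m1.-integrable setT (EFin \o p) -> m2.-integrable setT (EFin \o q) ->
  measurable_fun setT w -> (forall z, `|w z| <= K) ->
  \int[m1]_x (p x * \int[m2]_y (q y * w (x, y))) =
  \int[m2]_y (q y * \int[m1]_x (p x * w (x, y))).
Proof.
move=> ip iq mw wK.
have H := Fubini (integrable_prod_kernel ip iq mw wK).
have mw1 x : measurable_fun setT (fun y => w (x, y)).
  by apply: measurableT_comp => //; exact: pair1_measurable.
have mw2 y : measurable_fun setT (fun x => w (x, y)).
  by apply: measurableT_comp => //; exact: pair2_measurable.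
have i1 x : m2.-integrable setT (EFin \o (fun y => q y * w (x, y))).
  exact: (@integrable_Mbounded _ _ _ m2 setT measurableT q _ K).
have i2 y : m1.-integrable setT (EFin \o (fun x => p x * w (x, y))).
  exact: (@integrable_Mbounded _ _ _ m1 setT measurableT p _ K).
rewrite /Rintegral; congr fine.
have -> : (\int[m1]_x (p x * fine (\int[m2]_y (q y * w (x, y))%:E))%:E =
    \int[m1]_x \int[m2]_y (p x * q y * w (x, y))%:E)%E.
  apply: eq_integral => x _; rewrite EFinM fineK; last exact: (integrable_fin_num measurableT (i1 x)).
  rewrite -integralZl//; last exact: (i1 x).
  by apply: eq_integral => y _; rewrite -EFinM mulrA.
rewrite H; apply: eq_integral => y _ /=.
rewrite EFinM fineK; last exact: (integrable_fin_num measurableT (i2 y)).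
rewrite -integralZl//; last exact: (i2 y).
by apply: eq_integral => x _; rewrite -EFinM; congr EFin; ring.
Qed.

End fubini_kernel.

(** * Smooth functions and bumps *)

Section smooth_functions.
Context {R : realType}.

(** Iterated derivatives never leave a class that is stable under directional derivatives; each
    smoothness proof below exhibits such a class. *)
Lemma smooth_coind (V : normedModType R) (P : (V -> R) -> Prop) :
  (forall f, P f -> (forall x, differentiable f x) /\ forall v, P ('D_v f)) ->
  forall f, P f -> smooth f.
Proof.
move=> h f Pf l; suff : P (Defs.iterD l f) by move=> /h[].
by elim: l => //= v l /h[_]; apply.
Qed.

Lemma smooth_differentiable (V : normedModType R) (f : V -> R) x :
  smooth f -> differentiable f x.
Proof. by move=> /(_ [::] x). Qed.

Lemma smooth_derive (V : normedModType R) (f : V -> R) v :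
  smooth f -> smooth ('D_v f).
Proof. by move=> sf l x; have := sf (rcons l v) x; rewrite /Defs.iterD foldr_rcons. Qed.

Lemma smooth_continuous (V : normedModType R) (f : V -> R) : smooth f -> continuous f.
Proof. by move=> sf x; apply: differentiable_continuous; exact: smooth_differentiable. Qed.

Lemma smooth_cst (V : normedModType R) (c : R) : smooth (fun _ : V => c).
Proof.
apply: (@smooth_coind _ (fun f => exists c, f = fun _ => c)); last by exists c.
move=> _ [a ->]; split => [x|v]; first exact: differentiable_cst.
by exists 0; apply/funext => x; rewrite derive_cst.
Qed.

(** The algebra generated by [P]. By the product rule it is stable under derivatives as soon as it
    contains the derivatives of its generators, which is how products and inverses are treated. *)
Inductive fun_alg (V : normedModType R) (P : (V -> R) -> Prop) : (V -> R) -> Prop :=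
| fun_alg_base f of P f : fun_alg P f
| fun_alg_add f g of fun_alg P f & fun_alg P g : fun_alg P (f + g)
| fun_alg_mul f g of fun_alg P f & fun_alg P g : fun_alg P (f * g).

Lemma smooth_fun_alg (V : normedModType R) (P : (V -> R) -> Prop) :
  (forall f, P f -> (forall x, differentiable f x) /\ forall v, fun_alg P ('D_v f)) ->
  forall f, fun_alg P f -> smooth f.
Proof.
move=> HP; apply: smooth_coind => f; elim=> [{}f /HP//|{}f g _ [df Df] _ [dg Dg]|{}f g af [df Df] ag [dg Dg]].
- split => [x|v]; first exact: differentiableD.
  rewrite (_ : 'D_v (f + g) = 'D_v f + 'D_v g); first exact: fun_alg_add.
  by apply/funext => x; rewrite deriveD//; exact: diff_derivable.
- split => [x|v]; first exact: differentiableM.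
  rewrite (_ : 'D_v (f * g) = f * 'D_v g + g * 'D_v f).
    by apply: fun_alg_add; apply: fun_alg_mul.
  by apply/funext => x; rewrite deriveM//; exact: diff_derivable.
Qed.

Lemma smooth_alg_smooth (V : normedModType R) (f : V -> R) :
  fun_alg (@smooth R V) f -> smooth f.
Proof.
apply: smooth_fun_alg => {}f sf; split => [x|v]; first exact: smooth_differentiable.
exact/fun_alg_base/smooth_derive.
Qed.

Lemma smoothD (V : normedModType R) (f g : V -> R) :
  smooth f -> smooth g -> smooth (fun x => f x + g x).
Proof. by move=> sf sg; apply: smooth_alg_smooth; apply: fun_alg_add; exact: fun_alg_base. Qed.

Lemma smoothM (V : normedModType R) (f g : V -> R) :
  smooth f -> smooth g -> smooth (fun x => f x * g x).
Proof. by move=> sf sg; apply: smooth_alg_smooth; apply: fun_alg_mul; exact: fun_alg_base. Qed.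

(** The generators are the smooth functions and [1 / g]: the derivative [- g' (1 / g) (1 / g)] lies
    in the algebra they generate. *)
Lemma smoothV (V : normedModType R) (g : V -> R) :
  smooth g -> (forall x, g x != 0) -> smooth (fun x => (g x)^-1).
Proof.
move=> sg g0; have dg x : differentiable g x by exact: smooth_differentiable.
pose P (h : V -> R) := smooth h \/ h = fun x => (g x)^-1.
apply: (@smooth_fun_alg _ P); last by apply: fun_alg_base; right.
move=> f [sf|->].
  split => [x|v]; first exact: smooth_differentiable.
  by apply: fun_alg_base; left; exact: smooth_derive.
split => [x|v]; first exact: differentiableV.
rewrite (_ : 'D_v _ = (fun x => -1 * 'D_v g x) * ((fun x => (g x)^-1) * (fun x => (g x)^-1))).
  apply: fun_alg_mul.
    by apply: fun_alg_base; left; apply: smoothM; [exact: smooth_cst|exact: smooth_derive].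
  by apply: fun_alg_mul; apply: fun_alg_base; right.
apply/funext => x; rewrite deriveV//; last exact: diff_derivable.
by rewrite /GRing.scale/= !fctE; field; rewrite g0.
Qed.

Lemma smooth_prod (V : normedModType R) (I : Type) (s : seq I) (f : I -> V -> R) :
  (forall i, smooth (f i)) -> smooth (fun x => \prod_(i <- s) f i x).
Proof.
move=> sf; elim: s => [|i s IH].
  by under eq_fun do rewrite big_nil; exact: smooth_cst.
by under eq_fun do rewrite big_cons; exact: smoothM.
Qed.

Lemma smooth_comp (W V : normedModType R) (L ell : W -> V) (f : V -> R) :
  (forall x, differentiable L x) -> (forall x v, 'D_v L x = ell v) ->
  smooth f -> smooth (f \o L).
Proof.
move=> dL DL sf.
apply: (@smooth_coind _ (fun h => exists2 g, smooth g & h = g \o L)); last by exists f.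
move=> _ [g sg ->]; split => [x|v].
  by apply: differentiable_comp => //; exact: smooth_differentiable.
exists ('D_(ell v) g); first exact: smooth_derive.
apply/funext => x /=.
rewrite deriveE; last by apply: differentiable_comp => //; exact: smooth_differentiable.
rewrite diff_comp//=; last exact: smooth_differentiable.
have e1 : 'd L x v = ell v by rewrite -deriveE// DL.
by rewrite e1 deriveE//; exact: smooth_differentiable.
Qed.

Lemma derive_comp_affine (W V : normedModType R) (L ell : W -> V) (f : V -> R) x v :
  differentiable L x -> 'D_v L x = ell v -> differentiable f (L x) ->
  'D_v (f \o L) x = 'D_(ell v) f (L x).
Proof.
move=> dL DL df; rewrite deriveE; last exact: differentiable_comp.
have e1 : 'd L x v = ell v by rewrite -deriveE// DL.
by rewrite diff_comp//= e1 deriveE.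
Qed.

Lemma derive_R (f : R -> R) (x v : R) : differentiable f x -> 'D_v f x = v * 'D_1 f x.
Proof.
move=> df; rewrite !deriveE//; rewrite -[v in LHS]mulr1.
by rewrite (_ : v * 1 = v *: (1 : R^o))// linearZ.
Qed.

(** On the line every directional derivative is a multiple of the derivative, so the class [P] is
    enlarged by its scalar multiples. *)
Lemma smooth_R (P : (R -> R) -> Prop) :
  (forall f, P f -> exists2 g, P g & forall x : R, is_derive x (1 : R) f (g x)) ->
  forall f, P f -> smooth f.
Proof.
move=> h f Pf.
apply: (@smooth_coind _ (fun u => exists c g, P g /\ u = fun x => c * g x)); last first.
  by exists 1, f; split => //; apply/funext => x; rewrite mul1r.
move=> _ [c [g [Pg ->]]]; have [g' Pg' dg] := h _ Pg.
have df x : differentiable g x.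
  by apply/derivable1_diffP; have := dg x => -[].
split => [x|v].
  by apply: (@differentiableM _ _ (fun=> c) g) => //; exact: differentiable_cst.
exists (c * v), g'; split => //; apply/funext => x.
rewrite (_ : (fun x => c * g x) = c \*: g)// deriveZ; last exact: diff_derivable.
by rewrite derive_R// derive_val -mulrA.
Qed.

Lemma smooth_cos_sin (a b : R) : smooth (fun x : R => a * cos x + b * sin x).
Proof.
apply: (@smooth_R (fun f => exists a b, f = fun x : R => a * cos x + b * sin x)); last by exists a, b.
move=> _ [{}a [{}b ->]]; exists (fun x => b * cos x + (- a) * sin x); first by exists b, (- a).
move=> x.
have h1 := is_deriveZ a (is_derive_cos x); have h2 := is_deriveZ b (is_derive_sin x).
have := is_deriveD h1 h2; rewrite /= => h.
apply: (is_derive_eq h).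
by rewrite /GRing.scale/=; ring.
Qed.

Lemma smooth_id : smooth (fun x : R => x).
Proof.
apply: (@smooth_R (fun f => exists a b, f = fun x : R => a * x + b)); last first.
  by exists 1, 0; apply/funext => x; rewrite mul1r addr0.
move=> _ [a [b ->]]; exists (fun=> a); first by exists 0, a; apply/funext => x; rewrite mul0r add0r.
move=> x; have h := is_deriveD (is_deriveZ a (is_derive_id x 1)) (is_derive_cst b x 1).
by apply: (is_derive_eq h); rewrite addr0 /GRing.scale/= mulr1.
Qed.

End smooth_functions.

Section bump.
Context {R : realType}.

(** [flat 1] is the classical flat function; the polynomial factor in [1 / x] makes the family
    stable under differentiation. *)
Definition flat (p : {poly R}) (x : R) : R :=
  if 0 < x then p.[x^-1] * expR (- x^-1) else 0.

(** The exponential series gives [y^(k+2) <= (k+2)! e^y] at [y = 1 / x]. The two spare powers of [x]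
    make the derivative of [flat] vanish at the origin. *)
Lemma pow_expR_bound k (x : R) : 0 < x ->
  x^-1 ^+ k * expR (- x^-1) <= (k.+2)`!%:R * x ^+ 2.
Proof.
move=> x0; have y0 : 0 < x^-1 by rewrite invr_gt0.
have := expR_ge1Dxn k.+1 (ltW y0) => h.
have {}h : x^-1 ^+ k.+2 <= (k.+2)`!%:R * expR x^-1.
  rewrite mulrC -ler_pdivrMr ?ltr0n ?fact_gt0//; apply: le_trans h.
  by rewrite lerDr.
rewrite expRN ler_pdivrMr ?expR_gt0//.
have -> : x^-1 ^+ k = x^-1 ^+ k.+2 * x ^+ 2.
  by rewrite -addn2 exprD -mulrA -exprMn mulVf ?gt_eqF// expr1n mulr1.
by rewrite [leRHS]mulrAC ler_wpM2r// sqr_ge0.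
Qed.

Lemma flat_bound (p : {poly R}) : exists2 C, 0 <= C & forall x, `|flat p x| <= C * x ^+ 2.
Proof.
exists (\sum_(k < size p) `|p`_k| * (k.+2)`!%:R).
  by apply: sumr_ge0 => k _; rewrite mulr_ge0.
move=> x; rewrite /flat; case: ifPn => [x0|_]; last first.
  by rewrite normr0 mulr_ge0 ?sqr_ge0// sumr_ge0// => k _; rewrite mulr_ge0.
rewrite horner_coef mulr_suml mulr_suml (le_trans (ler_norm_sum _ _ _))//.
apply: ler_sum => k _; rewrite -!mulrA normrM ler_wpM2l//.
rewrite ger0_norm; first exact: pow_expR_bound.
by rewrite mulr_ge0 ?expR_ge0// exprn_ge0// invr_ge0 ltW.
Qed.

Lemma is_derive_flat (p : {poly R}) (x : R) :
  is_derive x 1 (flat p) (flat ('X^2 * (p - p^`())) x).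
Proof.
have [x0|x0|->] := ltgtP x 0.
- rewrite {2}/flat ltNge (ltW x0)/=.
  apply: (near_eq_is_derive _ (is_derive_cst (0 : R) x 1)).
  near=> y; rewrite /flat ltNge.
  by have -> : y <= 0 by apply: ltW; near: y; exact: lt_nbhsl.
- rewrite {2}/flat x0.
  have h0 : is_derive x 1 (fun y : R => y^-1) (- x ^- 2).
    have := @is_deriveV R id x 1 1 (lt0r_neq0 x0) (is_derive_id _ _).
    by move=> h; apply: (is_derive_eq h); rewrite /GRing.scale/= mulr1.
  have h1 : is_derive x 1 (fun y : R => p.[y^-1]) (p^`().[x^-1] * - x ^- 2).
    apply: (@is_derive1_comp _ (horner p) (fun y => y^-1)) => //.
  have h2 : is_derive x 1 (fun y : R => expR (- y^-1)) (expR (- x^-1) * x ^- 2).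
    apply: (@is_derive1_comp _ expR (fun y => - y^-1)).
    have := is_deriveN h0; rewrite opprK; exact.
  have h := is_deriveM h1 h2.
  have {}h := is_derive_eq h (erefl _ : _ = p.[x^-1] * (expR (- x^-1) * x ^- 2) +
    expR (- x^-1) * (p^`().[x^-1] * - x ^- 2)).
  rewrite (_ : _ * expR _ = p.[x^-1] * (expR (- x^-1) * x ^- 2) +
    expR (- x^-1) * (p^`().[x^-1] * - x ^- 2)); last first.
    by rewrite hornerM hornerXn hornerD hornerN exprVn; ring.
  apply: (near_eq_is_derive _ h); near=> y; rewrite /flat.
  by have -> : 0 < y by near: y; exact: lt_nbhsr.
(* At the origin the slope [flat p z / z] is at most [C |z|] by [flat_bound], hence continuous with
   value zero, as Caratheodory's criterion asks. *)
- rewrite {2}/flat ltxx; apply/is_derive1_caratheodory.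
  exists (fun z => flat p z / z); split.
  + move=> z; rewrite subr0 {2}/flat ltxx subr0.
    by have [->|z0] := eqVneq z 0; [rewrite /flat ltxx mul0r mul0r|rewrite divfK].
  + rewrite /prop_for /continuous_at invr0 mulr0.
    have [C C0 hC] := flat_bound p.
    apply/cvgrPdist_le => /= e e0; apply/nbhs_ballP.
    exists (e / (C + 1)) => /=; first by rewrite divr_gt0// ltr_wpDl.
    move=> z; rewrite /ball/= !sub0r !normrN normrM => zs.
    have [->|z0] := eqVneq z 0; first by rewrite invr0 normr0 mulr0 ltW.
    rewrite normfV ler_pdivrMr ?normr_gt0//; apply: (le_trans (hC z)).
    rewrite -real_normK ?num_real// expr2 mulrA ler_wpM2r//.
    rewrite (@le_trans _ _ ((C + 1) * `|z|))//; first by rewrite ler_wpM2r// lerDl.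
    by rewrite mulrC -ler_pdivlMr ?ltr_wpDl// ltW.
  + by rewrite invr0 mulr0.
Unshelve. all: by end_near. Qed.

Lemma smooth_flat (p : {poly R}) : smooth (flat p).
Proof.
apply: (@smooth_R R (fun f => exists p, f = flat p)); last by exists p.
move=> _ [q ->]; exists (flat ('X^2 * (q - q^`()))); first by exists ('X^2 * (q - q^`())).
by move=> x; exact: is_derive_flat.
Qed.

Definition bump1 (x : R) : R := flat 1 (1 - x) * flat 1 (1 + x).

Lemma flat1_ge0 x : 0 <= flat 1 x.
Proof. by rewrite /flat; case: ifP => // _; rewrite hornerC mul1r expR_ge0. Qed.

Lemma bump1_ge0 x : 0 <= bump1 x.
Proof. by rewrite mulr_ge0 ?flat1_ge0. Qed.

Lemma bump1_gt0 x : `|x| < 1 -> 0 < bump1 x.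
Proof.
rewrite ltr_norml => /andP[h1 h2]; rewrite /bump1 /flat.
by rewrite subr_gt0 h2 -ltrBlDl sub0r h1 mulr_gt0// hornerC mul1r expR_gt0.
Qed.

Lemma bump1_eq0 x : 1 <= `|x| -> bump1 x = 0.
Proof.
rewrite ler_normr => /orP[h|h]; rewrite /bump1 /flat.
  by rewrite subr_gt0 ltNge h /= mul0r.
by rewrite [0 < 1 + x]ltNge (_ : 1 + x <= 0) ?mulr0//; lra.
Qed.

Lemma bump1N x : bump1 (- x) = bump1 x.
Proof. by rewrite /bump1 opprK mulrC. Qed.

Lemma smooth_affine_R (f : R -> R) (a b : R) : smooth f -> smooth (fun x => f (a * x + b)).
Proof.
move=> sf; have dL (x : R) : is_derive x 1 (fun x : R => a * x + b) a.
  have := is_deriveD (is_deriveZ a (is_derive_id x 1)) (is_derive_cst b x 1).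
  by move=> h; apply: (is_derive_eq h); rewrite addr0 /GRing.scale/= mulr1.
have hd (x : R) : differentiable (fun x : R => a * x + b) x.
  by apply/derivable1_diffP; have := dL x => -[].
apply: (@smooth_comp R _ _ (fun x : R => a * x + b) (fun v => v * a) f hd _ sf) => x v.
by rewrite derive_R ?derive_val.
Qed.

Lemma smooth_bump1 : smooth bump1.
Proof.
apply: smoothM.
  have := @smooth_affine_R (flat 1) (-1) 1 (smooth_flat 1).
  by under eq_fun do rewrite mulN1r addrC.
have := @smooth_affine_R (flat 1) 1 1 (smooth_flat 1).
by under eq_fun do rewrite mul1r addrC.
Qed.

End bump.

(** * Test functions *)

Section test_functions.
Context {R : realType} {V : normedModType R}.
Implicit Types (f g : V -> R) (D : set V).

Lemma test_smooth D f : test_function D f -> smooth f.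
Proof. by case. Qed.

Lemma testM D f g : test_function D f -> smooth g -> test_function D (fun x => f x * g x).
Proof.
move=> [sf [A [cA AD f0]]] sg; split; first exact: smoothM.
by exists A; split => // x /f0 ->; rewrite mul0r.
Qed.

Lemma testMl D f g : test_function D f -> smooth g -> test_function D (fun x => g x * f x).
Proof. by move=> tf sg; under eq_fun do rewrite mulrC; exact: testM. Qed.

Lemma testZ D f c : test_function D f -> test_function D (fun x => c * f x).
Proof. by move=> tf; apply: testMl => //; exact: smooth_cst. Qed.

Lemma test_derive D f v : test_function D f -> test_function D ('D_v f).
Proof.
move=> [sf [A [cA AD f0]]]; split; first exact: smooth_derive.
exists A; split => // x Ax.
have oA : open (~` A).
  by apply: closed_openC; apply: compact_closed => //; exact: norm_hausdorff.
rewrite (@near_eq_derive _ _ _ f (cst 0)) ?derive_cst//.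
by move: oA; rewrite openE => /(_ x Ax); apply: filterS => y /f0.
Qed.

Lemma test_bounded D f : test_function D f -> exists2 M, 0 <= M & forall x, `|f x| <= M.
Proof.
move=> [sf [A [cA AD f0]]].
have [A0|/set0P A0] := eqVneq A set0.
  by exists 0 => // x; rewrite f0 ?A0 ?normr0.
have cf : {within A, continuous (fun x => `|f x|)}.
  apply: continuous_subspaceT => x.
  by apply: (@continuous_comp _ _ _ f); [exact: smooth_continuous|exact: norm_continuous].
have [c cA' hc] := compact_EVT_max A0 cA cf.
exists `|f c| => // x; have [Ax|Ax] := pselect (A x); first by apply: hc; rewrite inE.
by rewrite f0// normr0.
Qed.

Lemma test_bounded_support D f : test_function D f ->
  exists2 r, 0 < r & forall x, r <= `|x| -> f x = 0.
Proof.
move=> [sf [A [cA AD f0]]]; have [M [Mr hM]] := compact_bounded cA.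
exists (`|M| + 2); first by rewrite ltr_wpDl.
move=> x xM; apply: f0 => Ax.
have /hM/(_ x Ax) : M < `|M| + 1 by rewrite (le_lt_trans (ler_norm _))// ltrDl.
by rewrite /= leNgt => /negP; apply; rewrite (lt_le_trans _ xM)// ltrD2l ltr1n.
Qed.

Lemma is_derive_line f (x v : V) (t : R) : differentiable f (x + t *: v) ->
  is_derive t (1 : R) (fun t => f (x + t *: v)) ('D_v f (x + t *: v)).
Proof.
move=> df; have dv : derivable f (x + t *: v) v by exact: diff_derivable.
have E : (fun h : R => h^-1 *: (((fun t => f (x + t *: v)) \o shift t) (h *: (1 : R)) - f (x + t *: v)))
   = (fun h : R => h^-1 *: ((f \o shift (x + t *: v)) (h *: v) - f (x + t *: v))).
  apply/funext => h /=; congr (_ *: (f _ - _)).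
  by rewrite -[h%:A]/(h * 1) mulr1 scalerDl addrCA.
by apply: DeriveDef; rewrite /derivable /derive E.
Qed.

End test_functions.

Section test_functions_rV.
Context {R : realType} {n : nat}.
Local Notation E := 'rV[R]_n.
Local Notation leb := (@lebesgue_rV R n).
Implicit Types f g : E -> R.

Lemma integrable_bounded_support f (M r : R) : measurable_fun setT f ->
  (forall x, `|f x| <= M) -> (forall x, r <= `|x| -> f x = 0) ->
  leb.-integrable setT (EFin \o f).
Proof.
move=> mf fM f0; pose D := [set x : E | `|x| < Num.max r 1].
have r1 : 0 < Num.max r 1 :> R by rewrite lt_max ltr01 orbT.
have mD : measurable D by exact: measurable_lt_norm.
have -> : EFin \o f = (EFin \o f) \_ D.
  apply/funext => x; rewrite patchE; case: ifPn => //; rewrite notin_setE /D /= => /negP.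
  by rewrite -leNgt ge_max => /andP[rx _] /=; rewrite f0.
apply/(integrable_mkcond (EFin \o f) mD); apply: measurable_bounded_integrable => //.
- by rewrite [X in (X < _)%E](lebesgue_cube n r1) ltry.
- exact: measurable_funTS.
- by exists M; split; [exact: num_real|move=> y My x _ /=; exact: le_trans (fM x) (ltW My)].
Qed.

Lemma measurable_smooth f : smooth f -> measurable_fun setT f.
Proof. by move=> sf; apply: continuous_measurable_rV; exact: smooth_continuous. Qed.

Lemma test_integrable D f : test_function D f -> leb.-integrable setT (EFin \o f).
Proof.
move=> tf; have [M _ fM] := test_bounded tf; have [r _ f0] := test_bounded_support tf.
by apply: (@integrable_bounded_support _ M r) => //; apply: measurable_smooth; exact: test_smooth tf.
Qed.

Lemma differentiable_aff (c : R) (a x : E) : differentiable (fun x : E => c *: x + a) x.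
Proof.
apply: differentiableD; last exact: differentiable_cst.
by apply: differentiableZ; exact: ex_diff.
Qed.

Lemma derive_aff (c : R) (a x v : E) : 'D_v (fun x : E => c *: x + a) x = c *: v.
Proof.
rewrite (_ : (fun x : E => c *: x + a) = c \*: id + cst a)//.
rewrite deriveD// ?deriveZ// ?derive_id ?derive_cst ?addr0//.
Qed.

Lemma smooth_aff f (c : R) (a : E) : smooth f -> smooth (fun x => f (c *: x + a)).
Proof.
move=> sf; apply: (@smooth_comp _ _ _ (fun x : E => c *: x + a) (fun v => c *: v)) => //.
by move=> x v; exact: derive_aff.
Qed.

Lemma derive_comp_aff f (c : R) (a x v : E) : smooth f ->
  'D_v (fun x => f (c *: x + a)) x = c * 'D_v f (c *: x + a).
Proof.
move=> sf; rewrite (@derive_comp_affine _ _ _ (fun x : E => c *: x + a) (fun v => c *: v) f).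
- by rewrite !deriveE ?linearZ//; exact: smooth_differentiable.
- exact: differentiable_aff.
- exact: derive_aff.
- exact: smooth_differentiable.
Qed.

Lemma test_setTP f (r : R) : smooth f -> (forall x, r <= `|x| -> f x = 0) ->
  test_function setT f.
Proof.
move=> sf f0; split => //; exists (closed_ball (0 : E) (Num.max r 1)).
have r1 : 0 < Num.max r 1 :> R by rewrite lt_max ltr01 orbT.
have cbE : closed_ball (0 : E) (Num.max r 1) = [set x | `|x| <= Num.max r 1].
  by rewrite closed_ballE//; apply/seteqP; split => x; rewrite /closed_ball_/= sub0r normrN.
split => //.
- apply: bounded_closed_compact; last exact: closed_ball_closed.
  exists (Num.max r 1); split; first exact: num_real.
  by move=> y ry x; rewrite cbE /= => /le_trans; apply; exact: ltW.
- by move=> x; rewrite cbE /= => /negP; rewrite -ltNge gt_max => /andP[/ltW rx _]; exact: f0.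
Qed.

Lemma test_aff D f (c : R) (a : E) : c != 0 -> test_function D f ->
  test_function setT (fun x => f (c *: x + a)).
Proof.
move=> c0 tf; have [r r0 f0] := test_bounded_support tf.
apply: (@test_setTP _ ((r + `|a|) / `|c|)).
  by apply: smooth_aff; exact: test_smooth tf.
move=> x; rewrite ler_pdivrMr ?normr_gt0// => h; apply: f0.
have : `|c *: x| <= `|c *: x + a| + `|a| by rewrite -{1}[c *: x](addrK a) ler_normB.
by rewrite normrZ mulrC => /(le_trans h); rewrite lerD2r.
Qed.

Lemma smooth_coord (f : R -> R) i : smooth f -> smooth (fun x : E => f (x ord0 i)).
Proof.
move=> sf; apply: (@smooth_comp _ _ _ (fun x : E => x ord0 i) (fun v => v ord0 i)) => //.
  by move=> x; exact: differentiable_coord.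
move=> x v; rewrite deriveE; last exact: differentiable_coord.
have @f' : {linear E -> R}.
  by exists (fun x : E => x ord0 i); do 2![eexists]; do ?[constructor];
     rewrite ?mxE// => ? *; rewrite ?mxE//; move=> ?; rewrite !mxE.
by rewrite (_ : (fun _ => _) = f')// diff_lin//; exact: coord_continuous.
Qed.

(** By translation invariance the integral of [f (x + t v)] does not depend on [t]; its derivative
    at [t = 0], taken under the integral, is the integral of ['D_v f]. *)
Lemma integral_derive0 f v : test_function setT f -> \int[leb]_x 'D_v f x = 0.
Proof.
move=> tf; have [M M0 fM] := test_bounded (test_derive v tf).
have [r r0 f0] := test_bounded_support (test_derive v tf).
have sf := test_smooth tf.
pose h (t : R) (x : E) := f (x + t *: v).
have hI t : leb.-integrable setT (EFin \o h t).
  have := test_aff (t *: v) (oner_neq0 R) tf.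
  by under eq_fun do rewrite scale1r; exact: test_integrable.
have dh (t : R) x : is_derive t (1 : R) (h ^~ x) ('D_v f (x + t *: v)).
  by apply: is_derive_line; exact: smooth_differentiable.
have dh' (t : R) x : derivable (h ^~ x) t 1 by case: (dh t x).
(* For [|t| < 1] the translated derivative vanishes outside the cube of half side [r + |v|]. *)
pose G x := M * \1_[set x : E | `|x| < r + `|v|] x.
have IG : leb.-integrable setT (EFin \o G).
  apply: (@integrable_bounded_support _ M (r + `|v|)).
  - by apply: measurable_funM => //; apply: measurable_indic; exact: measurable_lt_norm.
  - move=> x; rewrite /G normrM ger0_norm// ler_piMr// indicE.
    by case: (_ \in _); rewrite ?normr0 ?normr1.
  - move=> x xr; rewrite /G indicE memNset ?mulr0//=.
    by apply/negP; rewrite -leNgt.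
have I0 : (`]-1, 1[%classic : set R) 0 by rewrite /= in_itv/= ltrN10 ltr01.
have := @differentiation_under_integral R _ E leb h setT measurableT 0 (-1) 1 I0
  (fun t _ => hI t) (fun t x _ _ => dh' t x) G _ IG _.
have d1E t x : partial1of2 h t x = 'D_v f (x + t *: v).
  by rewrite partial1of2E; exact: derive_val.
rewrite (_ : (fun x' => _) = cst (\int[leb]_x f x)); last first.
  apply/funext => t; rewrite -[RHS](Rintegral_shift (t *: v))//.
  exact: test_integrable tf.
rewrite derive1_cst => H; rewrite {}H.
- by apply: eq_Rintegral => x _; rewrite /= d1E scale0r addr0.
- by move=> x; rewrite /G mulr_ge0.
- move=> t x; rewrite /= in_itv/= => /andP[t1 t2] _; rewrite d1E /G indicE.
  have [xr|xr] := ltP `|x| (r + `|v|); first by rewrite mem_set// mulr1.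
  rewrite memNset/=; last by apply/negP; rewrite -leNgt.
  rewrite mulr0 f0 ?normr0//.
  have : `|x| <= `|x + t *: v| + `|t *: v| by rewrite -{1}[x](addrK (t *: v)) ler_normB.
  rewrite normrZ => xt.
  have : `|t| * `|v| <= `|v| by rewrite ler_piMl// ler_norml ltW//= ltW.
  lra.
Qed.

Definition Bump (x : E) : R := \prod_i bump1 (x ord0 i).

Lemma smooth_Bump : smooth Bump.
Proof. by apply: smooth_prod => i; apply: smooth_coord; exact: smooth_bump1. Qed.

Lemma Bump_ge0 x : 0 <= Bump x.
Proof. by apply: prodr_ge0 => i _; exact: bump1_ge0. Qed.

Lemma Bump_gt0 x : `|x| < 1 -> 0 < Bump x.
Proof.
move=> /(rV_norm_ltP _ ltr01) h; apply: prodr_gt0 => i _; exact: bump1_gt0.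
Qed.

Lemma Bump_eq0 x : 1 <= `|x| -> Bump x = 0.
Proof.
move=> x1; apply/eqP; apply: contraTT x1 => h; rewrite -ltNge.
apply/rV_norm_ltP => // i; rewrite ltNge; apply: contra h => h.
by rewrite /Bump (bigD1 i)//= bump1_eq0// mul0r.
Qed.

Lemma BumpN x : Bump (- x) = Bump x.
Proof. by apply: eq_bigr => i _; rewrite mxE bump1N. Qed.

Lemma test_Bump : test_function setT Bump.
Proof. by apply: (@test_setTP _ 1); [exact: smooth_Bump|exact: Bump_eq0]. Qed.

Lemma Rintegral_gt0_continuous f : continuous f -> (forall x, 0 <= f x) -> 0 < f 0 ->
  leb.-integrable setT (EFin \o f) -> 0 < \int[leb]_x f x.
Proof.
move=> cf f_ge0 f0 intf.
have b0 : 0 < f 0 / 2 by rewrite divr_gt0.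
have mf := continuous_measurable_rV cf.
have B0 : (0 < \int[leb]_x (f x)%:E)%E.
  have [e e0 he] : exists2 e : R, 0 < e & forall x : E, `|x| < e -> f 0 / 2 <= f x.
    have := cf (0 : E).
    move=> /cvgrPdist_le /= /(_ _ b0)/nbhs_ballP[e /= e0 he].
    exists e => // x xe; have := he x; rewrite -ball_normE /ball_/= sub0r normrN => /(_ xe).
    by rewrite ler_norml => /andP[h1 h2]; lra.
  apply: (@lt_le_trans _ _ (\int[leb]_(x in [set x | (`|x| < e)%R]) (f 0 / 2)%:E)%E).
    rewrite integral_cst; last exact: measurable_lt_norm.
    by rewrite [X in (_ * X)%E](lebesgue_cube n e0) -EFinM lte_fin mulr_gt0// exprn_gt0// mulr_gt0.
  apply: (@le_trans _ _ (\int[leb]_(x in [set x | (`|x| < e)%R]) (f x)%:E)%E).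
    apply: ge0_le_integral => //.
    - exact: measurable_lt_norm.
    - by move=> x _; rewrite lee_fin ltW.
    - exact/measurable_EFinP/measurable_funTS.
  apply: ge0_subset_integral => //.
  - exact: measurable_lt_norm.
  - exact/measurable_EFinP.
  - by move=> x _; rewrite lee_fin.
rewrite /Rintegral fine_gt0// B0 /=.
have := integrable_fin_num measurableT intf.
by rewrite ge0_fin_numE// ltW.
Qed.

Lemma integral_Bump_gt0 : 0 < \int[leb]_x Bump x.
Proof.
apply: Rintegral_gt0_continuous.
- exact: (smooth_continuous smooth_Bump).
- exact: Bump_ge0.
- by apply: Bump_gt0; rewrite normr0.
- exact: test_integrable test_Bump.
Qed.

Definition mollifier (x : E) : R := (\int[leb]_x Bump x)^-1 * Bump x.

Lemma mollifier_ge0 x : 0 <= mollifier x.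
Proof. by rewrite mulr_ge0 ?Bump_ge0// invr_ge0 ltW// integral_Bump_gt0. Qed.

Lemma mollifier_eq0 x : 1 <= `|x| -> mollifier x = 0.
Proof. by move=> /Bump_eq0; rewrite /mollifier => ->; rewrite mulr0. Qed.

Lemma mollifierN x : mollifier (- x) = mollifier x.
Proof. by rewrite /mollifier BumpN. Qed.

Lemma test_mollifier : test_function setT mollifier.
Proof. by apply: testZ; exact: test_Bump. Qed.

Lemma integral_mollifier : \int[leb]_x mollifier x = 1.
Proof.
rewrite RintegralZl//; last exact: test_integrable test_Bump.
by rewrite mulVf// gt_eqF// integral_Bump_gt0.
Qed.

End test_functions_rV.

(** * Smooth steps and windows on the line *)

Section smooth_step.
Context {R : realType}.

Definition step (x : R) : R := flat 1 x * (flat 1 x + flat 1 (1 - x))^-1.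

Lemma step_den_gt0 (x : R) : 0 < flat 1 x + flat 1 (1 - x).
Proof.
have h (y : R) : 0 < y -> 0 < flat 1 y by move=> y0; rewrite /flat y0 hornerC mul1r expR_gt0.
have [x0|x0] := ltP 0 x; first by rewrite ltr_pwDl ?h// flat1_ge0.
by rewrite ltr_wpDl ?flat1_ge0// h// subr_gt0 (le_lt_trans x0).
Qed.

Lemma smooth_step : smooth step.
Proof.
have s1 := @smooth_flat R 1.
have s2 : smooth (fun x : R => flat 1 (1 - x)).
  have := @smooth_affine_R R (flat 1) (-1) 1 s1.
  by under eq_fun do rewrite mulN1r addrC.
apply: smoothM => //; apply: smoothV; first exact: smoothD.
by move=> x; rewrite gt_eqF// step_den_gt0.
Qed.

Lemma step_ge0 (x : R) : 0 <= step x.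
Proof. by rewrite mulr_ge0 ?flat1_ge0// invr_ge0 ltW// step_den_gt0. Qed.

Lemma step_le1 (x : R) : step x <= 1.
Proof. by rewrite /step ler_pdivrMr ?step_den_gt0// mul1r lerDl flat1_ge0. Qed.

Lemma step_eq0 (x : R) : x <= 0 -> step x = 0.
Proof. by move=> x0; rewrite /step [X in X * _]/flat ltNge x0 mul0r. Qed.

Lemma step_eq1 (x : R) : 1 <= x -> step x = 1.
Proof.
move=> x1; rewrite /step; have -> : flat 1 (1 - x) = 0 by rewrite /flat subr_gt0 ltNge x1.
rewrite addr0 divff// gt_eqF//.
by rewrite /flat (lt_le_trans ltr01 x1) hornerC mul1r expR_gt0.
Qed.

Lemma step_derive_test : test_function setT ('D_1 step).
Proof.
split; first exact/smooth_derive/smooth_step.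
exists `[0, 1]%classic; split => //; first exact: segment_compact.
move=> x /=; rewrite in_itv/= => /negP; rewrite negb_and -!ltNge => /orP[x0|x1].
  rewrite (@near_eq_derive _ _ _ step (cst 0)) ?derive_cst//.
  near=> y; rewrite step_eq0//.
  by apply: ltW; near: y; exact: lt_nbhsl.
rewrite (@near_eq_derive _ _ _ step (cst 1)) ?derive_cst//.
near=> y; rewrite step_eq1//.
by apply: ltW; near: y; exact: lt_nbhsr.
Unshelve. all: by end_near. Qed.

Lemma step_derive_bounded : exists2 C, 0 <= C & forall x : R, `|'D_1 step x| <= C.
Proof. exact: test_bounded step_derive_test. Qed.

(** Approximation from below of the indicator of []a, b[], with transition layers of width
    [1 / (m + 1)] inside the interval. *)
Definition window (a b : R) (m : nat) (s : R) : R :=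
  step (m.+1%:R * (s - a)) * step (m.+1%:R * (b - s)).

Lemma test_window (t0 t1 a b : R) m : t0 < a -> b < t1 ->
  test_function `]t0, t1[ (window a b m).
Proof.
move=> ta bt; split.
  apply: smoothM.
    have := @smooth_affine_R R step m.+1%:R (- (m.+1%:R * a)) smooth_step.
    by under eq_fun do rewrite -mulrBr.
  have := @smooth_affine_R R step (- m.+1%:R) (m.+1%:R * b) smooth_step.
  by under eq_fun do rewrite mulNr addrC -mulrBr.
exists `[a, b]%classic; split; first exact: segment_compact.
  move=> x /=; rewrite !in_itv/= => /andP[h1 h2].
  by rewrite (lt_le_trans ta)// (le_lt_trans h2).
move=> x /=; rewrite in_itv/= => /negP; rewrite negb_and -!ltNge => /orP[x0|x1].
  by rewrite /window step_eq0 ?mul0r// pmulr_rle0// subr_le0 ltW.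
by rewrite /window [X in _ * X]step_eq0 ?mulr0// pmulr_rle0// subr_le0 ltW.
Qed.

Lemma window_ge0 a b m s : 0 <= window a b m s.
Proof. by rewrite mulr_ge0 ?step_ge0. Qed.

Lemma window_le1 a b m s : window a b m s <= 1.
Proof. by rewrite mulr_ile1 ?step_ge0 ?step_le1. Qed.

Lemma window_eq0 a b m s : ~~ (a < s < b) -> window a b m s = 0.
Proof.
rewrite negb_and -!leNgt => /orP[x0|x1].
  by rewrite /window step_eq0 ?mul0r// pmulr_rle0// subr_le0.
by rewrite /window [X in _ * X]step_eq0 ?mulr0// pmulr_rle0// subr_le0.
Qed.

Lemma step_scaled_cvg (x : R) : 0 < x -> step (m.+1%:R * x) @[m --> \oo] --> (1 : R).
Proof.
move=> x0; apply: cvg_near_cst.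
have := near_infty_natSinv_lt (PosNum x0); apply: filterS => m /= hm.
by apply: step_eq1; rewrite mulrC -ler_pdivrMr ?ltr0n// mul1r ltW.
Qed.

Lemma window_cvg a b s : window a b m s @[m --> \oo] --> (\1_(`]a, b[%classic : set R) s : R).
Proof.
have [/andP[h1 h2]|h] := boolP (a < s < b).
  rewrite indicE mem_set/=; last by rewrite in_itv/= h1.
  rewrite -[1%:R]mulr1; apply: cvgM; apply: step_scaled_cvg; by rewrite subr_gt0.
under eq_fun do rewrite window_eq0//.
by rewrite indicE memNset/=; [exact: cvg_cst|rewrite in_itv/=; exact/negP].
Qed.

End smooth_step.

Section spacetime_tests.
Context {R : realType} {n : nat}.
Local Notation E := 'rV[R]_n.
Context (t0 t1 : R) (theta : R -> R) (phi : E -> R).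
Context (tth : test_function (`]t0, t1[%classic : set R) theta) (tphi : test_function setT phi).

Let fst_cont : continuous (@fst R E). Proof. by move=> z; exact: cvg_fst. Qed.
Let snd_cont : continuous (@snd R E). Proof. by move=> z; exact: cvg_snd. Qed.
Let dfst z : differentiable (@fst R E) z.
Proof. by apply: (@linear_differentiable _ _ _ (@fst R E : {linear _ -> _})); exact: fst_cont. Qed.
Let dsnd z : differentiable (@snd R E) z.
Proof. by apply: (@linear_differentiable _ _ _ (@snd R E : {linear _ -> _})); exact: snd_cont. Qed.
Let Dfst z v : 'D_v (@fst R E) z = v.1.
Proof. by rewrite deriveE// (@diff_lin _ _ _ (@fst R E : {linear _ -> _})). Qed.
Let Dsnd z v : 'D_v (@snd R E) z = v.2.
Proof. by rewrite deriveE// (@diff_lin _ _ _ (@snd R E : {linear _ -> _})). Qed.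

Lemma test_spacetime : test_function (slab t0 t1) (fun z : R * E => theta z.1 * phi z.2).
Proof.
split.
  apply: smoothM.
    exact: (@smooth_comp _ _ _ (@fst R E) (@fst R E) theta dfst Dfst (test_smooth tth)).
  exact: (@smooth_comp _ _ _ (@snd R E) (@snd R E) phi dsnd Dsnd (test_smooth tphi)).
have [_ [A [cA AD a0]]] := tth; have [_ [B [cB BD b0]]] := tphi.
exists (A `*` B); split; first exact: compact_setX.
  by move=> z [/AD].
move=> z /= /not_andP[/a0 ->|/b0 ->]; [exact: mul0r|exact: mulr0].
Qed.

Lemma derive_spacetime a v (z : R * E) :
  'D_(a, v) (fun z : R * E => theta z.1 * phi z.2) z =
  'D_a theta z.1 * phi z.2 + theta z.1 * 'D_v phi z.2.
Proof.
have s1 := test_smooth tth; have s2 := test_smooth tphi.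
have e1 := @derive_comp_affine R _ _ (@fst R E) (@fst R E) theta z (a, v) (dfst z) (Dfst z (a, v))
  (smooth_differentiable _ s1).
have e2 := @derive_comp_affine R _ _ (@snd R E) (@snd R E) phi z (a, v) (dsnd z) (Dsnd z (a, v))
  (smooth_differentiable _ s2).
rewrite (@deriveM _ _ (theta \o fst) (phi \o snd)).
- by rewrite e1 e2 /GRing.scale/= addrC mulrC.
- by apply: diff_derivable; apply: differentiable_comp => //; exact: smooth_differentiable.
- by apply: diff_derivable; apply: differentiable_comp => //; exact: smooth_differentiable.
Qed.

End spacetime_tests.

(** * The fundamental lemma of the calculus of variations in time *)

Section du_bois_reymond_R.
Context {R : realType}.
Local Notation mu := (@lebesgue_measure R).

Lemma integral_tests_eq0 (t0 t1 : R) (f : R -> R) :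
  mu.-integrable `]t0, t1[ (EFin \o f) ->
  (forall theta, test_function (`]t0, t1[%classic : set R) theta ->
     \int[mu]_(s in `]t0, t1[) (theta s * f s) = 0) ->
  forall a b, t0 < a -> b < t1 -> \int[mu]_(s in `]a, b[) f s = 0.
Proof.
move=> intf h a b ta bt.
have mf := integrable_measurable intf.
have mI : measurable (`]t0, t1[%classic : set R) by exact: measurable_itv.
have abt : `]a, b[%classic `<=` (`]t0, t1[%classic : set R).
  move=> x /=; rewrite !in_itv/= => /andP[h1 h2].
  by rewrite (lt_trans ta)// (lt_trans h2).
have cv : \int[mu]_(s in `]t0, t1[) (window a b m s * f s) @[m --> \oo] -->
   \int[mu]_(s in `]t0, t1[) (\1_(`]a, b[%classic : set R) s * f s).
  apply: (@Rintegral_dct _ _ _ mu _ mI _ _ (fun s => `|f s|)).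
  - move=> m; apply: measurable_funM => //; apply: measurable_funTS.
    apply: continuous_measurable_fun; apply: smooth_continuous.
    exact: (test_smooth (test_window m ta bt)).
  - by move=> s _; apply: cvgMl; exact: window_cvg.
  - move=> m s _; rewrite normrM ler_piMl// ger0_norm ?window_ge0//.
    exact: window_le1.
  - exact: (integrable_norm intf).
have -> : \int[mu]_(s in `]a, b[) f s = \int[mu]_(s in `]t0, t1[) (\1_(`]a, b[%classic : set R) s * f s).
  rewrite -[in LHS](setIidr abt) Rintegral_mkcondr.
  by apply: eq_Rintegral => s _; rewrite patchE indicE; case: ifP => _; rewrite ?mul1r ?mul0r.
rewrite -(cvg_lim _ cv)//.
rewrite (_ : (fun m => _) = fun=> 0) ?lim_cst//.
by apply/funext => m; rewrite h//; exact: test_window.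
Qed.

(** The windows show that all integrals over subintervals vanish, so a primitive of [f] is constant;
    at Lebesgue points [f] is the derivative of its primitive. *)
Lemma du_bois_reymond_R (t0 t1 : R) (f : R -> R) :
  mu.-integrable `]t0, t1[ (EFin \o f) ->
  (forall theta, test_function (`]t0, t1[%classic : set R) theta ->
     \int[mu]_(s in `]t0, t1[) (theta s * f s) = 0) ->
  {ae mu, forall s, s \in `]t0, t1[ -> f s = 0}.
Proof.
move=> intf h; have I0 := integral_tests_eq0 intf h.
have mI : measurable (`]t0, t1[%classic : set (measurableTypeR R)) by exact: measurable_itv.
pose F := f \_ (`]t0, t1[%classic : set R).
have iF : mu.-integrable setT (EFin \o F).
  by move: intf; rewrite integrable_mkcond//= (restrict_EFin f).
have lF : locally_integrable setT F by exact: integrable_locally.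
have [Z [mZ Z0 hZ]] := lebesgue_differentiation lF.
exists Z; split => //; apply: subset_trans hZ => x /=; apply: contra_not => xF.
rewrite in_itv/= => /andP[h1 h2].
pose a := (t0 + x) / 2; have ta : t0 < a by rewrite /a; lra.
have ax : a < x by rewrite /a; lra.
have ix : mu.-integrable [set` Interval (BRight a) (BRight (x + 1))] (EFin \o F).
  by apply: (integrableS measurableT) => //; exact: measurable_itv.
have xx1 : x < x + 1 by rewrite ltrDl.
have ax' : (BRight a < BRight x)%O by rewrite bnd_simp.
have [_] := FTC1_lebesgue_pt xx1 ix ax' xF.
have Fx : F x = f x by rewrite /F patchE mem_set//= in_itv/= h1.
rewrite Fx => <-; rewrite derive1E.
rewrite (@near_eq_derive _ _ _ _ (cst 0)) ?derive_cst//.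
near=> y.
have yt : y < t1 by near: y; exact: lt_nbhsl.
rewrite -Rintegral_itv_bndo_bndc; last first.
  by apply: (integrableS measurableT) => //; exact: measurable_itv.
rewrite -[RHS](I0 a y ta yt); apply: eq_Rintegral => s; rewrite inE/= in_itv/= => /andP[s1 s2].
by rewrite /F patchE mem_set//= in_itv/= (lt_trans ta s1) (lt_trans s2 yt).
Unshelve. all: by end_near. Qed.

End du_bois_reymond_R.

(** * The Fourier transform *)

Section oscillation.
Context {R : realType}.

(** Real form of the character [e^(- i t)]: the parameters [(1, 0)] and [(0, 1)] give its real part
    and the opposite of its imaginary part, and differentiation acts on the parameters alone. *)
Definition osc (a b t : R) : R := a * cos t + b * sin t.

Lemma is_derive_osc a b (t : R) : is_derive t (1 : R) (osc a b) (osc b (- a) t).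
Proof.
have h1 := is_deriveZ a (is_derive_cos t); have h2 := is_deriveZ b (is_derive_sin t).
have h := is_deriveD h1 h2; apply: (is_derive_eq h).
by rewrite /GRing.scale/= /osc; ring.
Qed.

Lemma osc_bound a b t : `|osc a b t| <= `|a| + `|b|.
Proof.
apply: (le_trans (ler_normD _ _)); rewrite !normrM lerD// ler_piMr//.
  by rewrite ler_norml cos_geN1 cos_le1.
by rewrite ler_norml sin_geN1 sin_le1.
Qed.

Lemma lipschitz_osc a b t s : `|osc a b t - osc a b s| <= (`|a| + `|b|) * `|t - s|.
Proof.
wlog st : t s / s <= t.
  move=> h; have [/h//|/ltW /h] := leP s t.
  by rewrite distrC (distrC s).
have dosc x : x \in `]s, t[ -> is_derive x (1 : R) (osc a b) (osc b (- a) x).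
  by move=> _; exact: is_derive_osc.
have cosc : {within `[s, t], continuous (osc a b)}.
  apply: derivable_within_continuous => x _; by case: (is_derive_osc a b x).
have [c _ ->] := MVT_segment st dosc cosc.
by rewrite normrM ler_wpM2r// (le_trans (osc_bound _ _ _))// normrN addrC.
Qed.

Lemma taylor_osc a b t s :
  `|osc a b (t + s) - osc a b t - s * osc b (- a) t| <= (`|a| + `|b|) * s ^+ 2.
Proof.
(* Letting the slope be taken at any point [w] of the interval covers both signs of [s], for which
   the base point is the left or the right endpoint. *)
suff H u v : u <= v -> forall w, w \in `[u, v] ->
    `|osc a b v - osc a b u - (v - u) * osc b (- a) w| <= (`|a| + `|b|) * (v - u) ^+ 2.
  have [s0|s0] := leP 0 s.
    have := H t (t + s) _ t; rewrite lerDl => /(_ s0).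
    by rewrite in_itv/= lexx lerDl s0 => /(_ isT); rewrite (addrC t) addrK.
  have := H (t + s) t _ t; rewrite gerDl (ltW s0) => /(_ isT).
  rewrite in_itv/= lexx gerDl (ltW s0) => /(_ isT).
  have -> : t - (t + s) = - s by ring.
  rewrite sqrrN => h; rewrite -normrN.
  by rewrite [X in `|X|](_ : _ = osc a b t - osc a b (t + s) - - s * osc b (- a) t)//; ring.
move=> uv w; rewrite in_itv/= => /andP[uw wv].
have dosc x : x \in `]u, v[ -> is_derive x (1 : R) (osc a b) (osc b (- a) x).
  by move=> _; exact: is_derive_osc.
have cosc : {within `[u, v], continuous (osc a b)}.
  apply: derivable_within_continuous => x _; by case: (is_derive_osc a b x).
have [c] := MVT_segment uv dosc cosc; rewrite in_itv/= => /andP[uc cv] ->.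
rewrite (mulrC (v - u)) -mulrBl normrM expr2 mulrA.
rewrite ler_pM// ?normr_ge0//; last by rewrite ger0_norm// subr_ge0.
apply: (le_trans (lipschitz_osc _ _ _ _)); rewrite normrN [`|b| + _]addrC ler_wpM2l ?addr_ge0//.
by rewrite ler_norml; apply/andP; split; lra.
Qed.

Lemma smooth_osc a b : smooth (osc a b).
Proof. exact: smooth_cos_sin. Qed.

End oscillation.

Section quadratic_differentiability.
Context {R : realType} {n : nat}.
Local Notation E := 'rV[R]_n.

Lemma dotp_linear (w : E) : linear ((dotp ^~ w) : E -> R).
Proof. by move=> c x y; rewrite dotpDl dotpZl. Qed.

Lemma differentiable_dotpl (w x : E) : differentiable (dotp ^~ w) x.
Proof.
rewrite (_ : dotp ^~ w = \sum_i (fun x : E => x ord0 i * w ord0 i)); last first.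
  by apply/funext => y; rewrite fct_sumE.
apply: differentiable_sum => i.
apply: (@differentiableM _ _ (fun x : E => x ord0 i) (fun=> w ord0 i)).
  exact: differentiable_coord.
exact: differentiable_cst.
Qed.

Lemma continuous_dotpl (w : E) : continuous (dotp ^~ w).
Proof. by move=> x; apply: differentiable_continuous; exact: differentiable_dotpl. Qed.

Lemma derive_dotpl (w x v : E) : 'D_v (dotp ^~ w) x = dotp v w.
Proof.
pose fM := GRing.isLinear.Build _ _ _ _ _ (dotp_linear w).
pose f : {linear E -> R} := HB.pack (dotp ^~ w : E -> R) fM.
rewrite deriveE; last exact: differentiable_dotpl.
rewrite (_ : (dotp ^~ w) = f)// diff_lin//.
exact: continuous_dotpl.
Qed.

Lemma smooth_dotpl (f : R -> R) (w : E) : smooth f -> smooth (fun x : E => f (dotp x w)).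
Proof.
exact: (@smooth_comp _ _ _ (dotp ^~ w) (dotp ^~ w) f (differentiable_dotpl w) (derive_dotpl w)).
Qed.

Lemma differentiable_quadratic (f : E -> R) (x w : E) (C : R) : 0 <= C ->
  (forall h, `|f (x + h) - f x - dotp h w| <= C * `|h| ^+ 2) ->
  differentiable f x /\ forall v, 'D_v f x = dotp v w.
Proof.
move=> C0 H.
pose LM := GRing.isLinear.Build _ _ _ _ _ (dotp_linear w).
pose L : {linear E -> R} := HB.pack (dotp ^~ w : E -> R) LM.
have cL : continuous L by exact: continuous_dotpl.
have fE : f \o shift x = cst (f x) + L +o_ (0 : E) id.
  apply/eqaddoP => e e0; apply/nbhs_ballP; exists (e / (C + 1)) => /=.
    by rewrite divr_gt0// ltr_wpDl.
  move=> h; rewrite -ball_normE /ball_/= sub0r normrN => he.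
  rewrite !fctE /= [h + x]addrC opprD addrA; apply: (le_trans (H h)).
  rewrite expr2 mulrA ler_wpM2r//.
  rewrite (@le_trans _ _ ((C + 1) * `|h|))//; first by rewrite ler_wpM2r// lerDl.
  by rewrite mulrC -ler_pdivlMr ?ltr_wpDl// ltW.
have dE := diff_unique cL fE.
have df : differentiable f x.
  apply/diff_locallyxP; rewrite dE; split => // h.
  exact: (congr1 (fun g => g h) fE).
by split => // v; rewrite deriveE// dE.
Qed.

End quadratic_differentiability.

Section fourier_transform.
Context {R : realType} {n : nat}.
Local Notation E := 'rV[R]_n.
Local Notation leb := (@lebesgue_rV R n).
Implicit Types (phi : E -> R) (xi v : E).

(** Cosine and sine transforms at once: the Fourier transform of a real [phi] is
    [F 1 0 phi - i F 0 1 phi]. *)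
Definition osc_transform (a b : R) phi xi : R := \int[leb]_x (phi x * osc a b (dotp x xi)).
Local Notation F := osc_transform.

Lemma measurable_osc d (T : measurableType d) a b (f g : T -> E) :
  measurable_fun setT f -> measurable_fun setT g ->
  measurable_fun setT (fun t => osc a b (dotp (f t) (g t))).
Proof.
move=> mf mg; apply: (@measurableT_comp _ _ _ _ _ _ (osc a b)).
  apply: continuous_measurable_fun; apply: smooth_continuous; exact: smooth_osc.
exact: measurable_dotp.
Qed.

Lemma integrable_osc a b phi xi : leb.-integrable setT (EFin \o phi) ->
  leb.-integrable setT (EFin \o (fun x => phi x * osc a b (dotp x xi))).
Proof.
move=> ip; apply: (@integrable_Mbounded _ _ _ leb setT measurableT phi _ (`|a| + `|b|)) => //.
  by apply: measurable_osc => //; exact: measurable_cst.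
by move=> x _; exact: osc_bound.
Qed.

Lemma osc_transform_bound a b phi xi : leb.-integrable setT (EFin \o phi) ->
  `|F a b phi xi| <= (`|a| + `|b|) * \int[leb]_x `|phi x|.
Proof.
move=> ip; apply: (le_trans (le_normr_Rintegral measurableT (integrable_osc a b xi ip))).
have inp := integrable_norm ip.
rewrite -RintegralZl//; apply: le_Rintegral => //.
- exact: (integrable_norm (integrable_osc a b xi ip)).
- exact: integrable_Zl.
- by move=> x _; rewrite normrM mulrC ler_wpM2r// osc_bound.
Qed.

Lemma test_dotp phi v : test_function setT phi -> test_function setT (fun x => phi x * dotp x v).
Proof. by move=> tp; apply: testM => //; exact: (@smooth_dotpl _ _ id v (@smooth_id R)). Qed.

(** The second order remainder of [osc] is quadratic in [dotp x h], and [x] ranges over the bounded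
    support of [phi]; so the remainder of the transform is quadratic in [h]. The derivative is again
    a transform, of [phi] times a linear form, whence smoothness by iteration. *)
Lemma osc_transform_derive a b phi xi : test_function setT phi ->
  differentiable (F a b phi) xi /\
  forall v, 'D_v (F a b phi) xi = F b (- a) (fun x => phi x * dotp x v) xi.
Proof.
move=> tp; have ip := test_integrable tp.
have [r r0 p0] := test_bounded_support tp.
pose w : E := \row_j F b (- a) (fun x => phi x * x ord0 j) xi.
have icoord j : leb.-integrable setT (EFin \o (fun x => phi x * x ord0 j * osc b (- a) (dotp x xi))).
  apply: integrable_osc; apply: (@test_integrable _ _ setT).
  by apply: testM => //; exact: (@smooth_coord _ _ id j (@smooth_id R)).
have wE v : dotp v w = F b (- a) (fun x => phi x * dotp x v) xi.
  rewrite /dotp /F.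
  transitivity (\sum_i \int[leb]_x (v ord0 i * (phi x * x ord0 i * osc b (- a) (dotp x xi)))).
    by apply: eq_bigr => i _; rewrite mxE RintegralZl.
  rewrite -Rintegral_sum//; last first.
    by move=> i; exact: integrable_Zl.
  apply: eq_Rintegral => x _; rewrite mulr_sumr mulr_suml; apply: eq_bigr => i _; ring.
pose C := (`|a| + `|b|) * (n%:R * (n%:R * r)) ^+ 2 * \int[leb]_x `|phi x|.
have C0 : 0 <= C.
  apply: mulr_ge0; last exact: Rintegral_ge0.
  by apply: mulr_ge0; [exact: addr_ge0|exact: sqr_ge0].
have := @differentiable_quadratic R n (F a b phi) xi w C C0.
case.
  move=> h; rewrite wE.
  have i1 := integrable_osc a b (xi + h) ip.
  have i2 := integrable_osc a b xi ip.
  have i3 : leb.-integrable setT (EFin \o (fun x => phi x * dotp x h * osc b (- a) (dotp x xi))).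
    by apply: integrable_osc; apply: (@test_integrable _ _ setT); exact: test_dotp.
  have i12 : leb.-integrable setT (EFin \o (fun x => phi x * osc a b (dotp x (xi + h)) - phi x * osc a b (dotp x xi))).
    exact: integrable_B.
  rewrite /F -RintegralB// -RintegralB//.
  have i123 : leb.-integrable setT (EFin \o (fun x => phi x * osc a b (dotp x (xi + h)) - phi x * osc a b (dotp x xi) - phi x * dotp x h * osc b (- a) (dotp x xi))).
    exact: (integrable_B _ i12).
  apply: (le_trans (le_normr_Rintegral measurableT i123)).
  have inp := integrable_norm ip.
  have -> : C * `|h| ^+ 2 = (`|a| + `|b|) * ((n%:R * (n%:R * r)) ^+ 2 * `|h| ^+ 2) *
      \int[leb]_x `|phi x| by rewrite /C; ring.
  rewrite -RintegralZl//.
  apply: le_Rintegral => //.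
  - exact: (integrable_norm i123).
  - exact: integrable_Zl.
  move=> x _; rewrite [leRHS]mulrC.
  rewrite (_ : _ - _ = phi x * (osc a b (dotp x xi + dotp x h) - osc a b (dotp x xi) - dotp x h * osc b (- a) (dotp x xi))); last by rewrite dotpDr; ring.
  rewrite normrM; have [xr|/p0 ->] := ltP `|x| r; last by rewrite normr0 !mul0r.
  rewrite ler_wpM2l//; apply: (le_trans (taylor_osc _ _ _ _)).
  rewrite ler_wpM2l ?addr_ge0// -exprMn -[leLHS]real_normK ?num_real//.
  rewrite ler_pXn2r ?nnegrE ?mulr_ge0 ?(ltW r0)//.
  apply: (le_trans (dotp_CS _ _)).
  rewrite [leRHS](_ : _ = (n%:R * r) * (n%:R * `|h|)); last by ring.
  rewrite ler_pM ?enorm_ge0 ?enorm_le_norm//.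
  by rewrite (le_trans (enorm_le_norm _))// ler_wpM2l// ltW.
by move=> df Df; split => // v; rewrite Df wE.
Qed.

Lemma smooth_osc_transform a b phi : test_function setT phi -> smooth (F a b phi).
Proof.
move=> tp.
apply: (@smooth_coind _ _ (fun f => exists a b phi, test_function setT phi /\ f = F a b phi)); last by exists a, b, phi.
move=> _ [{tp}a [{}b [{}phi [tp ->]]]]; split => [x|v].
  by have [] := osc_transform_derive a b x tp.
exists b, (- a), (fun x => phi x * dotp x v); split; first exact: test_dotp.
by apply/funext => x; have [_] := osc_transform_derive a b x tp.
Qed.

Lemma iterD_osc_transform a b phi (l : seq E) : test_function setT phi ->
  exists a' b' phi', test_function setT phi' /\ Defs.iterD l (F a b phi) = F a' b' phi'.
Proof.
move=> tp; elim: l => [|v l [a' [b' [phi' [tp' IH]]]]] /=; first by exists a, b, phi.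
exists b', (- a'), (fun x => phi' x * dotp x v); split; first exact: test_dotp.
by rewrite -/(Defs.iterD l _) IH; apply/funext => x; have [_] := osc_transform_derive a' b' x tp'.
Qed.

(** Integration by parts: [xi_j osc a b] is the derivative of [osc (- b) a] in the direction
    [e_j]. *)
Lemma osc_transform_coord a b phi xi j : test_function setT phi ->
  xi ord0 j * F a b phi xi = - F (- b) a ('D_('e_j) phi) xi.
Proof.
move=> tp; have sp := test_smooth tp; have ip := test_integrable tp.
pose u x := osc (- b) a (dotp x xi).
have su : smooth u by apply: (@smooth_dotpl _ _ (osc (- b) a)); exact: smooth_osc.
have Du x : 'D_('e_j) u x = xi ord0 j * osc a b (dotp x xi).
  rewrite (@derive_comp_affine _ _ _ (dotp ^~ xi) (dotp ^~ xi) (osc (- b) a)).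
  - rewrite derive_R; last by apply: smooth_differentiable; exact: smooth_osc.
    rewrite (@derive_val _ _ _ _ _ _ _ (is_derive_osc (- b) a _)) opprK.
    congr (_ * _); rewrite /dotp (bigD1 j)//= mxE !eqxx mul1r big1 ?addr0// => i ij.
    by rewrite mxE eqxx (negbTE ij) mul0r.
  - exact: differentiable_dotpl.
  - exact: derive_dotpl.
  - by apply: smooth_differentiable; exact: smooth_osc.
have := integral_derive0 'e_j (testM tp su).
rewrite (_ : 'D_('e_j) _ = fun x => phi x * (xi ord0 j * osc a b (dotp x xi)) + 'D_('e_j) phi x * osc (- b) a (dotp x xi)); last first.
  apply/funext => x; rewrite (@deriveM _ _ phi u).
  - by rewrite Du /GRing.scale/= [u x * _]mulrC.
  - by apply: diff_derivable; exact: smooth_differentiable.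
  - by apply: diff_derivable; exact: smooth_differentiable.
have i1 : leb.-integrable setT (EFin \o (fun x => xi ord0 j * (phi x * osc a b (dotp x xi)))).
  by apply: integrable_Zl => //; exact: integrable_osc.
have i2 : leb.-integrable setT (EFin \o (fun x => 'D_('e_j) phi x * osc (- b) a (dotp x xi))).
  by apply: integrable_osc; apply: test_integrable; exact: test_derive tp.
under eq_Rintegral do rewrite mulrCA.
rewrite RintegralD// RintegralZl//; last exact: integrable_osc.
by move/eqP; rewrite addr_eq0 => /eqP.
Qed.

(** Each coordinate of [xi] is traded for a derivative of [phi], and [|xi|] is at most the sum of
    the absolute values of its coordinates. *)
Lemma osc_transform_decay m a b phi : test_function setT phi ->
  exists2 M, 0 <= M & forall xi, `|xi| ^+ m * `|F a b phi xi| <= M.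
Proof.
elim: m a b phi => [|m IH] a b phi tp.
  exists ((`|a| + `|b|) * \int[leb]_x `|phi x|).
    by rewrite mulr_ge0 ?addr_ge0//; apply: Rintegral_ge0.
  by move=> xi; rewrite expr0 mul1r osc_transform_bound//; exact: test_integrable tp.
have /choice[M hM] : forall j : 'I_n, exists M, 0 <= M /\
    forall xi, `|xi| ^+ m * `|F (- b) a ('D_('e_j) phi) xi| <= M.
  by move=> j; have [M M0 hM] := IH (- b) a _ (test_derive 'e_j tp); exists M.
exists (\sum_j M j); first by apply: sumr_ge0 => j _; case: (hM j).
move=> xi; rewrite exprSr -mulrA.
apply: (@le_trans _ _ (`|xi| ^+ m * \sum_j `|xi ord0 j * F a b phi xi|)).
  rewrite ler_wpM2l ?exprn_ge0//.
  under eq_bigr do rewrite normrM.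
  rewrite -mulr_suml ler_wpM2r//; apply: le_trans (norm_le_enorm _) _.
  exact: enorm_le_sum.
rewrite mulr_sumr; apply: ler_sum => j _.
by rewrite osc_transform_coord// normrN; case: (hM j).
Qed.

End fourier_transform.

(** * Inversion of the Fourier transform *)

Section fourier_inversion.
Context {R : realType} {n : nat}.
Local Notation E := 'rV[R]_n.
Local Notation leb := (@lebesgue_rV R n).
Local Notation F := (@osc_transform R n).
Implicit Types (phi : E -> R) (xi v : E).

(** On the dyadic shell of index [k] the weight [c k] dominates [|f|], and the integrals
    [c k (2 * 2^k)^n] over the dyadic cubes form a geometric series of ratio one half. *)
Lemma integrable_decay (f : E -> R) (M : R) : measurable_fun setT f ->
  (forall x, `|f x| <= M) -> (forall x, `|x| ^+ n.+1 * `|f x| <= M) ->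
  leb.-integrable setT (EFin \o f).
Proof.
move=> mf fM fD; have M0 : 0 <= M by apply: le_trans (fM 0).
pose c k : R := M * 2 ^+ n.+1 / (2 ^+ k) ^+ n.+1.
have c0 k : 0 <= c k by rewrite divr_ge0// ?mulr_ge0 ?exprn_ge0.
pose B k := [set x : E | `|x| < 2 ^+ k].
have p0 k : 0 < 2 ^+ k :> R by rewrite exprn_gt0.
have mB k : measurable (B k) by exact: measurable_lt_norm.
have mi k : measurable_fun setT (fun x : E => (\1_(B k) x : R)%:E).
  by apply/measurable_EFinP; exact: measurable_indic.
have mc k : measurable_fun setT (fun x : E => (c k * \1_(B k) x)%:E).
  by apply/measurable_EFinP; apply: measurable_funM => //; exact: measurable_indic.
have cB0 k x : (0 <= (c k * \1_(B k) x)%:E)%E by rewrite lee_fin mulr_ge0.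
have pt x : exists2 k, B k x & `|f x| <= c k.
  have exB : exists k, `|x| < 2 ^+ k.
    exists (Num.truncn `|x|).+1; apply: (lt_le_trans (truncnS_gt _)).
    by rewrite -natrX ler_nat ltnW// ltn_expl.
  case: (ex_minnP exB) => [[|k] xk kmin].
    by exists 0%N => //; apply: (le_trans (fM x)); rewrite /c expr0 expr1n divr1 ler_peMr// exprn_ege1// ler1n.
  exists k.+1 => //.
  have xk' : 2 ^+ k <= `|x| by rewrite leNgt; apply/negP => /kmin; rewrite ltnn.
  have x0 : 0 < `|x| by apply: lt_le_trans xk'.
  rewrite -(ler_pM2l (exprn_gt0 n.+1 x0)); apply: (le_trans (fD x)).
  have -> : c k.+1 = M / (2 ^+ k) ^+ n.+1.
    by rewrite /c [2 ^+ k.+1]exprS exprMn; field; rewrite expf_neq0 ?expf_neq0//= ?expf_neq0.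
  rewrite mulrA [X in X / _]mulrC -mulrA ler_peMr// ler_pdivlMr ?exprn_gt0// mul1r.
  by rewrite ler_pXn2r// nnegrE ltW.
have bd x : (`|(f x)%:E| <= \sum_(0 <= k <oo) (c k * \1_(B k) x)%:E)%E.
  have [k Bkx h] := pt x.
  apply: (@le_trans _ _ (\sum_(0 <= i < k.+1) (c i * \1_(B i) x)%:E)%E); last first.
    exact: nneseries_lim_ge.
  rewrite big_nat_recr//= indicE mem_set// mulr1; apply: (@le_trans _ _ (c k)%:E); first by rewrite lee_fin.
  by rewrite leeDr// sume_ge0.
apply/integrableP; split; first exact/measurable_EFinP.
apply: (@le_lt_trans _ _ (\int[leb]_x \sum_(0 <= k <oo) (c k * \1_(B k) x)%:E)%E).
  apply: ge0_le_integral => //.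
  - by apply: measurableT_comp => //; exact/measurable_EFinP.
  - exact: ge0_emeasurable_sum.
  - by move=> x _; exact: bd.
rewrite integral_nneseries//.
apply: (@le_lt_trans _ _ (M * 2 ^+ n.+1 * 2 ^+ n.+1)%:E); last exact: ltry.
apply: le_trans (epsilon_trick0 predT _); last by rewrite !mulr_ge0 ?exprn_ge0.
apply: lee_nneseries => [k _ _|k _]; first by apply: integral_ge0 => x _; exact: cB0.
under eq_integral do rewrite EFinM.
rewrite ge0_integralZl ?lee_fin//.
rewrite integral_indic// setIT [X in (_ * X)%E](lebesgue_cube n (p0 k)) -EFinM lee_fin.
rewrite le_eqVlt; apply/orP; left; apply/eqP; rewrite /c natrX exprMn [2 ^+ k.+1]exprS !(exprSr _ n).
by field; rewrite !expf_neq0.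
Qed.

Lemma integrable_osc_transform a b phi : test_function setT phi ->
  leb.-integrable setT (EFin \o F a b phi).
Proof.
move=> tp; have [M1 M10 h1] := osc_transform_decay 0 a b tp.
have [M2 M20 h2] := osc_transform_decay n.+1 a b tp.
apply: (@integrable_decay _ (M1 + M2)).
- by apply: measurable_smooth; exact: smooth_osc_transform.
- by move=> x; have := h1 x; rewrite expr0 mul1r => /le_trans; apply; rewrite lerDl.
- by move=> x; apply: (le_trans (h2 x)); rewrite lerDr.
Qed.

Lemma normc_le (x y : R) : Normc.normc (Complex x y) <= `|x| + `|y|.
Proof.
rewrite /Normc.normc/= -(ler_pXn2r (ltn0Sn 1)) ?nnegrE ?sqrtr_ge0 ?addr_ge0//.
rewrite sqr_sqrtr ?addr_ge0 ?sqr_ge0// sqrrD !real_normK ?num_real//.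
by rewrite addrAC lerDl mulrn_wge0// mulr_ge0.
Qed.

Lemma schwartz_osc_transform a b c d phi : test_function setT phi ->
  schwartz (fun xi : E => Complex (F a b phi xi) (F c d phi xi)).
Proof.
move=> tp; split; first by split; exact: smooth_osc_transform.
move=> m l.
have bnd a' b' phi' : test_function setT phi' ->
    exists2 M, 0 <= M & forall xi, (1 + enorm xi) ^+ m * `|F a' b' phi' xi| <= M.
  move=> tp'; have [M1 M10 h1] := osc_transform_decay 0 a' b' tp'.
  have [M2 M20 h2] := osc_transform_decay m a' b' tp'.
  exists ((1 + n%:R) ^+ m * (M1 + M2)); first by rewrite mulr_ge0 ?exprn_ge0 ?addr_ge0.
  move=> xi; apply: (@le_trans _ _ ((1 + n%:R) ^+ m * ((1 + `|xi| ^+ m) * `|F a' b' phi' xi|))).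
    rewrite mulrA ler_wpM2r//.
    have e1 : 1 + enorm xi <= 1 + n%:R * `|xi| by rewrite lerD2l enorm_le_norm.
    have [x1|x1] := leP `|xi| 1.
      rewrite -[leLHS]mulr1 ler_pM ?exprn_ge0 ?addr_ge0 ?enorm_ge0//.
        rewrite lerXn2r ?nnegrE ?addr_ge0 ?enorm_ge0//; apply: (le_trans e1).
        by rewrite lerD2l ler_piMr.
      by rewrite lerDl exprn_ge0.
    apply: (@le_trans _ _ ((1 + n%:R) ^+ m * `|xi| ^+ m)).
      rewrite -exprMn lerXn2r ?nnegrE ?mulr_ge0 ?addr_ge0 ?enorm_ge0//.
      by apply: (le_trans e1); rewrite mulrDl mul1r lerD2r ltW.
    by rewrite ler_wpM2l ?exprn_ge0 ?addr_ge0// lerDr.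
  rewrite ler_wpM2l ?exprn_ge0 ?addr_ge0// mulrDl mul1r lerD//.
  by have := h1 xi; rewrite expr0 mul1r.
have [a1 [b1 [p1 [t1 e1]]]] := iterD_osc_transform a b l tp.
have [a2 [b2 [p2 [t2 e2]]]] := iterD_osc_transform c d l tp.
have [M1 _ h1] := bnd a1 b1 p1 t1; have [M2 _ h2] := bnd a2 b2 p2 t2.
exists (M1 + M2) => x; rewrite /citerD /= e1 e2.
apply: (@le_trans _ _ ((1 + enorm x) ^+ m * (`|F a1 b1 p1 x| + `|F a2 b2 p2 x|))).
  by rewrite ler_wpM2l ?normc_le// exprn_ge0// addr_ge0 ?enorm_ge0.
by rewrite mulrDr lerD.
Qed.

(** Fubini, the kernel being symmetric in the two variables. *)
Lemma osc_transform_multiplication a b p q : leb.-integrable setT (EFin \o p) ->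
  leb.-integrable setT (EFin \o q) ->
  \int[leb]_xi (q xi * F a b p xi) = \int[leb]_y (p y * F a b q y).
Proof.
move=> ip iq.
have := @Fubini_kernel _ _ E E R leb leb q p (fun z => osc a b (dotp z.1 z.2)) (`|a| + `|b|) iq ip.
have mw : measurable_fun setT (fun z : E * E => osc a b (dotp z.1 z.2)).
  exact: measurable_osc.
move=> /(_ mw (fun z => osc_bound _ _ _)) /= H.
transitivity (\int[leb]_x (q x * \int[leb]_y (p y * osc a b (dotp x y)))).
  by apply: eq_Rintegral => x _; congr (_ * _); apply: eq_Rintegral => y _; rewrite dotpC.
by rewrite H.
Qed.

Lemma osc_transform_scale a b phi (e : R) xi : 0 < e -> test_function setT phi ->
  F a b phi xi = e ^+ n * F a b (fun x => phi (e *: x)) (e *: xi).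
Proof.
move=> e0 tp; rewrite /F /osc_transform.
have := @Rintegral_aff R n e 0 (fun x => phi x * osc a b (dotp x xi)) (lt0r_neq0 e0)
  (integrable_osc a b xi (test_integrable tp)).
rewrite gtr0_norm// => H.
rewrite (_ : \int[leb]_x (phi (e *: x) * _) = \int[leb]_x (phi (e *: x + 0) * osc a b (dotp (e *: x + 0) xi))).
  by rewrite H mulrA -exprMn divff ?expr1n ?mul1r// gt_eqF.
by apply: eq_Rintegral => x _; rewrite addr0 dotpZr dotpZl.
Qed.

Lemma osc_transform_shift a b phi y xi : test_function setT phi ->
  F a b (fun x => phi (x + y)) xi =
  F a b phi xi * cos (dotp y xi) + F (- b) a phi xi * sin (dotp y xi).
Proof.
move=> tp; have ip := test_integrable tp; rewrite /F /osc_transform.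
have i1 := integrable_osc a b xi ip; have i2 := integrable_osc (- b) a xi ip.
have := @Rintegral_shift R n y (fun x => phi x * osc a b (dotp x xi - dotp y xi)).
rewrite (_ : EFin \o _ = EFin \o (fun x => cos (dotp y xi) * (phi x * osc a b (dotp x xi)) +
    sin (dotp y xi) * (phi x * osc (- b) a (dotp x xi)))); last first.
  by apply/funext => x /=; rewrite /osc cosB sinB; congr EFin; ring.
move=> H; rewrite (_ : \int[leb]_x (phi (x + y) * _) =
   \int[leb]_x (phi (x + y) * osc a b (dotp (x + y) xi - dotp y xi))); last first.
  by apply: eq_Rintegral => x _; rewrite dotpDl addrK.
rewrite H; last by apply: integrable_D => //; exact: integrable_Zl.
rewrite mulrC -RintegralZl// [X in _ = _ + X]mulrC -RintegralZl// -RintegralD//; try exact: integrable_Zl.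
by apply: eq_Rintegral => x _; rewrite /osc cosB sinB; ring.
Qed.

(** The multiplication formula applied to [g] and a dilation of [phi] gives [\int (F phi)(x) g(e x)
    dx = \int (F g)(x) phi(e x) dx]; then [e] tends to zero. Hence the integral of a transform is
    the value at the origin times a constant that does not depend on the function, and no Gaussian
    has to be transformed. *)
Lemma osc_transform_inversion0 phi g : test_function setT phi -> test_function setT g ->
  g 0 * \int[leb]_xi F 1 0 phi xi = phi 0 * \int[leb]_xi F 1 0 g xi.
Proof.
move=> tp tg.
have iFp := integrable_osc_transform 1 0 tp; have iFg := integrable_osc_transform 1 0 tg.
pose e (k : nat) : R := k.+1%:R^-1.
have e0 k : 0 < e k by rewrite invr_gt0.
have ecv : e k @[k --> \oo] --> 0.
  have := @cvg_harmonic R; exact.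
have cv p f : test_function setT p -> leb.-integrable setT (EFin \o f) ->
    \int[leb]_x (f x * p (e k *: x)) @[k --> \oo] --> \int[leb]_x (f x * p 0).
  move=> tpp iff; have [M M0 pM] := test_bounded tpp.
  have sp := test_smooth tpp.
  apply: (@Rintegral_dct _ _ _ leb setT measurableT _ _ (fun x => `|f x| * M)).
  - move=> k; apply: measurable_funM; first exact: (integrable_measurable iff).
    apply: (measurableT_comp (measurable_smooth sp)).
    have := measurable_aff (e k) (0 : E); apply: eq_measurable_fun => x _.
    by rewrite addr0.
  - move=> x _; apply: cvgMr.
    apply: (cvg_comp (fun k => e k *: x) p); last exact: (smooth_continuous sp).
    rewrite -(scale0r x); exact: (cvgZr_tmp (V := E) (a := x)).
  - by move=> k x _; rewrite normrM ler_wpM2l.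
  - have := integrable_Zl measurableT M (integrable_norm iff).
    by apply: eq_integrable => // x _ /=; rewrite mulrC.
have h1 := cv g _ tg iFp; have h2 := cv phi _ tp iFg.
have E12 k : \int[leb]_x (F 1 0 phi x * g (e k *: x)) = \int[leb]_x (F 1 0 g x * phi (e k *: x)).
  have tpe : test_function setT (fun x => phi (e k *: x)).
    have := test_aff (0 : E) (lt0r_neq0 (e0 k)) tp.
    by under eq_fun do rewrite addr0.
  have ipe := test_integrable tpe.
  have -> : \int[leb]_x (F 1 0 g x * phi (e k *: x)) = \int[leb]_x (g x * F 1 0 (fun x => phi (e k *: x)) x).
    rewrite osc_transform_multiplication//; last exact: test_integrable tg.
    by apply: eq_Rintegral => x _; rewrite mulrC.
  have igF : leb.-integrable setT (EFin \o (fun x => g x * F 1 0 (fun x => phi (e k *: x)) x)).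
    have [M M0 gM] := test_bounded tg.
    have iFe := integrable_osc_transform 1 0 tpe.
    have := @integrable_Mbounded _ _ _ leb setT measurableT _ g M (measurable_smooth (test_smooth tg)) (fun x _ => gM x) iFe.
    by apply: eq_integrable => // x _ /=; rewrite mulrC.
  have := Rintegral_aff (0 : E) (lt0r_neq0 (e0 k)) igF.
  rewrite gtr0_norm// => H.
  have -> : \int[leb]_x (g x * F 1 0 (fun x => phi (e k *: x)) x) =
      e k ^+ n * \int[leb]_x (g (e k *: x + 0) * F 1 0 (fun x => phi (e k *: x)) (e k *: x + 0)).
    by rewrite H mulrA -exprMn divff ?expr1n ?mul1r// gt_eqF.
  have iga : leb.-integrable setT (EFin \o (fun x => g (e k *: x + 0) * F 1 0 (fun x => phi (e k *: x)) (e k *: x + 0))).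
    exact: (integrable_aff (0 : E) (lt0r_neq0 (e0 k)) igF).
  rewrite -RintegralZl//; apply: eq_Rintegral => x _.
  by rewrite addr0 (osc_transform_scale 1 0 x (e0 k) tp); ring.
move: h1; under eq_fun do rewrite E12.
move=> h1; have := cvg_unique _ h1 h2.
rewrite !RintegralZr// => H; rewrite mulrC H// mulrC//.
Qed.

(** This is [(2 pi)^n], obtained as the ratio of the integral of a cosine transform to the value at
    the origin, here for [Bump]. That it is nonzero is derived below from an energy identity instead
    of an evaluation. *)
Definition fourier_const : R := (\int[leb]_xi F 1 0 (@Bump R n) xi) / @Bump R n 0.

Lemma Bump0_gt0 : 0 < @Bump R n 0.
Proof. by apply: Bump_gt0; rewrite normr0. Qed.

Lemma osc_transform_cos_integral phi : test_function setT phi ->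
  \int[leb]_xi F 1 0 phi xi = fourier_const * phi 0.
Proof.
move=> tp; have := osc_transform_inversion0 tp (@test_Bump R n) => H.
rewrite /fourier_const mulrAC [_ * phi 0]mulrC -H mulrAC divff ?mul1r//.
by rewrite gt_eqF// Bump0_gt0.
Qed.

(** The sine transform is odd in [xi]. *)
Lemma osc_transform_sin_integral phi : test_function setT phi ->
  \int[leb]_xi F 0 1 phi xi = 0.
Proof.
move=> tp; have iF := integrable_osc_transform 0 1 tp.
have n1 : (-1 : R) != 0 by rewrite oppr_eq0 oner_neq0.
have := Rintegral_aff (0 : E) n1 iF.
rewrite normrN1 invr1 expr1n mul1r => H.
have : \int[leb]_xi F 0 1 phi (-1 *: xi + 0) = - \int[leb]_xi F 0 1 phi xi.
  transitivity (\int[leb]_xi (-1 * F 0 1 phi xi)); last by rewrite RintegralZl// mulN1r.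
  apply: eq_Rintegral => x _.
  rewrite addr0 /F /osc_transform -RintegralZl//; last by apply: integrable_osc; exact: test_integrable tp.
  apply: eq_Rintegral => y _; rewrite /osc dotpZr mulN1r sinN; ring.
rewrite H => /eqP; rewrite -addr_eq0 -mulr2n mulrn_eq0 => /eqP //.
Qed.

(** Translating [phi] moves the point of evaluation from the origin to [y]. The companion identity
    for the sine transform expresses that the inversion formula has no imaginary part. *)
Lemma cos_inversion phi y : test_function setT phi ->
  \int[leb]_xi (F 1 0 phi xi * cos (dotp y xi) + F 0 1 phi xi * sin (dotp y xi)) =
  fourier_const * phi y.
Proof.
move=> tp; have ts : test_function setT (fun x => phi (x + y)).
  by have := test_aff y (oner_neq0 R) tp; under eq_fun do rewrite scale1r.
have := osc_transform_cos_integral ts; rewrite add0r => <-.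
by apply: eq_Rintegral => x _; rewrite osc_transform_shift// oppr0.
Qed.

Lemma sin_inversion phi y : test_function setT phi ->
  \int[leb]_xi (F 0 1 phi xi * cos (dotp y xi) - F 1 0 phi xi * sin (dotp y xi)) = 0.
Proof.
move=> tp; have ts : test_function setT (fun x => phi (x + y)).
  by have := test_aff y (oner_neq0 R) tp; under eq_fun do rewrite scale1r.
rewrite -[RHS](osc_transform_sin_integral ts).
apply: eq_Rintegral => x _; rewrite osc_transform_shift//; congr (_ + _).
rewrite -mulNr; congr (_ * _).
rewrite /F /osc_transform -mulN1r -RintegralZl//; last by apply: integrable_osc; exact: test_integrable tp.
by apply: eq_Rintegral => z _; rewrite /osc; ring.
Qed.

(** Plancherel for [Bump]: the integral of the squared modulus of its transform is [fourier_const]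
    times the integral of its square, and it is positive because the transform at the origin is the
    integral of [Bump]. *)
Lemma fourier_const_neq0 : fourier_const != 0.
Proof.
pose phi := @Bump R n; have tp : test_function setT phi := @test_Bump R n.
have i1 := integrable_osc_transform 1 0 tp; have i2 := integrable_osc_transform 0 1 tp.
have ip := test_integrable tp.
have [M M0 pM] := test_bounded tp.
have mc a b : measurable_fun setT (fun z : E * E => osc (a : R) b (dotp z.1 z.2)) by exact: measurable_osc.
pose g xi := F 1 0 phi xi ^+ 2 + F 0 1 phi xi ^+ 2.
have sq a b : smooth (F a b phi) by exact: smooth_osc_transform.
have sg : smooth g.
  have h a b : smooth (fun x => F a b phi x ^+ 2).
    by under eq_fun do rewrite expr2; exact: smoothM.
  exact: smoothD.
have bF a b xi : `|F a b phi xi| <= (`|a| + `|b|) * \int[leb]_x `|phi x|.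
  exact: osc_transform_bound.
have isq a b : leb.-integrable setT (EFin \o (fun xi => F a b phi xi * F a b phi xi)).
  apply: (@integrable_Mbounded _ _ _ leb setT measurableT _ _ _ _ (fun x _ => bF a b x)).
    exact: measurable_smooth.
  exact: integrable_osc_transform.
have ig : leb.-integrable setT (EFin \o g).
  have := integrable_D measurableT (isq 1 0) (isq 0 1).
  by apply: eq_integrable => // x _ /=; rewrite /g !expr2.
have gpos : 0 < \int[leb]_xi g xi.
  apply: Rintegral_gt0_continuous => //.
  - exact: (smooth_continuous sg).
  - by move=> x; rewrite addr_ge0 ?sqr_ge0.
  - rewrite /g ltr_pwDl ?sqr_ge0// exprn_even_gt0//= /F /osc_transform.
    rewrite (_ : \int[leb]_x _ = \int[leb]_x phi x); first by rewrite gt_eqF// integral_Bump_gt0.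
    apply: eq_Rintegral => x _; rewrite -(scale0r (0 : E)) dotpZr mul0r /osc cos0 sin0; ring.
have : \int[leb]_xi g xi = fourier_const * \int[leb]_y (phi y * phi y).
  have H1 := @Fubini_kernel _ _ E E R leb leb _ _ _ _ i1 ip (mc 1 0) (fun z => osc_bound _ _ _).
  have H2 := @Fubini_kernel _ _ E E R leb leb _ _ _ _ i2 ip (mc 0 1) (fun z => osc_bound _ _ _).
  have FE a b xi : F a b phi xi = \int[leb]_y (phi y * osc a b (dotp xi y)).
    by apply: eq_Rintegral => y _; rewrite dotpC.
  transitivity (\int[leb]_xi (F 1 0 phi xi * F 1 0 phi xi) + \int[leb]_xi (F 0 1 phi xi * F 0 1 phi xi)).
    by rewrite -RintegralD//; apply: eq_Rintegral => x _; rewrite /g !expr2.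
  under [X in X + _]eq_Rintegral do rewrite {2}FE.
  under [X in _ + X]eq_Rintegral do rewrite {2}FE.
  rewrite /= in H1 H2; rewrite H1 H2.
  have ij a b c d : leb.-integrable setT (EFin \o (fun y => phi y * \int[leb]_x (F a b phi x * osc c d (dotp x y)))).
    have ifab := integrable_osc_transform a b tp.
    pose K := (`|c| + `|d|) * \int[leb]_x `|F a b phi x|.
    have mS : measurable_fun setT (fun y : E => \int[leb]_x (F a b phi x * osc c d (dotp x y))).
      apply: (@measurable_Rintegral_section _ _ E E R leb (fun z => F a b phi z.2 * osc c d (dotp z.2 z.1))).
      apply: measurable_funM.
        by apply: (measurableT_comp (measurable_smooth (sq a b))).
      by apply: measurable_osc; [exact: measurable_snd|exact: measurable_fst].
    have bS (y : E) : setT y -> `|\int[leb]_x (F a b phi x * osc c d (dotp x y))| <= K.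
      by move=> _; exact: (@osc_transform_bound R n c d (F a b phi) y ifab).
    have := @integrable_Mbounded _ _ _ leb setT measurableT _ _ K mS bS ip.
    exact.
  have ipp := @integrable_Mbounded _ _ _ leb setT measurableT phi phi M (measurable_smooth (test_smooth tp)) (fun x _ => pM x) ip.
  rewrite -(RintegralZl fourier_const measurableT ipp) -(RintegralD measurableT (ij 1 0 1 0) (ij 0 1 0 1)).
  apply: eq_Rintegral => y _; rewrite -mulrDr mulrCA -(cos_inversion y tp); congr (_ * _).
  rewrite -(RintegralD measurableT (integrable_osc 1 0 y i1) (integrable_osc 0 1 y i2)).
  by apply: eq_Rintegral => x _; rewrite /osc dotpC; ring.
move=> ge; apply: contraTneq gpos => c0; by rewrite ge c0 mul0r ltxx.
Qed.

End fourier_inversion.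

(** * Kernels of fundamental type *)

Section singular_integrals.
Context {R : realType} {n : nat}.
Local Notation E := 'rV[R]_n.
Local Notation leb := (@lebesgue_rV R n).
Local Notation F := (@osc_transform R n).
Local Notation c := (@fourier_const R n).
Implicit Types (phi : E -> R) (xi v : E).

(** Away from the origin the preimage of an open interval is open, and at the origin it has at most
    one point. *)
Lemma measurable_continuous_punctured (f : E -> R) :
  (forall x, x <> 0 -> {for x, continuous f}) -> measurable_fun setT f.
Proof.
move=> cf; apply: (measurability _ (RGenOpens.measurableE R)) => _ [_ [a [b ->] <-]].
rewrite setTI.
have oN : open (~` [set (0 : E)]).
  rewrite openE => x /= x0; apply/nbhs_ballP; exists `|x|.
    by rewrite /= normr_gt0; exact/eqP.
  by move=> y; rewrite -ball_normE /ball_/= => xy y0; move: xy; rewrite y0 subr0 ltxx.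
have -> : f @^-1` `]a, b[ = (f @^-1` `]a, b[ `&` ~` [set 0]) `|` (f @^-1` `]a, b[ `&` [set 0]).
  by rewrite -setIUr setUCl setIT.
have mC : measurable (~` [set (0 : E)]).
  by rewrite measurable_rV_borel; apply: sub_sigma_algebra.
apply: measurableU.
  rewrite measurable_rV_borel; apply: sub_sigma_algebra; rewrite openE => x [fx x0].
  apply: filterI; last by apply: open_nbhs_nbhs.
  apply: cf => //; apply: open_nbhs_nbhs; split => //; exact: interval_open.
have [fab|fab] := pselect (f 0 \in `]a, b[).
  rewrite (_ : _ `&` _ = [set 0]); last by apply/seteqP; split => [x []//|x /= ->].
  by rewrite -[X in measurable X]setCK; exact: measurableC.
by rewrite (_ : _ `&` _ = set0) // -subset0 => x /= [] /[swap] ->.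
Qed.

Lemma compact_closed_ball_rV (x : E) (r : R) : 0 < r -> compact (closed_ball x r).
Proof.
move=> r0; apply: bounded_closed_compact; last exact: closed_ball_closed.
exists (`|x| + r); split; first exact: num_real.
move=> y ry z; rewrite closed_ballE// /closed_ball_/= => xz.
apply: le_trans (ltW ry); rewrite -[z](subrK x) addrC (le_trans (ler_normD _ _))// lerD2l.
by rewrite distrC.
Qed.

Lemma osc_transformZ a b phi (k : R) xi : test_function setT phi ->
  F a b (fun x => k * phi x) xi = k * F a b phi xi.
Proof.
move=> tp; rewrite /F /osc_transform -RintegralZl//; last by apply: integrable_osc; exact: test_integrable tp.
by apply: eq_Rintegral => x _; rewrite mulrA.
Qed.

(** The inverse transform of a real test function. A distribution known through its Fourier
    transform can be evaluated on transforms only, so [phi] is written as the transform of this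
    Schwartz function. *)
Definition fourier_preimage phi : E -> R[i] :=
  fun xi => Complex (c^-1 * F 1 0 phi xi) (c^-1 * F 0 1 phi xi).

Lemma fourier_preimageE phi : test_function setT phi ->
  fourier (fourier_preimage phi) = fun x => real_complex R (phi x).
Proof.
move=> tp; apply/funext => x; have c0 := @fourier_const_neq0 R n.
have i1 := integrable_osc_transform 1 0 tp; have i2 := integrable_osc_transform 0 1 tp.
rewrite /fourier /cint /=; congr Complex.
  transitivity (c^-1 * (c * phi x)); last by rewrite mulKf.
  rewrite -(cos_inversion x tp) -RintegralZl//.
    by apply: eq_Rintegral => y _; rewrite (dotpC y); ring.
  have h1 := integrable_osc 1 0 x i1; have h2 := integrable_osc 0 1 x i2.
  have := integrable_D measurableT h1 h2; apply: eq_integrable => // y _ /=.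
  by rewrite /osc (dotpC y); congr EFin; ring.
transitivity (c^-1 * \int[leb]_xi (F 0 1 phi xi * cos (dotp x xi) - F 1 0 phi xi * sin (dotp x xi))).
  2: by rewrite sin_inversion// mulr0.
rewrite -RintegralZl//.
  by apply: eq_Rintegral => y _; rewrite (dotpC y); ring.
have h1 := integrable_osc 0 (-1) x i1; have h2 := integrable_osc 1 0 x i2.
have := integrable_D measurableT h1 h2; apply: eq_integrable => // y _ /=.
by rewrite /osc (dotpC y); congr EFin; ring.
Qed.

Lemma schwartz_fourier_preimage phi : test_function setT phi -> schwartz (fourier_preimage phi).
Proof.
move=> tp; have := schwartz_osc_transform 1 0 0 1 (testZ c^-1 tp).
by under eq_fun do rewrite !osc_transformZ//.
Qed.

(** Truncation at the essential supremum, separately for the real and imaginary parts: it alters the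
    symbol on a null set only and makes the bounds hold at every point. *)
Lemma Linfty_bounded_representative (f : E -> R[i]) : Linfty f ->
  exists (p q : E -> R) (M : R), [/\ measurable_fun setT p, measurable_fun setT q,
    forall x, `|p x| <= M, forall x, `|q x| <= M &
    {ae leb, forall x, f x = Complex (p x) (q x)}].
Proof.
move=> [[mr mi] fs].
pose M := fine (Order.max 0%E (ess_sup leb (fun x => (Normc.normc (f x))%:E))).
have fM : (\forall x \ae leb, ((Normc.normc (f x))%:E <= M%:E)%E).
  have := ess_sup_ge leb (fun x => (Normc.normc (f x))%:E); apply: filterS => x h.
  rewrite fineK; first by rewrite le_max h orbT.
  rewrite ge0_fin_numE ?le_max ?lexx//.
  by rewrite gt_max fs ltry.
pose t (u : R) : R := u * (`|u| <= M)%R%:R.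
have mt : measurable_fun setT t.
  apply: measurable_funM => //.
  apply: (measurableT_comp (f := fun b : bool => b%:R : R)) => //.
  by apply: measurable_fun_ler => //; exact: measurable_normr.
have tM u : `|t u| <= M.
  rewrite /t; have [uM|uM] := leP `|u| M; first by rewrite mulr1.
  by rewrite mulr0 normr0 fine_ge0// le_max lexx.
have tE u : `|u| <= M -> t u = u by move=> h; rewrite /t h mulr1.
exists (t \o (fun x => complex.Re (f x))), (t \o (fun x => complex.Im (f x))), M; split => //.
- exact: measurableT_comp.
- exact: measurableT_comp.
- by move=> x; exact: tM.
- by move=> x; exact: tM.
apply: filterS fM => x /=; rewrite lee_fin; case: (f x) => a b /= h.
have ha : `|a| <= M.
  apply: le_trans h; rewrite /Normc.normc -sqrtr_sqr ler_sqrt; last by rewrite addr_ge0 ?sqr_ge0.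
  by rewrite lerDl sqr_ge0.
have hb : `|b| <= M.
  apply: le_trans h; rewrite /Normc.normc -sqrtr_sqr ler_sqrt; last by rewrite addr_ge0 ?sqr_ge0.
  by rewrite lerDr sqr_ge0.
by rewrite !tE.
Qed.

Lemma ae_eq_Rintegral (f g : E -> R) : measurable_fun setT f -> measurable_fun setT g ->
  {ae leb, forall x, f x = g x} -> \int[leb]_x f x = \int[leb]_x g x.
Proof.
move=> mf mg fg; rewrite /Rintegral; congr fine.
apply: ae_eq_integral => //; try exact/measurable_EFinP.
by apply: filterS fg => x /= ->.
Qed.

(** Left unnormalized: its [L^1] norm is [rho^n] times that of [phi], whereas the [L^1] norm of its
    transform is bounded independently of [x] and [rho]. Both facts are used, the former against
    smooth functions and the latter near the diagonal. *)
Definition resc (x : E) (rho : R) phi : E -> R := fun z => phi (rho^-1 *: (z - x)).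

Lemma rescE x rho phi : resc x rho phi = fun z => phi (rho^-1 *: z + (- (rho^-1 *: x))).
Proof. by apply/funext => z; rewrite /resc scalerBr. Qed.

Lemma test_resc x rho phi : 0 < rho -> test_function setT phi -> test_function setT (resc x rho phi).
Proof. by move=> r0 tp; rewrite rescE; apply: test_aff tp; rewrite invr_neq0// gt_eqF. Qed.

Definition fourier_L1 phi : R := \int[leb]_xi (`|F 1 0 phi xi| + `|F 0 1 phi xi|).

Lemma osc_transformN phi xi : test_function setT phi -> F (-1) 0 phi xi = - F 1 0 phi xi.
Proof.
move=> tp.
rewrite /F /osc_transform -[RHS]mulN1r -RintegralZl//; last by apply: integrable_osc; exact: test_integrable tp.
by apply: eq_Rintegral => z _; rewrite /osc; ring.
Qed.

Lemma osc_transform_resc (x : E) (rho : R) phi xi : 0 < rho -> test_function setT phi ->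
  `|F 1 0 (resc x rho phi) xi| + `|F 0 1 (resc x rho phi) xi| <=
  2 * (rho ^+ n * (`|F 1 0 phi (rho *: xi)| + `|F 0 1 phi (rho *: xi)|)).
Proof.
move=> r0 tp.
pose p := fun z : E => phi (rho^-1 *: z).
have tpp : test_function setT p.
  have := test_aff (0 : E) (invr_neq0 (lt0r_neq0 r0)) tp.
  by under eq_fun do rewrite addr0.
have -> : resc x rho phi = fun z => p (z + (- x)) by [].
have sc a b : F a b p xi = rho ^+ n * F a b phi (rho *: xi).
  rewrite (osc_transform_scale a b xi r0 tpp); congr (_ * F _ _ _ _).
  by apply/funext => z; rewrite /p scalerA mulVf ?scale1r// gt_eqF.
have bd (u v t : R) : `|u * cos t + v * sin t| <= `|u| + `|v|.
  apply: (le_trans (ler_normD _ _)); rewrite !normrM lerD//.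
    by rewrite ler_piMr// ler_norml cos_geN1 cos_le1.
  by rewrite ler_piMr// ler_norml sin_geN1 sin_le1.
rewrite !osc_transform_shift//.
have := bd (F 1 0 p xi) (F (-0) 1 p xi) (dotp (-x) xi).
have := bd (F 0 1 p xi) (F (-1) 0 p xi) (dotp (-x) xi).
have Fm := osc_transformN xi tpp.
rewrite oppr0 Fm normrN !sc !normrM (ger0_norm (exprn_ge0 n (ltW r0))).
move: (cos _) (sin _) => ? ?; nra.
Qed.

(** Dilation preserves the [L^1] norm of the transform; translation rotates the pair formed by the
    cosine and sine transforms, which at most doubles the sum of their absolute values. *)
Lemma fourier_L1_resc (x : E) (rho : R) phi : 0 < rho -> test_function setT phi ->
  fourier_L1 (resc x rho phi) <= 2 * fourier_L1 phi.
Proof.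
move=> r0 tp; have i1 := integrable_osc_transform 1 0 tp; have i2 := integrable_osc_transform 0 1 tp.
have tr := test_resc x r0 tp.
have j1 := integrable_osc_transform 1 0 tr; have j2 := integrable_osc_transform 0 1 tr.
pose G := fun xi => `|F 1 0 phi xi| + `|F 0 1 phi xi|.
have iG : leb.-integrable setT (EFin \o G) by apply: integrable_D => //; exact: integrable_norm.
have := Rintegral_aff (0 : E) (lt0r_neq0 r0) iG; rewrite gtr0_norm// => H.
have iGr := integrable_aff (0 : E) (lt0r_neq0 r0) iG.
have -> : fourier_L1 phi = rho ^+ n * \int[leb]_xi G (rho *: xi + 0).
  by rewrite H mulrA -exprMn divff ?expr1n ?mul1r// gt_eqF.
rewrite -(RintegralZl (rho ^+ n) measurableT iGr).
have iZ := integrable_Zl measurableT (rho ^+ n) iGr.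
rewrite -(RintegralZl 2 measurableT iZ).
apply: le_Rintegral => //.
- by apply: integrable_D => //; exact: integrable_norm.
- exact: (integrable_Zl measurableT 2 iZ).
- by move=> xi _; rewrite addr0; exact: osc_transform_resc.
Qed.

Lemma osc_transform_le_L1 phi xi : test_function setT phi ->
  `|F 1 0 phi xi| + `|F 0 1 phi xi| <= 2 * \int[leb]_x `|phi x|.
Proof.
move=> tp; have ip := test_integrable tp.
have := osc_transform_bound 1 0 xi ip; have := osc_transform_bound 0 1 xi ip.
rewrite normr0 normr1 add0r addr0 mul1r; lra.
Qed.

Lemma resc_L1 (x : E) (rho : R) phi : 0 < rho -> test_function setT phi ->
  \int[leb]_z `|resc x rho phi z| = rho ^+ n * \int[leb]_z `|phi z|.
Proof.
move=> r0 tp; have ip := integrable_norm (test_integrable tp).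
have := Rintegral_aff (- (rho^-1 *: x)) (invr_neq0 (lt0r_neq0 r0)) ip.
by rewrite gtr0_norm ?invr_gt0// invrK rescE.
Qed.

(** * The action of one kernel on test functions *)

Section kernel.
Context (K : @Defs.distribution R n) (Khat : E -> R[i]).
Context (fK : fundamental_kernel K Khat).

(* Formally the operator is [u |-> (phi |-> \int u (kernel_action phi))]. *)
Definition kernel_action phi : E -> R :=
  fun y => complex.Re (K (fun x => real_complex R (phi (x + y)))).

Lemma measurable_osc_transform a b (v : E -> R) : measurable_fun setT v ->
  measurable_fun setT (F a b v).
Proof.
move=> mv; apply: (@measurable_Rintegral_section _ _ E E R leb (fun z => v z.2 * osc a b (dotp z.2 z.1))).
apply: measurable_funM; first exact: measurableT_comp.
by apply: measurable_osc; [exact: measurable_snd|exact: measurable_fst].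
Qed.

Lemma fourier_real (v : E -> R) xi : leb.-integrable setT (EFin \o v) ->
  fourier (fun x => real_complex R (v x)) xi = Complex (F 1 0 v xi) (- F 0 1 v xi).
Proof.
move=> iv; rewrite /fourier /cint; congr Complex.
  by apply: eq_Rintegral => x _ /=; rewrite /osc; ring.
rewrite -[RHS]mulN1r -RintegralZl//; last exact: integrable_osc.
by apply: eq_Rintegral => x _ /=; rewrite /osc; ring.
Qed.

(** With [Khat = p + i q], the functions [A] and [B] are the real and imaginary parts of [Khat]
    times the inverse transform of [phi]. Evaluating [K] on a translate of [phi] multiplies this
    product by a character, whence the cosine transform of [A] and the sine transform of [B]; in the
    last clause the product is paired with the transform of [v] instead. *)
Lemma kernel_action_symbol : exists (A B : (E -> R) -> E -> R) (M : R), 0 <= M /\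
  forall phi, test_function setT phi ->
    (forall a, A (fun x => a * phi x) = (fun xi => a * A phi xi) /\
               B (fun x => a * phi x) = (fun xi => a * B phi xi)) /\
    [/\ leb.-integrable setT (EFin \o A phi), leb.-integrable setT (EFin \o B phi),
    forall xi, `|A phi xi| + `|B phi xi| <= M * (`|F 1 0 phi xi| + `|F 0 1 phi xi|),
    forall y, kernel_action phi y = F 1 0 (A phi) y + F 0 1 (B phi) y &
    forall (T : @Defs.distribution R n) (v : E -> R), leb.-integrable setT (EFin \o v) ->
      (forall psi, schwartz psi -> fourier_dist T psi =
        dist_of_fun (fun xi => Khat xi * fourier (fun x => real_complex R (v x)) xi) psi) ->
      complex.Re (T (fun x => real_complex R (phi x))) =
        \int[leb]_xi (A phi xi * F 1 0 v xi) + \int[leb]_xi (B phi xi * F 0 1 v xi)].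
Proof.
have [_ [LK KE] _] := fK; have [[mr mi] _] := LK.
have [p [q [M [mp mq pM qM Kpq]]]] := Linfty_bounded_representative LK.
have M0 : 0 <= M by apply: le_trans (pM 0).
exists (fun phi xi => c^-1 * (F 1 0 phi xi * p xi - F 0 1 phi xi * q xi)).
exists (fun phi xi => c^-1 * (F 0 1 phi xi * p xi + F 1 0 phi xi * q xi)).
exists (`|c^-1| * (M + M)); split; first by rewrite mulr_ge0// addr_ge0.
move=> phi tp.
pose A := fun xi => c^-1 * (F 1 0 phi xi * p xi - F 0 1 phi xi * q xi).
pose B := fun xi => c^-1 * (F 0 1 phi xi * p xi + F 1 0 phi xi * q xi).
have i1 := integrable_osc_transform 1 0 tp; have i2 := integrable_osc_transform 0 1 tp.
have j (h : E -> R) (ih : leb.-integrable setT (EFin \o h)) (w : E -> R) (mw : measurable_fun setT w) (wM : forall x, `|w x| <= M) :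
   leb.-integrable setT (EFin \o (fun xi : E => h xi * w xi)).
  exact: (integrable_Mbounded measurableT mw (fun x _ => wM x) ih).
have iA : leb.-integrable setT (EFin \o A).
  exact: (integrable_Zl measurableT _ (integrable_B measurableT (j _ i1 _ mp pM) (j _ i2 _ mq qM))).
have iB : leb.-integrable setT (EFin \o B).
  exact: (integrable_Zl measurableT _ (integrable_D measurableT (j _ i2 _ mp pM) (j _ i1 _ mq qM))).
have mA := integrable_measurable iA; have mB := integrable_measurable iB.
have mF a b phi' : test_function setT phi' -> measurable_fun setT (F a b phi').
  by move=> tp'; apply: measurable_smooth; exact: smooth_osc_transform.
split.
  by move=> a; split; apply/funext => xi; rewrite !osc_transformZ//; ring.
split => //.
- move=> xi; rewrite /= !normrM -mulrDr -mulrA; apply: ler_wpM2l => //.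
  have := ler_normB (F 1 0 phi xi * p xi) (F 0 1 phi xi * q xi).
  have := ler_normD (F 0 1 phi xi * p xi) (F 1 0 phi xi * q xi).
  rewrite !normrM.
  have := ler_wpM2l (normr_ge0 (F 1 0 phi xi)) (pM xi).
  have := ler_wpM2l (normr_ge0 (F 1 0 phi xi)) (qM xi).
  have := ler_wpM2l (normr_ge0 (F 0 1 phi xi)) (pM xi).
  have := ler_wpM2l (normr_ge0 (F 0 1 phi xi)) (qM xi).
  by move: `|F 1 0 phi xi * p xi - _| `|F 0 1 phi xi * p xi + _| => ? ?; lra.
- move=> y.
  transitivity (\int[leb]_xi (A xi * cos (dotp y xi)) + \int[leb]_xi (B xi * sin (dotp y xi))).
    2: by congr (_ + _); apply: eq_Rintegral => x _; rewrite /osc (dotpC x) /A /B; ring.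
  have ts : test_function setT (fun x => phi (x + y)).
    by have := test_aff y (oner_neq0 R) tp; under eq_fun do rewrite scale1r.
  have sp := schwartz_fourier_preimage ts.
  rewrite /kernel_action -(fourier_preimageE ts).
  have := KE _ sp; rewrite /fourier_dist => ->.
  rewrite /dist_of_fun /cint.
  pose G x := Khat x * fourier_preimage (fun x => phi (x + y)) x.
  rewrite -[LHS]/(\int[leb]_x complex.Re (G x)).
  have iAc : leb.-integrable setT (EFin \o (fun xi => A xi * cos (dotp y xi))).
    have := integrable_osc 1 0 y iA; apply: eq_integrable => // xi _ /=.
    by rewrite /osc dotpC; congr EFin; ring.
  have iBs : leb.-integrable setT (EFin \o (fun xi => B xi * sin (dotp y xi))).
    have := integrable_osc 0 1 y iB; apply: eq_integrable => // xi _ /=.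
    by rewrite /osc dotpC; congr EFin; ring.
  rewrite -(RintegralD measurableT iAc iBs).
  apply: ae_eq_Rintegral.
  + rewrite /G.
    rewrite (_ : (fun x => complex.Re _) = fun x => complex.Re (Khat x) * (c^-1 * F 1 0 (fun x => phi (x + y)) x) - complex.Im (Khat x) * (c^-1 * F 0 1 (fun x => phi (x + y)) x)); last first.
      by apply/funext => x; rewrite /fourier_preimage; case: (Khat x) => u w /=; ring.
    by apply: measurable_funB; apply: measurable_funM => //; apply: measurable_funM => //; exact: mF.
  + by apply: measurable_funD; [exact: (integrable_measurable iAc)|exact: (integrable_measurable iBs)].
  + apply: filterS Kpq => x; rewrite /G => -> /=.
    by rewrite !osc_transform_shift// /A /B oppr0 osc_transformN//; ring.
move=> T v iv TE.
have sp := schwartz_fourier_preimage tp.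
rewrite -(fourier_preimageE tp).
have := TE _ sp; rewrite /fourier_dist => ->.
rewrite /dist_of_fun /cint.
pose G x := Khat x * fourier (fun x => real_complex R (v x)) x * fourier_preimage phi x.
rewrite -[LHS]/(\int[leb]_x complex.Re (G x)).
have mv := integrable_measurable iv.
have iAc : leb.-integrable setT (EFin \o (fun xi => A xi * F 1 0 v xi)).
  apply: (integrable_Mbounded measurableT _ (fun x _ => osc_transform_bound 1 0 x iv) iA).
  exact: measurable_osc_transform.
have iBs : leb.-integrable setT (EFin \o (fun xi => B xi * F 0 1 v xi)).
  apply: (integrable_Mbounded measurableT _ (fun x _ => osc_transform_bound 0 1 x iv) iB).
  exact: measurable_osc_transform.
rewrite -(RintegralD measurableT iAc iBs).
have m1 := measurable_osc_transform 1 0 mv; have m2 := measurable_osc_transform 0 1 mv.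
have mF1 := mF 1 0 _ tp; have mF2 := mF 0 1 _ tp.
apply: ae_eq_Rintegral.
- rewrite /G.
  rewrite (_ : (fun x => complex.Re _) = fun x =>
    (complex.Re (Khat x) * F 1 0 v x + complex.Im (Khat x) * F 0 1 v x) * (c^-1 * F 1 0 phi x) -
    (complex.Im (Khat x) * F 1 0 v x - complex.Re (Khat x) * F 0 1 v x) * (c^-1 * F 0 1 phi x)); last first.
    by apply/funext => x; rewrite fourier_real// /fourier_preimage; case: (Khat x) => a b /=; ring.
  apply: measurable_funB; apply: measurable_funM; try exact: measurable_funM.
  + by apply: measurable_funD; exact: measurable_funM.
  + by apply: measurable_funB; exact: measurable_funM.
- by apply: measurable_funD; [exact: (integrable_measurable iAc)|exact: (integrable_measurable iBs)].
- apply: filterS Kpq => x; rewrite /G => ->; rewrite fourier_real//=.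
  by rewrite /A /B; ring.
Qed.

Lemma kernel_actionZ phi a y : test_function setT phi ->
  kernel_action (fun x => a * phi x) y = a * kernel_action phi y.
Proof.
have [A [B [M [M0 h]]]] := kernel_action_symbol => tp.
have [AB [iA iB _ kE _]] := h _ tp; have [_ [_ _ _ kaE _]] := h _ (testZ a tp).
have [Aa Ba] := AB a; rewrite kE kaE Aa Ba mulrDr; congr (_ + _).
  by rewrite /F /osc_transform -RintegralZl//; [apply: eq_Rintegral => x _; rewrite mulrA|exact: integrable_osc].
by rewrite /F /osc_transform -RintegralZl//; [apply: eq_Rintegral => x _; rewrite mulrA|exact: integrable_osc].
Qed.

Lemma measurable_kernel_action phi : test_function setT phi ->
  measurable_fun setT (kernel_action phi).
Proof.
have [A [B [M [M0 h]]]] := kernel_action_symbol => /h[_ [iA iB _ kE _]].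
rewrite (_ : kernel_action phi = fun y => F 1 0 (A phi) y + F 0 1 (B phi) y); last exact/funext.
by apply: measurable_funD; apply: measurable_osc_transform; [exact: (integrable_measurable iA)|exact: (integrable_measurable iB)].
Qed.

(** A transform is bounded by the [L^1] norm of the function transformed, here a bounded symbol
    times the inverse transform of [phi]. *)
Lemma kernel_action_le_L1 : exists2 M : R, 0 <= M &
  forall phi y, test_function setT phi -> `|kernel_action phi y| <= M * fourier_L1 phi.
Proof.
have [A [B [M [M0 h]]]] := kernel_action_symbol; exists M => // phi y tp.
have [_ [iA iB AB kE _]] := h _ tp; rewrite kE.
apply: (le_trans (ler_normD _ _)).
have b1 := osc_transform_bound 1 0 y iA; have b2 := osc_transform_bound 0 1 y iB.
rewrite normr1 normr0 addr0 add0r !mul1r in b1 b2.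
apply: (le_trans (lerD b1 b2)).
have jA : leb.-integrable setT (EFin \o (fun x => `|A phi x|)) := integrable_norm iA.
have jB : leb.-integrable setT (EFin \o (fun x => `|B phi x|)) := integrable_norm iB.
rewrite -(RintegralD measurableT jA jB).
have i1 : leb.-integrable setT (EFin \o (fun x => `|F 1 0 phi x|)) := integrable_norm (integrable_osc_transform 1 0 tp).
have i2 : leb.-integrable setT (EFin \o (fun x => `|F 0 1 phi x|)) := integrable_norm (integrable_osc_transform 0 1 tp).
have i12 := integrable_D measurableT i1 i2.
rewrite -(RintegralZl M measurableT i12); apply: le_Rintegral => //.
- exact: (integrable_D measurableT jA jB).
- exact: (integrable_Zl measurableT M i12).
Qed.

(** The multiplication formula moves the transform from [v] back onto the symbol side. A singular
    integral of an integrable function is thus tested through a bounded function. *)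
Lemma kernel_action_dual (T : @Defs.distribution R n) (v : E -> R) phi :
  leb.-integrable setT (EFin \o v) ->
  (forall psi, schwartz psi -> fourier_dist T psi =
    dist_of_fun (fun xi => Khat xi * fourier (fun x => real_complex R (v x)) xi) psi) ->
  test_function setT phi ->
  complex.Re (T (fun x => real_complex R (phi x))) = \int[leb]_y (v y * kernel_action phi y).
Proof.
move=> iv TE tp; have [A [B [M [M0 h]]]] := kernel_action_symbol.
have [_ [iA iB AB kE /(_ _ _ iv TE) ->]] := h _ tp.
rewrite (osc_transform_multiplication 1 0 iv iA) (osc_transform_multiplication 0 1 iv iB).
have m1 := measurable_osc_transform 1 0 (integrable_measurable iA).
have m2 := measurable_osc_transform 0 1 (integrable_measurable iB).
have i1 := integrable_Mbounded measurableT m1 (fun x _ => osc_transform_bound 1 0 x iA) iv.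
have i2 := integrable_Mbounded measurableT m2 (fun x _ => osc_transform_bound 0 1 x iB) iv.
rewrite -(RintegralD measurableT i1 i2).
by apply: eq_Rintegral => y _; rewrite kE mulrDr.
Qed.

(** The transform of [chi] is integrable, while [A] and [B] for the rescaled [phi] are bounded by a
    multiple of the [L^1] norm of [resc x rho phi], of order [rho^n]. This is the boundedness of the
    operator on smooth functions, free of any logarithmic loss. *)
Lemma kernel_action_test chi phi : test_function setT chi -> test_function setT phi ->
  exists2 C, 0 <= C & forall x rho, 0 < rho ->
    `|\int[leb]_y (chi y * kernel_action (resc x rho phi) y)| <= C * rho ^+ n.
Proof.
move=> tc tp; have [A [B [M [M0 h]]]] := kernel_action_symbol.
have ic := test_integrable tc.
have j1 := integrable_osc_transform 1 0 tc; have j2 := integrable_osc_transform 0 1 tc.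
exists (M * (2 * \int[leb]_z `|phi z|) * fourier_L1 chi).
  rewrite !mulr_ge0//; try by apply: Rintegral_ge0 => // x _; rewrite ?addr_ge0.
move=> x rho r0; have tr := test_resc x r0 tp.
have [_ [iA iB AB kE _]] := h _ tr.
pose A' := A (resc x rho phi); pose B' := B (resc x rho phi).
have m1 := measurable_osc_transform 1 0 (integrable_measurable iA).
have m2 := measurable_osc_transform 0 1 (integrable_measurable iB).
have i1 := integrable_Mbounded measurableT m1 (fun x _ => osc_transform_bound 1 0 x iA) ic.
have i2 := integrable_Mbounded measurableT m2 (fun x _ => osc_transform_bound 0 1 x iB) ic.
have -> : \int[leb]_y (chi y * kernel_action (resc x rho phi) y) =
   \int[leb]_xi (A' xi * F 1 0 chi xi) + \int[leb]_xi (B' xi * F 0 1 chi xi).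
  rewrite (osc_transform_multiplication 1 0 ic iA) (osc_transform_multiplication 0 1 ic iB) -(RintegralD measurableT i1 i2).
  by apply: eq_Rintegral => y _; rewrite kE mulrDr.
have n1 := measurable_osc_transform 1 0 (integrable_measurable ic).
have n2 := measurable_osc_transform 0 1 (integrable_measurable ic).
have k1 := integrable_Mbounded measurableT n1 (fun x _ => osc_transform_bound 1 0 x ic) iA.
have k2 := integrable_Mbounded measurableT n2 (fun x _ => osc_transform_bound 0 1 x ic) iB.
rewrite -(RintegralD measurableT k1 k2).
have k12 := integrable_D measurableT k1 k2.
apply: (le_trans (le_normr_Rintegral measurableT k12)).
have l1 : leb.-integrable setT (EFin \o (fun x => `|F 1 0 chi x|)) := integrable_norm j1.
have l2 : leb.-integrable setT (EFin \o (fun x => `|F 0 1 chi x|)) := integrable_norm j2.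
have l12 := integrable_D measurableT l1 l2.
pose D := M * (2 * (rho ^+ n * \int[leb]_z `|phi z|)).
have -> : M * (2 * \int[leb]_z `|phi z|) * fourier_L1 chi * rho ^+ n =
   \int[leb]_xi (D * (`|F 1 0 chi xi| + `|F 0 1 chi xi|)).
  by rewrite (RintegralZl D measurableT l12) /D /fourier_L1; ring.
apply: le_Rintegral => //.
- exact: integrable_norm.
- exact: (integrable_Zl measurableT D l12).
move=> xi _; apply: (le_trans (ler_normD _ _)); rewrite !normrM.
have := AB xi; rewrite -/A' -/B' => ABx.
have := ler_wpM2l M0 (osc_transform_le_L1 xi tr); rewrite resc_L1// -/D => /(le_trans ABx).
have := normr_ge0 (A' xi); have := normr_ge0 (B' xi).
have := normr_ge0 (F 1 0 chi xi); have := normr_ge0 (F 0 1 chi xi).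
move: `|A' xi| `|B' xi| `|F 1 0 chi xi| `|F 0 1 chi xi| => a b u w; nra.
Qed.

(* Near [x] the symbol bound and Fourier inversion give a bounded function; at distance more than
   [2 rho] from [x] the kernel is evaluated away from its singularity. *)
Lemma kernel_action_resc phi : test_function setT phi -> (forall x, 1 <= `|x| -> phi x = 0) ->
  exists2 C, 0 <= C & forall x rho y, 0 < rho ->
    `|kernel_action (resc x rho phi) y| <= C * (rho ^+ n * kappa rho (y - x)).
Proof.
move=> tp phi0.
have [M M0 hM] := kernel_action_le_L1.
have [tK _ [k [kE kr ki [C0 [C1 [A2 [C00 _ _ kC _]]]]]]] := fK.
(* [3] bounds [(rho + |y - x|) / rho] when [|y - x| <= 2 rho]. Farther away, [|z| >= |y - x| / 2] on
   the support and [rho + |y - x| <= 3 |y - x|], whence [6 = 2 * 3]. *)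
pose C2 := 3 ^+ n * (M * (2 * fourier_L1 phi)); pose C3 := 6 ^+ n * (C0 * \int[leb]_z `|phi z|).
have ip := integrable_norm (test_integrable tp).
have C20 : 0 <= C2 by rewrite !mulr_ge0 ?exprn_ge0//; apply: Rintegral_ge0 => // x _; rewrite addr_ge0.
have C30 : 0 <= C3 by rewrite !mulr_ge0 ?exprn_ge0//; apply: Rintegral_ge0.
exists (C2 + C3) => [|x rho y r0]; first exact: addr_ge0.
have kap0 : 0 <= rho ^+ n * kappa rho (y - x) by rewrite mulr_ge0 ?exprn_ge0 ?kappa_ge0 ?ltW.
have pos : 0 < rho + `|y - x| by rewrite ltr_wpDr.
have [near|far] := leP `|y - x| (2 * rho).
  apply: (@le_trans _ _ (C2 * (rho ^+ n * kappa rho (y - x)))); last by rewrite ler_wpM2r// lerDl.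
  apply: (le_trans (hM _ y (test_resc x r0 tp))).
  apply: (@le_trans _ _ (M * (2 * fourier_L1 phi))); first by rewrite ler_wpM2l// fourier_L1_resc.
  rewrite /C2 mulrAC ler_peMl//; first by rewrite !mulr_ge0//; apply: Rintegral_ge0 => // z _; rewrite addr_ge0.
  rewrite /kappa mulrA -exprMn ler_pdivlMr ?exprn_gt0// mul1r.
  apply: lerXn2r; rewrite ?nnegrE; lra.
apply: (@le_trans _ _ (C3 * (rho ^+ n * kappa rho (y - x)))); last by rewrite ler_wpM2r// lerDr.
have y0 : 0 < `|y - x| by apply: le_lt_trans far; rewrite mulr_ge0// ltW.
pose f z := resc x rho phi (z + y).
have ts : test_function setT f.
  by have := test_aff y (oner_neq0 R) (test_resc x r0 tp); under eq_fun do rewrite scale1r.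
have f0 z : rho <= `|z + (y - x)| -> f z = 0.
  move=> h; rewrite /f /resc phi0// normrZ gtr0_norm ?invr_gt0// ler_pdivlMl// mulr1.
  by rewrite -addrA.
have zlow z : `|z + (y - x)| <= rho -> `|y - x| / 2 <= `|z|.
  move=> h.
  have := ler_normB (z + (y - x)) z; rewrite [z + _]addrC addrK => h2.
  move: h; rewrite addrC => h.
  by rewrite ler_pdivrMr//; lra.
have cs : compactly_supported_in (~` [set 0]) (fun z => real_complex R (f z)).
  exists (closed_ball (x - y) rho); split.
  - exact: compact_closed_ball_rV.
  - rewrite closed_ballE// => z; rewrite /closed_ball_/= => h z0; move: h; rewrite z0 subr0 distrC; lra.
  - rewrite closed_ballE// => z; rewrite /closed_ball_/= => h; rewrite f0//; apply/ltW; rewrite ltNge.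
    by apply/negP => h2; apply: h; rewrite distrC opprB.
have csm : csmooth (fun z => real_complex R (f z)) by split => /=; [exact: test_smooth ts|exact: smooth_cst].
rewrite /kernel_action -/f (kE _ csm cs) /dist_of_fun /cint /=.
pose g z := complex.Re (k z) * f z.
have -> : \int[leb]_z complex.Re (k z * real_complex R (f z)) = \int[leb]_z g z.
  by apply: eq_Rintegral => z _; rewrite /g; case: (k z) => a b /=; rewrite mulr0 subr0.
have gb z : `|g z| <= C0 * 2 ^+ n / `|y - x| ^+ n * `|f z|.
  rewrite /g normrM; have [h|h] := leP rho `|z + (y - x)|; first by rewrite f0// normr0 !mulr0.
  have zl := zlow z (ltW h); have z0 : 0 < `|z| by apply: lt_le_trans zl; rewrite divr_gt0.
  rewrite ler_wpM2r//; have zn : z != 0 by rewrite -normr_gt0.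
  have [kz _] := kC _ zn; apply: (@le_trans _ _ (Normc.normc (k z))).
    case: (k z) => a b; rewrite /Normc.normc/= -sqrtr_sqr ler_sqrt; last by rewrite addr_ge0 ?sqr_ge0.
    by rewrite lerDl sqr_ge0.
  apply: (le_trans kz); rewrite -mulrA ler_wpM2l//.
  have e0 : 0 < enorm z by apply: lt_le_trans (norm_le_enorm z).
  rewrite -exprVn -expr_div_n; apply: lerXn2r; rewrite ?nnegrE.
  - by rewrite invr_ge0 ltW.
  - by rewrite divr_ge0.
  - rewrite -[leRHS]invrK lef_pV2 ?posrE ?invr_gt0 ?divr_gt0// invfM invrK mulrC.
    exact: le_trans zl (norm_le_enorm z).
have mg : measurable_fun setT g.
  apply: measurable_funM; last by apply: measurable_smooth; exact: test_smooth ts.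
  apply: measurable_continuous_punctured => z z0; apply: differentiable_continuous.
  by have [] := kr z z0.
have i_f := integrable_norm (test_integrable ts).
have iCf := integrable_Zl measurableT (C0 * 2 ^+ n / `|y - x| ^+ n) i_f.
have ig : leb.-integrable setT (EFin \o g) by apply: (integrable_dominated measurableT mg _ iCf).
apply: (le_trans (le_normr_Rintegral measurableT ig)).
apply: (@le_trans _ _ (\int[leb]_z (C0 * 2 ^+ n / `|y - x| ^+ n * `|f z|))).
  by apply: le_Rintegral => //; exact: integrable_norm.
rewrite (RintegralZl _ measurableT i_f).
have -> : \int[leb]_z `|f z| = rho ^+ n * \int[leb]_z `|phi z|.
  rewrite -(resc_L1 x r0 tp); apply: (Rintegral_shift y (f := fun z => `|resc x rho phi z|)).
  exact: integrable_norm (test_integrable (test_resc x r0 tp)).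
have P0 : 0 <= \int[leb]_z `|phi z| by apply: Rintegral_ge0.
have -> : C0 * 2 ^+ n / `|y - x| ^+ n * (rho ^+ n * \int[leb]_z `|phi z|) =
   (2 ^+ n / `|y - x| ^+ n) * (C0 * (\int[leb]_z `|phi z|) * rho ^+ n) by ring.
have -> : C3 * (rho ^+ n * kappa rho (y - x)) =
   (6 ^+ n * kappa rho (y - x)) * (C0 * (\int[leb]_z `|phi z|) * rho ^+ n) by rewrite /C3; ring.
rewrite ler_wpM2r// ?mulr_ge0// ?(exprn_ge0 _ (ltW r0))// /kappa -!expr_div_n.
apply: lerXn2r; rewrite ?nnegrE.
- by rewrite divr_ge0.
- by rewrite divr_ge0// ltW.
- by rewrite ler_pdivrMr// mulrAC ler_pdivlMr//; lra.
Qed.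

End kernel.

(** All that is kept of a singular integral operator: a bounded function [kap phi] that represents
    it by duality, pairs boundedly with smooth functions, and has the size of the truncated kernel
    at scale [rho]. The factor [a] will be the time factor of a space-time test function at a fixed
    time. *)
Lemma singular_integral_kernel (S : (E -> R[i]) -> @Defs.distribution R n) :
  singular_integral_operator S -> exists kap : (E -> R) -> E -> R,
  [/\ forall phi, test_function setT phi -> measurable_fun setT (kap phi),
      forall phi, test_function setT phi -> exists M, forall y, `|kap phi y| <= M,
      forall u phi a, leb.-integrable setT (EFin \o u) -> test_function setT phi ->
        complex.Re (S (fun x => real_complex R (u x)) (fun x => real_complex R (a * phi x))) =
        a * \int[leb]_y (u y * kap phi y),
      forall chi phi, test_function setT chi -> test_function setT phi ->
        exists2 C, 0 <= C & forall x rho, 0 < rho ->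
        `|\int[leb]_y (chi y * kap (resc x rho phi) y)| <= C * rho ^+ n &
      forall phi, test_function setT phi -> (forall x, 1 <= `|x| -> phi x = 0) ->
        exists2 C, 0 <= C & forall x rho y, 0 < rho ->
        `|kap (resc x rho phi) y| <= C * (rho ^+ n * kappa rho (y - x))].
Proof.
move=> [K [Khat [fK SE]]]; exists (kernel_action K); split.
- by move=> phi; exact: measurable_kernel_action fK phi.
- move=> phi tp; have [M _ hM] := kernel_action_le_L1 fK.
  by exists (M * fourier_L1 phi) => y; exact: hM.
- move=> u phi a iu tp.
  have [M _ hM] := kernel_action_le_L1 fK.
  have iuk := integrable_Mbounded measurableT (measurable_kernel_action fK tp) (fun y _ => hM phi y tp) iu.
  rewrite (kernel_action_dual fK iu _ (testZ a tp)).
    rewrite -RintegralZl//; apply: eq_Rintegral => y _.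
    by rewrite (kernel_actionZ fK)// mulrCA.
  have ci : cintegrable leb setT (fun x => real_complex R (u x)).
    by split => //=; exact: integrable0.
  by have [_ h] := SE _ ci.
- by move=> chi phi; exact: kernel_action_test fK chi phi.
- by move=> phi; exact: kernel_action_resc fK phi.
Qed.

End singular_integrals.

Import HBSimple.

(** * Density of tensor products *)

Section tensor_density.
Context {R : realType} {n : nat} (T : R).
Local Notation E := 'rV[R]_n.
Local Notation leb := (@lebesgue_rV R n).
Local Notation mu1 := (@lebesgue_measure R).
Local Notation mu := (@spacetime_measure R n).
Local Notation D := (slab (n := n) 0 T : set (measurableTypeR R * E)).

Lemma derive_coord (f : E -> R) x v : differentiable f x ->
  'D_v f x = \sum_j v ord0 j * 'D_('e_j) f x.
Proof.
move=> df; rewrite deriveE// [in LHS](row_sum_delta v) linear_sum.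
by apply: eq_bigr => j _; rewrite linearZ/= deriveE.
Qed.

Lemma test_lipschitz (A : set E) chi : test_function A chi ->
  exists2 L : R, 0 <= L & forall x y, `|chi x - chi y| <= L * `|x - y|.
Proof.
move=> tc; have /choice[M hM] j : exists M, 0 <= M /\ forall x, `|'D_('e_j) chi x| <= M.
  by have [M M0 hM] := test_bounded (test_derive 'e_j tc); exists M.
have L0 : 0 <= \sum_j M j by apply: sumr_ge0 => j _; have [] := hM j.
exists (\sum_j M j) => // x y.
have dl t : is_derive t (1 : R) (fun t => chi (y + t *: (x - y))) ('D_(x - y) chi (y + t *: (x - y))).
  by apply: is_derive_line; apply: smooth_differentiable; exact: test_smooth tc.
have dd (t : R) : derivable (fun t : R => chi (y + t *: (x - y))) t (1 : R) by case: (dl t).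
have [t _] := @MVT_segment R (fun t => chi (y + t *: (x - y))) _ 0 1 ler01 (fun t _ => dl t)
  (derivable_within_continuous (fun t _ => dd t)).
rewrite scale1r scale0r addr0 subr0 mulr1 (addrC y (x - y)) subrK => ->.
rewrite derive_coord; last by apply: smooth_differentiable; exact: test_smooth tc.
rewrite mulr_suml (le_trans (ler_norm_sum _ _ _))// ler_sum// => j _.
rewrite normrM mulrC; have [M0 h] := hM j; rewrite ler_pM//.
exact: coord_le_norm.
Qed.

(** Finite sums of products. The time factors are merely bounded and measurable, as the operators
    act in [x] at each time separately. *)
Inductive tensor : (R -> E -> R) -> Prop :=
| tensor0 : tensor (fun _ _ => 0)
| tensorS (theta : R -> R) (chi : E -> R) h : measurable_fun setT theta -> (exists M, forall s, `|theta s| <= M) ->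
    test_function setT chi -> tensor h -> tensor (fun s x => theta s * chi x + h s x).

Lemma tensorD h1 h2 : tensor h1 -> tensor h2 -> tensor (fun s x => h1 s x + h2 s x).
Proof.
move=> t1 t2; elim: t1 => [|theta chi h mt bt tc th IH].
  by rewrite (_ : (fun s x => _) = h2)//; apply/funext => s; apply/funext => x; rewrite add0r.
rewrite (_ : (fun s x => _) = fun s x => theta s * chi x + (h s x + h2 s x)); first exact: tensorS.
by apply/funext => s; apply/funext => x; rewrite addrA.
Qed.

Lemma tensorZ c h : tensor h -> tensor (fun s x => c * h s x).
Proof.
elim => [|theta chi h' mt [M bt] tc th IH].
  by rewrite (_ : (fun s x => _) = fun _ _ => 0); [exact: tensor0|apply/funext => s; apply/funext => x; rewrite mulr0].
rewrite (_ : (fun s x => _) = fun s x => (c * theta s) * chi x + c * h' s x).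
  apply: tensorS => //; first exact: measurable_funM.
  by exists (`|c| * M) => s; rewrite normrM ler_wpM2l.
by apply/funext => s; apply/funext => x; rewrite mulrDr mulrA.
Qed.

Lemma tensor_measurable h : tensor h -> measurable_fun setT (fun z : measurableTypeR R * E => h z.1 z.2).
Proof.
elim => [|theta chi h' mt _ tc _ IH]; first exact: measurable_cst.
apply: measurable_funD => //; apply: measurable_funM.
  exact: (measurableT_comp (f := theta) mt (@measurable_fst _ _ (measurableTypeR R) E)).
apply: (measurableT_comp (f := chi)); last exact: (@measurable_snd _ _ (measurableTypeR R) E).
by apply: measurable_smooth; exact: test_smooth tc.
Qed.

Lemma tensor_bounded_support h : tensor h -> exists M r : R, [/\ 0 <= M, 0 < r,
  forall s x, `|h s x| <= M & forall s x, r <= `|x| -> h s x = 0].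
Proof.
elim => [|theta chi h' mt [Mt bt] tc _ [M [r [M0 r0 hM hr]]]].
  by exists 0, 1; split => // s x; rewrite normr0.
have [Mc Mc0 hMc] := test_bounded tc; have [rc rc0 hrc] := test_bounded_support tc.
have Mt0 : 0 <= Mt by apply: le_trans (bt 0).
exists (Mt * Mc + M), (Num.max r rc); split.
- by rewrite addr_ge0// mulr_ge0.
- by rewrite lt_max r0.
- by move=> s x; apply: (le_trans (ler_normD _ _)); rewrite lerD// normrM ler_pM.
- by move=> s x; rewrite ge_max => /andP[h1 h2]; rewrite hr// hrc// mulr0 addr0.
Qed.

Lemma tensor_lipschitz h : tensor h -> exists2 K : R, 0 <= K & forall s x y,
  `|h s x - h s y| <= K * `|x - y|.
Proof.
elim => [|theta chi h' mt [Mt bt] tc _ [K K0 hK]].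
  by exists 0 => // s x y; rewrite subrr normr0 mul0r.
have Mt0 : 0 <= Mt by apply: le_trans (bt 0).
have [L L0 hL] : exists2 L : R, 0 <= L & forall x y, `|chi x - chi y| <= L * `|x - y|.
  exact: test_lipschitz tc.
exists (Mt * L + K); first by rewrite addr_ge0// mulr_ge0.
move=> s x y; rewrite opprD addrACA -mulrBr (le_trans (ler_normD _ _))// mulrDl lerD//.
by rewrite normrM -mulrA ler_pM.
Qed.

Lemma slab_measurable : measurable D.
Proof. exact: measurableX. Qed.

Lemma integrable_slab_bounded (f : R * E -> R) (M r : R) : measurable_fun D f ->
  (forall z, D z -> `|f z| <= M) -> (forall z, D z -> r <= `|z.2| -> f z = 0) ->
  mu.-integrable D (EFin \o f).
Proof.
move=> mf fM f0; pose r1 := Num.max r 1; have r10 : 0 < r1 by rewrite lt_max ltr01 orbT.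
pose B := `]0, T[ `*` [set x : E | `|x| < r1] : set (measurableTypeR R * E).
have mB : measurable B by apply: measurableX => //; exact: measurable_lt_norm.
have BD : B `<=` D by move=> z [].
have muB : (mu B < +oo)%E.
  have -> : mu B = (mu1 `]0%R, T[%classic * leb [set x : E | (`|x| < r1)%R])%E.
    by apply: product_measure1E => //; exact: measurable_lt_norm.
  rewrite (lebesgue_cube n r10) lebesgue_measure_itv/=; case: ifP => _.
    by rewrite -EFinB -EFinM ltry.
  by rewrite mul0e ltry.
apply: (@integrable_dominated _ _ _ mu D slab_measurable _ (fun z => `|M| * \1_B z)) => //.
  move=> z Dz; rewrite indicE; have [zB|zB] := boolP (z \in B).
    by rewrite mulr1 (le_trans (fM z Dz))// ler_norm.
  rewrite f0 ?normr0 ?mulr0// leNgt; apply: contra zB => h.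
  rewrite inE; split; first by case: Dz.
  by rewrite /= lt_max h.
have iB : mu.-integrable D (EFin \o \1_B).
  apply/integrableP; split; first by apply/measurable_EFinP; exact: measurable_indic.
  under eq_integral => z _ do rewrite /= ger0_norm//.
  rewrite integral_indic//; last exact: slab_measurable.
  by rewrite (_ : B `&` D = B)//; exact/setIidPl.
exact: (integrable_Zl slab_measurable _ iB).
Qed.

Lemma tensor_integrable h : tensor h -> mu.-integrable D (EFin \o (fun z => h z.1 z.2)).
Proof.
move=> th; have [M [r [M0 r0 hM hr]]] := tensor_bounded_support th.
apply: (@integrable_slab_bounded _ M r).
- by apply: measurable_funTS; exact: tensor_measurable.
- by move=> z _.
- by move=> z _; exact: hr.
Qed.

Definition approximable (f : R * E -> R) := forall eps : R, 0 < eps -> exists h, tensor h /\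
  (\int[mu]_(z in D) (`|f z - h z.1 z.2|)%:E <= eps%:E)%E.

Lemma approximable_limit (f : R * E -> R) : measurable_fun D f ->
  (forall eps : R, 0 < eps -> exists g, [/\ measurable_fun D g, approximable g &
     (\int[mu]_(z in D) (`|f z - g z|)%:E <= eps%:E)%E]) -> approximable f.
Proof.
move=> mf H eps e0; have e20 : 0 < eps / 2 by rewrite divr_gt0.
have [g [mg ag fg]] := H _ e20; have [h [th gh]] := ag _ e20.
exists h; split => //.
have mh : measurable_fun D (fun z => h z.1 z.2) by apply: measurable_funTS; exact: tensor_measurable.
have m1 : measurable_fun D (fun z => `|f z - g z|%:E).
  by apply/measurable_EFinP; apply: measurableT_comp => //; exact: measurable_funB.
have m2 : measurable_fun D (fun z => `|g z - h z.1 z.2|%:E).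
  by apply/measurable_EFinP; apply: measurableT_comp => //; exact: measurable_funB.
apply: (@le_trans _ _ (\int[mu]_(z in D) (`|f z - g z|%:E + `|g z - h z.1 z.2|%:E))%E).
  apply: ge0_le_integral => //.
  - exact: slab_measurable.
  - by apply/measurable_EFinP; apply: measurableT_comp => //; exact: measurable_funB.
  - exact: emeasurable_funD.
  - by move=> z _; rewrite -EFinD lee_fin ler_distD.
rewrite ge0_integralD//; last exact: slab_measurable.
by rewrite [eps]splitr EFinD leeD.
Qed.

Lemma approximable_cvg (f : R * E -> R) (f_ : nat -> R * E -> R) (g : R * E -> R) : measurable_fun D f ->
  (forall k, measurable_fun D (f_ k)) -> (forall k, approximable (f_ k)) ->
  (forall z, D z -> f_ k z @[k --> \oo] --> f z) ->
  (forall k z, D z -> `|f_ k z| <= g z) -> mu.-integrable D (EFin \o g) -> approximable f.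
Proof.
move=> mf mf_ af cf fg ig; apply: approximable_limit => // eps e0.
have fg' z : D z -> `|f z| <= g z.
  move=> Dz; have c : `|f_ k z| @[k --> \oo] --> `|f z| by apply: cvg_norm; exact: cf.
  by apply: (ler_cvg_to c (cvg_cst (g z))); apply: nearW => k; exact: fg.
have g0 z : D z -> 0 <= g z by move=> Dz; apply: le_trans (fg' z Dz).
have ig2 := integrable_Zl slab_measurable 2 ig.
have : \int[mu]_(z in D) `|f z - f_ k z| @[k --> \oo] --> \int[mu]_(z in D) (0 : R).
  apply: (@Rintegral_dct _ _ _ mu D slab_measurable _ _ (fun z => 2 * g z)) => //.
  - by move=> k; apply: measurableT_comp => //; exact: measurable_funB.
  - move=> z Dz; have : f z - f_ k z @[k --> \oo] --> f z - f z by apply: cvgB; [exact: cvg_cst|exact: cf].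
    by move=> /cvg_norm; rewrite subrr normr0.
  - move=> k z Dz; rewrite normr_id (le_trans (ler_normB _ _))//.
    by rewrite mulr_natl mulr2n lerD// ?fg' ?fg.
rewrite Rintegral_cst; last exact: slab_measurable.
rewrite mul0r => /cvgrPdist_lt /(_ _ e0)[k _ /(_ k (leqnn k))].
rewrite sub0r normrN => hk; exists (f_ k); split => //.
have iff : mu.-integrable D (EFin \o (fun z => `|f z - f_ k z|)).
  apply: (integrable_dominated slab_measurable _ _ ig2).
    by apply: measurableT_comp => //; exact: measurable_funB.
  move=> z Dz; rewrite normr_id (le_trans (ler_normB _ _))//.
  by rewrite mulr_natl mulr2n lerD// ?fg' ?fg.
rewrite -[leLHS]fineK; last exact: (integrable_fin_num slab_measurable iff).
by rewrite lee_fin ltW// (le_lt_trans (ler_norm _) hk).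
Qed.

Lemma approximableD (f g : R * E -> R) : measurable_fun D f -> measurable_fun D g ->
  approximable f -> approximable g -> approximable (fun z => f z + g z).
Proof.
move=> mf mg af ag eps e0; have e20 : 0 < eps / 2 by rewrite divr_gt0.
have [h [th fh]] := af _ e20; have [k [tk gk]] := ag _ e20.
exists (fun s x => h s x + k s x); split; first exact: tensorD.
have mh : measurable_fun D (fun z => h z.1 z.2) by apply: measurable_funTS; exact: tensor_measurable.
have mk : measurable_fun D (fun z => k z.1 z.2) by apply: measurable_funTS; exact: tensor_measurable.
have m1 : measurable_fun D (fun z => `|f z - h z.1 z.2|%:E).
  by apply/measurable_EFinP; apply: measurableT_comp => //; exact: measurable_funB.
have m2 : measurable_fun D (fun z => `|g z - k z.1 z.2|%:E).
  by apply/measurable_EFinP; apply: measurableT_comp => //; exact: measurable_funB.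
apply: (@le_trans _ _ (\int[mu]_(z in D) (`|f z - h z.1 z.2|%:E + `|g z - k z.1 z.2|%:E))%E).
  apply: ge0_le_integral => //.
  - exact: slab_measurable.
  - apply/measurable_EFinP; apply: measurableT_comp => //; apply: measurable_funB; exact: measurable_funD.
  - exact: emeasurable_funD.
  - by move=> z _; rewrite -EFinD lee_fin opprD addrACA ler_normD.
rewrite ge0_integralD//; last exact: slab_measurable.
by rewrite [eps]splitr EFinD leeD.
Qed.

Lemma approximable0 : approximable (fun _ => 0).
Proof.
move=> eps e0; exists (fun _ _ => 0); split; first exact: tensor0.
under eq_integral do rewrite subrr normr0.
by rewrite integral0 lee_fin ltW.
Qed.

Lemma approximableZ c (f : R * E -> R) : measurable_fun D f -> approximable f -> approximable (fun z => c * f z).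
Proof.
move=> mf af eps e0; have c1 : 0 < `|c| + 1 by rewrite ltr_wpDl.
have e20 : 0 < eps / (`|c| + 1) by rewrite divr_gt0.
have [h [th fh]] := af _ e20.
exists (fun s x => c * h s x); split; first exact: tensorZ.
have mh : measurable_fun D (fun z => h z.1 z.2) by apply: measurable_funTS; exact: tensor_measurable.
have m1 : measurable_fun D (fun z => `|f z - h z.1 z.2|%:E).
  by apply/measurable_EFinP; apply: measurableT_comp => //; exact: measurable_funB.
under eq_integral do rewrite -mulrBr normrM EFinM.
rewrite ge0_integralZl ?lee_fin//; last exact: slab_measurable.
apply: (@le_trans _ _ (`|c|%:E * (eps / (`|c| + 1))%:E)%E); first by rewrite lee_wpmul2l ?lee_fin.
rewrite -EFinM lee_fin mulrA ler_pdivrMr// mulrC ler_wpM2l ?lerDl//; exact: ltW.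
Qed.

Definition box (a b : 'I_n -> R) : set E := [set x | forall i, a i < x ord0 i < b i].

Lemma box_bounded a b : exists2 r : R, 0 < r & forall x, box a b x -> `|x| < r.
Proof.
exists (1 + \sum_i (`|a i| + `|b i|)).
  by rewrite ltr_pwDl// sumr_ge0// => i _; rewrite addr_ge0.
move=> x xab; apply/rV_norm_ltP.
  by rewrite ltr_pwDl// sumr_ge0// => i _; rewrite addr_ge0.
move=> i; have /andP[h1 h2] := xab i.
apply: (@lt_le_trans _ _ (1 + (`|a i| + `|b i|))); last first.
  rewrite lerD2l (bigD1 i)//= lerDl sumr_ge0// => j _; exact: addr_ge0.
rewrite ltr_norml; have := ler_norm (- a i); have := ler_norm (b i).
have := normr_ge0 (a i); have := normr_ge0 (b i); rewrite normrN; lra.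
Qed.

Definition box_window a b k (x : E) : R := \prod_i window (a i) (b i) k (x ord0 i).

Lemma box_window_eq0 a b k x : ~ box a b x -> box_window a b k x = 0.
Proof.
move=> h; have [i hi] : exists i, ~~ (a i < x ord0 i < b i).
  by apply/existsP; rewrite -negb_forall; apply/negP => /forallP.
by rewrite /box_window (bigD1 i)//= window_eq0// mul0r.
Qed.

Lemma box_window_norm_le1 a b k x : `|box_window a b k x| <= 1.
Proof.
rewrite ger0_norm; last by apply: prodr_ge0 => i _; exact: window_ge0.
have /andP[] // : 0 <= box_window a b k x <= 1.
rewrite /box_window; elim/big_ind: _ => [|u v /andP[u0 u1] /andP[v0 v1]|i _].
- by rewrite ler01 lexx.
- by rewrite mulr_ge0//= mulr_ile1.
- by rewrite window_ge0 window_le1.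
Qed.

Lemma test_box_window a b k : test_function setT (box_window a b k).
Proof.
have [r r0 hr] := box_bounded a b.
apply: (@test_setTP _ _ _ r).
  apply: smooth_prod => i; apply: (@smooth_coord _ _ (window (a i) (b i) k)).
  have := @test_window R (a i - 1) (b i + 1) (a i) (b i) k.
  by rewrite gtrBl ltrDl ltr01 => /(_ isT isT)/test_smooth.
by move=> x rx; rewrite box_window_eq0// => /hr; rewrite ltNge rx.
Qed.

Lemma box_window_cvg a b x : box_window a b k x @[k --> \oo] --> (\1_(box a b) x : R).
Proof.
have -> : \1_(box a b) x = \prod_i (\1_(`]a i, b i[%classic : set R) (x ord0 i) : R).
  rewrite indicE; have [xab|xab] := boolP (x \in box a b).
    rewrite big1// => i _; rewrite indicE mem_set//=; move: xab; rewrite inE => /(_ i).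
    by rewrite in_itv.
  have [i hi] : exists i, ~~ (a i < x ord0 i < b i).
    apply/existsP; rewrite -negb_forall; apply: contra xab => /forallP h.
    by rewrite inE.
  rewrite (bigD1 i)//= indicE memNset ?mul0r//= in_itv/=; exact/negP.
rewrite /box_window; elim: (index_enum _) => [|i s IH].
  by under eq_fun do rewrite big_nil; rewrite big_nil; exact: cvg_cst.
under eq_fun do rewrite big_cons.
by rewrite big_cons; apply: cvgM => //; exact: window_cvg.
Qed.

Lemma box_setI a b a' b' : box a b `&` box a' b' =
  box (fun i => Num.max (a i) (a' i)) (fun i => Num.min (b i) (b' i)).
Proof.
apply/seteqP; split => [x [h1 h2] i|x h].
  by rewrite gt_max lt_min; have /andP[-> ->] := h1 i; have /andP[-> ->] := h2 i.
by split => i; have := h i; rewrite gt_max lt_min => /andP[/andP[h1 h2] /andP[h3 h4]]; apply/andP.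
Qed.

Definition boxes : set (set (measurableTypeR R * E)) :=
  [set S | exists A a b, measurable A /\ S = A `*` box a b].

Lemma measurable_box a b : measurable (box a b).
Proof.
have -> : box a b = \bigcap_(i in [set: 'I_n]) ((fun x : E => x ord0 i) @^-1` `]a i, b i[).
  apply/seteqP; split => [x h i _|x h i]; first by rewrite /= in_itv/=; exact: h.
  by have := h i I; rewrite /= in_itv.
rewrite bigcap_mkcond; apply: fin_bigcap_measurable => // i _; rewrite mem_set//.
by rewrite -[X in measurable X]setTI; exact: measurable_coord.
Qed.

Lemma boxes_setI_closed : setI_closed boxes.
Proof.
move=> _ _ [A [a [b [mA ->]]]] [A' [a' [b' [mA' ->]]]].
exists (A `&` A'), (fun i => Num.max (a i) (a' i)), (fun i => Num.min (b i) (b' i)).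
by split; [exact: measurableI|rewrite -box_setI setXI].
Qed.

Lemma box_cover (x : E) : exists k : nat, box (fun _ => - k%:R) (fun _ => k%:R) x.
Proof.
exists (Num.truncn `|x|).+1 => i; rewrite -ltr_norml.
exact: le_lt_trans (coord_le_norm x i) (truncnS_gt _).
Qed.

(** Both projections are measurable for the sigma-algebra generated by the boxes, because cylinders
    and half-spaces are countable unions of boxes. *)
Lemma measurable_boxes : @measurable _ (measurableTypeR R * E)%type = <<s boxes >>.
Proof.
apply/seteqP; split; last first.
  apply: smallest_sub; first exact: sigma_algebra_measurable.
  by move=> _ [A [a [b [mA ->]]]]; apply: measurableX => //; exact: measurable_box.
have mid : measurable_fun setT (id : g_sigma_algebraType boxes -> measurableTypeR R * E).
  apply/measurable_fun_pairP; split.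
    move=> _ A mA; rewrite setTI.
    have -> : (fst \o id) @^-1` A = \bigcup_k (A `*` box (fun _ => - k%:R) (fun _ => k%:R)).
      apply/seteqP; split => [[s x] /= As|[s x] [k _ []]//].
      by have [k hk] := box_cover x; exists k.
    apply: bigcup_measurable => k _; apply: sub_sigma_algebra.
    by exists A, (fun _ => - k%:R), (fun _ => k%:R).
  apply: measurable_fun_coordP => i.
  apply: (measurability _ (RGenOInfty.measurableE R)) => _ [_ [c ->] <-].
  rewrite setTI.
  have -> : (fun t : g_sigma_algebraType boxes => (snd \o id) t ord0 i) @^-1` `]c, +oo[ =
     \bigcup_k (setT `*` box (fun j => if j == i then c else - k%:R) (fun _ => k%:R)).
    apply/seteqP; split => [[s x]|[s x] [k _ [_ /= /(_ i)]]].
      rewrite /= in_itv/= andbT => cx; have [k hk] := box_cover x; exists k => //; split => // j.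
      by have /andP[h1 h2] := hk j; rewrite h2 andbT; case: eqP => [->|].
    by rewrite eqxx in_itv/= andbT => /andP[].
  apply: bigcup_measurable => k _; apply: sub_sigma_algebra.
  by exists setT, (fun j => if j == i then c else - k%:R), (fun _ => k%:R).
move=> A mA; have := mid measurableT A mA; rewrite setTI preimage_id; exact.
Qed.

(** Dynkin induction on the products of a measurable set of times with an open box, whose indicators
    are limits of tensors made of windows. The factor confining [x] to a cube keeps complements and
    countable unions integrable. *)
Lemma approximable_indic (r : R) S : 0 < r -> measurable S ->
  approximable (fun z : measurableTypeR R * E => \1_S z * \1_[set x : E | `|x| < r] z.2).
Proof.
move=> r0 mS; pose Q := [set x : E | `|x| < r].
pose f (A : set (measurableTypeR R * E)) (z : measurableTypeR R * E) : R := \1_A z * \1_Q z.2.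
have mQ : measurable_fun setT (fun z : measurableTypeR R * E => \1_Q z.2 : R).
  apply: (measurableT_comp (f := \1_Q : E -> R)); last exact: measurable_snd.
  by apply: measurable_indic; exact: measurable_lt_norm.
have mf A : measurable A -> measurable_fun D (f A).
  move=> mA; apply: measurable_funTS; apply: measurable_funM => //; exact: measurable_indic.
have QE : Q = box (fun _ => - r) (fun _ => r).
  apply/seteqP; split => [x /(rV_norm_ltP _ r0) h i|x h].
    by rewrite -ltr_norml.
  by apply/rV_norm_ltP => // i; rewrite ltr_norml.
have iQ : mu.-integrable D (EFin \o (fun z => \1_Q z.2)).
  apply: (@integrable_slab_bounded _ 1 r); first exact: measurable_funTS.
    by move=> z _; rewrite indicE; case: (_ \in _); rewrite ?normr1 ?normr0.
  by move=> z _ h; rewrite indicE memNset//= /Q/=; rewrite ltNge h.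
have mbw a b k : measurable_fun setT (box_window a b k).
  by apply: measurable_smooth; exact: test_smooth (test_box_window a b k).
have boxP A a b : measurable A -> approximable (f (A `*` box a b)).
  move=> mA; rewrite /f.
  pose a' i := Num.max (a i) (- r); pose b' i := Num.min (b i) r.
  have BQ : box a b `&` Q = box a' b' by rewrite QE box_setI.
  pose f_ k (z : R * E) := \1_A z.1 * box_window a' b' k z.2.
  have mf_ k : measurable_fun setT (fun z : measurableTypeR R * E => f_ k z).
    apply: measurable_funM.
      apply: (measurableT_comp (f := \1_A : measurableTypeR R -> R)); last exact: measurable_fst.
      exact: measurable_indic.
    by apply: (measurableT_comp (mbw a' b' k)); exact: measurable_snd.
  have cf z : f_ k z @[k --> \oo] --> f (A `*` box a b) z.
    have -> : f (A `*` box a b) z = \1_A z.1 * \1_(box a' b') z.2.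
      rewrite -BQ /f !indicE in_setX in_setI.
      by case: (z.1 \in A); case: (z.2 \in box a b); case: (z.2 \in Q); rewrite /= ?mulr0 ?mul0r ?mulr1.
    by apply: cvgM; [exact: cvg_cst|exact: box_window_cvg].
  apply: (approximable_cvg _ (fun k => measurable_funTS (mf_ k)) _ (fun z _ => cf z) _ iQ).
  - by apply: mf; apply: measurableX => //; exact: measurable_box.
  - move=> k eps e0; exists (fun s x => \1_A s * box_window a' b' k x + 0); split.
      apply: (@tensorS (\1_A)); last exact: tensor0.
      + exact: measurable_indic.
      + by exists 1 => s; rewrite indicE; case: (_ \in _); rewrite ?normr1 ?normr0.
      + exact: test_box_window.
    under eq_integral do rewrite addr0 subrr normr0.
    by rewrite integral0 lee_fin ltW.
  - move=> k z _; rewrite /f_ normrM.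
    have [zb|zb] := pselect (box a' b' z.2).
      rewrite [leRHS]indicE mem_set; last by move: zb; rewrite -BQ => -[].
      by rewrite mulr_ile1 ?box_window_norm_le1//  indicE; case: (_ \in _); rewrite ?normr1 ?normr0.
    by rewrite box_window_eq0// normr0 mulr0.
have PT : approximable (f setT).
  have -> : f setT = f (setT `*` Q).
    apply/funext => z; rewrite /f !indicE in_setT in_setX in_setT /=.
    by case: (z.2 \in Q); rewrite ?mulr0.
  by rewrite QE; exact: boxP.
suff : approximable (f S) by [].
move: (mS); rewrite measurable_boxes.
apply: (dynkin_induction (P := fun S => approximable (f S)) measurable_boxes boxes_setI_closed) => //.
- by move=> _ [A [a [b [mA ->]]]]; exact: boxP.
- move=> S' mS' aS'.
  rewrite (_ : f (~` S') = fun z => f setT z + (-1) * f S' z).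
    apply: approximableD => //; [exact: mf|apply: measurable_funM => //; exact: mf|].
    by apply: approximableZ => //; exact: mf.
  apply/funext => z; rewrite /f !indicE in_setC in_setT.
  by case: (z \in S'); rewrite ?mul0r ?mul1r ?mulr0 ?addr0 //= mulN1r subrr.
move=> F mF tF aF; pose U k := \big[setU/set0]_(i < k) F i.
have mU k : measurable (U k) by apply: bigsetU_measurable => i _; exact: mF.
have aU k : approximable (f (U k)).
  elim: k => [|k IH].
    rewrite (_ : f _ = fun _ => 0); first exact: approximable0.
    by apply/funext => z; rewrite /f /U big_ord0 indic0 mul0r.
  rewrite (_ : f _ = fun z => f (U k) z + f (F k) z).
    by apply: approximableD => //; exact: mf.
  apply/funext => z; rewrite /f -mulrDl; congr (_ * _).
  rewrite /U big_ord_recr/= -/(U k) !indicE in_setU.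
  have [zU|zU] := boolP (z \in U k); have [zF|zF] := boolP (z \in F k) => /=; rewrite ?addr0 ?add0r//.
  exfalso; move: zU zF; rewrite !inE /U -bigcup_mkord => -[i /= ik Fi] Fk.
  by have := tF i k I I (ex_intro _ z (conj Fi Fk)) => E'; move: ik; rewrite E' ltnn.
have cU z : f (U k) z @[k --> \oo] --> f (\bigcup_i F i) z.
  apply: cvg_near_cst; rewrite /f.
  have [[i _ Fi]|nF] := pselect ((\bigcup_i F i) z).
    exists i.+1 => // k /= ik; congr (_ * _); rewrite !indicE !mem_set//; first by exists i.
    by rewrite /U -bigcup_mkord; exists i.
  exists 0%N => // k _; congr (_ * _); rewrite !indicE !memNset//.
  by rewrite /U -bigcup_mkord => -[i _ Fi]; apply: nF; exists i.
apply: (approximable_cvg _ (fun k => mf _ (mU k)) aU (fun z _ => cU z) _ iQ).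
- by apply: mf; exact: bigcupT_measurable.
- move=> k z _; rewrite /f normrM [X in _ * X]ger0_norm// ler_piMl// indicE.
  by case: (_ \in _); rewrite ?normr1 ?normr0.
Qed.

Lemma approximable_sum m (F : 'I_m -> R * E -> R) :
  (forall j, measurable_fun D (F j)) -> (forall j, approximable (F j)) ->
  approximable (fun z => \sum_(j < m) F j z).
Proof.
move=> mF aF; elim: (index_enum _) => [|i s IH].
  by under eq_fun do rewrite big_nil; exact: approximable0.
under eq_fun do rewrite big_cons.
by apply: approximableD => //; exact: measurable_sum.
Qed.

(** Truncation to cubes, then approximation by simple functions, whose level sets are handled by
    [approximable_indic]. *)
Lemma tensor_dense (f : R * E -> R) : mu.-integrable D (EFin \o f) -> approximable f.
Proof.
move=> intf; have mf := integrable_measurable intf.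
pose Q k := [set x : E | `|x| < k.+1%:R].
have mQ k : measurable_fun setT (fun z : measurableTypeR R * E => \1_(Q k) z.2 : R).
  apply: (measurableT_comp (f := \1_(Q k) : E -> R)); last exact: measurable_snd.
  by apply: measurable_indic; exact: measurable_lt_norm.
have QE z : `|\1_(Q z.1) z.2 : R| <= 1.
  by rewrite indicE; case: (_ \in _); rewrite ?normr1 ?normr0.
have ifQ k : mu.-integrable D (EFin \o (fun z => f z * \1_(Q k) z.2)).
  apply: (@integrable_Mbounded _ _ _ mu D slab_measurable f (fun z => \1_(Q k) z.2) 1 _ _ intf).
    exact: measurable_funTS.
  by move=> z _; exact: (QE (k, z.2)).
have infn := integrable_norm intf.
apply: (@approximable_cvg _ (fun k z => f z * \1_(Q k) z.2) (fun z => `|f z|)) => //.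
- by move=> k; exact: (integrable_measurable (ifQ k)).
- move=> k; apply: approximable_limit => [|eps e0]; first exact: (integrable_measurable (ifQ k)).
  have [g [ig _ cg]] := approximation_sfun_integrable slab_measurable intf.
  have [i hi] : exists i, (\int[mu]_(z in D) `|(EFin \o f) z - (g i z)%:E| < eps%:E)%E.
    have /cg[i _ hi] : nbhs (0%E : \bar R) [set x | (x < eps%:E)%E].
      by apply: open_nbhs_nbhs; split; [exact: open_ereal_lt_ereal|rewrite /= lte_fin].
    by exists i; exact: (hi i (leqnn i)).
  have mgi : measurable_fun D (g i : measurableTypeR R * E -> R) := integrable_measurable (ig i).
  have mQD : measurable_fun D (fun z : measurableTypeR R * E => \1_(Q k) z.2 : R) by exact: measurable_funTS.
  exists (fun z => g i z * \1_(Q k) z.2); split.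
  + exact: measurable_funM.
  + rewrite (_ : (fun z => _) = fun z => \sum_(j < size (finmap.enum_fset (fset_set (range (g i)))))
       (finmap.enum_fset (fset_set (range (g i))))`_j *
       (\1_(g i @^-1` [set (finmap.enum_fset (fset_set (range (g i))))`_j]) z * \1_(Q k) z.2)); last first.
      apply/funext => z; rewrite fimfunEord mulr_suml; apply: eq_bigr => j _; by rewrite mulrA.
    have mP (c : R) : measurable (g i @^-1` [set c]).
      by rewrite -[X in measurable X]setTI; apply: measurable_funPT.
    have mj (c : R) : measurable_fun D (fun z : measurableTypeR R * E => \1_(g i @^-1` [set c]) z * \1_(Q k) z.2 : R).
      apply: measurable_funM => //; apply: measurable_funTS; exact: measurable_indic.
    apply: approximable_sum => j.
      exact: measurable_funM.
    by apply: approximableZ => //; exact: approximable_indic.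
  + apply: le_trans (ltW hi); apply: ge0_le_integral => //.
    * exact: slab_measurable.
    * apply/measurable_EFinP; apply: measurableT_comp => //.
      by apply: measurable_funB; exact: measurable_funM.
    * by apply/measurable_EFinP; apply: measurableT_comp => //; exact: measurable_funB.
    * move=> z _; rewrite -mulrBl normrM /= lee_fin ler_piMr//; exact: (QE (k, z.2)).
- move=> z _; apply: cvg_near_cst; exists (Num.truncn `|z.2|) => // k /= hk.
  rewrite indicE mem_set ?mulr1// /Q/=; apply: (lt_le_trans (truncnS_gt _)).
  by rewrite ler_nat.
- by move=> k z _; rewrite normrM ler_piMr//; exact: (QE (k, z.2)).
Qed.

End tensor_density.

(** * Spatial slices of the derivative condition *)

Section off_null.
Context d (X : measurableType d) {R : realType} (mu : {measure set X -> \bar R}).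
Import HBNNSimple.

(** The supremum over simple functions by which the integral is defined. It is compared directly
    since the functions concerned may fail to be measurable. *)
Let nnint (f : X -> \bar R) := ereal_sup
  [set sintegral mu h | h in [set h : {nnsfun X >-> R} | forall x, ((h x)%:E <= f x)%E]].

Let nnint_le (N : set X) (f g : X -> \bar R) : measurable N -> mu N = 0%E ->
  (forall x, 0 <= g x)%E -> (forall x, ~ N x -> f x = g x) -> (nnint f <= nnint g)%E.
Proof.
move=> mN N0 g0 fg; apply: ge_ereal_sup => _ [h hf <-].
have mI : measurable (~` N) by exact: measurableC.
(* Cutting a simple function off on the null set keeps its integral and places it below [g]. *)
pose k := mul_nnsfun h (indic_nnsfun R mI).
have kE x : k x = h x * \1_(~` N) x by [].
have kg x : ((k x)%:E <= g x)%E.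
  rewrite kE indicE; have [xN|xN] := pselect (N x).
    by rewrite memNset ?mulr0//=; apply.
  by rewrite mem_set// mulr1 -fg.
rewrite (_ : sintegral mu h = sintegral mu k); first by apply: ereal_sup_ubound; exists k.
rewrite -!integralT_nnsfun.
apply: ae_eq_integral => //.
- by apply/measurable_EFinP.
- by apply/measurable_EFinP.
exists N; split => // x /=; apply: contra_notP => xN _.
by rewrite mindicE mem_set// mulr1.
Qed.

(* Unlike [ae_eq_integral], this does not require the functions to be measurable. *)
Lemma eq_integral_off_null (N D : set X) (f g : X -> \bar R) : measurable N -> mu N = 0%E ->
  (forall x, D x -> ~ N x -> f x = g x) ->
  (\int[mu]_(x in D) f x = \int[mu]_(x in D) g x)%E.
Proof.
move=> mN N0 fg; have fgD x : ~ N x -> (f \_ D) x = (g \_ D) x.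
  by move=> xN; rewrite !patchE; case: ifPn => // /set_mem Dx; exact: fg.
rewrite /integral -/(nnint _) -/(nnint _) -/(nnint _) -/(nnint _).
have ge0p (h : X -> \bar R) x : (0 <= h^\+ x)%E by exact: funepos_ge0.
have ge0n (h : X -> \bar R) x : (0 <= h^\- x)%E by exact: funeneg_ge0.
congr (_ - _)%E; apply/eqP; rewrite eq_le; apply/andP; split.
- by apply: (nnint_le mN N0) => // x xN; rewrite !unlock fgD.
- by apply: (nnint_le mN N0) => // x xN; rewrite !unlock fgD.
- by apply: (nnint_le mN N0) => // x xN; rewrite !unlock fgD.
- by apply: (nnint_le mN N0) => // x xN; rewrite !unlock fgD.
Qed.

Lemma eq_Rintegral_off_null (D : set X) (f g : X -> R) :
  {ae mu, forall x, D x -> f x = g x} ->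
  \int[mu]_(x in D) f x = \int[mu]_(x in D) g x.
Proof.
move=> [N [mN N0 h]]; rewrite /Rintegral; congr fine.
apply: (@eq_integral_off_null N) => // x Dx xN; congr EFin.
by apply: contra_notP xN => nfg; apply: h => /= /(_ Dx).
Qed.

Lemma ae_imp (P Q : X -> Prop) : {ae mu, forall x, P x} -> (forall x, P x -> Q x) ->
  {ae mu, forall x, Q x}.
Proof.
move=> [N [mN N0 h]] PQ; exists N; split => //; apply: subset_trans h => x /=.
by apply: contra_not; exact: PQ.
Qed.

Lemma ae_and (P Q : X -> Prop) : {ae mu, forall x, P x} -> {ae mu, forall x, Q x} ->
  {ae mu, forall x, P x /\ Q x}.
Proof.
move=> hP hQ; exact: filterI hP hQ.
Qed.

Lemma ae_countable (I : countType) (P : I -> X -> Prop) :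
  (forall i, {ae mu, forall x, P i x}) -> {ae mu, forall x, forall i, P i x}.
Proof.
move=> h; have : {ae mu, forall x, forall k, if unpickle k is Some i then P i x else True}.
  apply: ae_foralln => k; case: (unpickle k) => [i|]; first exact: h.
  exact: aeW.
by apply: filterS => x hx i; have := hx (pickle i); rewrite pickleK.
Qed.

End off_null.

(** * Fubini and Tonelli on a slab *)

Section slab_sections.
Context {R : realType} {n : nat} (t0 t1 : R).
Local Notation E := 'rV[R]_n.
Local Notation leb := (@lebesgue_rV R n).
Local Notation mu1 := (@lebesgue_measure R).
Local Notation mu := (@spacetime_measure R n).
Local Notation D := (slab (n := n) t0 t1 : set (measurableTypeR R * E)).
Implicit Types f : R * E -> R.

Lemma measurable_slab : measurable D.
Proof. exact: measurableX. Qed.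

Lemma slab_patch f s x : s \in `]t0, t1[ -> (f \_ D) (s, x) = f (s, x).
Proof. by move=> st; rewrite patchE mem_set. Qed.

Lemma slab_measurable_patch f : measurable_fun D f ->
  measurable_fun [set: measurableTypeR R * E] (f \_ D).
Proof. by move=> mf; apply/(measurable_restrictT _ measurable_slab). Qed.

Lemma slab_integrable_patch f : mu.-integrable D (EFin \o f) ->
  mu.-integrable setT (EFin \o (f \_ D)).
Proof. by move=> intf; rewrite -restrict_EFin -integrable_mkcond//; exact: measurable_slab. Qed.

Lemma slab_section_measurable f s : measurable_fun D f -> s \in `]t0, t1[ ->
  measurable_fun setT (fun x : E => f (s, x)).
Proof.
move=> mf st; rewrite (_ : (fun x => _) = fun x => (f \_ D) (s, x)).
  apply: (measurableT_comp (slab_measurable_patch mf)); exact: pair1_measurable.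
by apply/funext => x; rewrite slab_patch.
Qed.

Lemma slab_section_integrable f : mu.-integrable D (EFin \o f) ->
  {ae mu1, forall s, s \in `]t0, t1[ -> leb.-integrable setT (EFin \o (fun x => f (s, x)))}.
Proof.
move=> /slab_integrable_patch /ae_integrable1; apply: filterS => s hs st.
by move: hs; apply: eq_integrable => // x _ /=; rewrite slab_patch.
Qed.

Let G (f : R * E -> \bar R) s := (\int[leb]_x f (s, x))%E.

Let slab_fubini_F (f : R * E -> \bar R) : fubini_F leb (f \_ D) = (G f) \_ `]t0, t1[.
Proof.
apply/funext => s; rewrite /fubini_F patchE; case: ifPn => st.
  apply: eq_integral => x _; rewrite patchE mem_set//; split => //; exact: set_mem st.
by apply: integral0_eq => x _; rewrite patchE memNset// => -[/= h _]; move/negP: st; apply; exact: mem_set.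
Qed.

Let slab_integrable_G f : mu.-integrable D (EFin \o f) ->
  mu1.-integrable `]t0, t1[ (G (EFin \o f)).
Proof.
move=> intf; rewrite integrable_mkcond//.
rewrite -slab_fubini_F restrict_EFin; apply: integrable_fubini_F; exact: slab_integrable_patch.
Qed.

Lemma slab_integrable_section f : mu.-integrable D (EFin \o f) ->
  mu1.-integrable `]t0, t1[ (EFin \o (fun s => \int[leb]_x f (s, x))).
Proof.
move=> /slab_integrable_G iG; have mG := measurable_int _ iG.
apply: le_integrable iG => //.
  by apply/measurable_EFinP; exact: (measurableT_comp (f := fine)).
move=> s _; rewrite /= /Rintegral.
have fine_le (y : \bar R) : (`|fine y|%:E <= `|y|)%E by case: y => [r||] //=; rewrite ?normr0 ?leey.
exact: fine_le.
Qed.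

Lemma slab_Fubini f : mu.-integrable D (EFin \o f) ->
  \int[mu]_(z in D) f z = \int[mu1]_(s in `]t0, t1[) \int[leb]_x f (s, x).
Proof.
move=> intf; have i2 := slab_integrable_patch intf.
rewrite /Rintegral; congr fine.
rewrite integral_mkcond restrict_EFin.
transitivity (\int[mu1]_s fubini_F leb (EFin \o (f \_ D)) s)%E.
  by rewrite integral12_prod_meas1.
rewrite -restrict_EFin slab_fubini_F -integral_mkcond.
have [N [mN N0 hN]] := slab_section_integrable intf.
apply: (@eq_integral_off_null _ _ _ mu1 N) => // s st sN.
rewrite /G fineK//; apply: integrable_fin_num => //.
by apply: contra_notP sN => h; apply: hN => /= /(_ st).
Qed.

Lemma slab_measurable_section (f : R * E -> \bar R) : measurable_fun D f ->
  (forall z, D z -> 0 <= f z)%E ->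
  measurable_fun (`]t0, t1[%classic : set (measurableTypeR R)) (fun s => \int[leb]_x f (s, x))%E.
Proof.
move=> mf f0; apply/(measurable_restrictT _ (measurable_itv _)).
rewrite -[X in measurable_fun _ X]slab_fubini_F.
apply: measurable_fun_fubini_tonelli_F; first exact/(measurable_restrictT _ measurable_slab).
by move=> z; rewrite patchE; case: ifPn => // /set_mem; exact: f0.
Qed.

Lemma slab_Tonelli (f : R * E -> \bar R) : measurable_fun D f -> (forall z, D z -> 0 <= f z)%E ->
  (\int[mu]_(z in D) f z = \int[mu1]_(s in `]t0, t1[) \int[leb]_x f (s, x))%E.
Proof.
move=> mf f0; rewrite integral_mkcond.
transitivity (\int[mu1]_s fubini_F leb (f \_ D) s)%E.
  apply: fubini_tonelli1; first exact/(measurable_restrictT _ measurable_slab).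
  by move=> z; rewrite patchE; case: ifPn => // /set_mem; exact: f0.
by rewrite slab_fubini_F -integral_mkcond.
Qed.

End slab_sections.

(** * The distributional equation at almost every time *)

Section weak_slices.
Context {R : realType} {n : nat} (T : R).
Local Notation E := 'rV[R]_n.
Local Notation leb := (@lebesgue_rV R n).
Local Notation mu1 := (@lebesgue_measure R).
Local Notation mu := (@spacetime_measure R n).
Local Notation D := (slab (n := n) 0 T : set (measurableTypeR R * E)).
Let mD : measurable D := measurable_slab (n := n) 0 T.

Definition slab_locally_integrable (u : R * E -> R) := forall r : R,
  mu.-integrable D (EFin \o (fun z => u z * \1_[set x : E | `|x| < r] z.2)).

Lemma slab_locally_integrable_test u phi : slab_locally_integrable u -> test_function setT phi ->
  mu.-integrable D (EFin \o (fun z => u z * phi z.2)).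
Proof.
move=> lu tp; have [M M0 hM] := test_bounded tp; have [r r0 hr] := test_bounded_support tp.
have mp : measurable_fun D (fun z : measurableTypeR R * E => phi z.2).
  apply: measurable_funTS; apply: (measurableT_comp (f := phi)); last exact: measurable_snd.
  by apply: measurable_smooth; exact: test_smooth tp.
have := @integrable_Mbounded _ _ _ mu D mD _ (fun z => phi z.2) M mp (fun z _ => hM z.2) (lu r).
apply: eq_integrable => // -[s x] _ /=; congr EFin; rewrite indicE.
have [xr|xr] := ltP `|x| r; first by rewrite mem_set// mulr1.
by rewrite hr// !mulr0.
Qed.

(** Testing the equation with [theta s * phi x] leaves the integral over time of [theta] against a
    function of [s], which therefore vanishes almost everywhere by the fundamental lemma. The
    exceptional set of times depends on [phi], so only countably many [phi] can be treated at
    once. *)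
Lemma weak_slice (u : R * E -> R) (v : E) m (S : 'I_m -> (E -> R[i]) -> @Defs.distribution R n)
    (g : 'I_m -> R -> E -> R) (kap : 'I_m -> (E -> R) -> E -> R) :
  slab_locally_integrable u ->
  (forall k, mu.-integrable D (EFin \o (fun z => g k z.1 z.2))) ->
  (forall k phi, test_function setT phi -> measurable_fun setT (kap k phi)) ->
  (forall k phi, test_function setT phi -> exists M, forall y, `|kap k phi y| <= M) ->
  (forall k w phi a, leb.-integrable setT (EFin \o w) -> test_function setT phi ->
        complex.Re (S k (fun x => real_complex R (w x)) (fun x => real_complex R (a * phi x))) =
        a * \int[leb]_y (w y * kap k phi y)) ->
  (forall phi, test_function (slab 0 T) phi ->
      real_complex R (- \int[mu]_(z in D) (u z * 'D_(0, v) phi z)) =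
      \sum_(k < m) cint mu1 `]0, T[
        (fun s => S k (fun x => real_complex R (g k s x)) (fun x => real_complex R (phi (s, x))))) ->
  forall phi, test_function setT phi -> {ae mu1, forall s, s \in `]0, T[ ->
     - (\int[leb]_x (u (s, x) * 'D_v phi x)) = \sum_(k < m) \int[leb]_y (g k s y * kap k phi y)}.
Proof.
move=> lu ig mk bk SE uS phi tp.
have iu := slab_locally_integrable_test lu (test_derive v tp).
have igk k : mu.-integrable D (EFin \o (fun z => g k z.1 z.2 * kap k phi z.2)).
  have [M hM] := bk k phi tp.
  have mkp : measurable_fun D (fun z : measurableTypeR R * E => kap k phi z.2).
    by apply: measurable_funTS; apply: (measurableT_comp (mk k phi tp)); exact: measurable_snd.
  exact: (@integrable_Mbounded _ _ _ mu D mD _ (fun z => kap k phi z.2) M mkp (fun z _ => hM z.2) (ig k)).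
have Iu := slab_integrable_section iu.
have Ig k := slab_integrable_section (igk k).
pose F s := \int[leb]_x (u (s, x) * 'D_v phi x) + \sum_(k < m) \int[leb]_y (g k s y * kap k phi y).
have mI : measurable (`]0, T[%classic : set (measurableTypeR R)) by exact: measurable_itv.
have iS : mu1.-integrable `]0, T[ (EFin \o (fun s => \sum_(k < m) \int[leb]_y (g k s y * kap k phi y))).
  exact: (integrable_Rsum mI _ Ig).
have iF : mu1.-integrable `]0, T[ (EFin \o F) by exact: (integrable_D mI Iu iS).
have h0 : forall theta, test_function (`]0, T[%classic : set R) theta ->
    \int[mu1]_(s in `]0, T[) (theta s * F s) = 0.
  move=> theta tt; have [M M0 hM] := test_bounded tt.
  have mt : measurable_fun (setT : set R) theta.
    by apply: continuous_measurable_fun; apply: smooth_continuous; exact: test_smooth tt.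
  have mtD : measurable_fun (`]0, T[%classic : set (measurableTypeR R)) theta by exact: measurable_funTS.
  have Mt w : mu1.-integrable `]0, T[ (EFin \o w) -> mu1.-integrable `]0, T[ (EFin \o (fun s => theta s * w s)).
    move=> iw; have := @integrable_Mbounded _ _ _ mu1 _ mI w theta M mtD (fun s _ => hM s) iw.
    by apply: eq_integrable => // s _ /=; rewrite mulrC.
  have := uS _ (test_spacetime tt tp) => /(congr1 (@complex.Re R)) /=.
  rewrite (big_morph (@complex.Re R) (id1 := 0) (op1 := +%R)) //; last by case=> ? ? [].
  under eq_bigr => k _.
    rewrite /=.
    have -> : \int[mu1]_(s in `]0, T[) complex.Re (S k (fun x => real_complex R (g k s x))
        (fun x => real_complex R (theta s * phi x))) =
        \int[mu1]_(s in `]0, T[) (theta s * \int[leb]_y (g k s y * kap k phi y)).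
      (* The operator is controlled on integrable densities only, that is, at almost every time, and
         its values are not known beforehand to be measurable in [s]. *)
      apply: eq_Rintegral_off_null; apply: (ae_imp (slab_section_integrable (ig k))).
      by move=> s hs st; apply: SE => //; exact: hs.
    over.
  have -> : \int[mu]_(z in D) (u z * 'D_(0, v) (fun z => theta z.1 * phi z.2) z) =
      \int[mu1]_(s in `]0, T[) (theta s * \int[leb]_x (u (s, x) * 'D_v phi x)).
    have iut : mu.-integrable D (EFin \o (fun z => u z * 'D_v phi z.2 * theta z.1)).
      apply: (@integrable_Mbounded _ _ _ mu D mD _ (fun z => theta z.1) M _ (fun z _ => hM z.1) iu).
      apply: measurable_funTS; apply: (measurableT_comp (f := theta)) => //; exact: measurable_fst.
    transitivity (\int[mu]_(z in D) (u z * 'D_v phi z.2 * theta z.1)).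
      apply: eq_Rintegral => z _; rewrite (derive_spacetime tt tp) derive0 mul0r add0r; ring.
    rewrite (slab_Fubini iut).
    apply: eq_Rintegral_off_null; apply: (ae_imp (slab_section_integrable iu)) => s hs st; rewrite /= -RintegralZl//; last exact: hs.
    by apply: eq_Rintegral => x _; rewrite mulrC.
  move=> H.
  transitivity (\int[mu1]_(s in `]0, T[) (theta s * \int[leb]_x (u (s, x) * 'D_v phi x)) +
     \int[mu1]_(s in `]0, T[) (theta s * \sum_(k < m) \int[leb]_y (g k s y * kap k phi y))).
    rewrite -(RintegralD mI (Mt _ Iu) (Mt _ iS)).
    by apply: eq_Rintegral => s _; rewrite mulrDr.
  rewrite (_ : \int[mu1]_(s in `]0, T[) (theta s * \sum_(k < m) \int[leb]_y (g k s y * kap k phi y)) =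
    \sum_(k < m) \int[mu1]_(s in `]0, T[) (theta s * \int[leb]_y (g k s y * kap k phi y))).
    by rewrite -H subrr.
  rewrite -(Rintegral_sum mI _ (fun k => Mt _ (Ig k))).
  by apply: eq_Rintegral => s _; rewrite mulr_sumr.
apply: (ae_imp (du_bois_reymond_R iF h0)) => s hs st.
by have := hs st; rewrite /F => /eqP; rewrite addrC addr_eq0 => /eqP ->.
Qed.

End weak_slices.

Lemma sum_injective_le (R : realType) (A B : finType) (phi : A -> B) (F : B -> R) :
  injective phi -> (forall b, 0 <= F b) -> \sum_a F (phi a) <= \sum_b F b.
Proof.
move=> iphi F0; rewrite [leRHS](bigID (mem (phi @: [set: A]%SET)))/=.
rewrite big_imset/=; last by move=> x y _ _; exact: iphi.
rewrite [X in _ <= X + _](eq_bigl xpredT); last by move=> x; rewrite finset.in_setT.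
by rewrite lerDl sumr_ge0.
Qed.

(** * Bounds for the derivatives of mollifications *)

Section derivative_bound.
Context {R : realType} {n : nat} (T : R).
Local Notation E := 'rV[R]_n.
Local Notation leb := (@lebesgue_rV R n).
Local Notation mu1 := (@lebesgue_measure R).
Local Notation mu := (@spacetime_measure R n).
Local Notation D := (slab (n := n) 0 T : set (measurableTypeR R * E)).
Let mD : measurable D := measurable_slab (n := n) 0 T.

Definition locally_integrable_rV (v : E -> R) := forall k : nat,
  leb.-integrable setT (EFin \o (fun z => v z * \1_[set x : E | `|x| < k%:R] z)).

Lemma locally_integrable_rVP v (r : R) : locally_integrable_rV v ->
  leb.-integrable setT (EFin \o (fun z => v z * \1_[set x : E | `|x| < r] z)).
Proof.
move=> lv; have [k rk] : exists k : nat, r <= k%:R.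
  by exists (Num.truncn `|r|).+1; rewrite (le_trans (ler_norm r))// ltW// truncnS_gt.
have mI : measurable_fun setT (\1_[set x : E | `|x| < r] : E -> R).
  by apply: measurable_indic; exact: measurable_lt_norm.
have b1 x : setT x -> `|\1_[set x : E | `|x| < r] x : R| <= 1.
  by move=> _; rewrite indicE; case: (_ \in _); rewrite ?normr1 ?normr0.
have := @integrable_Mbounded _ _ _ leb setT measurableT _ _ 1 mI b1 (lv k).
apply: eq_integrable => // x _ /=; congr EFin; rewrite -mulrA; congr (_ * _).
rewrite !indicE; have [xr|xr] := boolP (x \in [set x : E | `|x| < r]); last by rewrite mulr0.
rewrite mem_set ?mulr1//=; move: xr; rewrite inE/= => /lt_le_trans; exact.
Qed.

Lemma resc_eq0 x rho phi (z : E) : 0 < rho -> (forall w : E, 1 <= `|w| -> phi w = 0) ->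
  rho <= `|z - x| -> resc x rho phi z = 0 :> R.
Proof.
move=> r0 p0 h; apply: p0; rewrite normrZ gtr0_norm ?invr_gt0//.
by rewrite ler_pdivlMl// mulr1.
Qed.

Lemma locally_integrable_resc v x rho phi : locally_integrable_rV v -> 0 < rho ->
  test_function setT phi -> (forall w : E, 1 <= `|w| -> phi w = 0) ->
  leb.-integrable setT (EFin \o (fun z => v z * resc x rho phi z)).
Proof.
move=> lv r0 tp p0; have [M M0 hM] := test_bounded tp.
have mr : measurable_fun setT (resc x rho phi).
  by apply: measurable_smooth; exact: test_smooth (test_resc x r0 tp).
have hr z : setT z -> `|resc x rho phi z| <= M by move=> _; exact: hM.
have := @integrable_Mbounded _ _ _ leb setT measurableT _ _ M mr hr (locally_integrable_rVP (`|x| + rho) lv).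
apply: eq_integrable => // z _ /=; congr EFin; rewrite indicE.
have [zr|zr] := ltP `|z| (`|x| + rho); first by rewrite mem_set// mulr1.
rewrite (resc_eq0 r0 p0) ?mulr0//.
have := ler_normD (z - x) x; rewrite subrK; lra.
Qed.

Lemma resc_cvg v (x : E) (rho : R) (x_ : nat -> E) (rho_ : nat -> R) phi : locally_integrable_rV v -> 0 < rho ->
  test_function setT phi -> (forall w : E, 1 <= `|w| -> phi w = 0) ->
  x_ k @[k --> \oo] --> x -> rho_ k @[k --> \oo] --> rho ->
  (forall k, rho <= rho_ k <= rho + 1) -> (forall k, `|x_ k - x| <= 1) ->
  \int[leb]_z (v z * resc (x_ k) (rho_ k) phi z) @[k --> \oo] --> \int[leb]_z (v z * resc x rho phi z).
Proof.
move=> lv r0 tp p0 cx cr rk xk; have [M M0 hM] := test_bounded tp.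
have rk0 k : 0 < rho_ k by have /andP[h _] := rk k; exact: lt_le_trans h.
pose r := `|x| + 1 + (rho + 1).
have iv := integrable_norm (locally_integrable_rVP r lv).
apply: (@Rintegral_dct _ _ _ leb setT measurableT _ _ (fun z => M * `|v z * \1_[set x : E | `|x| < r] z|)).
- by move=> k; exact: (integrable_measurable (locally_integrable_resc (x_ k) lv (rk0 k) tp p0)).
- move=> z _; apply: cvgMr; rewrite /resc.
  apply: (cvg_comp (fun k => (rho_ k)^-1 *: (z - x_ k)) phi); last exact: (smooth_continuous (test_smooth tp)).
  apply: cvgZ; last by apply: cvgB => //; exact: cvg_cst.
  by apply: cvgV => //; rewrite gt_eqF.
- move=> k z _; rewrite normrM mulrC; have [zr|zr] := ltP `|z| r.
    by rewrite indicE mem_set//= mulr1 ler_wpM2r//; exact: hM.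
  rewrite (resc_eq0 (rk0 k) p0) ?normr0 ?mul0r ?mulr_ge0//.
  have := ler_normD (z - x_ k) (x_ k); rewrite subrK; have := ler_normD (x_ k - x) x; rewrite subrK.
  have := xk k; have /andP[_] := rk k; rewrite /r in zr; lra.
- exact: integrable_Zl.
Qed.

(** The pair [(x', rho')] lies in the cone above [(x, rho)], where the triangle inequality gives
    [rho + |y - x| <= rho' + |y - x'|]. This monotonicity along cones is used both to pass from
    rational scales to real ones and along the paths of the mollification. *)
Lemma kappa_mono (rho rho' : R) (x x' y : E) : 0 < rho -> `|x' - x| <= rho' - rho ->
  kappa rho' (y - x') <= kappa rho (y - x).
Proof.
move=> r0 h; rewrite /kappa.
have p1 : 0 < rho + `|y - x| by rewrite ltr_pwDl.
have p2 : rho + `|y - x| <= rho' + `|y - x'|.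
  have := ler_normD (y - x') (x' - x); rewrite addrA subrK; lra.
rewrite lef_pV2 ?posrE ?exprn_gt0//; last exact: lt_le_trans p2.
by apply: lerXn2r; rewrite ?nnegrE ?(ltW p1)// ltW// (lt_le_trans p1).
Qed.

Lemma integrable_kappa (G : E -> R) rho x : 0 < rho -> leb.-integrable setT (EFin \o G) ->
  leb.-integrable setT (EFin \o (fun y => G y * kappa rho (y - x))).
Proof.
move=> r0 iG; apply: (integrable_Mbounded measurableT (measurable_kappa x r0) (K := (rho ^+ n)^-1) _ iG).
move=> y _; rewrite ger0_norm; last by rewrite kappa_ge0// ltW.
have p1 : 0 < rho + `|y - x| by rewrite ltr_pwDl.
rewrite /kappa lef_pV2 ?posrE ?exprn_gt0//.
by apply: lerXn2r; rewrite ?nnegrE ?(ltW r0)// ?(ltW p1)// lerDl.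
Qed.

Lemma rational_approx (x : E) (d : R) : 0 < d -> exists q : 'rV[rat]_n, `|\row_i ratr (q ord0 i) - x| <= d.
Proof.
move=> d0; have /choice[q hq] : forall i, exists q : rat, x ord0 i < ratr q < x ord0 i + d.
  move=> i; have [|q hq] := @rat_in_itvoo R (x ord0 i) (x ord0 i + d); first by rewrite ltrDl.
  by exists q; move: hq; rewrite in_itv.
exists (\row_i q i); apply/rV_norm_leP; first exact: ltW.
move=> i; rewrite !mxE; have /andP[h1 h2] := hq i.
by rewrite ger0_norm ?subr_ge0 ?ltW//; lra.
Qed.

(** [x] and [rho] are approximated by rational [q] and [p > rho] with [|q - x| <= p - rho]: the
    left-hand side passes to the limit, and on the right-hand side [kappa] at [(q, p)] is dominated
    by [kappa] at [(x, rho)]. A bound obtained for countably many test functions thus extends to all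
    centres and scales, with a single null set of times. *)
Lemma resc_bound_extend v (G : E -> R) phi (C0 C1 : R) : locally_integrable_rV v ->
  leb.-integrable setT (EFin \o G) -> (forall y, 0 <= G y) -> 0 <= C0 -> 0 <= C1 ->
  test_function setT phi -> (forall w : E, 1 <= `|w| -> phi w = 0) ->
  (forall (q : 'rV[rat]_n) (p : rat), 0 < ratr p :> R ->
    `|\int[leb]_z (v z * resc (\row_i ratr (q ord0 i)) (ratr p) phi z)| <=
    ratr p ^+ n.+1 * (C0 * \int[leb]_y (G y * kappa (ratr p) (y - \row_i ratr (q ord0 i))) + C1)) ->
  forall x rho, 0 < rho ->
    `|\int[leb]_z (v z * resc x rho phi z)| <=
    rho ^+ n.+1 * (C0 * \int[leb]_y (G y * kappa rho (y - x)) + C1).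
Proof.
move=> lv iG G0 C00 C10 tp p0 H x rho r0.
have /choice[p hp] : forall k : nat, exists p : rat, rho < ratr p < rho + k.+1%:R^-1.
  move=> k; have [|q hq] := @rat_in_itvoo R rho (rho + k.+1%:R^-1); first by rewrite ltrDl invr_gt0.
  by exists q; move: hq; rewrite in_itv.
have pk k : rho < ratr (p k) by have /andP[] := hp k.
have pk2 k : ratr (p k) < rho + k.+1%:R^-1 by have /andP[] := hp k.
have pk0 k : 0 < ratr (p k) :> R by apply: lt_trans (pk k).
have /choice[q hq] : forall k, exists q : 'rV[rat]_n, `|\row_i ratr (q ord0 i) - x| <= ratr (p k) - rho.
  by move=> k; apply: rational_approx; rewrite subr_gt0.
have h1 k : k.+1%:R^-1 <= 1 :> R by rewrite invf_le1// ler1n.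
have hcv : k.+1%:R^-1 @[k --> \oo] --> (0 : R) by exact: cvg_harmonic.
have cp : ratr (p k) @[k --> \oo] --> rho.
  apply: (@squeeze_cvgr _ _ _ _ (fun=> rho) (fun k => rho + k.+1%:R^-1)).
  - by apply: nearW => k; rewrite !ltW.
  - exact: cvg_cst.
  - by rewrite -[X in _ --> X]addr0; apply: cvgD => //; exact: cvg_cst.
have cq : (\row_i ratr ((q k) ord0 i) : E) @[k --> \oo] --> x.
  apply/cvgrPdist_le => e e0.
  have /cvgrPdist_le/(_ e e0) := cp; apply: filterS => k; rewrite distrC => h.
  rewrite distrC; apply: (le_trans (hq k)); exact: le_trans (ler_norm _) h.
have cL := @resc_cvg v x rho _ _ phi lv r0 tp p0 cq cp.
have {}cL : `|\int[leb]_z (v z * resc (\row_i ratr ((q k) ord0 i)) (ratr (p k)) phi z)| @[k --> \oo] -->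
    `|\int[leb]_z (v z * resc x rho phi z)|.
  apply: cvg_norm; apply: cL => k.
    by rewrite ltW//= (le_trans (ltW (pk2 k)))// lerD2l.
  by rewrite (le_trans (hq k))// lerBlDr (le_trans (ltW (pk2 k)))// addrC lerD2r.
pose A := C0 * \int[leb]_y (G y * kappa rho (y - x)) + C1.
have cR : ratr (p k) ^+ n.+1 * A @[k --> \oo] --> rho ^+ n.+1 * A.
  by apply: cvgMl; apply: (cvg_comp _ (fun u : R => u ^+ n.+1) cp); exact: exprn_continuous.
apply: (ler_cvg_to cL cR); apply: nearW => k.
apply: (le_trans (H (q k) (p k) (pk0 k))).
rewrite ler_wpM2l ?exprn_ge0 ?(ltW (pk0 k))// lerD2r ler_wpM2l//.
apply: le_Rintegral => //.
- exact: integrable_kappa.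
- exact: integrable_kappa.
- by move=> y _; rewrite ler_wpM2l// kappa_mono.
Qed.

(* Differentiating [rho^-n phi ((z - x) / rho)] along a path in [(x, rho)] produces [z]-derivatives
   of [w_i phi w] and of [phi w]. *)
Definition probe (l : option 'I_n) (w : E) : R :=
  if l is Some i then w ord0 i * mollifier w else mollifier w.

Lemma test_probe l : test_function setT (probe l).
Proof.
case: l => [i|]; last exact: test_mollifier.
apply: testMl; first exact: test_mollifier.
exact: (@smooth_coord _ _ id i (@smooth_id R)).
Qed.

Lemma probe_eq0 l w : 1 <= `|w| -> probe l w = 0.
Proof. by move=> w1; case: l => [i|] /=; rewrite mollifier_eq0// mulr0. Qed.

(** Strictly outside the unit cube [phi] vanishes near the point; on its boundary the derivative is
    a limit of derivatives taken outside. *)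
Lemma derive_eq0_outside (phi : E -> R) v w : smooth phi -> (forall w : E, 1 <= `|w| -> phi w = 0) ->
  1 <= `|w| -> 'D_v phi w = 0.
Proof.
move=> sp p0.
have far (u : E) : 1 < `|u| -> 'D_v phi u = 0.
  move=> u1; rewrite (@near_eq_derive _ _ _ phi (cst 0)) ?derive_cst//.
  have : \forall z \near u, 1 < `|z| by apply: (cvgr_gt _ (@norm_continuous _ _ u)).
  by apply: filterS => z /ltW z1; exact: p0.
move=> w1; pose w_ (k : nat) : E := (1 + k.+1%:R^-1) *: w.
have hcv : k.+1%:R^-1 @[k --> \oo] --> (0 : R) by exact: cvg_harmonic.
have cw : w_ k @[k --> \oo] --> w.
  rewrite -[X in _ --> X]scale1r; apply: cvgZr_tmp.
  by rewrite -[X in _ --> X]addr0; apply: cvgD => //; exact: cvg_cst.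
have cD : 'D_v phi (w_ k) @[k --> \oo] --> 'D_v phi w.
  by apply: (cvg_comp w_ ('D_v phi) cw); exact: (smooth_continuous (smooth_derive v sp)).
rewrite -(cvg_lim _ cD)//.
rewrite (_ : (fun k => _) = fun=> 0) ?lim_cst//.
apply/funext => k; apply: far; rewrite normrZ gtr0_norm ?addr_gt0//.
by rewrite (lt_le_trans (y := 1 + k.+1%:R^-1))// ?ltrDl// ler_peMr// addr_ge0.
Qed.

(** By linearity it is enough to pair the kernel with each [chi], at a cost of order [rho^n]; the
    time factors enter through their bounds only, so the constant is uniform in [s]. *)
Lemma tensor_kernel_bound (kap : (E -> R) -> E -> R) phi h :
  (measurable_fun setT (kap phi)) ->
  (forall x rho, 0 < rho -> measurable_fun setT (kap (resc x rho phi))) ->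
  (forall x rho, 0 < rho -> exists M, forall y, `|kap (resc x rho phi) y| <= M) ->
  (forall chi, test_function setT chi ->
     exists2 C, 0 <= C & forall x rho, 0 < rho ->
        `|\int[leb]_y (chi y * kap (resc x rho phi) y)| <= C * rho ^+ n) ->
  tensor h -> exists2 C, 0 <= C & forall s x rho, 0 < rho ->
        `|\int[leb]_y (h s y * kap (resc x rho phi) y)| <= C * rho ^+ n.
Proof.
move=> _ mk bk ck; elim => [|theta chi h' mt [M bt] tc th [C C0 hC]].
  exists 0 => // s x rho _; rewrite (_ : \int[leb]_y _ = 0) ?normr0 ?mul0r//.
  under eq_Rintegral do rewrite mul0r.
  by rewrite Rintegral_cst// mul0r.
have [C' C'0 hC'] := ck _ tc; have M0 : 0 <= M by apply: le_trans (bt 0).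
exists (M * C' + C); first by rewrite addr_ge0// mulr_ge0.
move=> s x rho r0; have [B hB] := bk x rho r0.
have ic := integrable_Mbounded measurableT (mk x rho r0) (fun y _ => hB y) (test_integrable tc).
have ihs : leb.-integrable setT (EFin \o h' s).
  have [M' [r' [M'0 r'0 b' z']]] := tensor_bounded_support th.
  apply: (@integrable_bounded_support _ _ _ M' r').
  - exact: (measurableT_comp (tensor_measurable th) (pair1_measurable s)).
  - by move=> y; exact: b'.
  - by move=> y; exact: z'.
have ih := integrable_Mbounded measurableT (mk x rho r0) (fun y _ => hB y) ihs.
have -> : \int[leb]_y ((theta s * chi y + h' s y) * kap (resc x rho phi) y) =
  theta s * \int[leb]_y (chi y * kap (resc x rho phi) y) + \int[leb]_y (h' s y * kap (resc x rho phi) y).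
  rewrite -(RintegralZl (theta s) measurableT ic).
  rewrite -(RintegralD measurableT (integrable_Zl measurableT (theta s) ic) ih).
  by apply: eq_Rintegral => y _; rewrite mulrDl mulrA.
rewrite (le_trans (ler_normD _ _))// mulrDl lerD ?hC// normrM -mulrA.
by rewrite ler_pM// hC'.
Qed.

(* [G] is the part of the densities [g] left after subtracting tensor products of test functions,
   on which the kernels act boundedly, whence [C1]. *)
Lemma derivative_bound (b : R -> E -> E) : cond_R2 T b ->
  (forall i, slab_locally_integrable T (fun z => b z.1 z.2 ord0 i)) ->
  exists2 C0 : R, 0 <= C0 & forall eta : R, 0 < eta -> exists (G : R * E -> R) (C1 : R),
  [/\ 0 <= C1, forall z, 0 <= G z, mu.-integrable setT (EFin \o G),
     (\int[mu]_z (G z)%:E <= eta%:E)%E &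
     {ae mu1, forall s, s \in `]0, T[ -> leb.-integrable setT (EFin \o (fun y => G (s, y))) /\
       forall i j l x rho, 0 < rho ->
       `|\int[leb]_z (b s z ord0 i * resc x rho ('D_('e_j) (probe l)) z)| <=
       rho ^+ n.+1 * (C0 * \int[leb]_y (G (s, y) * kappa rho (y - x)) + C1)}].
Proof.
move=> [m [S [g [Sg gE]]]] lb.
pose I := ('I_n * 'I_n * 'I_m)%type.
pose S' (q : I) := S q.1.1 q.1.2 q.2; pose g' (q : I) := g q.1.1 q.1.2 q.2.
have /choice[kap hkap] : forall q : I, exists kap : (E -> R) -> E -> R,
  [/\ forall phi, test_function setT phi -> measurable_fun setT (kap phi),
      forall phi, test_function setT phi -> exists M, forall y, `|kap phi y| <= M,
      forall u phi a, leb.-integrable setT (EFin \o u) -> test_function setT phi ->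
        complex.Re (S' q (fun x => real_complex R (u x)) (fun x => real_complex R (a * phi x))) =
        a * \int[leb]_y (u y * kap phi y),
      forall chi phi, test_function setT chi -> test_function setT phi ->
        exists2 C, 0 <= C & forall x rho, 0 < rho ->
        `|\int[leb]_y (chi y * kap (resc x rho phi) y)| <= C * rho ^+ n &
      forall phi, test_function setT phi -> (forall x, 1 <= `|x| -> phi x = 0) ->
        exists2 C, 0 <= C & forall x rho y, 0 < rho ->
        `|kap (resc x rho phi) y| <= C * (rho ^+ n * kappa rho (y - x))].
  by move=> q; have [sio _] := Sg q.1.1 q.1.2 q.2; exact: singular_integral_kernel sio.
have ig q : mu.-integrable D (EFin \o (fun z => g' q z.1 z.2)) by have [_] := Sg q.1.1 q.1.2 q.2.
have /choice[C0 hC0] : forall q : I * option 'I_n, exists C : R, 0 <= C /\ forall x rho y, 0 < rho ->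
     `|kap q.1 (resc x rho (probe q.2)) y| <= C * (rho ^+ n * kappa rho (y - x)).
  move=> [q l]; have [_ _ _ _ h] := hkap q.
  by have [C ? ?] := h _ (test_probe l) (probe_eq0 l); exists C.
have C00 q : 0 <= C0 q by have [] := hC0 q.
exists (\sum_q C0 q) => [|eta eta0]; first exact: sumr_ge0.
(* The error is shared among all the densities; one is added to their number to cover the case of no
   density at all. *)
pose eta' := eta / (#|{: I}|.+1)%:R.
have eta'0 : 0 < eta' by rewrite divr_gt0.
have /choice[h hh] : forall q : I, exists h, tensor h /\
  (\int[mu]_(z in D) (`|g' q z.1 z.2 - h z.1 z.2|)%:E <= eta'%:E)%E.
  by move=> q; exact: tensor_dense (ig q) _ eta'0.
have th q : tensor (h q) by have [] := hh q.
have /choice[C1 hC1] : forall q : I * option 'I_n, exists C : R, 0 <= C /\ forall s x rho, 0 < rho ->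
     `|\int[leb]_y (h q.1 s y * kap q.1 (resc x rho (probe q.2)) y)| <= C * rho ^+ n.
  move=> [q l]; have [k1 k2 _ k3 _] := hkap q.
  have [] := @tensor_kernel_bound (kap q) (probe l) (h q) _ _ _ _ (th q).
  - exact: k1 (test_probe l).
  - by move=> x rho r0; apply: k1; exact: test_resc (test_probe l).
  - by move=> x rho r0; apply: k2; exact: test_resc (test_probe l).
  - by move=> chi tc; exact: k3 tc (test_probe l).
  - by move=> C ? ?; exists C.
have C10 q : 0 <= C1 q by have [] := hC1 q.
pose f q (z : R * E) := `|g' q z.1 z.2 - h q z.1 z.2|.
have i_f q : mu.-integrable D (EFin \o f q).
  exact: (integrable_norm (integrable_B mD (ig q) (tensor_integrable T (th q)))).
pose G := (fun z => \sum_q f q z) \_ D.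
have iG : mu.-integrable setT (EFin \o G).
  by apply: slab_integrable_patch; apply: integrable_Rsum.
exists G, (\sum_q C1 q); split => //.
- exact: sumr_ge0.
- by move=> z; rewrite /G patchE; case: ifP => // _; apply: sumr_ge0 => q _; exact: normr_ge0.
- rewrite [X in (X <= _)%E](_ : _ = \int[mu]_(z in D) (\sum_q f q z)%:E)%E; last by rewrite [RHS]integral_mkcond restrict_EFin.
  under eq_integral do rewrite /= -sumEFin.
  rewrite ge0_integral_sum//; last 2 first.
    + by move=> q; exact: (measurable_int _ (i_f q)).
    + by move=> q z _; rewrite lee_fin normr_ge0.
  apply: (@le_trans _ _ (\sum_(q : I) eta'%:E)%E).
    by apply: lee_sum => q _; have [] := hh q.
  rewrite sumEFin lee_fin sumr_const -mulr_natr /eta' mulrAC ler_pdivrMr//.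
  by rewrite ler_pM2l// ler_nat.
have A1 : {ae mu1, forall s q, s \in `]0, T[ -> leb.-integrable setT (EFin \o (g' q s))}.
  apply: ae_countable => q; exact: slab_section_integrable (ig q).
have A2 : {ae mu1, forall s (k : 'I_n * nat), s \in `]0, T[ ->
    leb.-integrable setT (EFin \o (fun z => b s z ord0 k.1 * \1_[set x : E | `|x| < k.2%:R] z))}.
  apply: ae_countable => -[i k]; exact: slab_section_integrable (lb i k%:R).
(* One null set per choice of matrix indices, probe, rational centre and rational scale: countably
   many in all. *)
have A3 : {ae mu1, forall s (q : 'I_n * 'I_n * option 'I_n * 'rV[rat]_n * rat), s \in `]0, T[ ->
     let: (i, j, l, xq, pq) := q in
     0 < ratr pq :> R -> let x : E := \row_i ratr (xq ord0 i) in let rho : R := ratr pq in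
     - (\int[leb]_z (b s z ord0 i * 'D_('e_j) (resc x rho (probe l)) z)) =
     \sum_(k < m) \int[leb]_y (g i j k s y * kap (i, j, k) (resc x rho (probe l)) y)}.
  apply: ae_countable => -[[[[i j] l] xq] pq].
  have [p0|p0] := ltP 0 (ratr pq : R); last by apply: aeW => s _.
  have := @weak_slice R n T (fun z => b z.1 z.2 ord0 i) 'e_j m (S i j) (g i j) (fun k => kap (i, j, k)).
  move=> /(_ (lb i) (fun k => ig (i, j, k))) H.
  have tr := test_resc (\row_i0 ratr (xq ord0 i0)) p0 (test_probe l).
  have {}H := H (fun k => let: And5 k1 _ _ _ _ := hkap (i, j, k) in k1)
    (fun k => let: And5 _ k2 _ _ _ := hkap (i, j, k) in k2)
    (fun k => let: And5 _ _ k3 _ _ := hkap (i, j, k) in k3) (gE i j) _ tr.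
  by apply: (ae_imp H) => s hs sT _; exact: hs.
have A4 := slab_section_integrable (integrable_Rsum mD (index_enum _) i_f).
apply: (ae_imp (ae_and (ae_and A1 A2) (ae_and A3 A4))) => s [[h1 h2] [h3 h4]] sT.
have GE y : G (s, y) = \sum_q f q (s, y) by rewrite /G slab_patch.
have iGs : leb.-integrable setT (EFin \o (fun y => G (s, y))).
  by have := h4 sT; apply: eq_integrable => // y _ /=; rewrite GE.
have f0 q z : 0 <= f q z by exact: normr_ge0.
split => // i j l; apply: resc_bound_extend => //.
- by move=> k; exact: (h2 (i, k) sT).
- by move=> y; rewrite GE sumr_ge0.
- exact: sumr_ge0.
- exact: sumr_ge0.
- exact: test_derive (test_probe l).
- by move=> w; apply: derive_eq0_outside; [exact: test_smooth (test_probe l)|exact: probe_eq0].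
move=> xq pq p0; have := h3 (i, j, l, xq, pq) sT p0.
set x : E := \row_i0 _; set rho : R := ratr pq => /= H.
have tr := test_resc x p0 (test_probe l).
have dE z : 'D_('e_j) (resc x rho (probe l)) z = rho^-1 * resc x rho ('D_('e_j) (probe l)) z.
  by rewrite !rescE derive_comp_aff//; exact: test_smooth (test_probe l).
have lbs : locally_integrable_rV (fun z => b s z ord0 i) by move=> k; exact: (h2 (i, k) sT).
have ib := locally_integrable_resc x lbs p0 (test_derive 'e_j (test_probe l))
  (fun w => derive_eq0_outside 'e_j (test_smooth (test_probe l)) (@probe_eq0 l) (w := w)).
have : rho^-1 * \int[leb]_z (b s z ord0 i * resc x rho ('D_('e_j) (probe l)) z) =
  - \sum_(k < m) \int[leb]_y (g i j k s y * kap (i, j, k) (resc x rho (probe l)) y).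
  rewrite -H opprK -RintegralZl//.
  by apply: eq_Rintegral => z _; rewrite dE mulrCA.
move=> /(congr1 (fun u => rho * u)); rewrite mulVKf ?gt_eqF// => ->.
rewrite mulrN normrN normrM gtr0_norm// exprS -mulrA ler_wpM2l ?(ltW p0)//.
apply: (le_trans (ler_norm_sum _ _ _)).
have iGk := integrable_kappa x p0 iGs.
pose K := \int[leb]_y (G (s, y) * kappa rho (y - x)).
have K0 : 0 <= K.
  apply: Rintegral_ge0 => // y _; rewrite mulr_ge0 ?kappa_ge0 ?(ltW p0)//.
  by rewrite GE sumr_ge0.
apply: (@le_trans _ _ (\sum_(k < m) (rho ^+ n * (C0 ((i, j, k), l) * K + C1 ((i, j, k), l))))).
  apply: ler_sum => k _; pose q : I := (i, j, k).
  have [k1 k2 _ _ _] := hkap q.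
  have mk := k1 _ tr; have [M hM] := k2 _ tr.
  have igq : leb.-integrable setT (EFin \o (g i j k s)) := h1 q sT.
  have ihq : leb.-integrable setT (EFin \o (h q s)).
    have [M' [r' [M'0 r'0 b' z']]] := tensor_bounded_support (th q).
    apply: (@integrable_bounded_support _ _ _ M' r').
    - exact: (measurableT_comp (tensor_measurable (th q)) (pair1_measurable s)).
    - by move=> y; exact: b'.
    - by move=> y; exact: z'.
  have id_ := integrable_Mbounded measurableT mk (fun y _ => hM y) (integrable_B measurableT igq ihq).
  have ih_ := integrable_Mbounded measurableT mk (fun y _ => hM y) ihq.
  (* [g] is split into [g - h], paired with the size of the kernel and absorbed into [G], and the
     tensor [h], paired through the constant [C1]. *)
  have -> : \int[leb]_y (g i j k s y * kap (i, j, k) (resc x rho (probe l)) y) =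
    \int[leb]_y ((g i j k s y - h q s y) * kap q (resc x rho (probe l)) y) +
    \int[leb]_y (h q s y * kap q (resc x rho (probe l)) y).
    rewrite -(RintegralD measurableT id_ ih_).
    by apply: eq_Rintegral => y _; rewrite -mulrDl subrK.
  apply: (le_trans (ler_normD _ _)); rewrite mulrDr lerD//; last first.
    by have [_ /(_ s x rho p0)] := hC1 (q, l); rewrite mulrC.
  apply: (le_trans (le_normr_Rintegral measurableT id_)).
  have iz := integrable_Zl measurableT (C0 (q, l) * rho ^+ n) iGk.
  rewrite mulrCA mulrA -(RintegralZl _ measurableT iGk); apply: le_Rintegral => //.
    exact: integrable_norm.
  move=> y _; rewrite normrM.
  have [_ /(_ x rho y p0) hk] := hC0 (q, l).
  apply: (@le_trans _ _ (f q (s, y) * (C0 (q, l) * (rho ^+ n * kappa rho (y - x))))).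
    by rewrite ler_wpM2l.
  rewrite [leRHS](_ : _ = G (s, y) * (C0 (q, l) * (rho ^+ n * kappa rho (y - x)))); last by ring.
  apply: ler_wpM2r.
    by rewrite mulr_ge0// mulr_ge0 ?exprn_ge0 ?kappa_ge0 ?(ltW p0).
  by rewrite GE (bigD1 q)//= lerDl sumr_ge0.
rewrite -mulr_sumr ler_wpM2l ?exprn_ge0 ?(ltW p0)// big_split/= -mulr_suml.
have inj : injective (fun k : 'I_m => ((i, j, k) : I, l)) by move=> k k' [].
apply: lerD; last exact: (sum_injective_le inj).
by rewrite ler_wpM2r//; exact: (sum_injective_le inj).
Qed.

End derivative_bound.

(** * The logarithmic Lipschitz estimate *)

Section mollify.
Context {R : realType} {n : nat}.
Local Notation E := 'rV[R]_n.
Local Notation leb := (@lebesgue_rV R n).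
Local Notation Phi := (@mollifier R n).

Definition mollify (rho : R) (v : E -> R) (x : E) : R :=
  rho ^- n * \int[leb]_z (v z * resc x rho Phi z).

Lemma is_derive_invX (k : nat) (t : R) : 0 < t ->
  is_derive t (1 : R) (fun t => (t ^+ k)^-1) (- (k%:R * (t ^+ k.+1)^-1)).
Proof.
move=> t0; have tk : t ^+ k != 0 by rewrite expf_neq0// gt_eqF.
have hX : is_derive t (1 : R) (fun t => t ^+ k) (k%:R * t ^+ k.-1).
  have hk := @is_deriveX R R (@id R) k t 1 1 (is_derive_id t (1 : R)).
  rewrite (_ : (fun t => t ^+ k) = (@id R : R -> R) ^+ k); last by apply/funext => u; rewrite exprfctE.
  by apply: (is_derive_eq hk); rewrite /GRing.scale/= mulr1.
have h := @is_deriveV R (fun t : R => t ^+ k) t _ 1 tk hX.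
apply: (is_derive_eq h); rewrite /GRing.scale/= mulNr; congr (- _).
case: k {h hX} tk => [|k] tk; first by rewrite /= !mul0r mulr0.
rewrite /= !exprS; field; apply/andP; split; rewrite ?expf_neq0 ?gt_eqF//.
Qed.

Lemma derive_coordE i (x v : E) : 'D_v (fun x : E => x ord0 i) x = v ord0 i.
Proof.
rewrite deriveE; last exact: differentiable_coord.
have @f' : {linear E -> R}.
  by exists (fun x : E => x ord0 i); do 2![eexists]; do ?[constructor];
     rewrite ?mxE// => ? *; rewrite ?mxE//; move=> ?; rewrite !mxE.
by rewrite (_ : (fun _ => _) = f')// diff_lin//; exact: coord_continuous.
Qed.

(* The mollifier along the path [(x + (t - delta) e, t)] from scale [delta] on. *)
Definition cone (x e : E) (delta t : R) (z : E) : R :=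
  (t ^+ n)^-1 * Phi (- e + t^-1 *: (z - x + delta *: e)).

Lemma coneE x e delta t z : 0 < t ->
  cone x e delta t z = t ^- n * resc (x + (t - delta) *: e) t Phi z.
Proof.
move=> t0; rewrite /cone /resc; congr (_ * Phi _).
by apply/rowP => i; rewrite !mxE; field; rewrite gt_eqF.
Qed.

Lemma derive_coord_mollifier j w :
  'D_('e_j) (probe (Some j)) w = Phi w + w ord0 j * 'D_('e_j) (probe None) w.
Proof.
have sm := test_smooth (@test_mollifier R n).
have sc := @smooth_coord R n id j (@smooth_id R).
rewrite (_ : probe (Some j) = (fun w : E => w ord0 j) * Phi)//.
rewrite deriveM.
- rewrite /GRing.scale/= addrC; congr (_ + _).
  by rewrite derive_coordE mxE !eqxx mulr1.
- by apply: diff_derivable; exact: smooth_differentiable.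
- by apply: diff_derivable; exact: smooth_differentiable.
Qed.

(** The derivative in [t] is [- t^-(n+1)] times [n Phi + (w + e) . grad Phi], where [w] is the
    rescaled variable. As [n Phi + w . grad Phi] is the divergence of [w Phi], only derivatives of
    probes remain, which are those controlled by [derivative_bound]. *)
Lemma is_derive_cone (x e : E) (delta t : R) (z : E) : 0 < t ->
  is_derive t (1 : R) (fun t => cone x e delta t z)
   (- (t ^+ n.+1)^-1 * \sum_j (resc (x + (t - delta) *: e) t ('D_('e_j) (probe (Some j))) z +
                               e ord0 j * resc (x + (t - delta) *: e) t ('D_('e_j) (probe None)) z)).
Proof.
move=> t0; pose A := z - x + delta *: e.
pose w := t^-1 *: (z - (x + (t - delta) *: e)).
have wE : - e + t^-1 *: A = w.
  by apply/rowP => i; rewrite /w /A !mxE; field; rewrite gt_eqF.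
have AE : A = t *: (w + e).
  by rewrite -wE addrAC addNr add0r scalerA divff ?gt_eqF// scale1r.
have sm := test_smooth (@test_mollifier R n).
have h1 := @is_derive_line R E Phi (- e) A t^-1 (smooth_differentiable _ sm).
have h2 := @is_derive_invX 1 t t0.
have h12 : is_derive t (1 : R) (fun t => Phi (- e + t^-1 *: A)) ((t ^+ 2)^-1 * - 'D_A Phi (- e + t^-1 *: A)).
  have h2' : is_derive t (1 : R) (fun t : R => t^-1) (- (t ^+ 2)^-1) by apply: (is_derive_eq h2); rewrite mul1r.
  have := is_derive1_comp (f := fun u => Phi (- e + u *: A)) (g := fun t : R => t^-1) h1 h2'.
  by move=> h; apply: (is_derive_eq h); rewrite !mulrN mulrC.
have h3 := @is_deriveM R R (fun t => (t ^+ n)^-1) (fun t => Phi (- e + t^-1 *: A)) t 1 _ _ (is_derive_invX n t0) h12.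
apply: (is_derive_eq h3); rewrite /resc -/w wE; clearbody w.
rewrite derive_coord; last exact: smooth_differentiable.
rewrite /GRing.scale/= AE.
under [in RHS]eq_bigr do rewrite derive_coord_mollifier -addrA -mulrDl.
rewrite big_split/= sumr_const card_ord -[X in _ = _ * (X + _)]mulr_natl.
under eq_bigr do rewrite !mxE -mulrA.
rewrite -mulr_sumr.
set Sg := \sum_j _; set p := Phi w.
rewrite !exprS; field; apply/andP; split; rewrite ?expf_neq0 ?gt_eqF//.
Qed.

(** Mean value theorem along the path: its point at scale [t] lies in the cone above [(x, delta)],
    so [V] there is at most [V delta x], and the derivative consists of [2 n] probe integrals
    divided by [t^(n+1)]. *)
Lemma conv_path (v : E -> R) (V : R -> E -> R) : locally_integrable_rV v ->
  (forall rho rho' x x', 0 < rho -> `|x' - x| <= rho' - rho -> V rho' x' <= V rho x) ->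
  (forall j l x rho, 0 < rho ->
     `|\int[leb]_z (v z * resc x rho ('D_('e_j) (probe l)) z)| <= rho ^+ n.+1 * V rho x) ->
  forall x e delta r, 0 < delta -> delta <= r -> `|e| <= 1 ->
    `|mollify r v (x + (r - delta) *: e) - mollify delta v x| <= (r - delta) * ((2 * n)%:R * V delta x).
Proof.
move=> lv Vm hV x e delta r d0 dr e1.
pose c (t : R) : E := x + (t - delta) *: e.
have hD (j : 'I_n) (l : option 'I_n) : exists M : R, 0 <= M /\ forall w, `|'D_('e_j) (probe l) w| <= M.
  by have [M ? ?] := test_bounded (test_derive 'e_j (@test_probe R n l)); exists M.
have /choice[M hM] : forall jl : 'I_n * option 'I_n, exists M : R, 0 <= M /\ forall w : E, `|'D_('e_(jl.1)) (probe jl.2) w| <= M.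
  by move=> jl; exact: hD.
have z0 (j : 'I_n) (l : option 'I_n) (w : E) : 1 <= `|w| -> 'D_('e_j) (@probe R n l) w = 0.
  by apply: derive_eq0_outside; [exact: test_smooth (test_probe l)|exact: probe_eq0].
pose d1 (t : R) (z : E) := - (t ^+ n.+1)^-1 * \sum_j (resc (c t) t ('D_('e_j) (probe (Some j))) z +
                               e ord0 j * resc (c t) t ('D_('e_j) (probe None)) z).
have e1j j : `|e ord0 j| <= 1 by apply: le_trans (coord_le_norm e j) e1.
pose B := \sum_j (M (j, Some j) + M (j, None)).
have B0 : 0 <= B by apply: sumr_ge0 => j _; apply: addr_ge0; [have [] := hM (j, Some j)|have [] := hM (j, None)].
have ir t z' : 0 < t -> forall j l, leb.-integrable setT (EFin \o (fun z => v z * resc z' t ('D_('e_j) (@probe R n l)) z)).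
  move=> t0 j l; apply: locally_integrable_resc => //; first exact: test_derive (test_probe l).
  exact: z0.
pose p t := \int[leb]_z (v z * cone x e delta t z).
have pE t : 0 < t -> p t = mollify t v (c t).
  move=> t0; have im := locally_integrable_resc (c t) lv t0 (@test_mollifier R n) (@mollifier_eq0 R n).
  rewrite /mollify -(RintegralZl (t ^- n) measurableT im).
  by apply: eq_Rintegral => z _; rewrite (coneE _ _ _ _ t0) mulrCA.
have dp (t : R) : 0 < t -> is_derive t (1 : R) p (\int[leb]_z (v z * d1 t z)).
  move=> t0; pose f (t : R) (z : E) := v z * cone x e delta t z.
  have t20 : 0 < t / 2 by rewrite divr_gt0.
  have It : (`]t / 2, (t + 1)[%classic : set R) t by rewrite /= in_itv/=; apply/andP; split; lra.
  have pos u : (`]t / 2, (t + 1)[%classic : set R) u -> 0 < u by rewrite /= in_itv/= => /andP[h _]; exact: lt_trans h.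
  have df (u : R) z : 0 < u -> is_derive u (1 : R) (f ^~ z) (v z * d1 u z).
    by move=> u0; have h := is_deriveZ (v z) (is_derive_cone x e delta z u0); apply: (is_derive_eq h).
  have i_f u : (`]t / 2, (t + 1)[%classic : set R) u -> leb.-integrable setT (EFin \o f u).
    move=> /pos u0; have := integrable_Zl measurableT (u ^- n) (locally_integrable_resc (c u) lv u0 (@test_mollifier R n) (@mollifier_eq0 R n)).
    by apply: eq_integrable => // z _ /=; rewrite /f coneE// mulrCA.
  have derf u z : (`]t / 2, (t + 1)[%classic : set R) u -> setT z -> derivable (f ^~ z) u 1.
    by move=> /pos u0 _; case: (df u z u0).
  (* For scales [u < t + 1] the centre of the path has norm at most [|x| + |u| + |delta|] and the
     support has radius [u], so all supports lie in this cube. *)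
  pose K := `|x| + `|t| + 1 + `|delta| + (t + 1).
  pose C := ((t / 2) ^+ n.+1)^-1 * B.
  have C0 : 0 <= C by rewrite mulr_ge0// invr_ge0 exprn_ge0// ltW.
  pose G z := C * `|v z * \1_[set x : E | `|x| < K] z|.
  have G0 z : 0 <= G z by rewrite mulr_ge0.
  have iG : leb.-integrable setT (EFin \o G).
    by apply: integrable_Zl => //; exact: (integrable_norm (locally_integrable_rVP K lv)).
  have p1E (u : R) z : 0 < u -> partial1of2 f u z = v z * d1 u z.
    by move=> u0; rewrite partial1of2E; have := df u z u0 => h; rewrite derive_val.
  have Gub u z : (`]t / 2, (t + 1)[%classic : set R) u -> setT z -> `|partial1of2 f u z| <= G z.
    move=> Iu _; have u0 := pos u Iu; rewrite p1E// normrM /G mulrC.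
    move: Iu; rewrite /= in_itv/= => /andP[u1 u2].
    have [zK|zK] := ltP `|z| K.
      rewrite indicE mem_set//= mulr1 ler_wpM2r// /d1 normrM normrN.
      have ui0 : 0 <= (u ^+ n.+1)^-1 by rewrite invr_ge0 exprn_ge0// ltW.
      rewrite (ger0_norm ui0) /C; apply: ler_pM => //.
      - rewrite lef_pV2 ?posrE ?exprn_gt0//; apply: lerXn2r; rewrite ?nnegrE ?(ltW u0) ?(ltW t20)//; exact: ltW.
      - apply: (le_trans (ler_norm_sum _ _ _)); apply: ler_sum => j _.
        apply: (le_trans (ler_normD _ _)); apply: lerD; first by have [_] := hM (j, Some j); exact.
        rewrite normrM -[leRHS]mul1r; apply: ler_pM => //.
        by have [_] := hM (j, None); exact.
    have far j l : resc (c u) u ('D_('e_j) (@probe R n l)) z = 0.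
      apply: resc_eq0 => //; first exact: z0.
      have := ler_normB (z - c u) (- c u); rewrite opprK subrK normrN.
      have : `|c u| <= `|x| + (`|u| + `|delta|).
        rewrite (le_trans (ler_normD _ _))// lerD2l normrZ -[leRHS]mulr1.
        by rewrite ler_pM// ler_normB.
      rewrite (gtr0_norm u0); rewrite /K (gtr0_norm t0) in zK; lra.
    have -> : d1 u z = 0.
      by rewrite /d1 big1 ?mulr0// => j _; rewrite !far mulr0 addr0.
    by rewrite normr0 mul0r mulr_ge0.
  have h1 := derivable_under_integral measurableT It i_f derf G0 iG Gub.
  have h2 := differentiation_under_integral measurableT It i_f derf G0 iG Gub.
  apply: DeriveDef; first exact: h1.
  rewrite -derive1E h2; by apply: eq_Rintegral => z _; rewrite p1E.
have dpb (t : R) : delta <= t -> `|\int[leb]_z (v z * d1 t z)| <= (2 * n)%:R * V delta x.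
  move=> dt; have t0 : 0 < t by apply: lt_le_trans dt.
  pose F j z := v z * resc (c t) t ('D_('e_j) (probe (Some j))) z.
  pose F' j z := v z * resc (c t) t ('D_('e_j) (@probe R n None)) z.
  have iF j : leb.-integrable setT (EFin \o F j) by exact: ir.
  have iF' j : leb.-integrable setT (EFin \o (fun z => e ord0 j * F' j z)) by apply: integrable_Zl => //; exact: ir.
  have iFF j := integrable_D measurableT (iF j) (iF' j).
  have iS : leb.-integrable setT (EFin \o (fun z => \sum_j (F j z + e ord0 j * F' j z))).
    exact: integrable_Rsum.
  have -> : \int[leb]_z (v z * d1 t z) = - (t ^+ n.+1)^-1 * \sum_j (\int[leb]_z F j z + e ord0 j * \int[leb]_z F' j z).
    transitivity (- (t ^+ n.+1)^-1 * \int[leb]_z (\sum_j (F j z + e ord0 j * F' j z))).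
      rewrite -(RintegralZl _ measurableT iS); apply: eq_Rintegral => z _; rewrite /d1 mulrCA; congr (_ * _).
      by rewrite mulr_sumr; apply: eq_bigr => j _; rewrite /F /F'; ring.
    congr (_ * _); rewrite (Rintegral_sum measurableT _ iFF); apply: eq_bigr => j _.
    by rewrite (RintegralD measurableT (iF j) (iF' j)) (RintegralZl _ measurableT (ir t (c t) t0 j None)).
  have ti0 : 0 <= (t ^+ n.+1)^-1 by rewrite invr_ge0 exprn_ge0// ltW.
  rewrite normrM normrN (ger0_norm ti0).
  rewrite ler_pdivrMl ?exprn_gt0//.
  have Vt : V t (c t) <= V delta x.
    apply: Vm => //; rewrite /c addrAC subrr add0r normrZ ger0_norm ?subr_ge0//.
    by rewrite ler_piMr// subr_ge0.
  have hVt j l : `|\int[leb]_z (v z * resc (c t) t ('D_('e_j) (probe l)) z)| <= t ^+ n.+1 * V delta x.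
    by apply: (le_trans (hV _ _ _ _ t0)); rewrite ler_wpM2l// exprn_ge0// ltW.
  apply: (le_trans (ler_norm_sum _ _ _)).
  apply: (@le_trans _ _ (\sum_(j < n) (2 * (t ^+ n.+1 * V delta x)))).
    apply: ler_sum => j _; apply: (le_trans (ler_normD _ _)); rewrite mulr2n mulrDl mul1r; apply: lerD.
      exact: hVt.
    rewrite normrM; apply: le_trans (hVt j None); rewrite ler_piMl//.
  by rewrite sumr_const card_ord -mulr_natr natrM le_eqVlt; apply/orP; left; apply/eqP; ring.
have dd (t : R) : delta <= t -> derivable p t (1 : R).
  by move=> dt; case: (dp t (lt_le_trans d0 dt)).
have cp : {within `[delta, r], continuous p}.
  by apply: derivable_within_continuous => t; rewrite in_itv/= => /andP[h _]; exact: dd.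
have dp' (t : R) : t \in `]delta, r[ -> is_derive t (1 : R) p (\int[leb]_z (v z * d1 t z)).
  by rewrite in_itv/= => /andP[h _]; apply: dp; exact: lt_trans h.
have [t] := MVT_segment dr dp' cp.
rewrite in_itv/= => /andP[dt tr].
rewrite !pE//; last exact: lt_le_trans dr.
have -> : c delta = x by rewrite /c subrr scale0r addr0.
have rd0 : 0 <= r - delta by rewrite subr_ge0.
rewrite -/(c r) => ->; rewrite normrM (ger0_norm rd0) mulrC.
by apply: ler_wpM2l => //; exact: dpb.
Qed.

(** The slanted path from [x] and the vertical path above [y], both starting at scale [delta], meet
    over [y] at scale [delta + |x - y|]. *)
Lemma mollify_lipschitz (v : E -> R) (V : R -> E -> R) : locally_integrable_rV v ->
  (forall rho rho' x x', 0 < rho -> `|x' - x| <= rho' - rho -> V rho' x' <= V rho x) ->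
  (forall j l x rho, 0 < rho ->
     `|\int[leb]_z (v z * resc x rho ('D_('e_j) (probe l)) z)| <= rho ^+ n.+1 * V rho x) ->
  forall x y delta, 0 < delta ->
    `|mollify delta v x - mollify delta v y| <= `|x - y| * ((2 * n)%:R * (V delta x + V delta y)).
Proof.
move=> lv Vm hV x y delta d0; have path := conv_path lv Vm hV.
have [->|xy] := eqVneq x y; first by rewrite !subrr !normr0 mul0r.
pose a := `|x - y|; have a0 : 0 < a by rewrite normr_gt0 subr_eq0.
have da : delta <= delta + a by rewrite lerDl ltW.
have e1 : `|a^-1 *: (y - x)| <= 1 by rewrite normrZ gtr0_norm ?invr_gt0// distrC mulVf// gt_eqF.
have := path x _ _ _ d0 da e1.
have dE : delta + a - delta = a by rewrite addrAC subrr add0r.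
have yE : x + a *: (a^-1 *: (y - x)) = y.
  by rewrite scalerA mulfV ?lt0r_neq0// scale1r addrC subrK.
rewrite dE yE => h1.
have := path y 0 _ _ d0 da; rewrite normr0 ler01 => /(_ isT).
rewrite scaler0 addr0 dE => h2.
apply: (le_trans (ler_distD (mollify (delta + a) v y) _ _)).
rewrite -/a !mulrDr; apply: lerD; last exact: h2.
by rewrite distrC.
Qed.

Lemma mollify_scale_step (v : E -> R) (V : R -> E -> R) : locally_integrable_rV v ->
  (forall rho rho' x x', 0 < rho -> `|x' - x| <= rho' - rho -> V rho' x' <= V rho x) ->
  (forall j l x rho, 0 < rho ->
     `|\int[leb]_z (v z * resc x rho ('D_('e_j) (probe l)) z)| <= rho ^+ n.+1 * V rho x) ->
  forall x delta r, 0 < delta -> delta <= r ->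
    `|mollify r v x - mollify delta v x| <= (r - delta) * ((2 * n)%:R * V delta x).
Proof.
move=> lv Vm hV x delta r d0 dr.
have := conv_path lv Vm hV x (e := 0) d0 dr; rewrite normr0 ler01 => /(_ isT).
by rewrite scaler0 addr0.
Qed.

End mollify.

(** * Integral estimates for mollifications and truncated kernels *)

Section kernel_integrals.
Context {R : realType} {n : nat}.
Local Notation E := 'rV[R]_n.
Local Notation leb := (@lebesgue_rV R n).
Local Notation Phi := (@mollifier R n).

(** Schur's test in its simplest form: after Tonelli the mass of [w] in the variable [x] is at most
    [c] for every [y]. Integrability in [y] is assumed because the inner integral is real-valued. *)
Lemma schur_bound (G : E -> R) (w : E * E -> R) (c : R) : leb.-integrable setT (EFin \o G) ->
  (forall y, 0 <= G y) -> measurable_fun setT w -> (forall z, 0 <= w z) ->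
  (forall x, leb.-integrable setT (EFin \o (fun y => G y * w (x, y)))) ->
  (forall y, (\int[leb]_x (w (x, y))%:E <= c%:E)%E) ->
  (\int[leb]_x (\int[leb]_y (G y * w (x, y)))%:E <= c%:E * \int[leb]_y (G y)%:E)%E.
Proof.
move=> iG G0 mw w0 iGw wc; have mG := integrable_measurable iG.
have mGw : measurable_fun setT (fun z : E * E => (G z.2 * w z)%:E).
  by apply/measurable_EFinP; apply: measurable_funM => //; exact: (measurableT_comp mG measurable_snd).
have Gw0 z : (0 <= (G z.2 * w z)%:E)%E by rewrite lee_fin mulr_ge0.
have c0 : 0 <= c.
  by rewrite -lee_fin; apply: le_trans (wc 0); apply: integral_ge0 => x _; rewrite lee_fin.
apply: (@le_trans _ _ (\int[leb]_x \int[leb]_y (G y * w (x, y))%:E)%E).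
  apply: ge0_le_integral => //.
  - by move=> x _; rewrite lee_fin Rintegral_ge0// => y _; rewrite mulr_ge0.
  - apply/measurable_EFinP; apply: (measurable_Rintegral_section leb (w := fun z => G z.2 * w z)).
    by apply: measurable_funM => //; exact: (measurableT_comp mG measurable_snd).
  - exact: (@measurable_fun_fubini_tonelli_F _ _ E E R leb _ mGw Gw0).
  - move=> x _; rewrite /Rintegral fineK//; exact: (integrable_fin_num measurableT (iGw x)).
rewrite (@fubini_tonelli _ _ E E R leb leb _ mGw Gw0)/=.
have mGE : measurable_fun setT (fun y => (G y)%:E) by exact: measurable_int iG.
rewrite -ge0_integralZl ?lee_fin//; last by move=> y _; rewrite lee_fin.
apply: ge0_le_integral => //.
- by move=> y _; apply: integral_ge0 => x _; rewrite lee_fin mulr_ge0.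
- exact: (@measurable_fun_fubini_tonelli_G _ _ E E R leb _ mGw Gw0).
- exact: (measurable_funeM c%:E mGE).
- move=> y _; under eq_integral do rewrite EFinM.
  rewrite ge0_integralZl//; [|by apply/measurable_EFinP; exact: (measurableT_comp mw (pair2_measurable y))|by move=> x _; rewrite lee_fin|by rewrite lee_fin].
  by rewrite muleC; apply: lee_wpmul2r; rewrite ?lee_fin.
Qed.

Lemma measurable_shift_kernel (f : E -> R) : measurable_fun setT f ->
  measurable_fun setT (fun z : E * E => f (z.2 - z.1)).
Proof.
move=> mf; apply: (measurableT_comp mf); apply: measurable_fun_coordP => i.
rewrite (_ : (fun t => _) = fun t : E * E => t.2 ord0 i - t.1 ord0 i).
  by apply: measurable_funB; apply: (measurableT_comp (measurable_coord i)); [exact: measurable_snd|exact: measurable_fst].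
by apply/funext => t; rewrite !mxE.
Qed.

Lemma integral_resc_mollifier x rho : 0 < rho ->
  \int[leb]_z resc x rho Phi z = rho ^+ n.
Proof.
move=> r0; rewrite rescE Rintegral_aff ?invr_neq0 ?gt_eqF//; last exact: test_integrable (@test_mollifier R n).
by rewrite integral_mollifier mulr1 gtr0_norm ?invr_gt0// invrK.
Qed.

Lemma resc_mollifierC (x y : E) rho : resc x rho Phi y = resc y rho Phi x.
Proof. by rewrite /resc -mollifierN -scalerN opprB. Qed.

(** On a cube enlarged by one, which contains the mollification radius, [v] is split into [v - h]
    and [h]. The first part and its mollification each cost its [L^1] norm, whence the factor two;
    the Lipschitz part moves by at most [K rho] on a cube of measure [(2 Lam)^n]. *)
Lemma mollify_slice (v h : E -> R) (K Lam rho : R) : locally_integrable_rV v ->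
  leb.-integrable setT (EFin \o h) -> 0 <= K -> (forall x y, `|h x - h y| <= K * `|x - y|) ->
  0 < Lam -> 0 < rho -> rho <= 1 ->
  (\int[leb]_x (\1_[set x : E | (`|x| < Lam)%R] x * `|v x - mollify rho v x|)%:E <=
   2%:E * \int[leb]_x (`|v x * \1_[set x : E | (`|x| < Lam + 1)%R] x - h x|)%:E +
    (K * rho * (2 * Lam) ^+ n)%:E)%E.
Proof.
move=> lv ih K0 hK L0 r0 r1.
pose f x := v x * \1_[set x : E | `|x| < Lam + 1] x.
have i_f : leb.-integrable setT (EFin \o f) by exact: locally_integrable_rVP.
pose g x := f x - h x.
have ig : leb.-integrable setT (EFin \o g) by exact: integrable_B.
have ing : leb.-integrable setT (EFin \o (fun x => `|g x|)) := integrable_norm ig.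
have rn0 : 0 < rho ^+ n by rewrite exprn_gt0.
have [M M0 hM] := test_bounded (@test_mollifier R n).
have mr x : measurable_fun setT (resc x rho Phi).
  by apply: measurable_smooth; exact: test_smooth (test_resc x r0 (@test_mollifier R n)).
have ir x := test_integrable (test_resc x r0 (@test_mollifier R n)).
have iw (u : E -> R) x : leb.-integrable setT (EFin \o u) -> leb.-integrable setT (EFin \o (fun z => u z * resc x rho Phi z)).
  by move=> iu; exact: (integrable_Mbounded measurableT (mr x) (fun z _ => hM _) iu).
have res0 x z : 0 <= resc x rho Phi z by exact: mollifier_ge0.
pose P x := \int[leb]_z (`|g z| * (rho ^- n * resc x rho Phi z)).
have iP x : leb.-integrable setT (EFin \o (fun z => `|g z| * (rho ^- n * resc x rho Phi z))).
  have := integrable_Zl measurableT (rho ^- n) (iw _ x ing); apply: eq_integrable => // z _ /=.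
  by rewrite mulrCA.
have P0 x : 0 <= P x.
  by apply: Rintegral_ge0 => // z _; apply: mulr_ge0 => //; apply: mulr_ge0 => //; rewrite invr_ge0 ltW.
have vfmf x : `|x| < Lam -> v x = f x /\ mollify rho v x = mollify rho f x.
  move=> xL; split; first by rewrite /f indicE mem_set ?mulr1//= ltr_wpDr.
  rewrite /mollify; congr (_ * _); apply: eq_Rintegral => z _; rewrite /f indicE.
  have [zL|zL] := ltP `|z| (Lam + 1); first by rewrite mem_set// mulr1.
  rewrite (resc_eq0 r0 (@mollifier_eq0 R n)) ?mulr0//.
  have := ler_normD (z - x) x; rewrite subrK; lra.
have pt x : `|x| < Lam -> `|v x - mollify rho v x| <= `|g x| + P x + K * rho.
  move=> xL; have [vf mf] := vfmf x xL.
  have fE : mollify rho f x = mollify rho g x + mollify rho h x.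
    rewrite /mollify -mulrDr -(RintegralD measurableT (iw _ x ig) (iw _ x ih)); congr (_ * _).
    by apply: eq_Rintegral => z _; rewrite -mulrDl /g subrK.
  have -> : v x - mollify rho v x = g x - mollify rho g x + (h x - mollify rho h x).
    by rewrite mf fE vf /g; ring.
  apply: (le_trans (ler_normD _ _)); apply: lerD.
    apply: (le_trans (ler_normB _ _)); rewrite lerD2l.
    rewrite /mollify normrM ger0_norm; last by rewrite invr_ge0 ltW.
    apply: (@le_trans _ _ (rho ^- n * \int[leb]_z (`|g z| * resc x rho Phi z))).
      rewrite ler_wpM2l ?invr_ge0 ?(ltW rn0)//.
      apply: (le_trans (le_normr_Rintegral measurableT (iw _ x ig))); apply: le_Rintegral => //.
      - exact: integrable_norm (iw _ x ig).
      - exact: iw.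
      - by move=> z _; rewrite normrM (ger0_norm (res0 x z)).
    rewrite -(RintegralZl _ measurableT (iw _ x ing)) le_eqVlt; apply/orP; left; apply/eqP.
    by apply: eq_Rintegral => z _; rewrite mulrCA.
  have -> : h x = rho ^- n * \int[leb]_z (h x * resc x rho Phi z).
    by rewrite (RintegralZl _ measurableT (ir x)) integral_resc_mollifier// mulrCA mulVf ?mulr1// gt_eqF.
  have ihx := integrable_Zl measurableT (h x) (ir x).
  rewrite /mollify -mulrBr -(RintegralB measurableT ihx (iw _ x ih)) normrM ger0_norm; last by rewrite invr_ge0 ltW.
  rewrite ler_pdivrMl//.
  have iB := integrable_B measurableT ihx (iw _ x ih).
  apply: (le_trans (le_normr_Rintegral measurableT iB)).
  have iZ := integrable_Zl measurableT (K * rho) (ir x).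
  apply: (@le_trans _ _ (\int[leb]_z (K * rho * resc x rho Phi z))); last first.
    by rewrite (RintegralZl _ measurableT (ir x)) integral_resc_mollifier// mulrC.
  apply: le_Rintegral => //; first exact: integrable_norm iB.
  move=> z _; rewrite -mulrBl normrM (ger0_norm (res0 x z)).
  have [zr|zr] := ltP `|z - x| rho; last by rewrite (resc_eq0 r0 (@mollifier_eq0 R n))// !mulr0.
  rewrite ler_wpM2r//; apply: (le_trans (hK _ _)); rewrite ler_wpM2l// distrC; exact: ltW.
have mP : measurable_fun setT P.
  apply: (measurable_Rintegral_section leb (w := fun z => `|g z.2| * (rho ^- n * resc z.1 rho Phi z.2))).
  apply: measurable_funM.
    apply: (measurableT_comp (f := fun x => `|g x|)); last exact: measurable_snd.
    exact: integrable_measurable ing.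
  apply: measurable_funM => //.
  apply: (measurable_shift_kernel (f := fun u => Phi (rho^-1 *: u))).
  have := measurable_smooth (test_smooth (test_resc 0 r0 (@test_mollifier R n))).
  by rewrite /resc; under eq_fun do rewrite subr0.
have iPle : (\int[leb]_x (P x)%:E <= 1%:E * \int[leb]_x (`|g x|)%:E)%E.
  apply: (@schur_bound (fun y => `|g y|) (fun z => rho ^- n * resc z.1 rho Phi z.2) 1) => //.
  - apply: measurable_funM => //.
    apply: (measurable_shift_kernel (f := fun u => Phi (rho^-1 *: u))).
    have := measurable_smooth (test_smooth (test_resc 0 r0 (@test_mollifier R n))).
    by rewrite /resc; under eq_fun do rewrite subr0.
  - by move=> z; rewrite mulr_ge0// invr_ge0 ltW.
  - move=> y /=; under eq_integral do rewrite resc_mollifierC.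
    have iZ := integrable_Zl measurableT (rho ^- n) (ir y).
    rewrite -[leLHS]fineK; last exact: (integrable_fin_num measurableT iZ).
    rewrite -/(Rintegral _ _ _) (RintegralZl _ measurableT (ir y)) integral_resc_mollifier//.
    by rewrite lee_fin mulVf// gt_eqF.
have m1 : measurable_fun setT (fun x => (`|g x|)%:E) by exact: (measurable_int _ ing).
have mPE : measurable_fun setT (fun x => (P x)%:E) by exact/measurable_EFinP.
have mI : measurable_fun setT (fun x : E => (K * rho * \1_[set x : E | `|x| < Lam] x)%:E).
  apply/measurable_EFinP; apply: measurable_funM => //; apply: measurable_indic; exact: measurable_lt_norm.
have KI0 (x : E) : (0 <= (K * rho * \1_[set x : E | `|x| < Lam] x)%:E)%E.
  by rewrite lee_fin !mulr_ge0// ltW.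
apply: (@le_trans _ _ (\int[leb]_x (((`|g x|)%:E + (P x)%:E) + (K * rho * \1_[set x : E | (`|x| < Lam)%R] x)%:E))%E).
  apply: ge0_le_integral => //.
  - apply/measurable_EFinP; rewrite (_ : (fun x => _) = fun x => \1_[set x : E | `|x| < Lam] x * `|f x - mollify rho f x|).
      apply: measurable_funM; first by apply: measurable_indic; exact: measurable_lt_norm.
      apply: measurableT_comp => //; apply: measurable_funB; first exact: integrable_measurable i_f.
      apply: measurable_funM => //.
      apply: (measurable_Rintegral_section leb (w := fun z => f z.2 * resc z.1 rho Phi z.2)).
      apply: measurable_funM; first exact: (measurableT_comp (integrable_measurable i_f) measurable_snd).
      apply: (measurable_shift_kernel (f := fun u => Phi (rho^-1 *: u))).
      have := measurable_smooth (test_smooth (test_resc 0 r0 (@test_mollifier R n))).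
      by rewrite /resc; under eq_fun do rewrite subr0.
    apply/funext => x; rewrite indicE; have [xL|xL] := ltP `|x| Lam.
      by have [-> ->] := vfmf x xL.
    by rewrite memNset ?mul0r//= ltNge xL.
  - by apply: emeasurable_funD => //; exact: emeasurable_funD.
  - move=> x _; rewrite -!EFinD lee_fin indicE; have [xL|xL] := ltP `|x| Lam.
      by rewrite mem_set// mul1r mulr1; exact: pt.
    by rewrite memNset//= ?mul0r ?mulr0 ?addr0 ?addr_ge0// ltNge xL.
rewrite ge0_integralD//; [|by move=> x _; rewrite -EFinD lee_fin addr_ge0|exact: emeasurable_funD].
rewrite ge0_integralD//; last by move=> x _; rewrite lee_fin.
apply: leeD.
  rewrite mul1e in iPle; rewrite (_ : 2%:E = (1 + 1)%:E)// EFinD ge0_muleDl// mul1e.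
  by rewrite leeD2l.
under eq_integral do rewrite EFinM.
rewrite ge0_integralZl//; last 2 first.
  - by apply/measurable_EFinP; apply: measurable_indic; exact: measurable_lt_norm.
  - by rewrite lee_fin mulr_ge0// ltW.
rewrite integral_indic//; last exact: measurable_lt_norm.
by rewrite setIT [X in (_ * X)%E](lebesgue_cube n L0) -EFinM.
Qed.

(** Schur's test for [kappa] restricted to the cube in [x]: by symmetry of the kernel its mass is
    the integral computed in [integral_kappa]. *)
Lemma kappa_slice (G : E -> R) (m : nat) (Lam : R) : leb.-integrable setT (EFin \o G) ->
  (forall y, 0 <= G y) -> 0 < Lam ->
  (\int[leb]_x (\1_[set x : E | (`|x| < Lam)%R] x * \int[leb]_y (G y * kappa (2 ^- m) (y - x)))%:E <=
   (4 ^+ n * m.+1%:R + (2 * Lam) ^+ n)%:E * \int[leb]_y (G y)%:E)%E.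
Proof.
move=> iG G0 L0; have d0 : 0 < 2 ^- m :> R by rewrite invr_gt0 exprn_gt0.
pose Q := [set x : E | `|x| < Lam].
pose w (z : E * E) := \1_Q z.1 * kappa (2 ^- m) (z.2 - z.1) : R.
have mQ : measurable_fun setT (\1_Q : E -> R) by apply: measurable_indic; exact: measurable_lt_norm.
have mk : measurable_fun setT (fun z : E => kappa (2 ^- m) z : R).
  by have := measurable_kappa (0 : E) d0; under eq_fun do rewrite subr0.
have k0 (z : E) : 0 <= kappa (2 ^- m) z :> R by apply: kappa_ge0; exact: ltW.
have ik x := integrable_kappa x d0 iG.
under eq_integral => x _ do rewrite -(RintegralZl _ measurableT (ik x)).
have -> : (\int[leb]_x (\int[leb]_y (\1_Q x * (G y * kappa (2 ^- m) (y - x))))%:E =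
   \int[leb]_x (\int[leb]_y (G y * w (x, y)))%:E)%E.
  by apply: eq_integral => x _; congr EFin; apply: eq_Rintegral => y _; rewrite mulrCA.
apply: schur_bound => //.
- apply: measurable_funM; first exact: (measurableT_comp mQ measurable_fst).
  exact: measurable_shift_kernel.
- by move=> z; rewrite mulr_ge0.
- move=> x; have := integrable_Zl measurableT (\1_Q x) (ik x); apply: eq_integrable => // y _ /=.
  by rewrite mulrCA.
move=> y; apply: le_trans (integral_kappa m y L0).
rewrite [leRHS]integral_mkcond; rewrite le_eqVlt; apply/orP; left; apply/eqP.
apply: eq_integral => x _; rewrite patchE /w /= indicE; case: ifP => _; rewrite ?mul1r ?mul0r//.
by rewrite /kappa distrC.
Qed.

End kernel_integrals.

(** * Chaining over dyadic scales *)

Section log_lipschitz.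
Context {R : realType} {n : nat} (T : R) (T0 : 0 < T).
Local Notation E := 'rV[R]_n.
Local Notation leb := (@lebesgue_rV R n).
Local Notation mu1 := (@lebesgue_measure R).
Local Notation mu := (@spacetime_measure R n).
Local Notation D := (slab (n := n) 0 T : set (measurableTypeR R * E)).
Let mD : measurable D := measurable_slab (n := n) 0 T.

Lemma ge0_slab_le (f : R * E -> R) (g : R -> \bar R) :
  measurable_fun D f -> (forall z, 0 <= f z) ->
  measurable_fun (`]0, T[%classic : set (measurableTypeR R)) g -> (forall s, 0 <= g s)%E ->
  {ae mu1, forall s, s \in `]0, T[ -> (\int[leb]_x (f (s, x))%:E <= g s)%E} ->
  (\int[mu]_(z in D) (f z)%:E <= \int[mu1]_(s in `]0%R, T[) g s)%E.
Proof.
move=> mf f0 mg g0 fg.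
have mfE : measurable_fun D (EFin \o f) by apply/measurable_EFinP.
rewrite (@slab_Tonelli R n 0 T (EFin \o f) mfE (fun z _ => f0 z)).
apply: ae_ge0_le_integral => //.
- by move=> s _; apply: integral_ge0 => x _; rewrite lee_fin.
- exact: (slab_measurable_section mfE (fun z _ => f0 z)).
Qed.

(** The sum is computed exactly by induction. The weights [2^-(j+1)] of the chain beat the linear
    growth of the norms, so that the number [J] of scales, over which there is no control,
    disappears. *)
Lemma geometric_sum_bound (A a : R) (J : nat) : 0 <= A -> 0 <= a ->
  \sum_(j < J) (2 ^+ j.+1)^-1 * (A + a * j%:R) <= A + a.
Proof.
move=> A0 a0.
suff -> : \sum_(j < J) (2 ^+ j.+1)^-1 * (A + a * j%:R) = A + a - (2 ^+ J)^-1 * (A + a * J.+1%:R).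
  by rewrite gerBl mulr_ge0// ?invr_ge0 ?exprn_ge0// addr_ge0// mulr_ge0.
elim: J => [|J IH]; first by rewrite big_ord0 expr0 invr1 mul1r mulr1 subrr.
rewrite big_ord_recr/= IH !exprS -[J.+2]addn1 natrD -[J.+1]addn1 natrD.
by field; rewrite expf_neq0.
Qed.

Lemma measurable_mollify (rho : R) (u : R * E -> R) : 0 < rho ->
  measurable_fun (setT : set (measurableTypeR R * E)) u ->
  measurable_fun setT (fun z : measurableTypeR R * E => mollify rho (fun x => u (z.1, x)) z.2).
Proof.
move=> r0 mu_; apply: measurable_funM => //.
apply: (@measurable_Rintegral_section _ _ (measurableTypeR R * E)%type E R leb
  (fun w => u (w.1.1, w.2) * resc w.1.2 rho (@mollifier R n) w.2)).
apply: measurable_funM.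
  apply: (measurableT_comp mu_); apply/measurable_fun_pairP; split => /=.
    exact: (measurableT_comp measurable_fst measurable_fst).
  exact: measurable_snd.
apply: (measurableT_comp (f := fun z : E * E => resc z.1 rho (@mollifier R n) z.2)
   (g := fun w : (measurableTypeR R * E) * E => (w.1.2, w.2))).
  apply: (measurable_shift_kernel (f := fun u => mollifier (rho^-1 *: u))).
  have := measurable_smooth (test_smooth (test_resc 0 r0 (@test_mollifier R n))).
  by rewrite /resc; under eq_fun do rewrite subr0.
apply/measurable_fun_pairP; split => /=; last exact: measurable_snd.
exact: (measurableT_comp measurable_snd measurable_fst).
Qed.

Lemma measurable_indic_snd (Lam : R) :
  measurable_fun setT (fun z : measurableTypeR R * E => \1_[set x : E | `|x| < Lam] z.2 : R).
Proof.
apply: (measurableT_comp (f := \1_[set x : E | `|x| < Lam] : E -> R)); last exact: measurable_snd.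
by apply: measurable_indic; exact: measurable_lt_norm.
Qed.

Lemma integral_time_cst (c : R) : 0 <= c -> (\int[mu1]_(s in `]0%R, T[) c%:E = (c * T)%:E)%E.
Proof.
move=> c0; rewrite integral_cst//= lebesgue_measure_itv/= lte_fin T0 -EFinB subr0.
by rewrite EFinM.
Qed.

(** Density of tensors reduces the claim to a function that is Lipschitz in [x] uniformly in time,
    for which the error is proportional to the scale. *)
Lemma mollify_cvg_slab (u : R * E -> R) (Lam eps : R) (m : nat) : measurable_fun D u ->
  slab_locally_integrable T u -> 0 < Lam -> 0 < eps ->
  exists J : nat,
   (\int[mu]_(z in D) (\1_[set x : E | (`|x| < Lam)%R] z.2 *
      `|(u \_ D) z - mollify (2 ^- (m + J)) (fun x => (u \_ D) (z.1, x)) z.2|)%:E <= eps%:E)%E.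
Proof.
move=> mu_ lu L0 e0; have e40 : 0 < eps / 4 by rewrite divr_gt0.
pose f z := u z * \1_[set x : E | `|x| < Lam + 1] z.2.
have i_f : mu.-integrable D (EFin \o f) by exact: lu.
have [h [th fh]] := tensor_dense i_f e40.
have [K K0 hK] := tensor_lipschitz th.
pose B := K * (2 * Lam) ^+ n * T.
have B0 : 0 <= B by rewrite !mulr_ge0 ?exprn_ge0 ?mulr_ge0// ltW.
have [J hJ] : exists J : nat, B <= eps / 4 * 2 ^+ J.
  exists (Num.truncn (B / (eps / 4))).+1.
  rewrite -ler_pdivrMl// mulrC ltW//; apply: (lt_le_trans (truncnS_gt _)).
  by rewrite -natrX ler_nat ltnW// ltn_expl.
exists J; pose rho : R := 2 ^- (m + J).
have r0 : 0 < rho by rewrite invr_gt0 exprn_gt0.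
have r1 : rho <= 1 by rewrite invf_le1 ?exprn_gt0// exprn_ege1// ler1n.
have Br : B * rho <= eps / 4.
  rewrite /rho ler_pdivrMr ?exprn_gt0//; apply: (le_trans hJ).
  by rewrite ler_pM2l// exprD ler_peMl ?exprn_ge0// exprn_ege1// ler1n.
have mT := slab_measurable_patch mu_.
have mh := tensor_measurable th.
have mfh : measurable_fun D (fun z => (`|f z - h z.1 z.2|)%:E).
  apply/measurable_EFinP; apply: measurableT_comp => //; apply: measurable_funB.
    exact: integrable_measurable i_f.
  exact: measurable_funTS.
pose g s : \bar R := (2%:E * \int[leb]_x (`|f (s, x) - h s x|)%:E + (K * rho * (2 * Lam) ^+ n)%:E)%E.
have mS : measurable_fun (`]0, T[%classic : set (measurableTypeR R)) (fun s => \int[leb]_x (`|f (s, x) - h s x|)%:E)%E.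
  exact: (slab_measurable_section mfh).
have c0 : 0 <= K * rho * (2 * Lam) ^+ n by rewrite !mulr_ge0 ?exprn_ge0 ?mulr_ge0// ltW.
have S0 s : (0 <= \int[leb]_x (`|f (s, x) - h s x|)%:E)%E by apply: integral_ge0 => x _; rewrite lee_fin.
apply: (@le_trans _ _ (\int[mu1]_(s in `]0%R, T[) g s)%E).
  apply: (@ge0_slab_le _ g).
  - apply: measurable_funTS; apply: measurable_funM; first exact: measurable_indic_snd.
    by apply: measurableT_comp => //; apply: measurable_funB => //; exact: measurable_mollify.
  - by move=> z; rewrite mulr_ge0.
  - by apply: emeasurable_funD => //; exact: measurable_funeM.
  - by move=> s; rewrite adde_ge0 ?mule_ge0 ?lee_fin.
  have A1 : {ae mu1, forall s (k : nat), s \in `]0, T[ ->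
      leb.-integrable setT (EFin \o (fun x => u (s, x) * \1_[set x : E | `|x| < k%:R] x))}.
    by apply: ae_countable => k; exact: slab_section_integrable (lu k%:R).
  have A2 := slab_section_integrable (tensor_integrable T th).
  apply: (ae_imp (ae_and A1 A2)) => s [h1 h2] sT.
  have lus : locally_integrable_rV (fun x => u (s, x)) by move=> k; exact: h1.
  have := mollify_slice lus (h2 sT) K0 (hK s) L0 r0 r1.
  have uE : (fun x : E => (u \_ D) (s, x)) = (fun x => u (s, x)) by apply/funext => x; rewrite slab_patch.
  move=> H; apply: le_trans H; rewrite le_eqVlt; apply/orP; left; apply/eqP.
  by apply: eq_integral => x _; rewrite /= uE slab_patch.
rewrite /g ge0_integralD//; last 2 first.
  - by move=> s _; rewrite mule_ge0 ?lee_fin.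
  - exact: measurable_funeM.
rewrite ge0_integralZl ?lee_fin// integral_time_cst//.
have <- : (\int[mu]_(z in D) (`|f z - h z.1 z.2|)%:E = \int[mu1]_(s in `]0%R, T[) \int[leb]_x (`|f (s, x) - h s x|)%:E)%E.
  by rewrite (slab_Tonelli mfh).
apply: (@le_trans _ _ (2%:E * (eps / 4)%:E + (eps / 4)%:E)%E).
  apply: leeD; first by apply: lee_wpmul2l; rewrite ?lee_fin.
  rewrite lee_fin; apply: le_trans Br; rewrite /B le_eqVlt; apply/orP; left; apply/eqP; ring.
by rewrite -EFinM -EFinD lee_fin; lra.
Qed.

Section log_lipschitz_proof.
Context (Lam : R) (L0 : 0 < Lam).
Let Q := [set x : E | `|x| < Lam].
Let N (f : measurableTypeR R * E -> R) : \bar R := (\int[mu]_(z in D) (\1_Q z.2 * f z)%:E)%E.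
Let mQ : measurable_fun D (fun z : measurableTypeR R * E => \1_Q z.2 : R) := measurable_funTS (measurable_indic_snd Lam).
Let nn (f : measurableTypeR R * E -> R) := measurable_fun setT f /\ forall z, 0 <= f z.

Let nnM f : nn f -> measurable_fun D (fun z => (\1_Q z.2 * f z)%:E).
Proof. by move=> [mf _]; apply/measurable_EFinP; apply: measurable_funM => //; exact: measurable_funTS. Qed.
Let nn0 f z : nn f -> (0 <= (\1_Q z.2 * f z)%:E)%E.
Proof. by move=> [_ f0]; rewrite lee_fin mulr_ge0. Qed.

Let nnD f g : nn f -> nn g -> nn (fun z => f z + g z).
Proof. by move=> [mf f0] [mg g0]; split => [|z]; [exact: measurable_funD|rewrite addr_ge0]. Qed.
Let nnZ c f : 0 <= c -> nn f -> nn (fun z => c * f z).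
Proof. by move=> c0 [mf f0]; split => [|z]; [exact: measurable_funM|rewrite mulr_ge0]. Qed.
Let nnS (I : Type) (s : seq I) (f : I -> _) : (forall i, nn (f i)) -> nn (fun z => \sum_(i <- s) f i z).
Proof.
move=> h; split => [|z]; first by apply: measurable_sum => i; have [] := h i.
by apply: sumr_ge0 => i _; have [_] := h i.
Qed.

Let N_D f g : nn f -> nn g -> N (fun z => f z + g z) = (N f + N g)%E.
Proof.
move=> hf hg; rewrite /N; under eq_integral do rewrite mulrDr EFinD.
rewrite ge0_integralD//.
- by move=> z _; exact: nn0.
- exact: nnM.
- by move=> z _; exact: nn0.
- exact: nnM.
Qed.
Let N_Z c f : 0 <= c -> nn f -> N (fun z => c * f z) = (c%:E * N f)%E.
Proof.
move=> c0 hf; rewrite /N; under eq_integral do rewrite mulrCA EFinM.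
rewrite ge0_integralZl ?lee_fin//; first exact: nnM.
by move=> z _; exact: nn0.
Qed.
Let N_S (I : Type) (s : seq I) (f : I -> _) : (forall i, nn (f i)) ->
  N (fun z => \sum_(i <- s) f i z) = (\sum_(i <- s) N (f i))%E.
Proof.
move=> h; elim: s => [|i s IH].
  rewrite big_nil /N; under eq_integral do rewrite big_nil mulr0.
  by rewrite integral0.
rewrite big_cons -IH -N_D//; last exact: nnS.
by congr N; apply/funext => z; rewrite big_cons.
Qed.

(** The gradients at scale [2^-m] give the term in [|x - y|]; the successive differences from scale
    [2^-m] down to [2^-(m + J)], together with the final error [P], give the term in [2^-m]. At
    scale [2^-k] the gradient bound has norm at most [a (k + 1) + c], where [a] is proportional to
    [eta] and hence as small as desired. *)
Lemma log_lipschitz (b : R -> E -> E) : measurable_field T b -> cond_R2 T b ->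
  (forall i, slab_locally_integrable T (fun z => b z.1 z.2 ord0 i)) ->
  forall eps : R, 0 < eps -> exists2 C : R, 0 <= C & forall m : nat,
  exists W : R -> E -> R,
  [/\ forall s x, 0 <= W s x,
      measurable_fun setT (fun z : measurableTypeR R * E => W z.1 z.2),
      (\int[mu]_(z in D) (\1_[set x : E | (`|x| < Lam)%R] z.2 * W z.1 z.2)%:E <= (eps * m%:R + C)%:E)%E &
      {ae mu1, forall s, s \in `]0, T[ -> forall x y,
        enorm (b s x - b s y) <= (`|x - y| + 2 ^- m) * (W s x + W s y)}].
Proof.
move=> mb R2 lb eps eps0.
have [C0 C00 HC] := derivative_bound R2 lb.
(* The coefficient of [eta * m] in the norm of [W]: two groups of terms of order [m], the factor
   [2 n], the [n] coordinates, and [C0 * 4^n] from the kernel integral. *)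
pose q : R := 4 * n%:R ^+ 2 * C0 * 4 ^+ n.
have q0 : 0 <= q by rewrite !mulr_ge0 ?exprn_ge0.
pose eta := eps / (q + 1).
have eta0 : 0 < eta by rewrite divr_gt0// ltr_wpDl.
have [G [C1 [C10 G0 iG Geta HG]]] := HC eta eta0.
pose a := C0 * 4 ^+ n * eta.
pose c := C0 * (2 * Lam) ^+ n * eta + C1 * (2 * Lam) ^+ n * T.
have L20 : 0 <= (2 * Lam) ^+ n by rewrite exprn_ge0// mulr_ge0// ltW.
have eta0' := ltW eta0; have T0' := ltW T0.
have a0 : 0 <= a by apply: mulr_ge0 => //; rewrite mulr_ge0 ?exprn_ge0.
have c0 : 0 <= c.
  apply: addr_ge0; first by apply: mulr_ge0 => //; rewrite mulr_ge0.
  by rewrite mulr_ge0// mulr_ge0.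
exists (n%:R * ((2 * n)%:R * (4 * a + 2 * c) + 1)).
  by apply: mulr_ge0 => //; apply: addr_ge0 => //; apply: mulr_ge0 => //; apply: addr_ge0; apply: mulr_ge0.
move=> m.
pose V k (z : measurableTypeR R * E) := C0 * \int[leb]_y (G (z.1, y) * kappa (2 ^- k) (y - z.2)) + C1.
have d0 k : 0 < 2 ^- k :> R by rewrite invr_gt0 exprn_gt0.
have mG : measurable_fun (setT : set (measurableTypeR R * E)) G := integrable_measurable iG.
have k0 k (z : E) : 0 <= kappa (2 ^- k) z :> R by apply: kappa_ge0; exact: ltW.
have nV k : nn (V k).
  split => [|z]; last by rewrite addr_ge0// mulr_ge0// Rintegral_ge0// => y _; rewrite mulr_ge0.
  apply: measurable_funD => //; apply: measurable_funM => //.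
  apply: (@measurable_Rintegral_section _ _ (measurableTypeR R * E)%type E R leb
    (fun w => G (w.1.1, w.2) * kappa (2 ^- k) (w.2 - w.1.2))).
  apply: measurable_funM.
    apply: (measurableT_comp mG); apply/measurable_fun_pairP; split => /=; last exact: measurable_snd.
    exact: (measurableT_comp measurable_fst measurable_fst).
  apply: (measurableT_comp (f := fun z : E * E => kappa (2 ^- k) (z.2 - z.1))
     (g := fun w : (measurableTypeR R * E) * E => (w.1.2, w.2))).
    apply: measurable_shift_kernel.
    by have := measurable_kappa (0 : E) (d0 k); under eq_fun do rewrite subr0.
  apply/measurable_fun_pairP; split => /=; last exact: measurable_snd.
  exact: (measurableT_comp measurable_snd measurable_fst).
have NV k : (N (V k) <= (a * k.+1%:R + c)%:E)%E.
  pose B := C0 * (4 ^+ n * k.+1%:R + (2 * Lam) ^+ n).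
  have B0 : 0 <= B by rewrite /B mulr_ge0// addr_ge0// mulr_ge0// exprn_ge0.
  have CL0 : 0 <= C1 * (2 * Lam) ^+ n by rewrite mulr_ge0.
  have mGE : measurable_fun D (EFin \o G) by apply/measurable_EFinP; exact: measurable_funTS.
  have mS : measurable_fun (`]0, T[%classic : set (measurableTypeR R)) (fun s => \int[leb]_y (G (s, y))%:E)%E.
    by apply: (slab_measurable_section mGE) => z _; rewrite lee_fin.
  have S0 s : (0 <= \int[leb]_y (G (s, y))%:E)%E by apply: integral_ge0 => y _; rewrite lee_fin.
  pose g s : \bar R := (B%:E * \int[leb]_y (G (s, y))%:E + (C1 * (2 * Lam) ^+ n)%:E)%E.
  apply: (@le_trans _ _ (\int[mu1]_(s in `]0%R, T[) g s)%E).
    apply: (@ge0_slab_le (fun z => \1_Q z.2 * V k z) g).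
    - by apply: measurable_funM => //; apply: measurable_funTS; have [] := nV k.
    - by move=> z; rewrite mulr_ge0//; have [_] := nV k.
    - by apply: emeasurable_funD => //; exact: measurable_funeM.
    - by move=> s; rewrite /g adde_ge0 ?mule_ge0 ?lee_fin.
    apply: (ae_imp HG) => s hs sT; have [iGs _] := hs sT.
    have mIx : measurable_fun setT (fun x : E => \int[leb]_y (G (s, y) * kappa (2 ^- k) (y - x))).
      apply: (measurable_Rintegral_section leb (w := fun z : E * E => G (s, z.2) * kappa (2 ^- k) (z.2 - z.1))).
      apply: measurable_funM; first exact: (measurableT_comp (integrable_measurable iGs) measurable_snd).
      apply: measurable_shift_kernel.
      by have := measurable_kappa (0 : E) (d0 k); under eq_fun do rewrite subr0.
    have Ix0 (x : E) : 0 <= \int[leb]_y (G (s, y) * kappa (2 ^- k) (y - x)).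
      by apply: Rintegral_ge0 => // y _; rewrite mulr_ge0.
    have m1 : measurable_fun setT (\1_Q : E -> R) by apply: measurable_indic; exact: measurable_lt_norm.
    rewrite /V/=; under eq_integral do rewrite mulrDr EFinD mulrCA EFinM [\1_Q _ * C1]mulrC [(C1 * _)%:E]EFinM.
    rewrite ge0_integralD//; last 4 first.
    + by move=> x _; rewrite mule_ge0 ?lee_fin// mulr_ge0.
    + by apply: measurable_funeM; apply/measurable_EFinP; exact: measurable_funM.
    + by move=> x _; rewrite mule_ge0 ?lee_fin.
    + by apply: measurable_funeM; exact/measurable_EFinP.
    rewrite ge0_integralZl ?lee_fin//; last 2 first.
    + by apply/measurable_EFinP; exact: measurable_funM.
    + by move=> x _; rewrite lee_fin mulr_ge0.
    rewrite ge0_integralZl ?lee_fin//; last exact/measurable_EFinP.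
    rewrite integral_indic//; last exact: measurable_lt_norm.
    rewrite setIT [X in (_ + _ * X <= _)%E](lebesgue_cube n L0) -EFinM /g leeD2r//.
    rewrite /B EFinM -muleA; apply: lee_wpmul2l; first by rewrite lee_fin.
    by apply: kappa_slice.
  rewrite /g ge0_integralD//; last 2 first.
  - by move=> s _; rewrite mule_ge0 ?lee_fin.
  - exact: measurable_funeM.
  rewrite ge0_integralZl ?lee_fin// integral_time_cst//.
  apply: (@le_trans _ _ (B%:E * eta%:E + (C1 * (2 * Lam) ^+ n * T)%:E)%E); last first.
    by rewrite -EFinM -EFinD lee_fin le_eqVlt; apply/orP; left; apply/eqP; rewrite /B /a /c; ring.
  apply: leeD => //; apply: lee_wpmul2l; first by rewrite lee_fin.
  apply: le_trans Geta.
  have -> : (\int[mu1]_(s in `]0%R, T[) \int[leb]_y (G (s, y))%:E = \int[mu]_(z in D) (G z)%:E)%E.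
    by rewrite (slab_Tonelli mGE)// => z _; rewrite lee_fin.
  apply: ge0_subset_integral => //.
  - by apply/measurable_EFinP.
  - by move=> z _; rewrite lee_fin.
pose u (i : 'I_n) : R * E -> R := (fun z : R * E => b z.1 z.2 ord0 i) \_ D.
have mbi i : measurable_fun D (fun z : measurableTypeR R * E => b z.1 z.2 ord0 i).
  exact: (measurableT_comp (measurable_coord i) mb).
have e20 : 0 < 2 ^- m :> R by [].
pose P' i (J : nat) (z : measurableTypeR R * E) := `|u i z - mollify (2 ^- (m + J)) (fun x => u i (z.1, x)) z.2|.
(* The last error is asked to be at most [2^-m] in norm because it enters [W] multiplied by
   [2^m]. *)
have /choice[J hJ] : forall i : 'I_n, exists J : nat, (N (P' i J) <= (2 ^- m)%:E)%E.
  by move=> i; exact: (mollify_cvg_slab m (mbi i) (lb i) L0 e20).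
pose P i := P' i (J i).
have nP i : nn (P i).
  split => [|z]; last exact: normr_ge0.
  apply: measurableT_comp => //; apply: measurable_funB; first exact: slab_measurable_patch.
  by apply: measurable_mollify => //; exact: slab_measurable_patch.
pose S i (z : measurableTypeR R * E) := \sum_(j < J i) (2 ^+ j.+1)^-1 * V (m + j).+1 z.
have p0 j : 0 <= (2 ^+ j.+1)^-1 :> R by rewrite invr_ge0 exprn_ge0.
have nS i : nn (S i) by apply: nnS => j; exact: nnZ.
pose W z := \sum_(i < n) ((2 * n)%:R * (V m z + S i z) + 2 ^+ m * P i z).
have nWi i : nn (fun z => (2 * n)%:R * (V m z + S i z) + 2 ^+ m * P i z).
  by apply: nnD; [apply: nnZ => //; exact: nnD|apply: nnZ => //; exact: exprn_ge0].
have nW : nn W by exact: nnS.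
exists (fun s x => W (s, x)); split.
- by move=> s x; have [_] := nW.
- rewrite (_ : (fun z => _) = W); first by have [] := nW.
  by apply/funext => -[].
- rewrite (_ : (\int[mu]_(z in D) _)%E = N W); last by apply: eq_integral => -[].
  rewrite N_S//; apply: (@le_trans _ _ (\sum_(i < n) ((2 * n)%:R * ((a * m.+1%:R + c) + (a * m.+2%:R + c + a)) + 1)%:E)%E).
    apply: lee_sum => i _; rewrite N_D//; [|by apply: nnZ => //; exact: nnD|by apply: nnZ => //; exact: exprn_ge0].
    rewrite N_Z//; last exact: nnD.
    rewrite N_D// N_Z// ?exprn_ge0// EFinD; apply: leeD; last first.
      rewrite [leRHS](_ : _ = (2 ^+ m * 2 ^- m)%:E); last by rewrite divff// expf_neq0.
      by rewrite EFinM; apply: lee_wpmul2l; rewrite ?lee_fin ?exprn_ge0//; exact: hJ.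
    rewrite EFinM; apply: lee_wpmul2l; first by rewrite lee_fin.
    rewrite EFinD; apply: leeD; first exact: NV.
    rewrite /S N_S; last by move=> j; exact: nnZ.
    apply: (@le_trans _ _ (\sum_(j < J i) ((2 ^+ j.+1)^-1 * ((a * m.+2%:R + c) + a * j%:R))%:E)%E).
      apply: lee_sum => j _; rewrite N_Z// EFinM; apply: lee_wpmul2l; first by rewrite lee_fin.
      apply: (le_trans (NV _)); rewrite lee_fin le_eqVlt; apply/orP; left; apply/eqP.
      have -> : (m + j).+2%:R = m.+2%:R + j%:R :> R by rewrite -natrD !addSn.
      by ring.
    rewrite sumEFin lee_fin; apply: geometric_sum_bound => //.
    by rewrite addr_ge0// mulr_ge0.
  rewrite sumEFin lee_fin sumr_const card_ord -[leLHS]mulr_natr.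
  have -> : ((2 * n)%:R * (a * m.+1%:R + c + (a * m.+2%:R + c + a)) + 1) * n%:R =
     (4 * n%:R ^+ 2 * a) * m%:R + n%:R * ((2 * n)%:R * (4 * a + 2 * c) + 1).
    have -> : m.+2%:R = m%:R + 2 :> R by rewrite -natrD addn2.
    have -> : m.+1%:R = m%:R + 1 :> R by rewrite -natr1.
    by rewrite natrM; ring.
  rewrite lerD2r ler_wpM2r//.
  rewrite (_ : _ * a = q * eta); last by rewrite /a /q; ring.
  by rewrite /eta mulrA ler_pdivrMr ?ltr_wpDl// mulrC ler_pM2l// lerDl.
have A2 : {ae mu1, forall s (k : 'I_n * nat), s \in `]0, T[ ->
    leb.-integrable setT (EFin \o (fun z => b s z ord0 k.1 * \1_[set x : E | `|x| < k.2%:R] z))}.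
  apply: ae_countable => -[i k]; exact: slab_section_integrable (lb i k%:R).
apply: (ae_imp (ae_and HG A2)) => s [hG h2] sT x y.
have [iGs hV] := hG sT.
pose V' rho x := C0 * \int[leb]_y (G (s, y) * kappa rho (y - x)) + C1.
have V'm rho rho' x0 x' : 0 < rho -> `|x' - x0| <= rho' - rho -> V' rho' x' <= V' rho x0.
  move=> r0 h; rewrite lerD2r ler_wpM2l//.
  have r'0 : 0 < rho' by have := normr_ge0 (x' - x0); lra.
  apply: le_Rintegral => //; try exact: integrable_kappa.
  by move=> z _; rewrite ler_wpM2l// kappa_mono.
apply: (le_trans (enorm_le_sum _)); rewrite /W -big_split/= mulr_sumr; apply: ler_sum => i _.
rewrite !mxE.
pose v z := b s z ord0 i.
have lv : locally_integrable_rV v by move=> k; exact: (h2 (i, k) sT).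
have hVi j l z rho : 0 < rho -> `|\int[leb]_z0 (v z0 * resc z rho ('D_('e_j) (probe l)) z0)| <= rho ^+ n.+1 * V' rho z.
  exact: hV.
have uE z : u i (s, z) = v z by rewrite /u slab_patch.
have uvE : (fun z => u i (s, z)) = v by apply/funext => z; exact: uE.
have PE z : P i (s, z) = `|v z - mollify (2 ^- (m + J i)) v z| by rewrite /P /P' /= uE uvE.
have lip := mollify_lipschitz lv V'm hVi x y (d0 m).
have tele z : `|mollify (2 ^- (m + J i)) v z - mollify (2 ^- m) v z| <= 2 ^- m * ((2 * n)%:R * S i (s, z)).
  rewrite /S; elim: (J i) => [|k IH].
    by rewrite addn0 subrr normr0 big_ord0 !mulr0.
  have sc := mollify_scale_step lv V'm hVi z (d0 (m + k).+1) (r := 2 ^- (m + k)).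
  have dd : 2 ^- (m + k) - 2 ^- (m + k).+1 = 2 ^- m * (2 ^+ k.+1)^-1 :> R.
    by rewrite !exprS exprD; field; rewrite !expf_neq0.
  have {}sc := sc _; rewrite dd in sc.
  rewrite big_ord_recr/= mulrDr mulrDr.
  apply: (le_trans (ler_distD (mollify (2 ^- (m + k)) v z) _ _)).
  rewrite addrC; apply: lerD; first exact: IH.
  rewrite distrC addnS; apply: le_trans (sc _) _.
    by rewrite -subr_ge0 dd mulr_ge0// ltW.
  by rewrite le_eqVlt; apply/orP; left; apply/eqP; rewrite /V' /V/=; ring.
have tri z : `|v z - mollify (2 ^- m) v z| <= 2 ^- m * (2 ^+ m * P i (s, z) + (2 * n)%:R * S i (s, z)).
  rewrite mulrDr [2 ^- m * (2 ^+ m * _)]mulKf ?expf_neq0// PE.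
  by apply: (le_trans (ler_distD (mollify (2 ^- (m + J i)) v z) _ _)); apply: lerD.
have tx := tri x; have ty := tri y.
have nnx z : 0 <= V m (s, z) /\ 0 <= S i (s, z) /\ 0 <= P i (s, z).
  by have [_ ?] := nV m; have [_ ?] := nS i; have [_ ?] := nP i.
have [Vx0 [Sx0 Px0]] := nnx x; have [Vy0 [Sy0 Py0]] := nnx y.
rewrite -/(v x) -/(v y).
apply: (le_trans (ler_distD (mollify (2 ^- m) v x) _ _)).
apply: (le_trans (lerD tx (ler_distD (mollify (2 ^- m) v y) _ _))).
rewrite [X in _ + (_ + X)]distrC.
apply: (le_trans (lerD (lexx _) (lerD lip ty))).
rewrite /V' -/(V m (s, x)) -/(V m (s, y)).
(* Expanding the product leaves, besides the left-hand side, nonnegative terms only. *)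
have alg (d e M N' Vx Vy Sx Sy Px Py : R) : 0 <= d -> 0 <= e -> 0 <= M -> 0 <= N' ->
   0 <= Vx -> 0 <= Vy -> 0 <= Sx -> 0 <= Sy -> 0 <= Px -> 0 <= Py ->
   e * (M * Px + N' * Sx) + (d * (N' * (Vx + Vy)) + e * (M * Py + N' * Sy)) <=
   (d + e) * (N' * (Vx + Sx) + M * Px + (N' * (Vy + Sy) + M * Py)).
  move=> *; rewrite -subr_ge0 [X in 0 <= X](_ : _ = d * (N' * Sx + N' * Sy + M * Px + M * Py) + e * (N' * Vx + N' * Vy)); last by ring.
  by rewrite addr_ge0// mulr_ge0// !addr_ge0// mulr_ge0.
have M0 : 0 <= 2 ^+ m :> R by rewrite exprn_ge0.
exact: (alg _ _ _ _ _ _ _ _ _ _ (normr_ge0 (x - y)) (ltW e20) M0 (ler0n R (2 * n)) Vx0 Vy0 Sx0 Sy0 Px0 Py0).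
Qed.

End log_lipschitz_proof.

End log_lipschitz.

(** * Absolutely continuous functions *)

Section absolute_continuity.
Context {R : realType} (t T : R).
Local Notation mu1 := (@lebesgue_measure R).
Implicit Types (P f h : R -> R).

(** Absolute continuity as a pair of a function and its density. The density is carried along so
    that sums, products and compositions come with an explicit one. *)
Definition ac P f := mu1.-integrable `[t, T] (EFin \o f) /\
  forall s, s \in `[t, T] -> P s = P t + \int[mu1]_(r in `[t, s]) f r.

Lemma integrable_sub_itv f s : mu1.-integrable `[t, T] (EFin \o f) -> s \in `[t, T] ->
  mu1.-integrable `[t, s] (EFin \o f).
Proof.
move=> intf; rewrite in_itv/= => /andP[_ sT]; apply: integrableS intf => //.
by apply: subset_itv; rewrite bnd_simp.
Qed.

Lemma ac_within_continuous P f : t <= T -> ac P f -> {within `[t, T], continuous P}.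
Proof.
move=> tT [intf hP].
apply: (@subspace_eq_continuous _ _ _ (fun s => P t + \int[mu1]_(r in `[t, s]) f r)).
  by move=> s /set_mem sT; rewrite -hP.
have cI := parameterized_integral_continuous tT intf.
move=> s; apply: (@continuousD _ R _ (cst (P t) : subspace `[t, T] -> R)
  (fun s => \int[mu1]_(r in `[t, s]) f r)); first exact: cst_continuous.
exact: cI.
Qed.

Lemma ac_cst c : ac (fun=> c) (fun=> 0).
Proof.
split; first exact: integrable0.
by move=> s _; rewrite Rintegral_cst//= mul0r addr0.
Qed.

Lemma acD P f P' f' : ac P f -> ac P' f' -> ac (fun s => P s + P' s) (fun s => f s + f' s).
Proof.
move=> [i1 h1] [i2 h2]; split; first exact: integrable_D.
move=> s sT; rewrite (h1 s sT) (h2 s sT) RintegralD//; [ring|exact: integrable_sub_itv..].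
Qed.

Lemma acZ P f c : ac P f -> ac (fun s => c * P s) (fun s => c * f s).
Proof.
move=> [i1 h1]; split; first exact: integrable_Zl.
move=> s sT; rewrite (h1 s sT) RintegralZl//; [ring|exact: integrable_sub_itv].
Qed.

Lemma acB P f P' f' : ac P f -> ac P' f' -> ac (fun s => P s - P' s) (fun s => f s - f' s).
Proof.
move=> h1 h2; have := acD h1 (acZ (-1) h2).
by congr (ac _ _); apply/funext => s; rewrite mulN1r.
Qed.

Lemma ac_sum (I : Type) (r : seq I) (P f : I -> R -> R) : (forall i, ac (P i) (f i)) ->
  ac (fun s => \sum_(i <- r) P i s) (fun s => \sum_(i <- r) f i s).
Proof.
move=> h; elim: r => [|i r IH].
  have := ac_cst 0; congr (ac _ _); by apply/funext => s; rewrite big_nil.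
have := acD (h i) IH; congr (ac _ _); by apply/funext => s; rewrite big_cons.
Qed.

Lemma bounded_on_compact (g : R -> R) (M : R) : continuous g ->
  exists2 K, 0 <= K & forall u, `|u| <= M -> `|g u| <= K.
Proof.
move=> cg; have [M0|M0] := ltP M 0.
  by exists 0 => // u uM; have := normr_ge0 u; rewrite leNgt (le_lt_trans uM).
have cgn : {within `[- M, M], continuous (fun u => `|g u|)}.
  apply: continuous_subspaceT => u; apply: (continuous_comp (cg u)); exact: norm_continuous.
have [|c _ hc] := @EVT_max R (fun u => `|g u|) (- M) M _ cgn; first by lra.
by exists `|g c| => // u uM; apply: hc; rewrite in_itv/= -ler_norml.
Qed.

Lemma ge0_Rintegral_sub (A B : set R) f : measurable A -> measurable B -> A `<=` B ->
  mu1.-integrable B (EFin \o f) -> (forall x, B x -> 0 <= f x) ->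
  \int[mu1]_(x in A) f x <= \int[mu1]_(x in B) f x.
Proof.
move=> mA mB AB intf f0; rewrite /Rintegral fine_le//.
- by apply: integrable_fin_num => //; exact: integrableS intf.
- exact: integrable_fin_num.
by apply: ge0_subset_integral => //; exact: measurable_int intf.
Qed.

(** Density of continuous functions in [L^1]; the sequence is shifted so that every error is at most
    one. *)
Lemma continuous_approximation f : mu1.-integrable `[t, T] (EFin \o f) ->
  exists g : nat -> R -> R, [/\ forall k, continuous (g k),
    forall k, mu1.-integrable `[t, T] (EFin \o g k),
    forall k, \int[mu1]_(z in `[t, T]) `|f z - g k z| <= 1 &
    (\int[mu1]_(z in `[t, T]) `|f z - g k z|) @[k --> \oo] --> (0 : R)].
Proof.
move=> intf.
have fin : (mu1 `[t, T] < +oo)%E by rewrite lebesgue_measure_itv/=; case: ifP => _; rewrite ltry.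
have [g [cg ig gf]] := approximation_continuous_integrable (measurable_itv _) fin intf.
have {}gf : (\int[mu1]_(z in `[t, T]) `|f z - g k z|) @[k --> \oo] --> (0 : R).
  exact: (fine_cvg gf).
have [N _ hN] := (cvgrPdist_le _ _).1 gf 1 ltr01.
exists (fun k => g (k + N)%N); split => //; last by move: gf; rewrite -(cvg_shiftn N).
move=> k; have := hN (k + N)%N (leq_addl _ _); rewrite sub0r normrN; exact: le_trans (ler_norm _).
Qed.

(* The density is approximated by continuous functions, for which this is the fundamental theorem
   of calculus. *)
Lemma ac_comp P f h h' : t <= T -> ac P f -> (forall u : R, is_derive u (1 : R) h (h' u)) ->
  continuous h' -> ac (fun s => h (P s)) (fun s => h' (P s) * f s).
Proof.
move=> tT acP hd ch'; have [intf hP] := acP.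
have cP := ac_within_continuous tT acP.
have ch : continuous h.
  by move=> u; apply: differentiable_continuous; apply/derivable1_diffP; case: (hd u).
have mI s : measurable (`[t, s]%classic : set R) by exact: measurable_itv.
have [g [cg ig g1 e0]] := continuous_approximation intf.
set e := (fun k => \int[mu1]_(z in _) _) in e0.
have ifg k : mu1.-integrable `[t, T] (EFin \o (fun z => f z - g k z)) by exact: integrable_B.
have ifga k : mu1.-integrable `[t, T] (EFin \o (fun z => `|f z - g k z|)).
  have := integrable_norm (ifg k); exact.
pose P' k s := P t + \int[mu1]_(r in `[t, s]) g k r.
have P't k : P' k t = P t by rewrite /P' set_itv1 Rintegral_set1 addr0.
have acP' k : ac (P' k) (g k) by split => // s sT; rewrite P't.
have PP k s : s \in `[t, T] -> `|P' k s - P s| <= e k.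
  move=> sT; rewrite (hP s sT) /P' addrAC opprD addrA subrr sub0r addrC.
  have ig' := integrable_sub_itv (ig k) sT; have if' := integrable_sub_itv intf sT.
  rewrite -RintegralB//.
  apply: le_trans (le_normr_Rintegral _ _) _ => //; first exact: integrable_B.
  rewrite (_ : (fun x => `|g k x - f x|) = (fun x => `|f x - g k x|)); last first.
    by apply/funext => x; rewrite distrC.
  apply: ge0_Rintegral_sub => //.
  by apply: subset_itv; rewrite bnd_simp//; move: sT; rewrite in_itv/= => /andP[].
have ifn : mu1.-integrable `[t, T] (EFin \o (fun z => `|f z|)) by have := integrable_norm intf; exact.
(* A common bound for [P] and all the approximating primitives, the last unit absorbing their
   uniform distance to [P]; the derivative of [h] is bounded on this range. *)
pose M : R := `|P t| + \int[mu1]_(z in `[t, T]) `|f z| + 1.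
have PM s : s \in `[t, T] -> `|P s| <= M - 1.
  move=> sT; rewrite /M addrK (hP s sT); apply: le_trans (ler_normD _ _) _; rewrite lerD2l.
  have if' := integrable_sub_itv intf sT.
  apply: le_trans (le_normr_Rintegral _ _) _ => //.
  apply: ge0_Rintegral_sub => //.
  by apply: subset_itv; rewrite bnd_simp//; move: sT; rewrite in_itv/= => /andP[].
have P'M k s : s \in `[t, T] -> `|P' k s| <= M.
  move=> sT; have := PP k s sT; have := PM s sT; have := g1 k; rewrite -/(e k).
  have := ler_normD (P' k s - P s) (P s); rewrite subrK; lra.
have [K K0 hK] := bounded_on_compact M ch'.
have cc (Q : R -> R) (w : R -> R) s : s \in `[t, T] -> {within `[t, T], continuous Q} -> continuous w ->
    {within `[t, s], continuous (fun r => w (Q r))}.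
  move=> sT cQ cw; apply: (@continuous_subspaceW _ _ `[t, s] `[t, T]).
    by apply: subset_itv; rewrite bnd_simp//; move: sT; rewrite in_itv/= => /andP[].
  by move=> r; apply: continuous_comp; [exact: cQ|exact: cw].
have mm (Q : R -> R) (w : R -> R) s : s \in `[t, T] -> {within `[t, T], continuous Q} -> continuous w ->
    measurable_fun `[t, s] (fun r => w (Q r)).
  by move=> sT cQ cw; apply: subspace_continuous_measurable_fun => //; exact: cc.
have TT : T \in `[t, T] by rewrite in_itv/= tT lexx.
have sub s r : s \in `[t, T] -> r \in `[t, s] -> r \in `[t, T].
  by rewrite !in_itv/= => /andP[_ h1] /andP[-> h2]; exact: le_trans h2 h1.
have PM' s : s \in `[t, T] -> `|P s| <= M by move=> sT; have := PM s sT; lra.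
have bnd (Q w' : R -> R) s : s \in `[t, T] -> {within `[t, T], continuous Q} ->
    (forall r, r \in `[t, T] -> `|Q r| <= M) -> mu1.-integrable `[t, s] (EFin \o w') ->
    mu1.-integrable `[t, s] (EFin \o (fun r => h' (Q r) * w' r)).
  move=> sT cQ QM iw'.
  have := @integrable_Mbounded _ _ _ mu1 _ (mI s) w' (fun r => h' (Q r)) K (mm _ _ _ sT cQ ch') _ iw'.
  rewrite (_ : (fun x => w' x * h' (Q x)) = (fun r => h' (Q r) * w' r)); last first.
    by apply/funext => r; rewrite mulrC.
  by apply => r rs; apply: hK; apply: QM; exact: sub rs.
split; first exact: bnd.
move=> s sT; have := sT; rewrite in_itv/= le_eqVlt => /andP[/orP[/eqP <- _|ts sleT]].
  by rewrite set_itv1 Rintegral_set1 addr0.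
have cP' k := ac_within_continuous tT (acP' k).
have ftc k : h (P' k s) = h (P t) + \int[mu1]_(r in `[t, s]) (h' (P' k r) * g k r).
  have cI : {within `[t, s], continuous (fun r => h' (P' k r) * g k r)}.
    have cgs : {within `[t, s], continuous (g k)} by apply: continuous_subspaceT; exact: cg.
    by move=> r; apply: continuousM; [exact: cc|exact: cgs].
  have dd r : r \in `]t, s[ -> is_derive (r : R) (1 : R) (fun r => h (P' k r)) (h' (P' k r) * g k r).
    rewrite in_itv/= => /andP[tr rs].
    have [d1 d2] := continuous_FTC1_closed rs (integrable_sub_itv (ig k) sT) tr (cg k r).
    have dP : is_derive (r : R) (1 : R) (P' k) (g k r).
      have e1 : is_derive (r : R) (1 : R) (fun x => \int[mu1]_(t in `[t, x]) g k t) (g k r).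
        by apply: (DeriveDef d1); rewrite -d2 derive1E.
      by have := is_deriveD (is_derive_cst (P t) r (1 : R)) e1; rewrite add0r.
    exact: (is_derive1_comp (f := h) (g := P' k)).
  have := continuous_FTC2 (F := fun r => h (P' k r)) ts cI.
  rewrite /Rintegral => ->; first by rewrite -EFinB/= P't addrC subrK.
  - have [_ c2 c3] := (continuous_within_itvP (fun r => h (P' k r)) ts).1 (cc _ _ _ sT (cP' k) ch).
    by split => // r rs; case: (dd r rs).
  - by move=> r rs; rewrite derive1E; case: (dd r rs).
have if' := integrable_sub_itv intf sT.
have L1 : h (P' k s) @[k --> \oo] --> h (P s).
  apply: continuous_cvg; first exact: ch.
  apply/cvgrPdist_le => eps eps0; have [N _ hN] := (cvgrPdist_le _ _).1 e0 eps eps0.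
  exists N => // k Nk; have := hN k Nk; rewrite sub0r normrN => h1; rewrite distrC.
  by apply: le_trans (PP k s sT) _; apply: le_trans (ler_norm _) h1.
rewrite -(cvg_lim (@Rhausdorff R) L1); apply: cvg_lim; first exact: Rhausdorff.
under eq_cvg do rewrite ftc.
apply: cvgD; first exact: cvg_cst.
have sp k : \int[mu1]_(r in `[t, s]) (h' (P' k r) * g k r) =
    \int[mu1]_(r in `[t, s]) (h' (P' k r) * f r) - \int[mu1]_(r in `[t, s]) (h' (P' k r) * (f r - g k r)).
  rewrite -RintegralB//.
  - by apply: eq_Rintegral => r _; ring.
  - by apply: bnd => //; exact: P'M.
  - by apply: bnd => //; [exact: P'M|exact: integrable_sub_itv].
under eq_cvg do rewrite sp.
have cA : \int[mu1]_(r in `[t, s]) (h' (P' k r) * f r) @[k --> \oo] -->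
    \int[mu1]_(r in `[t, s]) (h' (P r) * f r).
  apply: (@Rintegral_dct _ _ _ mu1 _ (mI s) _ _ (fun r => K * `|f r|)).
  - move=> k; apply: measurable_funM; first exact: mm.
    by apply: (@integrable_measurable _ _ _ mu1).
  - move=> r rs; apply: cvgM; last exact: cvg_cst.
    apply: continuous_cvg; first exact: ch'.
    have rT : r \in `[t, T] by exact: sub rs.
    apply/cvgrPdist_le => eps eps0; have [N _ hN] := (cvgrPdist_le _ _).1 e0 eps eps0.
    exists N => // k Nk; have := hN k Nk; rewrite sub0r normrN => h1; rewrite distrC.
    by apply: le_trans (PP k r rT) _; apply: le_trans (ler_norm _) h1.
  - move=> k r rs; rewrite normrM ler_wpM2r//; apply: hK; apply: P'M; exact: sub rs.
  - apply: integrable_Zl => //; have := integrable_norm if'; exact.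
suff cB : \int[mu1]_(r in `[t, s]) (h' (P' k r) * (f r - g k r)) @[k --> \oo] --> (0 : R).
  by have := cvgB cA cB; rewrite subr0; exact.
apply/cvgrPdist_le => eps eps0.
have Ke : K * e k @[k --> \oo] --> (0 : R) by rewrite -[X in _ --> X](mulr0 K); apply: cvgM e0; exact: cvg_cst.
have [N _ hN] := (cvgrPdist_le _ _).1 Ke eps eps0.
exists N => // k Nk; have := hN k Nk; rewrite !sub0r !normrN => h1.
apply: le_trans (le_trans (ler_norm _) h1).
have ib : mu1.-integrable `[t, s] (EFin \o (fun r => h' (P' k r) * (f r - g k r))).
  by apply: bnd => //; [exact: P'M|exact: integrable_sub_itv].
apply: le_trans (le_normr_Rintegral _ _) _ => //.
apply: (@le_trans _ _ (\int[mu1]_(r in `[t, s]) (K * `|f r - g k r|))).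
  apply: le_Rintegral => //.
  - have := integrable_norm ib; exact.
  - by apply: integrable_Zl => //; exact: integrable_sub_itv.
  - move=> r rs; rewrite normrM ler_wpM2r//; apply: hK; apply: P'M; exact: sub rs.
rewrite RintegralZl//; last exact: integrable_sub_itv.
rewrite ler_wpM2l//; apply: ge0_Rintegral_sub => //.
by apply: subset_itv; rewrite bnd_simp.
Qed.

Lemma ac_sqr P f : t <= T -> ac P f -> ac (fun s => P s ^+ 2) (fun s => 2 * P s * f s).
Proof.
move=> tT acP; apply: (ac_comp tT acP (h := fun u => u ^+ 2)) => [u|].
  have := is_deriveX 2 (is_derive_id u (1 : R)); rewrite exprfctE => h.
  by apply: (is_derive_eq h); rewrite /= expr1 /GRing.scale/= mulr1 mulr_natl.
by move=> u; apply: cvgM; [exact: cvg_cst|exact: cvg_id].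
Qed.

(** Polarization: [4 P P'] is the difference of the squares of [P + P'] and [P - P']. *)
Lemma acM P f P' f' : t <= T -> ac P f -> ac P' f' ->
  ac (fun s => P s * P' s) (fun s => f s * P' s + P s * f' s).
Proof.
move=> tT h1 h2.
have := acB (acZ (4^-1) (ac_sqr tT (acD h1 h2))) (acZ (4^-1) (ac_sqr tT (acB h1 h2))).
by congr (ac _ _); apply/funext => s; field.
Qed.

End absolute_continuity.

(** * Regular Lagrangian flows *)

Section representative.
Context {R : realType} {n : nat} (t T : R).
Local Notation E := 'rV[R]_n.
Local Notation leb := (@lebesgue_rV R n).
Local Notation mu1 := (@lebesgue_measure R).
Implicit Types (u v w : E -> E) (X : R -> E -> E).

Lemma measurable_fun_rVB d (S : measurableType d) (f g : S -> E) : measurable_fun setT f ->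
  measurable_fun setT g -> measurable_fun setT (fun x => f x - g x).
Proof.
move=> mf mg; apply: measurable_fun_coordP => i.
rewrite (_ : (fun _ => _) = (fun x => f x ord0 i - g x ord0 i)); last first.
  by apply/funext => x; rewrite !mxE.
by apply: measurable_funB; apply: (measurableT_comp (measurable_coord i)).
Qed.

Lemma measurable_set_lt d (S : measurableType d) (f : S -> R) (r : R) : measurable_fun setT f ->
  measurable [set x | f x < r].
Proof.
move=> mf; rewrite (_ : [set x | f x < r] = setT `&` f @^-1` `]-oo, r[%classic); first exact: mf.
by rewrite setTI; apply/seteqP; split => x /=; rewrite in_itv.
Qed.

Lemma measurable_set_gt d (S : measurableType d) (f : S -> R) (r : R) : measurable_fun setT f ->
  measurable [set x | r < f x].
Proof.
move=> mf; rewrite (_ : [set x | r < f x] = setT `&` f @^-1` `]r, +oo[%classic); first exact: mf.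
by rewrite setTI; apply/seteqP; split => x /=; rewrite in_itv/= andbT.
Qed.

Lemma measurable_eball (r : R) : measurable (eball r : set E).
Proof. exact: measurable_set_lt measurable_enorm. Qed.

Lemma measurable_exceeds_in (r gamma : R) u v : measurable_fun setT u -> measurable_fun setT v ->
  measurable (exceeds_in r gamma u v).
Proof.
move=> mu mv; apply: (measurableI _ [set x | gamma < enorm (u x - v x)]); first exact: measurable_eball.
apply: measurable_set_gt; apply: (measurableT_comp measurable_enorm); exact: measurable_fun_rVB.
Qed.

Lemma exceeds_in_sym (r gamma : R) u v : exceeds_in r gamma u v = exceeds_in r gamma v u.
Proof. by apply/seteqP; split=> x [xr h]; split => //; rewrite -opprB enormN. Qed.

Lemma exceeds_in_triangle (r gamma : R) w u v :
  exceeds_in r gamma u v `<=` exceeds_in r (gamma / 2) u w `|` exceeds_in r (gamma / 2) w v.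
Proof.
move=> x [xr h]; have := enormD (u x - w x) (w x - v x); rewrite addrA subrK => tri.
have [h1|h1] := ltP (gamma / 2) (enorm (u x - w x)); [by left|right; split => //; lra].
Qed.

Lemma exceeds_in_measure_triangle (r gamma : R) w u v : measurable_fun setT u ->
  measurable_fun setT v -> measurable_fun setT w ->
  (leb (exceeds_in r gamma u v) <=
   leb (exceeds_in r (gamma / 2) u w) + leb (exceeds_in r (gamma / 2) w v))%E.
Proof.
move=> mu mv mw; have m1 := measurable_exceeds_in r (gamma / 2) mu mw.
have m2 := measurable_exceeds_in r (gamma / 2) mw mv.
apply: (le_trans _ (measureU2 leb m1 m2)); apply: le_measure.
- by rewrite inE; exact: measurable_exceeds_in.
- by rewrite inE; exact: measurableU.
- exact: exceeds_in_triangle.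
Qed.

Lemma continuous_L0loc_near X s0 (r gamma eps : R) : continuous_L0loc T t X -> s0 \in `[t, T] ->
  0 < r -> 0 < gamma -> 0 < eps -> exists2 d : R, 0 < d &
  forall s, s \in `[t, T] -> `|s - s0| < d -> (leb (exceeds_in r gamma (X s) (X s0)) <= eps%:E)%E.
Proof.
move=> [_ cX] s0T r0 g0 e0; have /fine_cvgP[h1 h2] := cX s0 s0T r gamma r0 g0.
have /nbhs_ballP[d1 /= d10 hd1] := h1.
have h3 : \forall s \near within `[t, T] (nbhs s0), `|0 - fine (leb (exceeds_in r gamma (X s) (X s0)))| <= eps.
  exact: (cvgrPdist_le _ _).1 h2 eps e0.
have /nbhs_ballP[d2 /= d20 hd2] := h3.
exists (Num.min d1 d2) => [|s sT]; first by rewrite lt_min d10.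
rewrite lt_min => /andP[sd1 sd2].
have f1 : leb (exceeds_in r gamma (X s) (X s0)) \is a fin_num.
  by apply: hd1 => //; rewrite /ball/= distrC.
rewrite -(fineK f1) lee_fin; have := hd2 s; rewrite /ball/= distrC => /(_ sd2 sT).
by rewrite sub0r normrN; exact: le_trans (ler_norm _).
Qed.

(** Compactness of [[t, T]]: near each [s0] both times are compared with [s0], at half the threshold
    and half the measure. *)
Lemma continuous_L0loc_uniform X (r gamma eps : R) : continuous_L0loc T t X ->
  0 < r -> 0 < gamma -> 0 < eps -> exists2 d : R, 0 < d &
  forall s s', s \in `[t, T] -> s' \in `[t, T] -> `|s - s'| < d ->
    (leb (exceeds_in r gamma (X s) (X s')) <= eps%:E)%E.
Proof.
move=> cX r0 g0 e0; have [mX _] := cX.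
pose P (d s : R) := forall s', s \in `[t, T] -> s' \in `[t, T] -> `|s - s'| < d ->
    (leb (exceeds_in r gamma (X s) (X s')) <= eps%:E)%E.
have nc : near_covering (`[t, T]%classic : set R).
  by apply/compact_near_coveringP; exact: segment_compact.
have H : \forall d \near (0 : R)^'+, `[t, T]%classic `<=` P d.
  apply: nc => s0 s0T.
  have g20 : 0 < gamma / 2 by lra.
  have e20 : 0 < eps / 2 by lra.
  have [d d0 hd] := continuous_L0loc_near cX s0T r0 g20 e20.
  have d20 : 0 < d / 2 by lra.
  exists (ball s0 (d / 2), [set d' : R | d' < d / 2]).
    split; first exact: nbhsx_ballx.
    exact: nbhs_right_lt.
  move=> [s d'] [/= s1 s2] s' sT s'T ss'.
  move: s1; rewrite /ball/= => s1.
  have h1 := hd s sT; have h2 := hd s' s'T.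
  have {}h1 : (leb (exceeds_in r (gamma / 2) (X s) (X s0)) <= (eps / 2)%:E)%E.
    by apply: h1; rewrite distrC; lra.
  have {}h2 : (leb (exceeds_in r (gamma / 2) (X s') (X s0)) <= (eps / 2)%:E)%E.
    apply: h2; have := ler_distD s s' s0; rewrite (distrC s' s) (distrC s s0) => h; lra.
  apply: le_trans (exceeds_in_measure_triangle r gamma (mX s sT) (mX s' s'T) (mX s0 s0T)) _.
  by rewrite (splitr eps) EFinD leeD// exceeds_in_sym.
have H0 := nbhs_right_gt (0 : R).
near (0 : R)^'+ => d; have hd : `[t, T]%classic `<=` P d by near: d.
by exists d => // s s' sT; apply: hd => //.
Unshelve. all: by end_near. Qed.

(** On each cell of the partition of time by the integer part of [u] the map depends on [x] alone.
    Negative values of [u] are truncated to zero, which is why the first cell consists of all times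
    with [u < 1]. *)
Lemma measurable_piecewise (f : nat -> E -> E) (u : R -> R) : (forall j, measurable_fun setT (f j)) ->
  measurable_fun setT u ->
  measurable_fun setT (fun z : measurableTypeR R * E => f (Num.truncn (u z.1)) z.2).
Proof.
move=> mf mu _ A mA; rewrite setTI.
pose L j : set (measurableTypeR R) := [set s | u s < j.+1%:R].
have mL j : measurable (L j) by exact: measurable_set_lt.
pose L' j := L j `\` (if j is j'.+1 then L j' else set0).
have mL' j : measurable (L' j) by apply: measurableD => //; case: j.
rewrite (_ : _ @^-1` A = \bigcup_j (L' j `*` (f j @^-1` A))).
  apply: bigcupT_measurable => j; apply: measurableX => //.
  by rewrite -[X in measurable X]setTI; exact: mf.
apply/seteqP; split=> [[s x] /= h|[s x] [j _ [/= [h1 h2] h3]]].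
  exists (Num.truncn (u s)) => //; split => //=; split; rewrite /L/= ?truncnS_gt//.
  case e : (Num.truncn (u s)) => [|j] //=.
  by rewrite -truncn_le_nat e ltnn.
suff -> : Num.truncn (u s) = j by [].
apply/eqP; rewrite eqn_leq truncn_le_nat h1/=.
by case: j h1 h2 h3 => // j _ /= h2 _; rewrite ltnNge truncn_le_nat; apply/negP.
Qed.

(** Freezing [X] at the nodes of finer and finer partitions of time gives jointly measurable maps.
    At each fixed [s] the map of step [k] differs from [X s] by more than [2^-k] within the ball of
    radius [k + 1] on a set of measure at most [2^-(k+1)] only. By Borel-Cantelli these maps
    converge to [X s] almost everywhere, and their upper limit is the representative. *)
Lemma joint_representative X : t <= T -> continuous_L0loc T t X ->
  exists Y : R -> E -> E,
    measurable_fun setT (fun z : measurableTypeR R * E => Y z.1 z.2) /\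
    forall s, s \in `[t, T] -> {ae leb, forall x, Y s x = X s x}.
Proof.
move=> tT cX; have [mX _] := cX.
have /choice[N hN] : forall k : nat, exists N : nat, forall s s', s \in `[t, T] -> s' \in `[t, T] ->
    `|s - s'| <= N.+1%:R^-1 ->
    (leb (exceeds_in k.+1%:R (2 ^- k) (X s) (X s')) <= (1 / (2 ^ k.+1)%:R)%:E)%E.
  move=> k; have g0 : 0 < 2 ^- k :> R by rewrite invr_gt0 exprn_gt0.
  have e0 : 0 < 1 / (2 ^ k.+1)%:R :> R by rewrite divr_gt0// ltr0n expn_gt0.
  have [d d0 hd] := continuous_L0loc_uniform cX (ltr0Sn R k) g0 e0.
  have [N _ hN] := near_infty_natSinv_lt (PosNum d0).
  exists N => s s' sT s'T ss'; apply: hd => //; apply: le_lt_trans ss' _; exact: hN (leqnn _).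
pose u (k : nat) (s : R) : R := `|(N k).+1%:R * (s - t)|.
(* The minimum keeps the nodes inside [[t, T]], where the flow is continuous in measure. *)
pose p (k j : nat) : R := Num.min T (t + j%:R / (N k).+1%:R).
have pT k j : p k j \in `[t, T].
  rewrite /p in_itv/= ge_min lexx le_min tT/= andbT lerDl; exact: mulr_ge0.
pose Xk k (z : measurableTypeR R * E) := X (p k (Num.truncn (u k z.1))) z.2.
have mXk k : measurable_fun setT (Xk k).
  apply: (measurable_piecewise (f := fun j => X (p k j))) => [j|]; first exact: mX.
  apply: measurableT_comp => //; apply: measurable_funM => //; exact: measurable_funB.
have close (k : nat) (s : R) : s \in `[t, T] -> `|p k (Num.truncn (u k s)) - s| <= (N k).+1%:R^-1.
  rewrite in_itv/= => /andP[ts sT].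
  have N0 : 0 < (N k).+1%:R :> R by [].
  have us : u k s = (N k).+1%:R * (s - t).
    by rewrite /u ger0_norm//; apply: mulr_ge0 => //; lra.
  have /andP[a1 a2] := truncn_itv (normr_ge0 ((N k).+1%:R * (s - t))).
  rewrite -/(u k s) us in a1 a2; rewrite us /p.
  set j := Num.truncn _ in a1 a2 *.
  have b1 : j%:R / (N k).+1%:R <= s - t by rewrite ler_pdivrMr// mulrC.
  have b2 : s - t <= j%:R / (N k).+1%:R + (N k).+1%:R^-1.
    have -> : j%:R / (N k).+1%:R + (N k).+1%:R^-1 = j.+1%:R / (N k).+1%:R :> R.
      by rewrite -(natr1 j) mulrDl mul1r.
    by rewrite ler_pdivlMr// mulrC; exact: ltW.
  move: b1 b2; set w : R := j%:R / _; set e : R := _^-1 => b1 b2.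
  have /min_idPr -> : t + w <= T by lra.
  rewrite ler_norml; apply/andP; split; lra.
pose Y s x : E := \row_i fine (limn_esup (fun k => (Xk k (s, x) ord0 i)%:E)).
exists Y; split.
  apply: measurable_fun_coordP => i.
  rewrite (_ : (fun _ => _) = (fun z : measurableTypeR R * E =>
      fine (limn_esup (fun k => (Xk k z ord0 i)%:E)))); last first.
    by apply/funext => -[s x]; rewrite mxE.
  apply: measurableT_comp => //; apply: (@measurable_fun_limn_esup _ _ R setT (fun k z => (Xk k z ord0 i)%:E)).
  move=> k; apply/measurable_EFinP; exact: (measurableT_comp (measurable_coord i)).
move=> s sT.
pose Z k : E -> E := fun x => Xk k (s, x).
have mZ k : measurable_fun setT (Z k).
  apply: (measurableT_comp (mXk k)); exact: pair1_measurable.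
pose F k := exceeds_in k.+1%:R (2 ^- k) (Z k) (X s).
have mF k : measurable (F k) := measurable_exceeds_in _ _ (mZ k) (mX s sT).
have F0 : leb (lim_sup_set F) = 0%E.
  apply: lim_sup_set_cvg0 => //; apply: (@le_lt_trans _ _ 1%:E); last exact: ltry.
  apply: le_trans (epsilon_trick0 xpredT ler01); apply: lee_nneseries => // k _.
  exact: (hN k (p k (Num.truncn (u k s))) s (pT _ _) sT (close k s sT)).
exists (lim_sup_set F); split => //.
  rewrite /lim_sup_set; apply: bigcapT_measurable => k.
  by apply: bigcup_measurable.
move=> x /= nYX k _; apply: contra_notP nYX => hk.
have {}hk j : (k <= j)%N -> ~ F j x by move=> kj Fj; apply: hk; exists j.
apply/rowP => i; rewrite mxE.
suff cv : Xk j (s, x) ord0 i @[j --> \oo] --> X s x ord0 i.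
  have cvE : (Xk j (s, x) ord0 i)%:E @[j --> \oo] --> (X s x ord0 i)%:E.
    by apply: cvg_EFin; [exact: nearW|exact: cv].
  by rewrite (cvg_limn_einf_sup cvE).2.
apply/cvgrPdist_le => e e0.
have [K1 hK1] : exists K1 : nat, enorm x < K1%:R.
  by exists (Num.truncn (enorm x)).+1; exact: truncnS_gt.
have cg : geometric 1 (2^-1 : R) k @[k --> \oo] --> (0 : R).
  by apply: cvg_geometric; rewrite ger0_norm ?invr_ge0//; rewrite invf_lt1// ltr1n.
have [K2 _ hK2] := (cvgrPdist_le _ _).1 cg e e0.
exists (maxn k (maxn K1 K2)) => // j; rewrite /= !geq_max => /andP[kj /andP[K1j K2j]].
have nF := hk j kj.
have xj : eball j.+1%:R x.
  by rewrite /eball/=; apply: lt_trans hK1 _; rewrite ltr_nat ltnS.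
have h1 : enorm (Xk j (s, x) - X s x) <= 2 ^- j by rewrite leNgt; apply/negP => h; apply: nF.
have h2 := hK2 j K2j; rewrite /geometric/= mul1r sub0r normrN exprVn in h2.
rewrite distrC; have := coord_le_norm (Xk j (s, x) - X s x) i; rewrite !mxE => h3.
apply: le_trans h3 _; apply: le_trans (norm_le_enorm _) _; apply: le_trans h1 _.
exact: le_trans (ler_norm _) h2.
Qed.

End representative.

Section nonmeasurable_comparison.
Context d (S : measurableType d) {R : realType} (mu : {measure set S -> \bar R}).
Import HBNNSimple.

(** Monotonicity read off the definition by simple functions. It serves for functions of time whose
    measurability is not at hand, such as essential suprema in space. *)
Lemma le_integral_off_null (N D1 D2 : set S) (f g : S -> \bar R) : measurable N -> mu N = 0%E ->
  D1 `<=` D2 -> (forall x, D1 x -> 0 <= f x)%E -> (forall x, D2 x -> 0 <= g x)%E ->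
  (forall x, D1 x -> ~ N x -> f x <= g x)%E ->
  (\int[mu]_(x in D1) f x <= \int[mu]_(x in D2) g x)%E.
Proof.
move=> mN N0 D12 f0 g0 fg.
pose f' x := if x \in N then 0%E else f x.
have -> : (\int[mu]_(x in D1) f x = \int[mu]_(x in D1) f' x)%E.
  by apply: (eq_integral_off_null mN N0) => x _ xN; rewrite /f' memNset.
have f'0 x : D1 x -> (0 <= f' x)%E by rewrite /f'; case: ifP => // _; exact: f0.
rewrite (integral_mkcond D1) (integral_mkcond D2) !ge0_integralTE.
- apply: ge_ereal_sup => _ [h hf <-]; apply: ereal_sup_ubound; exists h => // x.
  apply: le_trans (hf x) _; rewrite !patchE.
  case: ifPn => [/set_mem xD1|_].
    rewrite mem_set; last exact: D12.
    rewrite /f'; case: ifPn => [_|/negP xN]; first by apply: g0; exact: D12.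
    by apply: fg => // Nx; apply: xN; exact: mem_set.
  by case: ifPn => // /set_mem; exact: g0.
- by move=> x; rewrite patchE; case: ifPn => // /set_mem; exact: g0.
- by move=> x; rewrite patchE; case: ifPn => // /set_mem; exact: f'0.
Qed.

End nonmeasurable_comparison.

(** * Maps of bounded compression *)

Section compression.
Context {R : realType} {n : nat}.
Local Notation E := 'rV[R]_n.
Local Notation leb := (@lebesgue_rV R n).
Implicit Types (L : R) (u : E -> E).

Definition compressive L u := [/\ 0 <= L, measurable_fun setT u &
  forall B : set E, measurable B -> (leb (u @^-1` B) <= L%:E * leb B)%E].

Lemma compressive_id : compressive 1 (@id E).
Proof. by split => // B _; rewrite mul1e preimage_id. Qed.

Lemma compressive_flow T t X L s u : compression_constant T t X L -> continuous_L0loc T t X ->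
  s \in `[t, T] -> measurable_fun setT u -> {ae leb, forall x, u x = X s x} -> compressive L u.
Proof.
move=> [L0 hL] [mX _] sT mu [N [mN N0 hN]]; split => // B mB.
have mBu : measurable (u @^-1` B) by rewrite -[X in measurable X]setTI; exact: mu.
have mBX : measurable (X s @^-1` B) by rewrite -[X in measurable X]setTI; exact: mX.
suff -> : leb (u @^-1` B) = leb (X s @^-1` B) by exact: hL.
have e A : measurable A -> leb A = (\int[leb]_x (\1_A x)%:E)%E.
  by move=> mA; rewrite integral_indic// setIT.
rewrite (e _ mBu) (e _ mBX); apply: (eq_integral_off_null mN N0) => x _ xN.
have uX : u x = X s x by apply: contra_notP xN => h; apply: hN.
by rewrite !indicE; congr ((_ : bool)%:R%:E); apply/idP/idP => /set_mem/= h; apply/mem_set;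
  rewrite /preimage/= ?uX// -uX.
Qed.

Lemma compressive_integral L u (h : E -> \bar R) : compressive L u -> measurable_fun setT h ->
  (forall z, 0 <= h z)%E -> (\int[leb]_x h (u x) <= L%:E * \int[leb]_z h z)%E.
Proof.
move=> [L0 mu hL] mh h0.
have h1 := @ge0_integral_pushforward _ _ _ _ R u mu leb setT h measurableT mh (fun y _ => h0 y).
rewrite preimage_setT in h1.
rewrite (_ : (\int[leb]_x h (u x))%E = (\int[leb]_x (h \o u) x)%E)// -h1.
rewrite -(@ge0_integral_mscale _ _ R leb setT measurableT (NngNum L0) h mh (fun x _ => h0 x)).
by apply: ge0_le_measure_integral => // B mB; exact: hL.
Qed.

Lemma compressive_ae L u (P : E -> Prop) : compressive L u -> {ae leb, forall z, P z} ->
  {ae leb, forall x, P (u x)}.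
Proof.
move=> [L0 mu hL] [N [mN N0 hN]]; exists (u @^-1` N); split.
- by rewrite -[X in measurable X]setTI; exact: mu.
- by apply/eqP; rewrite eq_le measure_ge0 andbT; apply: le_trans (hL N mN) _; rewrite N0 mule0.
- by move=> x /= nP; exact: hN.
Qed.

End compression.

(** * Growth of the field along a flow *)

Section growth.
Context {R : realType} {n : nat} (T : R) (n0 : (0 < n)%N).
Local Notation E := 'rV[R]_n.
Local Notation leb := (@lebesgue_rV R n).
Local Notation mu1 := (@lebesgue_measure R).
Local Notation mu := (@spacetime_measure R n).
Implicit Types (c Y : R -> E -> E) (L t : R).

Lemma ae_spacetime_slice (P : R -> E -> Prop) : {ae mu, forall z, P z.1 z.2} ->
  {ae mu1, forall s, {ae leb, forall x, P s x}}.
Proof.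
move=> [N [mN N0 hN]].
have m1 : measurable_fun setT (fun s => leb (xsection N s)) by exact: measurable_fun_xsection.
have I0 : (\int[mu1]_s `|leb (xsection N s)| = 0)%E.
  rewrite -[RHS]N0 /spacetime_measure /=; apply: eq_integral => s _.
  by rewrite gee0_abs// measure_ge0.
have := (@ae_eq_integral_abs _ _ _ mu1 setT measurableT _ m1).1 I0.
move=> h; apply: (ae_imp h) => s /(_ Logic.I) h1.
exists (xsection N s); split => //; first exact: measurable_xsection.
by move=> x nP; rewrite /xsection/= inE; exact: hN.
Qed.

(** It bounds the rate of change of [ln (1 + |z|)] along the field, and it is the quantity that the
    growth condition controls. *)
Definition relative_speed c (s : R) (z : E) : R := enorm (c s z) / (1 + enorm z).

Lemma enorm1_gt0 (z : E) : 0 < 1 + enorm z.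
Proof. by rewrite ltr_pwDl// enorm_ge0. Qed.

Lemma relative_speed_ge0 c s z : 0 <= relative_speed c s z.
Proof. by rewrite /relative_speed divr_ge0 ?enorm_ge0// ltW// enorm1_gt0. Qed.

Lemma growth_slice c c1 c2 : growth_decomposition T c c1 c2 ->
  {ae mu1, forall s, s \in `]0, T[ -> {ae leb, forall z,
    relative_speed c s z <= enorm (c1 s z) + enorm (c2 s z)}}.
Proof.
move=> [_ _ _ _ h].
apply: (ae_imp (ae_spacetime_slice (P := fun s z => slab 0 T (s, z) ->
   (1 + enorm z)^-1 *: c s z = c1 s z + c2 s z) h)) => s hs sT.
apply: (ae_imp hs) => z hz; have := hz (conj sT Logic.I) => e.
have z0 := enorm1_gt0 z.
rewrite /relative_speed mulrC -(@ger0_norm _ (1 + enorm z)^-1); last by rewrite invr_ge0; exact: ltW.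
rewrite -enormZ; rewrite e; exact: enormD.
Qed.

Lemma slab_measurable_flow d (V : measurableType d) t (v : R -> E -> V) Y : 0 <= t ->
  measurable_fun (slab 0 T : set (measurableTypeR R * E)) (fun z => v z.1 z.2) ->
  measurable_fun (setT : set (measurableTypeR R * E)) (fun z => Y z.1 z.2) ->
  measurable_fun (slab t T : set (measurableTypeR R * E)) (fun z => v z.1 (Y z.1 z.2)).
Proof.
move=> t0 mv mY.
apply: (@measurable_comp _ _ _ _ _ V (slab 0 T : set (measurableTypeR R * E)) (fun z => v z.1 z.2)
   (slab t T) (fun z : measurableTypeR R * E => (z.1, Y z.1 z.2))) => //.
- exact: measurable_slab.
- move=> _ [[s x] [/= h _] <-]; split => //=; move: h; rewrite !in_itv/= => /andP[h ->].
  by rewrite (le_lt_trans t0 h).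
apply: measurable_funTS; apply/measurable_fun_pairP; split => //; exact: measurable_fst.
Qed.

Lemma leb_setT_gt0 : (0 < leb setT)%E.
Proof.
apply: (@lt_le_trans _ _ (leb [set x : E | `|x| < 1])).
  by rewrite (lebesgue_cube n (@ltr01 R)) lte_fin exprn_gt0// mulr_gt0.
by apply: le_measure => //; rewrite inE//; exact: measurable_lt_norm.
Qed.

(** The part [c1] is integrated over the whole space and costs the compression constant. The part
    [c2], bounded in space, costs only the measure of [A]: compression pulls null sets back to null
    sets, so the essential bound persists along the flow. *)
Lemma flow_speed_bound t c c1 c2 Y L (A : set E) (a : R) : 0 <= t -> 0 <= L ->
  measurable_field T c -> growth_decomposition T c c1 c2 ->
  measurable_fun (setT : set (measurableTypeR R * E)) (fun z => Y z.1 z.2) ->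
  (forall s, s \in `]t, T[ -> compressive L (Y s)) ->
  measurable A -> leb A = a%:E ->
  (\int[mu]_(z in slab t T) (relative_speed c z.1 (Y z.1 z.2) * \1_A z.2)%:E <=
    L%:E * norm_L1L1 T c1 + a%:E * norm_L1Linfty T c2)%E.
Proof.
move=> t0 L0 mc gd mY cY mA lA.
have a0 : 0 <= a by rewrite -lee_fin -lA measure_ge0.
have [mc1 f1 mc2 f2 _] := gd.
have tT s : s \in `]t, T[ -> s \in `]0, T[.
  by rewrite !in_itv/= => /andP[h ->]; rewrite (le_lt_trans t0 h).
have mDt : measurable (slab t T : set (measurableTypeR R * E)) by exact: measurable_slab.
have mI2 : measurable_fun (slab t T : set (measurableTypeR R * E)) (fun z => \1_A z.2 : R).
  by apply: measurable_funTS; apply: (measurableT_comp (f := \1_A : E -> R)) => //; exact: measurable_snd.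
have men (v : R -> E -> E) : measurable_field T v ->
    measurable_fun (slab t T : set (measurableTypeR R * E)) (fun z => enorm (v z.1 (Y z.1 z.2))).
  by move=> mv; apply: (measurableT_comp measurable_enorm); exact: (slab_measurable_flow t0 mv mY).
have mq : measurable_fun (slab t T : set (measurableTypeR R * E))
    (fun z => relative_speed c z.1 (Y z.1 z.2) * \1_A z.2).
  apply: measurable_funM => //; apply: measurable_funM; first exact: men.
  apply: measurable_funTS; apply: measurable_fun_invr_gt0.
    by move=> z; exact: enorm1_gt0.
  by apply: measurable_funD => //; apply: (measurableT_comp measurable_enorm).
pose F1 z := (enorm (c1 z.1 (Y z.1 z.2)))%:E.
pose F2 z := (enorm (c2 z.1 (Y z.1 z.2)) * \1_A z.2)%:E.
have ind0 x : 0 <= \1_A x :> R by [].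
have mF1 : measurable_fun (slab t T : set (measurableTypeR R * E)) F1 by apply/measurable_EFinP; exact: men.
have mF2 : measurable_fun (slab t T : set (measurableTypeR R * E)) F2.
  by apply/measurable_EFinP; apply: measurable_funM => //; exact: men.
have F10 z : (0 <= F1 z)%E by rewrite lee_fin enorm_ge0.
have F20 z : (0 <= F2 z)%E by rewrite lee_fin; apply: mulr_ge0 => //; exact: enorm_ge0.
pose J1 s := (\int[leb]_x F1 (s, x))%E.
pose J2 s := (\int[leb]_x F2 (s, x))%E.
have mJ1 : measurable_fun (`]t, T[%classic : set (measurableTypeR R)) J1.
  by apply: slab_measurable_section.
have mJ2 : measurable_fun (`]t, T[%classic : set (measurableTypeR R)) J2.
  by apply: slab_measurable_section.
have J10 s : (0 <= J1 s)%E by apply: integral_ge0.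
have J20 s : (0 <= J2 s)%E by apply: integral_ge0.
rewrite slab_Tonelli; first last.
- by move=> z _; rewrite lee_fin; apply: mulr_ge0 => //; exact: relative_speed_ge0.
- exact/measurable_EFinP.
apply: (@le_trans _ _ (\int[mu1]_(s in `]t, T[) (J1 s + J2 s))%E).
  have [N [mN N0 hN]] := growth_slice gd.
  apply: (@le_integral_off_null _ _ _ mu1 N) => //.
  - move=> s _; apply: integral_ge0 => x _; rewrite lee_fin; apply: mulr_ge0 => //; exact: relative_speed_ge0.
  - by move=> s _; apply: adde_ge0.
  move=> s st sN.
  have {}sN : {ae leb, forall z, relative_speed c s z <= enorm (c1 s z) + enorm (c2 s z)}.
    by apply: contra_notP sN => h; apply: hN => /= h1; apply: h; apply: h1; exact: tT.
  have [N' [mN' N'0 hN']] := compressive_ae (cY s st) sN.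
  have ms (v : R -> E -> E) : measurable_field T v -> measurable_fun setT (fun x => enorm (v s (Y s x))).
    by move=> mv; exact: (slab_section_measurable (men v mv) st).
  rewrite /J1 /J2 -ge0_integralD//; first last.
  - apply/measurable_EFinP; apply: measurable_funM; [exact: ms|exact: measurable_indic].
  - by apply/measurable_EFinP; exact: ms.
  apply: (@le_integral_off_null _ _ _ leb N') => //.
  - by move=> x _; rewrite lee_fin; apply: mulr_ge0 => //; exact: relative_speed_ge0.
  - by move=> x _; apply: adde_ge0.
  move=> x _ xN; have {}xN : relative_speed c s (Y s x) <= enorm (c1 s (Y s x)) + enorm (c2 s (Y s x)).
    by apply: contra_notP xN => h; apply: hN'.
  rewrite /F1 /F2 -EFinD lee_fin /= indicE; case: (x \in A) => /=; rewrite ?mulr1 ?mulr0//.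
  by rewrite addr0 enorm_ge0.
rewrite ge0_integralD//; apply: leeD.
  rewrite /norm_L1L1 -ge0_integralZl//; first last.
  - by move=> s _; apply: integral_ge0 => x _; rewrite lee_fin enorm_ge0.
  - apply: (slab_measurable_section (t0 := 0) (t1 := T) (f := fun z => (enorm (c1 z.1 z.2))%:E)).
      by apply/measurable_EFinP; apply: (measurableT_comp measurable_enorm).
    by move=> z _; rewrite lee_fin enorm_ge0.
  apply: (@le_integral_off_null _ _ _ mu1 set0) => //.
  - by move=> s _; apply: mule_ge0; rewrite ?lee_fin//; apply: integral_ge0 => x _; rewrite lee_fin enorm_ge0.
  move=> s st _; apply: (compressive_integral (h := fun z => (enorm (c1 s z))%:E) (cY s st)).
    apply/measurable_EFinP.
    apply: (slab_section_measurable (t0 := 0) (t1 := T) (f := fun z => enorm (c1 z.1 z.2)) (s := s)); last exact: tT.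
    by apply: (measurableT_comp measurable_enorm).
  by move=> z; rewrite lee_fin enorm_ge0.
have J2le s : s \in `]t, T[ -> (J2 s <= a%:E * ess_sup leb (fun x => (enorm (c2 s x))%:E))%E.
  move=> st; have := ess_sup_ge leb (fun x => (enorm (c2 s x))%:E).
  move=> /(compressive_ae (cY s st)) [N [mN N0 hN]].
  rewrite -lA muleC -integral_cst//.
  rewrite (integral_mkcond A); apply: (@le_integral_off_null _ _ _ leb N) => //.
  - move=> x _; rewrite patchE; case: ifP => // _; apply: ess_sup_gee; first exact: leb_setT_gt0.
    by apply: aeW => y; rewrite lee_fin enorm_ge0.
  move=> x _ xN; rewrite patchE /F2 /= indicE; case: ifPn => xA; last by rewrite mulr0.
  by rewrite mulr1; apply: contra_notP xN => h; apply: hN.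
have es0 s : (0 <= ess_sup leb (fun x => (enorm (c2 s x))%:E))%E.
  by apply: ess_sup_gee; [exact: leb_setT_gt0|apply: aeW => y; rewrite lee_fin enorm_ge0].
(* The essential supremum is not known to be measurable in time, so the constant [a] is factored out
   of [J2], which is measurable, rather than out of the bound; this divides by [a]. *)
have [a00|a00] := eqVneq a 0.
  rewrite a00 mul0e integral0_eq// => s st; apply/eqP; rewrite eq_le J20 andbT.
  by apply: le_trans (J2le s st) _; rewrite a00 mul0e.
have a1 : 0 < a by rewrite lt_neqAle eq_sym a00.
rewrite (_ : J2 = (fun s => a%:E * ((a^-1)%:E * J2 s))%E); last first.
  by apply/funext => s; rewrite muleA -EFinM divff// mul1e.
rewrite ge0_integralZl//; first last.
- by move=> s _; apply: mule_ge0; rewrite ?lee_fin ?invr_ge0.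
- by apply: measurable_funeM.
apply: lee_wpmul2l => //; rewrite /norm_L1Linfty.
apply: (@le_integral_off_null _ _ _ mu1 set0) => //.
- by move=> s _; apply: mule_ge0; rewrite ?lee_fin ?invr_ge0.
- by move=> s st _; rewrite muleC lee_pdivrMr// muleC; exact: J2le.
Qed.

(** [flow_speed_bound] along the identity, whose compression constant is one, over a cube, on which
    [1 + |z|] is bounded. *)
Lemma growth_locally_integrable c c1 c2 i : measurable_field T c -> growth_decomposition T c c1 c2 ->
  slab_locally_integrable T (fun z => c z.1 z.2 ord0 i).
Proof.
move=> mc gd r; have [mc1 f1 mc2 f2 _] := gd.
have [r0|r0] := leP r 0.
  rewrite (_ : EFin \o _ = cst 0%E); first exact: integrable0.
  apply/funext => z /=; rewrite indicE memNset ?mulr0//= => h; have := normr_ge0 z.2; lra.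
have mD := measurable_slab (n := n) 0 T.
have h := flow_speed_bound (Y := fun _ x => x) (L := 1) (lexx 0) ler01 mc gd measurable_snd
  (fun s _ => compressive_id) (measurable_lt_norm r) (lebesgue_cube n r0).
have mr : measurable_fun (slab 0 T : set (measurableTypeR R * E)) (fun z => relative_speed c z.1 z.2).
  apply: measurable_funM; first by apply: (measurableT_comp measurable_enorm).
  apply: measurable_funTS; apply: measurable_fun_invr_gt0; first by move=> z; exact: enorm1_gt0.
  by apply: measurable_funD => //; apply: (measurableT_comp measurable_enorm); exact: measurable_snd.
have mI : measurable_fun (slab 0 T : set (measurableTypeR R * E)) (fun z => \1_[set x : E | `|x| < r] z.2 : R).
  by apply: measurable_funTS; exact: measurable_indic_snd.
have mci : measurable_fun (slab 0 T : set (measurableTypeR R * E)) (fun z => c z.1 z.2 ord0 i).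
  by apply: (measurableT_comp (measurable_coord i)).
have h2 : mu.-integrable (slab 0 T) (EFin \o (fun z : measurableTypeR R * E =>
    relative_speed c z.1 z.2 * \1_[set x : E | `|x| < r] z.2)).
  apply/integrableP; split; first by apply/measurable_EFinP; exact: measurable_funM.
  under eq_integral => z _.
    rewrite /= ger0_norm; last by apply: mulr_ge0 => //; exact: relative_speed_ge0.
    over.
  apply: le_lt_trans h _; rewrite mul1e; apply: lte_add_pinfty => //.
  apply: lte_mul_pinfty => //; rewrite lee_fin; apply: exprn_ge0; apply: mulr_ge0 => //; exact: ltW.
have h3 := integrable_Zl mD (1 + n%:R * r) h2.
apply: (integrable_dominated mD _ _ h3); first exact: measurable_funM.
move=> z _; rewrite normrM indicE; have [zr|zr] := ltP `|z.2| r; last first.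
  rewrite memNset/=; last by apply/negP; rewrite -leNgt.
  by rewrite normr0 !mulr0.
rewrite mem_set// normr1 !mulr1 /relative_speed.
have z0 := enorm1_gt0 z.2.
apply: le_trans (coord_le_norm _ i) _; apply: le_trans (norm_le_enorm _) _.
rewrite mulrCA -[X in X <= _]mulr1; apply: ler_wpM2l; first exact: enorm_ge0.
rewrite ler_pdivlMr// mul1r lerD2l; apply: le_trans (enorm_le_norm _) _.
by apply: ler_wpM2l => //; exact: ltW.
Qed.

End growth.

(** * A one-sided approximate identity in time *)

Section step_approximate_identity.
Context {R : realType}.
Local Notation mu1 := (@lebesgue_measure R).
Implicit Types (a s : R) (G : R -> R).

Definition ramp m a s : R := step (m.+1%:R * (s - a)).
Definition ramp' m a s : R := m.+1%:R * 'D_1 (@step R) (m.+1%:R * (s - a)).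

Lemma ramp_affine m a : ramp m a = (fun s => step (m.+1%:R * s + - (m.+1%:R * a))).
Proof. by apply/funext => s; rewrite /ramp mulrBr. Qed.

Lemma smooth_ramp m a : smooth (ramp m a).
Proof. by rewrite ramp_affine; apply: smooth_affine_R; exact: smooth_step. Qed.

Lemma is_derive_ramp m a s : is_derive s (1 : R) (ramp m a) (ramp' m a s).
Proof.
have h1 : is_derive s (1 : R) (fun s => m.+1%:R * (s - a)) (m.+1%:R).
  have := is_deriveZ m.+1%:R (is_deriveB (is_derive_id s (1 : R)) (is_derive_cst a s (1 : R))).
  by rewrite subr0 /GRing.scale/= mulr1.
have h2 : is_derive (m.+1%:R * (s - a)) (1 : R) (@step R) ('D_1 (@step R) (m.+1%:R * (s - a))).
  by apply: derivableP; apply: diff_derivable; apply: smooth_differentiable; exact: smooth_step.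
have := is_derive1_comp (g := fun s => m.+1%:R * (s - a)) h2 h1; rewrite mulrC; exact.
Qed.

Lemma derive_ramp m a s : 'D_1 (ramp m a) s = ramp' m a s.
Proof. by case: (is_derive_ramp m a s). Qed.

Lemma continuous_ramp' m a : continuous (ramp' m a).
Proof.
have -> : ramp' m a = 'D_1 (ramp m a) by apply/funext => s; rewrite derive_ramp.
by apply: smooth_continuous; apply: smooth_derive; exact: smooth_ramp.
Qed.

Lemma ramp_eq0 m a s : s <= a -> ramp m a s = 0.
Proof. by move=> sa; apply: step_eq0; rewrite pmulr_rle0// subr_le0. Qed.

Lemma ramp_eq1 m a s : a + m.+1%:R^-1 <= s -> ramp m a s = 1.
Proof.
move=> sa; apply: step_eq1; rewrite -[X in X <= _](@mulfV R m.+1%:R)// ler_pM2l//.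
by rewrite lerBrDl.
Qed.

Lemma ramp'_eq0 m a s : ~~ (a <= s <= a + m.+1%:R^-1) -> ramp' m a s = 0.
Proof.
rewrite negb_and -!ltNge => h; rewrite -derive_ramp.
have : \forall y \near s, ramp m a y = ramp m a s.
  case/orP : h => h.
    near=> y; rewrite !ramp_eq0//; first exact: ltW.
    by apply: ltW; near: y; exact: lt_nbhsl.
  near=> y; rewrite !ramp_eq1//; first exact: ltW.
  by apply: ltW; near: y; exact: lt_nbhsr.
by move=> hn; rewrite (@near_eq_derive _ _ _ _ (cst (ramp m a s)))// derive_cst.
Unshelve. all: by end_near. Qed.

Lemma integral_ramp' m a : \int[mu1]_(s in `[a, a + m.+1%:R^-1]) ramp' m a s = 1.
Proof.
have aa : a < a + m.+1%:R^-1 by rewrite ltrDl invr_gt0.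
rewrite /Rintegral (continuous_FTC2 (F := ramp m a) aa).
- by rewrite ramp_eq1// ramp_eq0// sube0.
- apply: continuous_subspaceT; exact: continuous_ramp'.
- split.
  + by move=> s _; case: (is_derive_ramp m a s).
  + by apply: cvg_at_right_filter; apply: smooth_continuous; exact: smooth_ramp.
  + by apply: cvg_at_left_filter; apply: smooth_continuous; exact: smooth_ramp.
- by move=> s _; rewrite derive1E derive_ramp.
Qed.

(** [ramp' m a] has integral one, is supported in [[a, a + 1 / (m + 1)]] and is at most [C (m + 1)]
    in absolute value, so its total variation is at most [C]. The values of [G] just after [a] are
    the only ones that count, whence the one-sided continuity. *)
Lemma ramp'_cvg (t0 t1 : R) a G : t0 < a -> a < t1 ->
  mu1.-integrable `]t0, t1[ (EFin \o G) ->
  (forall e : R, 0 < e -> exists2 d : R, 0 < d & forall s, a <= s -> s < a + d -> `|G s - G a| <= e) ->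
  \int[mu1]_(s in `]t0, t1[) (G s * ramp' m a s) @[m --> \oo] --> G a.
Proof.
move=> ta at1 iG cG; have [C C0 hC] := @step_derive_bounded R.
apply/cvgrPdist_le => e e0.
have C10 : 0 < C + 1 by lra.
have [d d0 hd] := cG (e / (C + 1)) (divr_gt0 e0 C10).
have dd0 : 0 < Num.min d (t1 - a) by rewrite lt_min d0 subr_gt0.
have [N _ hN] := near_infty_natSinv_lt (PosNum dd0).
exists N => // m /hN /=; rewrite lt_min => /andP[md mt].
pose I := `[a, a + m.+1%:R^-1]%classic : set R.
have mI : measurable I by exact: measurable_itv.
have It : I `<=` `]t0, t1[%classic.
  move=> s /=; rewrite !in_itv/= => /andP[h1 h2]; have {}h2 : s <= a + m.+1%:R^-1 := h2.
  rewrite (lt_le_trans ta h1)/=.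
  by apply: le_lt_trans h2 _; rewrite -ltrBrDl.
have m0 : 0 < m.+1%:R^-1 :> R by rewrite invr_gt0.
have mr : measurable_fun I (ramp' m a).
  by apply: measurable_funTS; apply: continuous_measurable_fun; exact: continuous_ramp'.
have rb s : `|ramp' m a s| <= C * m.+1%:R.
  by rewrite /ramp' normrM ger0_norm// mulrC ler_wpM2r.
have iGI : mu1.-integrable I (EFin \o G) by exact: integrableS iG.
have fI : (mu1 I < +oo)%E by rewrite lebesgue_measure_itv/=; case: ifP => _; rewrite ltry.
have lI : fine (mu1 I) = m.+1%:R^-1.
  by rewrite /I lebesgue_measure_itv/= lte_fin ltrDl m0 -EFinB/= addrAC subrr add0r.
have ic (k : R) : mu1.-integrable I (EFin \o cst k).
  by apply: measurable_bounded_integrable => //; exact: bounded_cst.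
have ir : mu1.-integrable I (EFin \o ramp' m a).
  exact: (@integrable_dominated _ _ _ mu1 I mI _ (cst (C * m.+1%:R)) mr (fun s _ => rb s) (ic _)).
have iGr : mu1.-integrable I (EFin \o (fun s => G s * ramp' m a s)).
  exact: (@integrable_Mbounded _ _ _ mu1 I mI G (ramp' m a) (C * m.+1%:R) mr (fun s _ => rb s) iGI).
have -> : \int[mu1]_(s in `]t0, t1[) (G s * ramp' m a s) = \int[mu1]_(s in I) (G s * ramp' m a s).
  rewrite -[in RHS](setIidr It) Rintegral_mkcondr; apply: eq_Rintegral => s _; rewrite patchE.
  case: ifPn => // /negP sI; rewrite ramp'_eq0 ?mulr0//; apply/negP => h; apply: sI; apply/mem_set.
  by rewrite /I/= in_itv.
have {1}-> : G a = \int[mu1]_(s in I) (G a * ramp' m a s).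
  by rewrite RintegralZl// integral_ramp' mulr1.
rewrite -RintegralB//; last exact: integrable_Zl.
have iD : mu1.-integrable I (EFin \o (fun s => G a * ramp' m a s - G s * ramp' m a s)).
  by apply: integrable_B => //; exact: integrable_Zl.
apply: le_trans (le_normr_Rintegral _ _) _ => //.
apply: (@le_trans _ _ (\int[mu1]_(s in I) (e / (C + 1) * (C * m.+1%:R)))).
  apply: le_Rintegral => //.
  - have := integrable_norm iD; exact.
  - exact: ic.
  move=> s; rewrite /I/= in_itv/= => /andP[s1 s2].
  rewrite -mulrBl normrM; apply: ler_pM => //; rewrite distrC; apply: hd => //.
  by apply: le_lt_trans s2 _; rewrite ltrD2l.
rewrite Rintegral_cst// lI.
rewrite mulrA mulfK// -mulrA -[X in _ <= X]mulr1 ler_pM2l// mulrC ler_pdivrMr// mul1r; lra.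
Qed.

End step_approximate_identity.

(** * The fundamental lemma in space *)

Section fundamental_lemma_rV.
Context {R : realType} {n : nat}.
Local Notation E := 'rV[R]_n.
Local Notation leb := (@lebesgue_rV R n).
Local Notation mu1 := (@lebesgue_measure R).
Local Notation mu := (@spacetime_measure R n).

(** Seen as a function of space-time that is constant during a unit of time, [v] falls under the
    convergence of mollifications on slabs, and all its mollifications vanish. *)
Lemma du_bois_reymond_rV (v : E -> R) : measurable_fun setT v -> locally_integrable_rV v ->
  (forall zeta, test_function setT zeta -> \int[leb]_x (v x * zeta x) = 0) ->
  {ae leb, forall x, v x = 0}.
Proof.
move=> mv lv h.
pose D : set (measurableTypeR R * E) := slab 0 1.
pose u (z : R * E) := v z.2.
have mD : measurable D by exact: measurable_slab.
have mu_ : measurable_fun D u.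
  by apply: measurable_funTS; apply: (measurableT_comp mv); exact: measurable_snd.
have sec (w : E -> R) : measurable_fun setT w -> (forall x, 0 <= w x) ->
    (\int[mu]_(z in D) (w z.2)%:E = \int[leb]_x (w x)%:E)%E.
  move=> mw w0; rewrite slab_Tonelli//=.
  - rewrite integral_cst//= lebesgue_measure_itv/= lte_fin ltr01 -EFinB subr0 mule1; exact.
  - apply/measurable_EFinP; apply: measurable_funTS; apply: (measurableT_comp mw); exact: measurable_snd.
  - by move=> z _; rewrite lee_fin.
have mind (r : R) : measurable_fun setT (\1_[set x : E | `|x| < r] : E -> R).
  by apply: measurable_indic; exact: measurable_lt_norm.
have lu : slab_locally_integrable 1 u.
  move=> r; have /integrableP[m1 f1] := locally_integrable_rVP r lv.
  apply/integrableP; split.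
    by apply/measurable_EFinP; apply: measurable_funM => //; apply: measurable_funTS; exact: measurable_indic_snd.
  have := sec (fun x => `|v x * \1_[set x : E | `|x| < r] x|) _ (fun x => normr_ge0 _).
  move=> -> //; apply: measurableT_comp => //; exact: measurable_funM.
have moll rho x : 0 < rho -> mollify rho v x = 0.
  move=> r0; rewrite /mollify (h _ (test_resc x r0 (@test_mollifier R n))) mulr0 //.
have zero (k : nat) : {ae leb, forall x : E, `|x| < k.+1%:R -> v x = 0}.
  pose w x := `|v x| * \1_[set x : E | `|x| < k.+1%:R] x.
  have mw : measurable_fun setT w by apply: measurable_funM => //; apply: measurableT_comp.
  have w0 x : 0 <= w x by apply: mulr_ge0.
  have I0 : (\int[leb]_x (w x)%:E = 0)%E.
    apply/eqP; rewrite eq_le; apply/andP; split; last by apply: integral_ge0 => x _; rewrite lee_fin.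
    apply/lee_addgt0Pr => e e0; rewrite add0e.
    have [J hJ] := mollify_cvg_slab ltr01 0 mu_ lu (ltr0Sn R k) e0.
    apply: le_trans hJ; rewrite -(sec w mw w0) le_eqVlt; apply/orP; left; apply/eqP.
    apply: eq_integral => -[s x] /set_mem [/= st _].
    rewrite slab_patch// (_ : (fun x0 => _) = v).
      by rewrite moll ?subr0 ?invr_gt0 ?exprn_gt0// /w mulrC.
    by apply/funext => y; rewrite slab_patch.
  have mE : measurable_fun setT (EFin \o w) by apply/measurable_EFinP.
  have := (@ae_eq_integral_abs _ _ _ leb setT measurableT _ mE).1.
  under eq_integral do rewrite /= ger0_norm//.
  move=> /(_ I0) hae; apply: (ae_imp hae) => x /(_ Logic.I) /= [wx] xk.
  move: wx; rewrite /w indicE mem_set// mulr1 => /eqP; rewrite normr_eq0 => /eqP //.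
have := ae_countable zero; move=> hae; apply: (ae_imp hae) => x hx.
by apply: (hx (Num.truncn `|x|)); exact: truncnS_gt.
Qed.

End fundamental_lemma_rV.

(** * Cutoff functions as renormalizations *)

Section cutoffs.
Context {R : realType} {n : nat}.
Local Notation E := 'rV[R]_n.
Implicit Types (beta : E -> R) (M Lam : R).

(** A concrete class of renormalizations. As the gradient vanishes outside a cube, local
    integrability of the field makes the rate [grad beta . c] integrable. *)
Definition cutoff beta M Lam := [/\ C1_on setT beta, 0 <= M /\ 0 <= Lam, forall z, `|beta z| <= M,
  forall z, enorm (grad beta z) <= M & forall z, Lam <= `|z| -> grad beta z = 0].

Lemma derive_grad beta z v : differentiable beta z -> 'D_v beta z = dotp (grad beta z) v.
Proof.
by move=> df; rewrite derive_coord//; apply: eq_bigr => j _; rewrite mxE mulrC.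
Qed.

Lemma cutoff_measurable beta M Lam : cutoff beta M Lam -> measurable_fun setT beta.
Proof.
move=> [hC _ _ _ _]; apply: continuous_measurable_rV => z.
by apply: differentiable_continuous; have [] := hC z Logic.I.
Qed.

Lemma cutoff_measurable_grad beta M Lam : cutoff beta M Lam -> measurable_fun setT (grad beta).
Proof.
move=> [hC _ _ _ _]; apply: measurable_fun_coordP => j.
rewrite (_ : (fun _ => _) = 'D_('e_j) beta); last by apply/funext => z; rewrite mxE.
by apply: continuous_measurable_rV => z; have [_] := hC z Logic.I; apply.
Qed.

Lemma cutoff_lipschitz beta M Lam x y : cutoff beta M Lam -> `|beta x - beta y| <= M * enorm (x - y).
Proof.
move=> [hC _ _ hg _].
have df z : differentiable beta z by have [] := hC z Logic.I.
have dl t : is_derive t (1 : R) (fun t => beta (y + t *: (x - y))) ('D_(x - y) beta (y + t *: (x - y))).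
  exact: is_derive_line.
have dd (t : R) : derivable (fun t : R => beta (y + t *: (x - y))) t (1 : R) by case: (dl t).
have [t _] := @MVT_segment R (fun t => beta (y + t *: (x - y))) _ 0 1 ler01 (fun t _ => dl t)
  (derivable_within_continuous (fun t _ => dd t)).
rewrite scale1r scale0r addr0 subr0 mulr1 (addrC y (x - y)) subrK => ->.
rewrite derive_grad//; apply: le_trans (dotp_CS _ _) _.
by apply: ler_wpM2r; [exact: enorm_ge0|exact: hg].
Qed.

Lemma cutoff_log_renormalization beta M Lam : cutoff beta M Lam -> log_renormalization beta.
Proof.
move=> [hC [M0 L0] hb hg hs]; split => //; exists (M * (1 + n%:R * Lam)) => z.
have z0 := enorm_ge0 z; have z1 : 0 < 1 + enorm z by rewrite ltr_pwDl.
have nL : 0 <= n%:R * Lam by apply: mulr_ge0.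
split.
  apply: le_trans (hb z) _; rewrite -mulrA -[X in X <= _]mulr1; apply: ler_wpM2l => //.
  have ln0 : 0 <= ln (1 + enorm z) by apply: ln_ge0; rewrite lerDl.
  rewrite -[X in X <= _]mulr1; apply: ler_pM => //; rewrite lerDl//.
rewrite ler_pdivlMr//; have [zL|zL] := leP Lam `|z|.
  by rewrite hs// enorm0 mul0r mulr_ge0// addr_ge0.
apply: ler_pM => //; [exact: enorm_ge0|exact: ltW|rewrite lerD2l].
apply: le_trans (enorm_le_norm _) _; apply: ler_wpM2l => //; exact: ltW.
Qed.

End cutoffs.

Section fubini_second.
Context d1 d2 (T1 : measurableType d1) (T2 : measurableType d2) {R : realType}.
Context (m1 : {sigma_finite_measure set T1 -> \bar R}) (m2 : {sigma_finite_measure set T2 -> \bar R}).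

Lemma integrable_fubini_fine (f : T1 * T2 -> R) : (m1 \x m2)%E.-integrable setT (EFin \o f) ->
  m2.-integrable setT (EFin \o (fun y => \int[m1]_x f (x, y))).
Proof.
move=> i_f; have mf := measurable_int _ i_f.
have mG := measurable_fubini_G i_f.
have iG : m2.-integrable setT (fubini_G m1 (EFin \o f)).
  have ma : measurable_fun setT (abse \o (EFin \o f)) by exact: measurableT_comp.
  have iJ : m2.-integrable setT (fubini_G m1 (abse \o (EFin \o f))).
    apply/integrableP; split; first by apply: measurable_fun_fubini_tonelli_G => // z; exact: abse_ge0.
    have -> : (\int[m2]_y `|fubini_G m1 (abse \o (EFin \o f)) y| =
        \int[m2]_y fubini_G m1 (abse \o (EFin \o f)) y)%E.
      by apply: eq_integral => y _; rewrite gee0_abs//; apply: integral_ge0 => x _; exact: abse_ge0.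
    rewrite -(@fubini_tonelli2 _ _ _ _ _ m1 m2) => [|//|z]; last exact: abse_ge0.
    by have /integrableP[] := i_f.
  apply: (le_integrable measurableT mG _ iJ) => y _.
  rewrite [X in (_ <= X)%E]gee0_abs; last by apply: integral_ge0 => x _; exact: abse_ge0.
  by apply: le_abse_integral => //; apply: measurableT_comp mf _; exact: pair2_measurable.
apply: (le_integrable measurableT _ _ iG).
  by apply/measurable_EFinP; exact: (measurableT_comp (f := fine)).
move=> y _; rewrite /= /Rintegral.
have fine_le (e : \bar R) : (`|fine e|%:E <= `|e|)%E by case: e => [r||] //=; rewrite ?normr0 ?leey.
exact: fine_le.
Qed.

End fubini_second.

(** * The equation of a flow along almost every trajectory *)

Section flow.
Context {R : realType} {n : nat} (n0 : (0 < n)%N) (T t : R) (t0 : 0 <= t) (tT : t < T).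
Local Notation E := 'rV[R]_n.
Local Notation leb := (@lebesgue_rV R n).
Local Notation mu1 := (@lebesgue_measure R).
Local Notation mu := (@spacetime_measure R n).
Context (c c1 c2 X Y : R -> E -> E) (L : R).
Context (mc : measurable_field T c) (gd : growth_decomposition T c c1 c2)
  (fX : regular_lagrangian_flow T c t X) (cL : compression_constant T t X L).
Context (mY : measurable_fun (setT : set (measurableTypeR R * E)) (fun z => Y z.1 z.2))
  (YX : forall s, s \in `[t, T] -> {ae leb, forall x, Y s x = X s x}).
Let D : set (measurableTypeR R * E) := slab t T.
Let D0 : set (measurableTypeR R * E) := slab 0 T.
Let mD : measurable D. Proof. exact: measurable_slab. Qed.
Let mD0 : measurable D0. Proof. exact: measurable_slab. Qed.
Let mI : measurable (`]t, T[%classic : set (measurableTypeR R)). Proof. exact: measurable_itv. Qed.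

Let DD0 : D `<=` D0.
Proof.
move=> [s x] [/= h _]; split => //=; move: h; rewrite !in_itv/= => /andP[h ->].
by rewrite (le_lt_trans t0 h).
Qed.

Lemma measurable_section s : measurable_fun setT (Y s).
Proof. exact: (measurableT_comp mY (@pair1_measurable _ _ (measurableTypeR R) E s)). Qed.

Lemma flow_compressive s : s \in `[t, T] -> compressive L (Y s).
Proof.
move=> sT; have [cX _ _ _ _] := fX.
exact: (compressive_flow cL cX sT (measurable_section s) (YX sT)).
Qed.

Lemma oo_cc s : s \in `]t, T[ -> s \in `[t, T].
Proof. by rewrite !in_itv/= => /andP[/ltW -> /ltW ->]. Qed.

(** Compression at each time. The time interval is enlarged from [(t, T)] to [(0, T)], which makes
    the bound independent of the initial time. *)
Lemma flow_integral_le (w : R -> E -> R) : measurable_fun D0 (fun z => w z.1 z.2) ->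
  (forall s z, 0 <= w s z) ->
  (\int[mu]_(z in D) (w z.1 (Y z.1 z.2))%:E <= L%:E * \int[mu]_(z in D0) (w z.1 z.2)%:E)%E.
Proof.
move=> mw w0; have [L0 _] := cL.
have mwY : measurable_fun D (fun z => w z.1 (Y z.1 z.2)) by exact: (slab_measurable_flow t0 mw mY).
rewrite slab_Tonelli; [|exact/measurable_EFinP|by move=> z _; rewrite lee_fin].
rewrite slab_Tonelli; [|exact/measurable_EFinP|by move=> z _; rewrite lee_fin].
rewrite -ge0_integralZl//; first last.
- by move=> s _; apply: integral_ge0 => x _; rewrite lee_fin.
- apply: (slab_measurable_section (t0 := 0) (t1 := T) (f := fun z => (w z.1 z.2)%:E)).
    exact/measurable_EFinP.
  by move=> z _; rewrite lee_fin.
apply: (@le_integral_off_null _ _ _ mu1 set0) => //.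
- by move=> s /=; rewrite !in_itv/= => /andP[h ->]; rewrite (le_lt_trans t0 h).
- by move=> s _; apply: integral_ge0 => x _; rewrite lee_fin.
- by move=> s _; apply: mule_ge0; rewrite ?lee_fin//; apply: integral_ge0 => x _; rewrite lee_fin.
move=> s /= st _; apply: (compressive_integral (h := fun z => (w s z)%:E) (flow_compressive (oo_cc st))).
  apply/measurable_EFinP; apply: (slab_section_measurable (f := fun z => w z.1 z.2) mw).
  by move: st; rewrite !in_itv/= => /andP[h ->]; rewrite (le_lt_trans t0 h).
by move=> z; rewrite lee_fin.
Qed.

Lemma flow_integrable (w : R -> E -> R) : mu.-integrable D0 (EFin \o (fun z => w z.1 z.2)) ->
  mu.-integrable D (EFin \o (fun z => w z.1 (Y z.1 z.2))).
Proof.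
move=> iw; have mw := integrable_measurable iw; have /integrableP[_ fw] := iw.
have [L0 _] := cL.
apply/integrableP; split; first by apply/measurable_EFinP; exact: (slab_measurable_flow t0 mw mY).
have := @flow_integral_le (fun s z => `|w s z|) _ (fun s z => normr_ge0 _).
move=> h; apply: le_lt_trans (h _) _; first exact: measurableT_comp.
by apply: lte_mul_pinfty; rewrite ?lee_fin.
Qed.

Context (beta : E -> R) (M Lam : R) (hb : cutoff beta M Lam).

Definition flow_rate s z : R := dotp (grad beta z) (c s z).

Lemma flow_rate_integrable : mu.-integrable D0 (EFin \o (fun z => flow_rate z.1 z.2)).
Proof.
have [hC [M0 L0] hbM hg hs] := hb.
have lc i : slab_locally_integrable T (fun z => c z.1 z.2 ord0 i).
  exact: (growth_locally_integrable _ mc gd).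
have li i := lc i (Lam + 1).
have iS := integrable_Rsum mD0 (index_enum 'I_n) (fun i => integrable_norm (li i)).
have iS' := integrable_Zl mD0 M iS.
apply: (integrable_dominated mD0 _ _ iS').
  apply: measurable_sum => i; apply: measurable_funM; last exact: (measurableT_comp (measurable_coord i) mc).
  apply: measurable_funTS; apply: (measurableT_comp (measurable_coord i)).
  by apply: (measurableT_comp (cutoff_measurable_grad hb)); exact: measurable_snd.
move=> z _; rewrite /flow_rate; apply: le_trans (dotp_CS _ _) _.
have nn : 0 <= \sum_i `|c z.1 z.2 ord0 i * \1_[set x : E | `|x| < Lam + 1] z.2|.
  by apply: sumr_ge0.
have [zL|zL] := leP Lam `|z.2|; first by rewrite hs// enorm0 mul0r mulr_ge0.
apply: ler_pM => //; [exact: enorm_ge0|exact: enorm_ge0|].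
apply: le_trans (enorm_le_sum _) _; apply: ler_sum => i _.
by rewrite /= indicE mem_set ?mulr1//=; lra.
Qed.

Let B s x := flow_rate s (Y s x).

Lemma integrable_rate : mu.-integrable D (EFin \o (fun z => B z.1 z.2)).
Proof. exact: (flow_integrable flow_rate_integrable). Qed.

Section averages.
Context (zeta : E -> R) (tz : test_function setT zeta).

Definition average s : R := \int[leb]_x (beta (Y s x) * zeta x).

Let mzeta : measurable_fun setT zeta. Proof. exact: measurable_smooth (test_smooth tz). Qed.

Let mbY : measurable_fun setT (fun z : measurableTypeR R * E => beta (Y z.1 z.2)).
Proof. exact: (measurableT_comp (cutoff_measurable hb) mY). Qed.

Lemma average_integrable s : leb.-integrable setT (EFin \o (fun x => beta (Y s x) * zeta x)).
Proof.
have [_ _ hbM _ _] := hb.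
have mb : measurable_fun setT (fun x => beta (Y s x)).
  exact: (measurableT_comp (cutoff_measurable hb) (measurable_section s)).
have := @integrable_Mbounded _ _ _ leb setT measurableT zeta _ M mb (fun x _ => hbM _) (test_integrable tz).
by apply: eq_integrable => // x _ /=; rewrite mulrC.
Qed.

Lemma average_time_integrable : mu1.-integrable `]t, T[ (EFin \o average).
Proof.
have [_ [M0 _] hbM _ _] := hb.
have [K K0 hK] := test_bounded tz; have [r r0 hr] := test_bounded_support tz.
apply: (slab_integrable_section (f := fun z => beta (Y z.1 z.2) * zeta z.2)).
apply: (integrableS mD0 mD DD0).
apply: (@integrable_slab_bounded _ _ _ _ (M * K) r).
- apply: measurable_funM; first exact: measurable_funTS.
  by apply: measurable_funTS; apply: (measurableT_comp mzeta); exact: measurable_snd.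
- by move=> z _; rewrite normrM; apply: ler_pM.
- by move=> z _ rz; rewrite hr ?mulr0.
Qed.

(** Where [X s] and [X a] differ by at most [gam], the Lipschitz bound of [beta] applies; the other
    points of the support of [zeta] form a set of measure at most [eps], on which [beta] is merely
    bounded. Both parameters are chosen so that each part costs at most [e / 2]. *)
Lemma average_continuous a (e : R) : a \in `[t, T] -> 0 < e ->
  exists2 d : R, 0 < d & forall s, s \in `[t, T] -> `|s - a| < d -> `|average s - average a| <= e.
Proof.
move=> aT e0; have [_ [M0 _] hbM _ _] := hb; have [cX _ _ _ _] := fX.
have [K K0 hK] := test_bounded tz; have [r r0 hr] := test_bounded_support tz.
pose Z := \int[leb]_x `|zeta x|.
have iz : leb.-integrable setT (EFin \o (fun x => `|zeta x|)) by have := integrable_norm (test_integrable tz); exact.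
have Z0 : 0 <= Z by apply: Rintegral_ge0.
have MZ0 : 0 < 2 * (M * Z + 1) by have := mulr_ge0 M0 Z0; lra.
have MK0 : 0 < 2 * (2 * M * K + 1) by have := mulr_ge0 M0 K0; lra.
pose gam := e / (2 * (M * Z + 1)); pose eps := e / (2 * (2 * M * K + 1)).
have g0 : 0 < gam by rewrite divr_gt0.
have eps0 : 0 < eps by rewrite divr_gt0.
(* The cube of half side [r] for the sup norm, which contains the support of [zeta], lies in the
   Euclidean ball of radius [n r]. *)
have nr0 : 0 < n%:R * r by rewrite mulr_gt0// ltr0n.
have [d d0 hd] := continuous_L0loc_near cX aT nr0 g0 eps0.
exists d => // s sT sa; have {}hd := hd s sT sa.
have [mX _] := cX.
pose A := exceeds_in (n%:R * r) gam (X s) (X a).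
have mA : measurable A by exact: (measurable_exceeds_in _ _ (mX s sT) (mX a aT)).
have fA : (leb A < +oo)%E by apply: le_lt_trans hd _; exact: ltry.
have iA : leb.-integrable setT (EFin \o (\1_A : E -> R)).
  apply/integrableP; split; first by apply/measurable_EFinP; exact: measurable_indic.
  under eq_integral => z _ do rewrite /= ger0_norm//.
  by rewrite integral_indic// setIT.
have lA : \int[leb]_x \1_A x <= eps.
  rewrite /Rintegral integral_indic// setIT -lee_fin fineK//.
  by rewrite ge0_fin_numE// measure_ge0.
rewrite /average -RintegralB//; try exact: average_integrable.
have iD : leb.-integrable setT (EFin \o (fun x => beta (Y s x) * zeta x - beta (Y a x) * zeta x)).
  by apply: integrable_B => //; exact: average_integrable.
apply: le_trans (le_normr_Rintegral _ _) _ => //.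
pose u x := M * gam * `|zeta x| + 2 * M * K * \1_A x.
have iu : leb.-integrable setT (EFin \o u) by apply: integrable_D => //; exact: integrable_Zl.
have -> : \int[leb]_x `|beta (Y s x) * zeta x - beta (Y a x) * zeta x| =
    \int[leb]_x `|beta (X s x) * zeta x - beta (X a x) * zeta x|.
  apply: eq_Rintegral_off_null; apply: (ae_imp (ae_and (YX sT) (YX aT))) => x [h1 h2] _.
  by rewrite h1 h2.
have mbX r' : r' \in `[t, T] -> measurable_fun setT (fun x => beta (X r' x) * zeta x).
  move=> rT; apply: measurable_funM => //; exact: (measurableT_comp (cutoff_measurable hb) (mX r' rT)).
have pt x : `|beta (X s x) * zeta x - beta (X a x) * zeta x| <= u x.
  have nA : 0 <= \1_A x :> R by [].
  have MK : 0 <= 2 * M * K by apply: mulr_ge0 => //; exact: mulr_ge0.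
  have Mg : 0 <= M * gam by apply: mulr_ge0 => //; exact: ltW.
  rewrite -mulrBl normrM /u; have [xr|xr] := leP r `|x|.
    by rewrite hr// normr0 !mulr0 add0r mulr_ge0.
  have [xA|xA] := boolP (x \in A).
    rewrite indicE xA mulr1 ler_wpDl//; first exact: mulr_ge0.
    apply: ler_pM => //; apply: le_trans (ler_normB _ _) _; rewrite mulr_natl mulr2n.
    by apply: lerD; exact: hbM.
  rewrite ler_wpDr//; first exact: mulr_ge0.
  apply: ler_wpM2r => //; apply: le_trans (cutoff_lipschitz _ _ hb) _; apply: ler_wpM2l => //.
  rewrite leNgt; apply/negP => h; move/negP : xA; apply; apply/mem_set; split => //.
  by rewrite /eball/=; apply: le_lt_trans (enorm_le_norm _) _; rewrite ltr_pM2l// ltr0n.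
apply: (@le_trans _ _ (\int[leb]_x u x)).
  apply: le_Rintegral => //.
  apply: (integrable_dominated measurableT _ _ iu).
    by apply: measurableT_comp => //; apply: measurable_funB; apply: mbX.
  by move=> x _; rewrite normr_id.
rewrite /u RintegralD//; try exact: integrable_Zl.
rewrite !RintegralZl//.
rewrite -/Z.
have h1 : M * gam * Z <= e / 2.
  rewrite /gam mulrAC mulrA ler_pdivrMr// [e / 2 * _]mulrA divfK ?gt_eqF//.
  by rewrite mulrC ler_pM2l//; lra.
have h2 : 2 * M * K * (\int[leb]_x \1_A x) <= e / 2.
  apply: (@le_trans _ _ (2 * M * K * eps)).
    by apply: ler_wpM2l => //; apply: mulr_ge0 => //; exact: mulr_ge0.
  rewrite /eps mulrA ler_pdivrMr// [e / 2 * _]mulrA divfK ?gt_eqF//.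
  by rewrite mulrC ler_pM2l//; lra.
lra.
Qed.

Definition rate_average s : R := \int[leb]_x (B s x * zeta x).

Lemma rate_test_integrable : mu.-integrable D (EFin \o (fun z => B z.1 z.2 * zeta z.2)).
Proof.
have [K K0 hK] := test_bounded tz.
have mz : measurable_fun D (fun z => zeta z.2).
  by apply: measurable_funTS; apply: (measurableT_comp mzeta); exact: measurable_snd.
exact: (@integrable_Mbounded _ _ _ mu D mD _ (fun z => zeta z.2) K mz (fun z _ => hK z.2) integrable_rate).
Qed.

Lemma rate_average_integrable : mu1.-integrable `]t, T[ (EFin \o rate_average).
Proof. exact: (slab_integrable_section rate_test_integrable). Qed.

Lemma flow_weak (theta : R -> R) : test_function (`]t, T[%classic : set R) theta ->
  - (\int[mu1]_(s in `]t, T[) (average s * ('D_1 theta s : R))) =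
  \int[mu1]_(s in `]t, T[) (rate_average s * theta s).
Proof.
move=> tt; have [_ _ ode _ _] := fX.
have := ode beta (cutoff_log_renormalization hb) _ (test_spacetime tt tz).
have -> : \int[mu1]_(s in `]t, T[) (\int[leb]_x (beta (X s x) *
     'D_(1, 0) (fun z : R * E => theta z.1 * zeta z.2) (s, x))) =
   \int[mu1]_(s in `]t, T[) (average s * 'D_1 theta s).
  apply: eq_Rintegral => s /set_mem st.
  have iA := average_integrable s.
  rewrite /average mulrC -(RintegralZl _ measurableT iA).
  apply: eq_Rintegral_off_null; apply: (ae_imp (YX (oo_cc st))) => x h _.
  rewrite (derive_spacetime tt tz)/= derive0 mulr0 addr0 h; ring.
move=> ->; apply: eq_Rintegral_off_null.
apply: (ae_imp (slab_section_integrable rate_test_integrable)) => s hs st.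
rewrite /rate_average mulrC -(RintegralZl _ measurableT (hs st)).
apply: eq_Rintegral_off_null; apply: (ae_imp (YX (oo_cc st))) => x h _.
rewrite /= /B /flow_rate h; ring.
Qed.

Lemma test_ramps (t0' t1' a b : R) m : t0' < a -> a <= b -> b + m.+1%:R^-1 < t1' ->
  test_function (`]t0', t1'[%classic : set R) (fun s => ramp m a s - ramp m b s).
Proof.
move=> ta ab bt; split.
  have sN : smooth (fun s => -1 * ramp m b s) by apply: smoothM; [exact: smooth_cst|exact: smooth_ramp].
  have := smoothD (smooth_ramp m a) sN.
  by congr smooth; apply/funext => s; rewrite mulN1r.
exists `[a, b + m.+1%:R^-1]%classic; split; first exact: segment_compact.
  move=> x /=; rewrite !in_itv/= => /andP[h1 h2].
  by rewrite (lt_le_trans ta h1) (le_lt_trans h2 bt).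
move=> x /=; rewrite in_itv/= => /negP; rewrite negb_and -!ltNge => /orP[x0|x1].
  by rewrite !ramp_eq0 ?subrr//; [exact: le_trans (ltW x0) ab|exact: ltW].
rewrite !ramp_eq1 ?subrr//; first exact: ltW.
by apply: le_trans (ltW x1); rewrite lerD2r.
Qed.

Lemma ramp_cvg a s : ramp m a s @[m --> \oo] --> (\1_(`]a, +oo[%classic : set R) s : R).
Proof.
have [sa|sa] := leP s a.
  rewrite indicE memNset/=; last by rewrite in_itv/= andbT; apply/negP; rewrite -leNgt.
  rewrite (_ : (fun m => _) = fun=> 0); first exact: cvg_cst.
  by apply/funext => m; rewrite ramp_eq0.
rewrite indicE mem_set/=; last by rewrite in_itv/= sa.
by apply: step_scaled_cvg; rewrite subr_gt0.
Qed.

(** The weak equation is tested with the difference of two ramps: it tends to the indicator of []a,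
    b]], while its derivative is an approximate identity at [a] minus one at [b]. *)
Lemma average_increment a b : t < a -> a <= b -> b < T ->
  average b - average a = \int[mu1]_(s in `]t, T[) (rate_average s * \1_(`]a, b]%classic : set R) s).
Proof.
move=> ta ab bT; have aT := le_lt_trans ab bT; have tb := lt_le_trans ta ab.
have cvG r' : t < r' -> r' < T ->
    \int[mu1]_(s in `]t, T[) (average s * ramp' m r' s) @[m --> \oo] --> average r'.
  move=> tr rT; apply: ramp'_cvg => //; first exact: average_time_integrable.
  move=> e e0; have rt : r' \in `[t, T] by rewrite in_itv/= !ltW.
  have [d d0 hd] := average_continuous rt e0.
  have d'0 : 0 < Num.min d (T - r') by rewrite lt_min d0 subr_gt0.
  exists (Num.min d (T - r')) => // s rs; rewrite -ltrBlDl lt_min => /andP[h1 h2].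
  apply: hd; last by rewrite ger0_norm// subr_ge0.
  rewrite in_itv/= (le_trans (ltW tr) rs)/=; apply: ltW; move: h2; rewrite ltrD2r; exact.
have iav := average_time_integrable; have ira := rate_average_integrable.
have rint m r' : mu1.-integrable `]t, T[ (EFin \o (fun s => average s * ramp' m r' s)).
  have [C C0 hC] := @step_derive_bounded R.
  apply: (@integrable_Mbounded _ _ _ mu1 _ mI average (ramp' m r') (m.+1%:R * C)) => //.
    by apply: measurable_funTS; apply: continuous_measurable_fun; exact: continuous_ramp'.
  by move=> s _; rewrite /ramp' normrM ger0_norm//; apply: ler_wpM2l.
have L1 : \int[mu1]_(s in `]t, T[) (average s * ramp' m b s) -
    \int[mu1]_(s in `]t, T[) (average s * ramp' m a s) @[m --> \oo] --> average b - average a.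
  by apply: cvgB; apply: cvG.
have L2 : \int[mu1]_(s in `]t, T[) (rate_average s * (ramp m a s - ramp m b s)) @[m --> \oo] -->
    \int[mu1]_(s in `]t, T[) (rate_average s * \1_(`]a, b]%classic : set R) s).
  apply: (@Rintegral_dct _ _ _ mu1 _ mI _ _ (fun s => `|rate_average s|)).
  - move=> m; apply: measurable_funM; first exact: integrable_measurable ira.
    apply: measurable_funTS; apply: continuous_measurable_fun => s.
    by apply: cvgB; apply: smooth_continuous; exact: smooth_ramp.
  - move=> s _; apply: cvgMl_tmp.
    have -> : \1_(`]a, b]%classic : set R) s = \1_(`]a, +oo[%classic : set R) s - \1_(`]b, +oo[%classic : set R) s :> R.
      rewrite !indicE !mem_setE !in_itv/= !andbT; case: (ltP a s) => /= h1; case: (leP s b) => h2; rewrite ?subr0 ?subrr//.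
      by have := lt_le_trans h2 (le_trans h1 ab); rewrite ltxx.
    by apply: cvgB; exact: ramp_cvg.
  - move=> m s _; rewrite normrM -[X in _ <= X]mulr1; apply: ler_wpM2l => //.
    have h1 := step_ge0 (m.+1%:R * (s - a)); have h2 := step_le1 (m.+1%:R * (s - a)).
    have h3 := step_ge0 (m.+1%:R * (s - b)); have h4 := step_le1 (m.+1%:R * (s - b)).
    rewrite /ramp ler_norml; apply/andP; split; lra.
  - have := integrable_norm ira; exact.
have Tb0 : 0 < T - b by rewrite subr_gt0.
have [N _ hN] := near_infty_natSinv_lt (PosNum Tb0).
have drv m s : 'D_1 (fun s => ramp m a s - ramp m b s) s = ramp' m a s - ramp' m b s.
  by have h := is_deriveB (is_derive_ramp m a s) (is_derive_ramp m b s); case: h.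
rewrite -(cvg_lim (@Rhausdorff R) L1); apply: cvg_lim; first exact: Rhausdorff.
apply: cvg_trans L2; apply: near_eq_cvg; exists N => // m Nm /=.
have bm : b + m.+1%:R^-1 < T by rewrite -ltrBrDl; exact: hN.
rewrite -(flow_weak (test_ramps ta ab bm)).
have -> : \int[mu1]_(s in `]t, T[) (average s * 'D_1 (fun s => ramp m a s - ramp m b s) s) =
    \int[mu1]_(s in `]t, T[) (average s * ramp' m a s) - \int[mu1]_(s in `]t, T[) (average s * ramp' m b s).
  rewrite -RintegralB//.
  by apply: eq_Rintegral => s _; rewrite drv mulrBr.
by rewrite opprB.
Qed.

(** The left endpoint tends to [t]; the initial condition enters through the continuity of the
    averages at [t]. *)
Lemma average_from_start b : t < b -> b < T ->
  average b - \int[leb]_x (beta x * zeta x) = \int[mu1]_(s in `]t, T[) (rate_average s * \1_(`]t, b]%classic : set R) s).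
Proof.
move=> tb bT; have [_ _ _ X0 _] := fX.
have tt : t \in `[t, T] by rewrite in_itv/= lexx ltW.
have -> : \int[leb]_x (beta x * zeta x) = average t.
  apply: eq_Rintegral_off_null; apply: (ae_imp (ae_and X0 (YX tt))) => x [h1 h2] _.
  by rewrite h2 h1.
have iav := average_time_integrable; have ira := rate_average_integrable.
pose a (k : nat) : R := t + (b - t) * k.+1%:R^-1.
have bt0 : 0 < b - t by rewrite subr_gt0.
have ta k : t < a k by rewrite /a ltrDl mulr_gt0// invr_gt0.
have ab k : a k <= b.
  by rewrite /a -lerBrDl -[X in _ <= X]mulr1 ler_pM2l// invf_le1// ler1n.
have a_t : a k @[k --> \oo] --> t.
  have h : (b - t) * k.+1%:R^-1 @[k --> \oo] --> (0 : R).
    by rewrite -[X in _ --> X](mulr0 (b - t)); apply: cvgMl_tmp; exact: cvg_harmonic.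
  by have := cvgD (cvg_cst t) h; rewrite addr0; exact.
have L1 : average b - average (a k) @[k --> \oo] --> average b - average t.
  apply: cvgB; first exact: cvg_cst.
  apply/cvgrPdist_le => e e0; have [d d0 hd] := average_continuous tt e0.
  have [N _ hN] := (cvgrPdist_lt _ _).1 a_t d d0.
  exists N => // k Nk; rewrite distrC; apply: hd; last by rewrite distrC; exact: hN.
  by rewrite in_itv/= (ltW (ta k))/=; exact: le_trans (ab k) (ltW bT).
have L2 : \int[mu1]_(s in `]t, T[) (rate_average s * \1_(`]a k, b]%classic : set R) s) @[k --> \oo] -->
    \int[mu1]_(s in `]t, T[) (rate_average s * \1_(`]t, b]%classic : set R) s).
  apply: (@Rintegral_dct _ _ _ mu1 _ mI _ _ (fun s => `|rate_average s|)).
  - move=> m; apply: measurable_funM; first exact: integrable_measurable ira.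
    by apply: measurable_funTS; exact: measurable_indic.
  - move=> s; rewrite /= in_itv/= => /andP[ts sT]; apply: cvgMl_tmp.
    have [N _ hN] := (cvgrPdist_lt _ _).1 a_t (s - t) (ltac:(by rewrite subr_gt0)).
    apply: cvg_near_cst; exists N => // k Nk.
    have aks : a k < s.
      have := hN k Nk; rewrite /= distrC ger0_norm; last by rewrite subr_ge0; exact: ltW (ta k).
      by rewrite ltrD2r.
    by rewrite !indicE !mem_setE !in_itv/= aks ts.
  - by move=> m s _; rewrite normrM indicE; case: (_ \in _); rewrite ?normr1 ?normr0 ?mulr1 ?mulr0.
  - have := integrable_norm ira; exact.
rewrite -(cvg_lim (@Rhausdorff R) L1) -(cvg_lim (@Rhausdorff R) L2).
rewrite (_ : (fun k => average b - _) = (fun k => \int[mu1]_(s in `]t, T[)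
  (rate_average s * \1_(`]a k, b]%classic : set R) s)))//; apply/funext => k.
by rewrite (average_increment (ta k) (ab k) bT).
Qed.

End averages.

(** The density in time of [beta (Y s x)], extended by zero outside the slab so that it is
    integrable on the whole space-time. *)
Definition rate_density (s : R) (x : E) : R := ((fun z => B z.1 z.2) \_ D) (s, x).

Lemma rate_density_integrable : mu.-integrable setT (EFin \o (fun z => rate_density z.1 z.2)).
Proof.
have := slab_integrable_patch integrable_rate.
by congr (mu.-integrable _ (EFin \o _)); apply/funext => -[].
Qed.

(* The equation holds in the sense of distributions for [beta (Y s x)] averaged against every
   [zeta]; the fundamental lemma removes [zeta]. *)
Lemma flow_pointwise b : t < b -> b < T ->
  {ae leb, forall x, beta (Y b x) = beta x + \int[mu1]_(s in `[t, b]) rate_density s x}.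
Proof.
move=> tb bT; have [_ [M0 _] hbM _ _] := hb.
pose W (z : E * measurableTypeR R) : R := rate_density z.2 z.1 * \1_(`[t, b]%classic : set R) z.2.
pose I x := \int[mu1]_s W (x, s).
pose v x := beta (Y b x) - beta x - I x.
have iW : mu.-integrable setT (EFin \o (fun z => rate_density z.1 z.2 * \1_(`[t, b]%classic : set R) z.1)).
  have m1 : measurable_fun setT (fun z : measurableTypeR R * E => \1_(`[t, b]%classic : set R) z.1 : R).
    by apply: (measurableT_comp (f := \1_(`[t, b]%classic : set R) : R -> R)) => //; exact: measurable_fst.
  apply: (@integrable_Mbounded _ _ _ mu setT measurableT _ _ 1 m1 _ rate_density_integrable).
  by move=> z _; rewrite indicE; case: (_ \in _); rewrite ?normr1 ?normr0.
have eW x : \int[mu1]_(s in `[t, b]) rate_density s x = I x.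
  rewrite Rintegral_mkcond; apply: eq_Rintegral => s _; rewrite patchE /W /= indicE.
  by case: (s \in _); rewrite ?mulr1 ?mulr0.
have iI : leb.-integrable setT (EFin \o I) := integrable_fubini_fine iW.
have mbY : measurable_fun setT (fun x => beta (Y b x)).
  exact: (measurableT_comp (cutoff_measurable hb) (measurable_section b)).
have mbeta := cutoff_measurable hb.
have mIm : measurable_fun setT I := integrable_measurable iI.
have tmp : {ae leb, forall x, v x = 0}; last first.
  apply: (ae_imp tmp) => x; rewrite /v => /eqP; rewrite subr_eq0 subr_eq => /eqP ->.
  by rewrite eW addrC.
apply: du_bois_reymond_rV.
- by apply: measurable_funB => //; exact: measurable_funB.
- move=> k; have mk : measurable_fun setT (\1_[set x : E | `|x| < k%:R] : E -> R).
    by apply: measurable_indic; exact: measurable_lt_norm.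
  have i1 : leb.-integrable setT (EFin \o (fun x => (beta (Y b x) - beta x) * \1_[set x : E | `|x| < k%:R] x)).
    apply: (@integrable_bounded_support _ _ _ (2 * M) k%:R).
    + by apply: measurable_funM => //; exact: measurable_funB.
    + move=> x; rewrite normrM -[X in _ <= X]mulr1; apply: ler_pM => //.
        apply: le_trans (ler_normB _ _) _; rewrite mulr_natl mulr2n; apply: lerD; exact: hbM.
      by rewrite indicE; case: (_ \in _); rewrite ?normr1 ?normr0.
    + by move=> x kx; rewrite indicE memNset ?mulr0//=; apply/negP; rewrite -leNgt.
  have b1 x : setT x -> `|\1_[set x : E | `|x| < k%:R] x : R| <= 1.
    by move=> _; rewrite indicE; case: (_ \in _); rewrite ?normr1 ?normr0.
  have i2 := @integrable_Mbounded _ _ _ leb setT measurableT _ _ 1 mk b1 iI.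
  have := integrable_B measurableT i1 i2; apply: eq_integrable => // x _ /=.
  by congr EFin; rewrite /v; ring.
move=> zeta tz.
have iA := average_integrable tz b.
have [K K0 hK] := test_bounded tz; have mz := measurable_smooth (test_smooth tz).
have ibz : leb.-integrable setT (EFin \o (fun x => beta x * zeta x)).
  have := @integrable_Mbounded _ _ _ leb setT measurableT zeta _ M mbeta (fun x _ => hbM _) (test_integrable tz).
  by apply: eq_integrable => // x _ /=; rewrite mulrC.
have iIz : leb.-integrable setT (EFin \o (fun x => I x * zeta x)).
  exact: (@integrable_Mbounded _ _ _ leb setT measurableT _ _ K mz (fun x _ => hK x) iI).
have -> : \int[leb]_x (v x * zeta x) = average zeta b - \int[leb]_x (beta x * zeta x) - \int[leb]_x (I x * zeta x).
  have i1 := integrable_B measurableT iA ibz.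
  rewrite /average -RintegralB// -RintegralB//.
  by apply: eq_Rintegral => x _; rewrite /v; ring.
rewrite (average_from_start tz tb bT); apply/eqP; rewrite subr_eq0; apply/eqP/esym.
pose f' (z : measurableTypeR R * E) := rate_density z.1 z.2 * \1_(`[t, b]%classic : set R) z.1 * zeta z.2.
have mz2 : measurable_fun setT (fun z : measurableTypeR R * E => zeta z.2).
  by apply: (measurableT_comp mz); exact: measurable_snd.
have if' : mu.-integrable setT (EFin \o f').
  exact: (@integrable_Mbounded _ _ _ mu setT measurableT _ (fun z => zeta z.2) K mz2 (fun z _ => hK z.2) iW).
(* Both sides are the space-time integral of the density against [zeta] over the times in [[t, b]],
   taken in the two orders. *)
transitivity (\int[mu]_z f' z).
  rewrite /Rintegral -(integral21_prod_meas1 if'); congr fine.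
  have [N [mN N0 hN]] := ae_integrable2 iW.
  apply: (@eq_integral_off_null _ _ _ leb N) => // x _ xN.
  have ix : mu1.-integrable setT (EFin \o (fun s => W (x, s))) by apply: contra_notP xN => h; exact: hN.
  rewrite /fubini_G; transitivity (\int[mu1]_s ((zeta x)%:E * (W (x, s))%:E))%E.
    rewrite integralZl// -[in RHS](fineK (integrable_fin_num measurableT ix)) -EFinM mulrC.
    by congr ((_ * _)%:E).
  by apply: eq_integral => s _; rewrite /f' /W /= -EFinM mulrC.
transitivity (\int[mu]_(z in D) (B z.1 z.2 * zeta z.2 * \1_(`[t, b]%classic : set R) z.1)).
  rewrite [RHS]Rintegral_mkcond; apply: eq_Rintegral => -[s x] _.
  rewrite /f' /rate_density /= !patchE; case: ifP => _; [ring|by rewrite !mul0r].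
have i1 : mu.-integrable D (EFin \o (fun z => B z.1 z.2 * zeta z.2 * \1_(`[t, b]%classic : set R) z.1)).
  have m1 : measurable_fun D (fun z : measurableTypeR R * E => \1_(`[t, b]%classic : set R) z.1 : R).
    apply: measurable_funTS; apply: (measurableT_comp (f := \1_(`[t, b]%classic : set R) : R -> R)) => //.
  apply: (@integrable_Mbounded _ _ _ mu D mD _ _ 1 m1 _ (rate_test_integrable tz)).
  by move=> z _; rewrite indicE; case: (_ \in _); rewrite ?normr1 ?normr0.
rewrite slab_Fubini//.
apply: eq_Rintegral_off_null; apply: (ae_imp (slab_section_integrable (rate_test_integrable tz))) => s hs st.
rewrite /rate_average mulrC -(RintegralZl _ measurableT (hs st)); apply: eq_Rintegral => x _ /=.
rewrite mulrC; congr (_ * _); rewrite !indicE !mem_setE !in_itv/=.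
by move: st; rewrite /= in_itv/= => /andP[ts _]; rewrite ts (ltW ts).
Qed.

End flow.

(** * The logarithmic functional *)

Section logarithmic_cutoff.
Context {R : realType} {n : nat}.
Local Notation E := 'rV[R]_n.
Implicit Types (mu s : R) (z v : E).

Lemma dotpp_ge0 z : 0 <= dotp z z.
Proof. by rewrite -enorm_sq exprn_ge0// enorm_ge0. Qed.

Lemma dotp_e z (j : 'I_n) : dotp z 'e_j = z ord0 j.
Proof.
rewrite /dotp (bigD1 j)//= big1 => [|i ij]; first by rewrite mxE !eqxx mulr1 addr0.
by rewrite mxE eqxx/= (negbTE ij) mulr0.
Qed.

Lemma differentiable_coordE i z : differentiable (fun x : E => x ord0 i) z.
Proof.
have h := smooth_coord i (@smooth_id R).
exact: smooth_differentiable.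
Qed.

Lemma smooth_dotpp : smooth (fun z : E => dotp z z).
Proof.
rewrite /dotp; elim: (index_enum _) => [|i r IH].
  under eq_fun do rewrite big_nil; exact: smooth_cst.
under eq_fun do rewrite big_cons; apply: smoothD => //.
by apply: smoothM; exact: (smooth_coord i (@smooth_id R)).
Qed.

Lemma derive_dotpp z v : 'D_v (fun z : E => dotp z z) z = 2 * dotp z v.
Proof.
have df : differentiable (fun z : E => dotp z z) (z + (0 : R) *: v).
  exact: smooth_differentiable smooth_dotpp.
have h := is_derive_line df; rewrite scale0r addr0 in h.
have e : (fun t : R => dotp (z + t *: v) (z + t *: v)) =
    (fun t : R => dotp z z + (2 * dotp z v * t + dotp v v * t ^+ 2)).
  by apply/funext => t; rewrite !dotpDl !dotpDr !dotpZl !dotpZr (dotpC v z); ring.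
rewrite e in h.
have h2 : is_derive (0 : R) (1 : R) (fun t : R => dotp z z + (2 * dotp z v * t + dotp v v * t ^+ 2)) (2 * dotp z v).
  have d2 := is_deriveX 2 (is_derive_id (0 : R) (1 : R)); rewrite exprfctE in d2.
  have := is_deriveD (is_derive_cst (dotp z z) (0 : R) (1 : R))
    (is_deriveD (is_deriveZ (2 * dotp z v) (is_derive_id (0 : R) (1 : R))) (is_deriveZ (dotp v v) d2)).
  move=> h0; apply: (is_derive_eq h0); rewrite /GRing.scale/= expr1; ring.
by case: h => _ e1; case: h2 => _ e2; exact: etrans (esym e1) e2.
Qed.

Lemma chain_rule_R (h : R -> R) (f : E -> R) z (dh : R) : differentiable f z ->
  is_derive (f z) (1 : R) h dh ->
  differentiable (h \o f) z /\ forall v, 'D_v (h \o f) z = dh * 'D_v f z.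
Proof.
move=> df dhh; have dh' : differentiable h (f z) by apply/derivable1_diffP; case: dhh.
split=> [|v]; first exact: differentiable_comp.
rewrite (@derive_comp_affine _ _ _ f (fun v => 'D_v f z) h)// derive_R//.
by case: dhh => _ ->; rewrite mulrC.
Qed.

(** A smooth step in the variable [ln (1 + s) / mu]: equal to one as long as [ln (1 + s) <= mu] and
    to zero from [2 mu] on, so that the transition takes place over an exponentially long range of
    [s]. *)
Definition psi mu s : R := 1 - step (ln (1 + s) / mu - 1).
Definition psi' mu s : R := - ('D_1 (@step R) (ln (1 + s) / mu - 1) * (mu^-1 * (1 + s)^-1)).

Lemma is_derive_psi mu s : 0 <= s -> is_derive s (1 : R) (psi mu) (psi' mu s).
Proof.
move=> s0; have s1 : 0 < 1 + s by rewrite ltr_pwDl.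
have h1 : is_derive s (1 : R) (fun s => 1 + s) (1 : R).
  by have := is_deriveD (is_derive_cst (1 : R) s (1 : R)) (is_derive_id s (1 : R)); rewrite add0r.
have h2 := is_derive1_comp (g := fun s => 1 + s) (is_derive1_ln s1) h1.
have h3 : is_derive s (1 : R) (fun s => ln (1 + s) / mu - 1) (mu^-1 * (1 + s)^-1).
  have := is_deriveB (is_deriveZ (mu^-1) h2) (is_derive_cst (1 : R) s (1 : R)).
  rewrite subr0 mulr1; congr (is_derive _ _ _ _); apply/funext => u /=.
  by rewrite /GRing.scale/= mulrC.
have h4 : is_derive (ln (1 + s) / mu - 1) (1 : R) (@step R) ('D_1 (@step R) (ln (1 + s) / mu - 1)).
  by apply: derivableP; apply: diff_derivable; apply: smooth_differentiable; exact: smooth_step.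
have h5 := is_derive1_comp (g := fun s => ln (1 + s) / mu - 1) h4 h3.
by have := is_deriveB (is_derive_cst (1 : R) s (1 : R)) h5; rewrite sub0r.
Qed.

Lemma continuous_psi' mu s : 0 <= s -> {for s, continuous (psi' mu)}.
Proof.
move=> s0; have s1 : 0 < 1 + s by rewrite ltr_pwDl.
have cs : continuous ('D_1 (@step R)).
  by apply: smooth_continuous; apply: smooth_derive; exact: smooth_step.
have c1 : (1 + u) @[u --> s] --> 1 + s by apply: cvgD; [exact: cvg_cst|exact: cvg_id].
apply: cvgN; apply: cvgM.
  apply: (@cvg_comp _ _ _ (fun u => ln (1 + u) / mu - 1) ('D_1 (@step R)) _ (nbhs (ln (1 + s) / mu - 1))).
    apply: cvgB; last exact: cvg_cst.
    apply: cvgMr_tmp; apply: (@cvg_comp _ _ _ (fun u => 1 + u) (@ln R) _ (nbhs (1 + s))) => //.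
    exact: continuous_ln.
  exact: cs.
by apply: cvgMl_tmp; apply: cvgV => //; rewrite gt_eqF.
Qed.

Definition logcut mu z : R := psi mu (dotp z z).
Definition lsq z : R := ln (1 + dotp z z).

Lemma cut_ge0 mu z : 0 <= logcut mu z.
Proof. by rewrite /logcut /psi subr_ge0 step_le1. Qed.

Lemma cut_le1 mu z : logcut mu z <= 1.
Proof. by rewrite /logcut /psi lerBlDr lerDl step_ge0. Qed.

Lemma cut_eq1 mu z : 0 < mu -> lsq z <= mu -> logcut mu z = 1.
Proof.
by move=> m0 h; rewrite /logcut /psi step_eq0 ?subr0// subr_le0 ler_pdivrMr// mul1r.
Qed.

Lemma cut_eq0 mu z : 0 < mu -> 2 * mu <= lsq z -> logcut mu z = 0.
Proof.
move=> m0 h; rewrite /logcut /psi step_eq1 ?subrr// lerBrDr ler_pdivlMr//.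
Qed.

Lemma cut_derive mu z : differentiable (logcut mu) z /\
  forall v, 'D_v (logcut mu) z = 2 * psi' mu (dotp z z) * dotp z v.
Proof.
have [d1 d2] := chain_rule_R (smooth_differentiable z smooth_dotpp) (is_derive_psi mu (dotpp_ge0 z)).
split => // v; rewrite (d2 v) derive_dotpp; ring.
Qed.

Lemma grad_cut mu z : grad (logcut mu) z = (2 * psi' mu (dotp z z)) *: z.
Proof. by apply/rowP => j; rewrite !mxE (cut_derive mu z).2 dotp_e. Qed.

Lemma step'_eq0 (u : R) : u < 0 \/ 1 < u -> 'D_1 (@step R) u = 0.
Proof.
case=> h.
  rewrite (@near_eq_derive _ _ _ (@step R) (cst 0)) ?derive_cst//.
  by near=> y; rewrite step_eq0//; apply: ltW; near: y; exact: lt_nbhsl.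
rewrite (@near_eq_derive _ _ _ (@step R) (cst 1)) ?derive_cst//.
by near=> y; rewrite step_eq1//; apply: ltW; near: y; exact: lt_nbhsr.
Unshelve. all: by end_near. Qed.

Lemma grad_cut_eq0 mu z : 0 < mu -> lsq z < mu \/ 2 * mu < lsq z -> grad (logcut mu) z = 0.
Proof.
move=> m0 h; rewrite grad_cut /psi' step'_eq0 ?mul0r ?oppr0 ?mulr0 ?scale0r//.
case: h => h; [left|right].
  by rewrite subr_lt0 ltr_pdivrMr// mul1r.
by rewrite ltrBrDr ltr_pdivlMr// -(natrD _ 1 1).
Qed.

(** The factor [4] absorbs [2 |z| (1 + |z|) / (1 + |z|^2)], which the chain rule produces in
    [grad_cut_le]. *)
Definition cutC : R := 4 * projT1 (cid2 (@step_derive_bounded R)).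

Lemma cutC_ge0 : 0 <= cutC.
Proof. by rewrite /cutC; case: cid2 => C /= C0 _; exact: mulr_ge0. Qed.

(** By the chain rule the gradient is at most [2 |z| / (mu (1 + |z|^2))] times the derivative of
    [step]. Its pairing with the field is thus at most [cutC / mu] times [relative_speed], which is
    why the error of the cutoff vanishes as [mu] grows. *)
Lemma grad_cut_le mu z : 0 < mu -> enorm (grad (logcut mu) z) <= cutC / mu / (1 + enorm z).
Proof.
move=> m0; rewrite /cutC; case: cid2 => C /= C0 hC; rewrite grad_cut enormZ.
have z0 := enorm_ge0 z; have z1 : 0 < 1 + enorm z by rewrite ltr_pwDl.
have zz := dotpp_ge0 z; have z2 : 0 < 1 + dotp z z by rewrite ltr_pwDl.
have nm : `|mu^-1| = mu^-1 by rewrite ger0_norm// invr_ge0 ltW.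
have nz : `|(1 + dotp z z)^-1| = (1 + dotp z z)^-1 by rewrite ger0_norm// invr_ge0 ltW.
rewrite /psi' mulrN normrN !normrM nm nz (@ger0_norm _ 2)//.
rewrite ler_pdivlMr//.
have h := hC (ln (1 + dotp z z) / mu - 1); set w := `|_| in h *.
have e : 2 * enorm z * (1 + enorm z) / (1 + dotp z z) <= 4.
  rewrite ler_pdivrMr// -enorm_sq; nra.
rewrite (_ : _ * _ = w * mu^-1 * (2 * enorm z * (1 + enorm z) / (1 + dotp z z))); last by ring.
rewrite (_ : 4 * C / mu = C * mu^-1 * 4); last by ring.
have m1 : 0 <= mu^-1 by rewrite invr_ge0 ltW.
apply: ler_pM => //.
- exact: mulr_ge0 (normr_ge0 _) m1.
- by apply: divr_ge0; [apply: mulr_ge0; [exact: mulr_ge0|exact: ltW]|exact: ltW].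
- exact: ler_wpM2r.
Qed.

Lemma lsq_bound mu z : lsq z <= 2 * mu -> enorm z <= expR mu.
Proof.
move=> h; have zz := dotpp_ge0 z; have z2 : 0 < 1 + dotp z z by rewrite ltr_pwDl.
have : dotp z z <= expR mu ^+ 2.
  rewrite -expRM_natl; have : 1 + dotp z z <= expR (2 * mu) by rewrite -[X in X <= _]lnK ?posrE// ler_expR.
  lra.
by rewrite -enorm_sq ler_pXn2r// nnegrE ?enorm_ge0// expR_ge0.
Qed.

Lemma far_lsq mu z : expR mu < `|z| -> 2 * mu < lsq z.
Proof.
move=> h; rewrite ltNge; apply/negP => /lsq_bound h2.
by have := lt_le_trans h (le_trans (norm_le_enorm z) h2); rewrite ltxx.
Qed.

Lemma cut_C1 mu : C1_on setT (logcut mu).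
Proof.
move=> z _; split; first by have [] := cut_derive mu z.
move=> v; rewrite (_ : 'D_v (logcut mu) = fun z => 2 * psi' mu (dotp z z) * dotp z v); last first.
  by apply/funext => y; rewrite (cut_derive mu y).2.
apply: continuousM; last exact: continuous_dotpl.
apply: continuousM; first exact: cst_continuous.
apply: (continuous_comp (f := fun y : E => dotp y y) (g := psi' mu)).
  by apply: smooth_continuous; exact: smooth_dotpp.
by apply: continuous_psi'; exact: dotpp_ge0.
Qed.

Lemma cut_cutoff mu : 0 < mu -> cutoff (logcut mu) (1 + cutC / mu) (expR mu + 1).
Proof.
move=> m0; have C0 : 0 <= cutC / mu by apply: divr_ge0; [exact: cutC_ge0|exact: ltW].
split; first exact: cut_C1.
- by split; rewrite addr_ge0// expR_ge0.
- by move=> z; rewrite ger0_norm ?cut_ge0//; apply: le_trans (cut_le1 _ _) _; rewrite lerDl.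
- move=> z; apply: le_trans (grad_cut_le z m0) _; apply: (@le_trans _ _ (cutC / mu)); last by rewrite lerDr.
  have z0 := enorm_ge0 z; rewrite ler_pdivrMr; last by rewrite ltr_pwDl.
  by rewrite mulrDr mulr1 lerDl mulr_ge0.
- move=> z h; apply: grad_cut_eq0 => //; right; apply: far_lsq; lra.
Qed.

(** The coordinates grow too fast to be admissible renormalizations; they are cut at a level higher
    than the one where they are used. *)
Definition cutcoord mu i z : R := z ord0 i * logcut mu z.

Lemma cutcoord_derive mu i z : differentiable (cutcoord mu i) z /\
  forall v, 'D_v (cutcoord mu i) z = v ord0 i * logcut mu z + z ord0 i * 'D_v (logcut mu) z.
Proof.
have [d1 d2] := cut_derive mu z; have dc := differentiable_coordE i z.
split; first exact: differentiableM.
move=> v; rewrite (@deriveM _ _ (fun z : E => z ord0 i) (logcut mu)); try exact: diff_derivable.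
rewrite derive_coordE /GRing.scale/=; ring.
Qed.

Lemma grad_cutcoord mu i z : grad (cutcoord mu i) z = logcut mu z *: 'e_i + z ord0 i *: grad (logcut mu) z.
Proof.
apply/rowP => j; rewrite [LHS]mxE (cutcoord_derive mu i z).2 !mxE eqxx/= mulrC; congr (_ * _ + _).
by rewrite eq_sym.
Qed.

Lemma enorm_e i : enorm ('e_i : E) = 1.
Proof. by rewrite /enorm dotp_e mxE !eqxx sqrtr1. Qed.

Lemma cutcoord_cutoff mu i : 0 < mu -> cutoff (cutcoord mu i) (expR mu + 1 + cutC / mu) (expR mu + 1).
Proof.
move=> m0; have C0 : 0 <= cutC / mu by apply: divr_ge0; [exact: cutC_ge0|exact: ltW].
have e0 := expR_ge0 mu.
have cz z : `|z ord0 i| <= enorm z by apply: le_trans (coord_le_norm z i) (norm_le_enorm z).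
split.
- move=> z _; split; first by have [] := cutcoord_derive mu i z.
  move=> v; rewrite (_ : 'D_v (cutcoord mu i) = fun z => v ord0 i * logcut mu z + z ord0 i * 'D_v (logcut mu) z); last first.
    by apply/funext => y; rewrite (cutcoord_derive mu i y).2.
  have h1 : C1_on setT (logcut mu : E -> R) := @cut_C1 mu.
  have [dc cD] := h1 z Logic.I.
  apply: continuousD; first by apply: continuousM; [exact: cst_continuous|exact: differentiable_continuous].
  by apply: continuousM; [exact: coord_continuous|exact: cD].
- by split; lra.
- move=> z; rewrite /cutcoord normrM (ger0_norm (cut_ge0 mu z)).
  have [h|h] := leP (lsq z) (2 * mu).
    have := lsq_bound h; have := cz z; have := cut_le1 mu z; have := cut_ge0 mu z; have := normr_ge0 (z ord0 i); nra.
  by rewrite cut_eq0 ?ltW// mulr0; lra.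
- move=> z; rewrite grad_cutcoord; apply: le_trans (enormD _ _) _; rewrite !enormZ enorm_e mulr1.
  rewrite (ger0_norm (cut_ge0 mu z)); apply: (@le_trans _ _ (1 + cutC / mu)); last by lra.
  apply: lerD; first exact: cut_le1.
  have z0 := enorm_ge0 z; have z1 : 0 < 1 + enorm z by rewrite ltr_pwDl.
  apply: (@le_trans _ _ (enorm z * (cutC / mu / (1 + enorm z)))).
    by apply: ler_pM => //; [exact: enorm_ge0|exact: grad_cut_le].
  rewrite mulrA ler_pdivrMr// mulrC; apply: ler_wpM2l => //; lra.
- move=> z h; have h2 : 2 * mu < lsq z by apply: far_lsq; lra.
  by rewrite grad_cutcoord (grad_cut_eq0 m0 (or_intror h2)) scaler0 addr0 cut_eq0 ?ltW// scale0r.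
Qed.

Lemma cutcoord_near mu i z : 0 < mu -> lsq z < mu -> grad (cutcoord mu i) z = 'e_i.
Proof.
by move=> m0 h; rewrite grad_cutcoord (grad_cut_eq0 m0 (or_introl h)) scaler0 addr0 cut_eq1 ?ltW// scale1r.
Qed.

Lemma cutcoord_eq mu i z : 0 < mu -> lsq z <= mu -> cutcoord mu i z = z ord0 i.
Proof. by move=> m0 h; rewrite /cutcoord cut_eq1// mulr1. Qed.

End logarithmic_cutoff.

(** * The logarithmic weight *)

Section log_functional.
Context {R : realType}.
Implicit Types u : R.

(** Applied to [u = |x - y|^2 / delta^2]. Squaring [u] makes the weight differentiable on the whole
    line, as the chain rule [ac_comp] demands. *)
Definition ell u : R := ln (1 + u ^+ 2).
Definition ell' u : R := 2 * u / (1 + u ^+ 2).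

Lemma ell_den u : 0 < 1 + u ^+ 2.
Proof. by rewrite ltr_pwDl// sqr_ge0. Qed.

Lemma ell_ge0 u : 0 <= ell u.
Proof. by apply: ln_ge0; rewrite lerDl sqr_ge0. Qed.

Lemma ell0 : ell 0 = 0.
Proof. by rewrite /ell expr0n addr0 ln1. Qed.

Lemma is_derive_ell u : is_derive u (1 : R) ell (ell' u).
Proof.
have h1 : is_derive u (1 : R) (fun u => 1 + u ^+ 2) (2 * u).
  have d2 := is_deriveX 2 (is_derive_id u (1 : R)); rewrite exprfctE in d2.
  have h := is_deriveD (is_derive_cst (1 : R) u (1 : R)) d2.
  by apply: (is_derive_eq h); rewrite /GRing.scale/= expr1 add0r mulr1 mulr_natl.
have h2 := is_derive1_comp (g := fun u => 1 + u ^+ 2) (is_derive1_ln (ell_den u)) h1.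
by apply: (is_derive_eq h2); rewrite /ell' mulrC.
Qed.

Lemma continuous_ell' : continuous ell'.
Proof.
move=> u; apply: continuousM; first by apply: continuousM; [exact: cst_continuous|exact: cvg_id].
apply: continuousV; first by rewrite gt_eqF// ell_den.
by apply: continuousD; [exact: cst_continuous|exact: exprn_continuous].
Qed.

(** The left-hand side is the derivative of [ell (d^2 / delta^2)] in [d], and the denominator on the
    right matches the factor [|x - y| + 2^-m] of the logarithmic estimate. With [a = d / delta] the
    claim reads [4 a^3 (a + 1) <= 8 (1 + a^4)], which follows from [a^3 <= 1 + a^4]. *)
Lemma ell'_bound (d delta : R) : 0 <= d -> 0 < delta ->
  ell' (delta ^- 2 * d ^+ 2) * (2 * delta ^- 2 * d) <= 8 / (d + delta).
Proof.
move=> d0 e0; pose a := d / delta; have a0 : 0 <= a by apply: divr_ge0 => //; exact: ltW.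
have -> : delta ^- 2 * d ^+ 2 = a ^+ 2 by rewrite /a expr_div_n mulrC.
have -> : 2 * delta ^- 2 * d = 2 * a / delta by rewrite /a; field; rewrite gt_eqF.
have -> : 8 / (d + delta) = 8 / (a + 1) / delta.
  by rewrite /a; field; rewrite !gt_eqF ?ltr_wpDl// ltr_wpDl.
have a1 : 0 < a + 1 by rewrite ltr_wpDl.
have a4 := ell_den (a ^+ 2).
rewrite mulrA ler_pM2r ?invr_gt0// ler_pdivlMr// /ell'.
have -> : 2 * a ^+ 2 / (1 + (a ^+ 2) ^+ 2) * (2 * a) * (a + 1) = (4 * a ^+ 3 * (a + 1)) / (1 + (a ^+ 2) ^+ 2).
  by field; rewrite gt_eqF.
rewrite ler_pdivrMr//.
have h : a ^+ 3 <= 1 + a ^+ 4.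
  have [h1|h1] := leP a 1.
    by apply: (@le_trans _ _ 1); [exact: exprn_ile1|rewrite lerDl exprn_ge0].
  by apply: (@le_trans _ _ (a ^+ 4)); [rewrite ler_weXn2l// ltW|rewrite lerDr].
have -> : (a ^+ 2) ^+ 2 = a ^+ 4 by rewrite -exprM.
have -> : 4 * a ^+ 3 * (a + 1) = 4 * a ^+ 4 + 4 * a ^+ 3 by ring.
have := exprn_ge0 4 a0; lra.
Qed.

End log_functional.

(** * The functional and its derivative along a pair of trajectories *)

Section pointwise_rate.
Context {R : realType} {n : nat} (lam kap : R) (m : nat) (l0 : 0 < lam) (k0 : 0 <= kap).
Local Notation E := 'rV[R]_n.
Local Notation C := (@cutC R).
Implicit Types (y z u v : E).
Let delta : R := 2 ^- m.
Let d0 : 0 < delta. Proof. by rewrite invr_gt0 exprn_gt0. Qed.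
Let l20 : 0 < 2 * lam. Proof. by rewrite mulr_gt0. Qed.
Let l40 : 0 < 4 * lam. Proof. by rewrite mulr_gt0. Qed.
Let q := logcut (n := n) (2 * lam).
Let p := cutcoord (n := n) (4 * lam).

Definition sep (A B : 'I_n -> R) : R := \sum_i delta ^- 2 * (A i - B i) ^+ 2.
Definition sep' (A B a b : 'I_n -> R) : R := \sum_i delta ^- 2 * (2 * (A i - B i) * (a i - b i)).

(** The arguments stand for values along the two flows: [P] for the cutoff at level [lam], [Q] for
    the one at level [2 * lam], [A] and [B] for the cut coordinates. [phi] is the derivative of
    [Phi] when they vary at the rates [f], [g], [a] and [b]. *)
Definition Phi (P1 P2 Q1 Q2 : R) (A B : 'I_n -> R) : R :=
  2 - (P1 + P2) + kap * (Q1 * Q2 * ell (sep A B)).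
Definition phi (f1 f2 Q1 Q2 g1 g2 : R) (A B a b : 'I_n -> R) : R :=
  - (f1 + f2) + kap * ((g1 * Q2 + Q1 * g2) * ell (sep A B) +
    Q1 * Q2 * (ell' (sep A B) * sep' A B a b)).

Let rate (beta : E -> R) z v : R := dotp (grad beta z) v.

Lemma rate_cut_le mu z v : 0 < mu -> `|rate (logcut mu) z v| <= C / mu * (enorm v / (1 + enorm z)).
Proof.
move=> m0; apply: le_trans (dotp_CS _ _) _.
rewrite mulrA mulrAC; apply: ler_wpM2r; first exact: enorm_ge0.
exact: grad_cut_le.
Qed.

Lemma sep_eq y z : lsq y <= 4 * lam -> lsq z <= 4 * lam ->
  sep (fun i => p i y) (fun i => p i z) = delta ^- 2 * enorm (y - z) ^+ 2.
Proof.
move=> hy hz; rewrite enorm_sq /dotp mulr_sumr; apply: eq_bigr => i _.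
by rewrite /p !cutcoord_eq// !mxE expr2.
Qed.

Lemma sep'_eq y z u v : lsq y < 4 * lam -> lsq z < 4 * lam ->
  sep' (fun i => p i y) (fun i => p i z) (fun i => rate (p i) y u) (fun i => rate (p i) z v) =
  2 * delta ^- 2 * dotp (y - z) (u - v).
Proof.
move=> hy hz; rewrite /dotp mulr_sumr; apply: eq_bigr => i _.
have e (w : E) : dotp 'e_i w = w ord0 i by rewrite dotpC dotp_e.
rewrite /rate /p !cutcoord_near// !e !cutcoord_eq ?ltW// !mxE; ring.
Qed.

(** The logarithm of [e^5 e^(4 m) e^(8 lam)], which by [2 <= e] exceeds [1 + u^2] for
    [u = 4 * 4^m e^(4 lam)], a bound of [sep] at points within the level [4 * lam]. *)
Definition ellmax : R := 5 + 8 * lam + 4 * m%:R.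

Lemma ellmax_ge0 : 0 <= ellmax.
Proof. by rewrite /ellmax !addr_ge0// mulr_ge0// ltW. Qed.

Lemma ell_sep_le y z : lsq y <= 4 * lam -> lsq z <= 4 * lam ->
  ell (sep (fun i => p i y) (fun i => p i z)) <= ellmax.
Proof.
move=> hy hz; rewrite sep_eq//; set w := _ * _.
have e4 (x : E) : lsq x <= 4 * lam -> enorm x <= expR (2 * lam).
  by move=> h; apply: lsq_bound; rewrite mulrA -(natrM R 2 2).
have dyz : enorm (y - z) <= 2 * expR (2 * lam).
  apply: le_trans (enormD _ _) _; rewrite enormN mulr_natl mulr2n; apply: lerD; exact: e4.
have w0 : 0 <= w by apply: mulr_ge0; [rewrite invr_ge0 exprn_ge0// ltW|rewrite exprn_ge0// enorm_ge0].
have d2 : delta ^- 2 = 2 ^+ (2 * m) by rewrite /delta exprVn invrK -exprM mulnC.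
have wle : w <= 4 * 2 ^+ (2 * m) * expR (4 * lam).
  have -> : 4 * 2 ^+ (2 * m) * expR (4 * lam) = 2 ^+ (2 * m) * (4 * expR (4 * lam)) by ring.
  rewrite /w d2; apply: ler_wpM2l; first exact: exprn_ge0.
  have -> : 4 * expR (4 * lam) = (2 * expR (2 * lam)) ^+ 2.
    by rewrite exprMn -expRM_natl mulrA -(natrM R 2 2) -natrX.
  by rewrite ler_pXn2r// nnegrE ?enorm_ge0// mulr_ge0// expR_ge0.
have e1 : 2 <= expR 1 :> R by have := expR_ge1Dx (1 : R); rewrite -(natrD _ 1 1).
rewrite /ell -(expRK ellmax) ler_ln ?posrE ?ell_den ?expR_gt0//.
have -> : expR ellmax = expR 1 ^+ 5 * (expR 1 ^+ (2 * m)) ^+ 2 * expR (4 * lam) ^+ 2.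
  rewrite -!exprM -!expRM_natl -!expRD /ellmax; congr expR; rewrite !natrM; ring.
have a1 : 32 <= expR 1 ^+ 5 :> R.
  have -> : 32 = 2 ^+ 5 :> R by rewrite -natrX.
  by rewrite ler_pXn2r// nnegrE// expR_ge0.
have a2 : 2 ^+ (2 * m) <= expR 1 ^+ (2 * m) :> R by apply: lerXn2r => //; rewrite nnegrE// expR_ge0.
have b1 : 1 <= 2 ^+ (2 * m) :> R by rewrite exprn_ege1// ler1n.
have b2 : 1 <= expR (4 * lam) by have := expR_ge1Dx (4 * lam); have := l40; lra.
set s := 2 ^+ (2 * m) in wle a2 b1; set r := expR 1 ^+ (2 * m) in a2 *; set g := expR (4 * lam) in wle b2 *.
have sg : 1 <= s * g by rewrite -[X in X <= _]mulr1; apply: ler_pM.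
have w2 : w ^+ 2 <= 16 * (s * g) ^+ 2.
  have -> : 16 * (s * g) ^+ 2 = (4 * s * g) ^+ 2 by ring.
  by rewrite ler_pXn2r// nnegrE//; apply: mulr_ge0; [apply: mulr_ge0 => //|]; lra.
have sg2 : 1 <= (s * g) ^+ 2 by rewrite exprn_ege1.
apply: (@le_trans _ _ (32 * (s * g) ^+ 2)); first lra.
have -> : expR 1 ^+ 5 * r ^+ 2 * g ^+ 2 = expR 1 ^+ 5 * (r * g) ^+ 2 by ring.
have sg0 : 0 <= (s * g) ^+ 2 by exact: sqr_ge0.
apply: ler_pM => //; rewrite ler_pXn2r// ?nnegrE; [|lra|apply: mulr_ge0; lra].
by apply: ler_wpM2r => //; lra.
Qed.

Lemma q_small z : q z != 0 -> lsq z < 4 * lam.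
Proof.
move=> qz; rewrite ltNge; apply/negP => h; move/negP : qz; apply; apply/eqP.
by apply: cut_eq0 => //; rewrite mulrA -(natrM R 2 2).
Qed.

Lemma rate_q_small z v : rate q z v != 0 -> lsq z <= 4 * lam.
Proof.
move=> h; rewrite leNgt; apply/negP => hz; move/negP : h; apply; apply/eqP.
rewrite /rate /q grad_cut_eq0//; first by rewrite dotpC; apply: big1 => i _; rewrite mxE mulr0.
by right; rewrite mulrA -(natrM R 2 2).
Qed.

(** The weight [ell] is bounded only where both points are within the level [4 * lam]; elsewhere the
    rate of the first cutoff or the value of the second vanishes, and so does the product. *)
Lemma rate_q_ell y z v w : 0 <= w -> (rate q y v != 0 -> q z != 0 -> w <= ellmax) ->
  `|rate q y v * q z * w| <= C / lam * (enorm v / (1 + enorm y)) * ellmax.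
Proof.
move=> w0 h; have ry0 : 0 <= enorm v / (1 + enorm y).
  by apply: divr_ge0; [exact: enorm_ge0|rewrite addr_ge0// enorm_ge0].
have Cl : 0 <= C / lam by apply: divr_ge0; [exact: cutC_ge0|exact: ltW].
have r0 : 0 <= C / lam * (enorm v / (1 + enorm y)) * ellmax.
  by apply: mulr_ge0; [exact: mulr_ge0|exact: ellmax_ge0].
have [e|e] := eqVneq (rate q y v) 0; first by rewrite e !mul0r normr0.
have [e2|e2] := eqVneq (q z) 0; first by rewrite e2 mulr0 mul0r normr0.
rewrite normrM (ger0_norm w0); apply: ler_pM => //; last exact: h.
rewrite normrM (ger0_norm (cut_ge0 _ _)) -[X in _ <= X]mulr1; apply: ler_pM => //.
- exact: cut_ge0.
- apply: le_trans (rate_cut_le y v l20) _; apply: ler_wpM2r => //.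
  apply: ler_wpM2l; first exact: cutC_ge0.
  by rewrite lef_pV2 ?posrE//; have := l0; lra.
- exact: cut_le1.
Qed.

(** The derivatives falling on cutoffs give relative speeds divided by [lam], multiplied by at most
    the maximum of [ell]. The derivative falling on [ell] gives a difference quotient of the fields;
    where its factors [q] do not vanish the coordinates are uncut, so that [sep] is the squared
    distance over [delta^2]. *)
Lemma phi_le y z u v :
  `|phi (rate (logcut lam) y u) (rate (logcut lam) z v) (q y) (q z) (rate q y u) (rate q z v)
      (fun i => p i y) (fun i => p i z) (fun i => rate (p i) y u) (fun i => rate (p i) z v)| <=
  C / lam * (1 + kap * ellmax) * (enorm u / (1 + enorm y) + enorm v / (1 + enorm z)) +
  8 * kap * (if (q y != 0) && (q z != 0) then enorm (u - v) / (enorm (y - z) + delta) else 0).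
Proof.
pose U := sep (fun i => p i y) (fun i => p i z); have U0 := ell_ge0 U.
set ry := enorm u / _; set rz := enorm v / _.
have h1 := rate_cut_le y u l0; have h2 := rate_cut_le z v l0.
have h3 : `|rate q y u * q z * ell U| <= C / lam * ry * ellmax.
  apply: rate_q_ell => // hy hz; apply: ell_sep_le; first exact: (rate_q_small hy).
  by apply: ltW; exact: q_small.
have h4 : `|q y * rate q z v * ell U| <= C / lam * rz * ellmax.
  rewrite (mulrC (q y)); apply: rate_q_ell => // hz hy; apply: ell_sep_le; last exact: (rate_q_small hz).
  by apply: ltW; exact: q_small.
have h5 : `|q y * q z * (ell' U * sep' (fun i => p i y) (fun i => p i z) (fun i => rate (p i) y u)
     (fun i => rate (p i) z v))| <=
   8 * (if (q y != 0) && (q z != 0) then enorm (u - v) / (enorm (y - z) + delta) else 0).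
  have [ey|ey] /= := eqVneq (q y) 0; first by rewrite ey !mul0r normr0 mulr0.
  have [ez|ez] /= := eqVneq (q z) 0; first by rewrite ez mulr0 mul0r normr0 mulr0.
  have hy := q_small ey; have hz := q_small ez.
  rewrite /U sep_eq; [|exact: ltW|exact: ltW].
  rewrite sep'_eq// normrM [`|q y * q z|]normrM (ger0_norm (cut_ge0 _ y)) (ger0_norm (cut_ge0 _ z)).
  have D0 := enorm_ge0 (y - z); have V0 := enorm_ge0 (u - v).
  have dd : 0 <= delta ^- 2 by rewrite invr_ge0 exprn_ge0// ltW.
  have W0 : 0 <= delta ^- 2 * enorm (y - z) ^+ 2 by apply: mulr_ge0 => //; exact: exprn_ge0.
  have L0 : 0 <= ell' (delta ^- 2 * enorm (y - z) ^+ 2).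
    by apply: divr_ge0; [exact: mulr_ge0|exact: ltW (ell_den _)].
  apply: (@le_trans _ _ (1 * (ell' (delta ^- 2 * enorm (y - z) ^+ 2) * (2 * delta ^- 2 * enorm (y - z)) * enorm (u - v)))).
    apply: ler_pM.
    - by apply: mulr_ge0; exact: cut_ge0.
    - exact: normr_ge0.
    - by rewrite -[X in _ <= X]mulr1; apply: ler_pM; rewrite ?cut_ge0 ?cut_le1.
    - have d2' : 0 <= 2 * delta ^- 2 by exact: mulr_ge0.
      have alg (a k d e x : R) : 0 <= a -> 0 <= k -> x <= d * e -> a * (k * x) <= a * (k * d) * e.
        by move=> a0 k1 h; rewrite -!mulrA; apply: ler_wpM2l => //; exact: ler_wpM2l.
      rewrite normrM (ger0_norm L0) normrM (ger0_norm d2'); exact: alg L0 d2' (dotp_CS _ _).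
  rewrite mul1r; apply: (@le_trans _ _ (8 / (enorm (y - z) + delta) * enorm (u - v))).
    by apply: ler_wpM2r => //; exact: ell'_bound.
  by rewrite mulrAC -mulrA.
rewrite /phi -/U.
set r1 := rate (logcut lam) y u in h1 *; set r2 := rate (logcut lam) z v in h2 *.
set T1 := rate q y u * q z * ell U in h3; set T2 := q y * rate q z v * ell U in h4.
set T3 := q y * q z * _ in h5 *; set F := (if _ then _ else _) in h5 *.
have -> : - (r1 + r2) + kap * ((rate q y u * q z + q y * rate q z v) * ell U + T3) =
    - r1 - r2 + kap * (T1 + T2 + T3) by rewrite /T1 /T2; ring.
apply: le_trans (ler_normD _ _) _.
have a1 : `|- r1 - r2| <= C / lam * ry + C / lam * rz.
  by apply: le_trans (ler_normB _ _) _; rewrite normrN; exact: lerD.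
have a2 : `|kap * (T1 + T2 + T3)| <= kap * (C / lam * ry * ellmax + C / lam * rz * ellmax + 8 * F).
  rewrite normrM (ger0_norm k0); apply: ler_wpM2l => //.
  apply: le_trans (ler_normD _ _) _; apply: lerD => //.
  by apply: le_trans (ler_normD _ _) _; exact: lerD.
apply: le_trans (lerD a1 a2) _; rewrite le_eqVlt; apply/orP; left; apply/eqP; ring.
Qed.

(** If one point is beyond the level [2 * lam], its cutoff at level [lam] vanishes and the first
    part is at least one. Otherwise both [q] equal one, and the weighted logarithm is at least one
    by the assumption on [kap]. *)
Lemma Phi_ge1 y z gam : 0 <= gam -> 1 <= kap * ell (delta ^- 2 * gam ^+ 2) -> gam < enorm (y - z) ->
  1 <= Phi (logcut lam y) (logcut lam z) (q y) (q z) (fun i => p i y) (fun i => p i z).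
Proof.
move=> g0 h hyz; have cy := cut_le1 lam y; have cz := cut_le1 lam z.
have kp : 0 <= kap * (q y * q z * ell (sep (fun i => p i y) (fun i => p i z))).
  apply: mulr_ge0 => //; apply: mulr_ge0; last exact: ell_ge0.
  by apply: mulr_ge0; exact: cut_ge0.
have [hy|hy] := leP (2 * lam) (lsq y).
  by rewrite /Phi (cut_eq0 l0 hy); lra.
have [hz|hz] := leP (2 * lam) (lsq z).
  by rewrite /Phi (cut_eq0 l0 hz); lra.
rewrite /Phi /q (cut_eq1 l20 (ltW hy)) (cut_eq1 l20 (ltW hz)) !mul1r sep_eq; [|have := l0; lra|have := l0; lra].
apply: (@le_trans _ _ (kap * ell (delta ^- 2 * enorm (y - z) ^+ 2))); last by lra.
apply: le_trans h _; apply: ler_wpM2l => //; rewrite /ell ler_ln ?posrE ?ell_den// lerD2l.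
have dd : 0 <= delta ^- 2 by rewrite invr_ge0 exprn_ge0// ltW.
rewrite ler_pXn2r// ?nnegrE; first 1 last.
- by apply: mulr_ge0 => //; exact: exprn_ge0.
- by apply: mulr_ge0 => //; apply: exprn_ge0; exact: enorm_ge0.
by apply: ler_wpM2l => //; rewrite ler_pXn2r ?nnegrE ?enorm_ge0// ltW.
Qed.

Lemma Phi_start x : lsq x <= lam ->
  Phi (logcut lam x) (logcut lam x) (q x) (q x) (fun i => p i x) (fun i => p i x) = 0.
Proof.
move=> h; rewrite /Phi (cut_eq1 l0 h) /sep big1 => [|i _]; last by rewrite subrr expr0n mulr0.
by rewrite ell0 mulr0 mulr0 addr0 -(natrD R 1 1) subrr.
Qed.

Lemma Phi_ac (t b : R) (P1 P2 Q1 Q2 f1 f2 g1 g2 : R -> R) (A B a b' : 'I_n -> R -> R) : t <= b ->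
  ac t b P1 f1 -> ac t b P2 f2 -> ac t b Q1 g1 -> ac t b Q2 g2 ->
  (forall i, ac t b (A i) (a i)) -> (forall i, ac t b (B i) (b' i)) ->
  ac t b (fun s => Phi (P1 s) (P2 s) (Q1 s) (Q2 s) (fun i => A i s) (fun i => B i s))
    (fun s => phi (f1 s) (f2 s) (Q1 s) (Q2 s) (g1 s) (g2 s) (fun i => A i s) (fun i => B i s)
       (fun i => a i s) (fun i => b' i s)).
Proof.
move=> tb hP1 hP2 hQ1 hQ2 hA hB.
have hU := ac_sum (index_enum 'I_n) (fun i => acZ (delta ^- 2) (ac_sqr tb (acB (hA i) (hB i)))).
have hl := ac_comp tb hU is_derive_ell continuous_ell'.
have h1 := acB (ac_cst t b 2) (acD hP1 hP2).
have h2 := acZ kap (acM tb (acM tb hQ1 hQ2) hl).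
have := acD h1 h2; congr (ac t b _ _).
by apply/funext => s; rewrite /phi -/(sep _ _) sub0r.
Qed.

End pointwise_rate.

(** * Absolutely continuous representatives in time *)

Section potentials.
Context {R : realType} {n : nat}.
Local Notation E := 'rV[R]_n.
Local Notation leb := (@lebesgue_rV R n).
Local Notation mu1 := (@lebesgue_measure R).
Local Notation mu := (@spacetime_measure R n).

(** At each time in []t, T[] it agrees with [beta (Y s x)] for almost every [x]. For almost every
    [x] it is absolutely continuous in [s], which the composition along the representative need not
    be. *)
Definition potential (t : R) (beta : E -> R) (rd : R -> E -> R) (s : R) (x : E) : R :=
  beta x + \int[mu1]_(r in `[t, s]) rd r x.

(** The interval of integration moves with [s]; the integral is written over all times against the
    indicator of [t <= r <= s], a measurable set of triples. *)
Lemma measurable_potential t beta rd : measurable_fun setT beta ->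
  measurable_fun setT (fun z : measurableTypeR R * E => rd z.1 z.2) ->
  measurable_fun setT (fun z : measurableTypeR R * E => potential t beta rd z.1 z.2).
Proof.
move=> mb mrd; apply: measurable_funD; first by apply: (measurableT_comp mb); exact: measurable_snd.
pose A : set ((measurableTypeR R * E) * measurableTypeR R) :=
  ~` [set u | u.2 < t] `&` ~` [set u | 0 < u.2 - u.1.1].
have mA : measurable A.
  apply: measurableI; apply: measurableC.
    by apply: (measurable_set_lt (f := fun u : (measurableTypeR R * E) * measurableTypeR R => u.2)); exact: measurable_snd.
  apply: (measurable_set_gt (f := fun u : (measurableTypeR R * E) * measurableTypeR R => u.2 - u.1.1)).
  apply: measurable_funB; first exact: measurable_snd.
  exact: (measurableT_comp measurable_fst measurable_fst).
pose w (u : (measurableTypeR R * E) * measurableTypeR R) : R := rd u.2 u.1.2 * \1_A u.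
have mw : measurable_fun setT w.
  apply: measurable_funM; last exact: measurable_indic.
  apply: (measurableT_comp (f := fun z : measurableTypeR R * E => rd z.1 z.2)
    (g := fun u : (measurableTypeR R * E) * measurableTypeR R => (u.2, u.1.2))) => //.
  apply/measurable_fun_pairP; split; first exact: measurable_snd.
  exact: (measurableT_comp measurable_snd measurable_fst).
have := @measurable_Rintegral_section _ _ (measurableTypeR R * E)%type (measurableTypeR R) R mu1 w mw.
congr (measurable_fun _ _); apply/funext => -[s x]; rewrite [RHS]Rintegral_mkcond.
apply: eq_Rintegral => r _; rewrite patchE /w /= indicE.
have -> : ((s, x, r) \in A) = (r \in `[t, s]%classic).
  rewrite mem_setE in_itv/=; apply/idP/idP => [/set_mem[/= h1 h2]|/andP[h1 h2]].
    by rewrite !leNgt; apply/andP; split; apply/negP => // h; apply: h2; rewrite subr_gt0.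
  apply/mem_set; split => /=; apply/negP; rewrite -leNgt//.
  by rewrite subr_le0.
by case: (r \in _); rewrite ?mulr1 ?mulr0.
Qed.

Lemma potential_ac t b beta (rd : R -> E -> R) :
  mu.-integrable setT (EFin \o (fun z => rd z.1 z.2)) ->
  {ae leb, forall x, ac t b (fun s => potential t beta rd s x) (fun s => rd s x)}.
Proof.
move=> i_; have h := ae_integrable2 i_; apply: (ae_imp h) => x hx; split.
  by apply: (integrableS measurableT) hx.
by move=> s sb; rewrite /potential set_itv1 Rintegral_set1 addr0.
Qed.

Lemma measurable_phi d (S : measurableType d) kap m (f1 f2 Q1 Q2 g1 g2 : S -> R) (A B a b : 'I_n -> S -> R) :
  measurable_fun setT f1 -> measurable_fun setT f2 -> measurable_fun setT Q1 -> measurable_fun setT Q2 ->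
  measurable_fun setT g1 -> measurable_fun setT g2 ->
  (forall i, measurable_fun setT (A i)) -> (forall i, measurable_fun setT (B i)) ->
  (forall i, measurable_fun setT (a i)) -> (forall i, measurable_fun setT (b i)) ->
  measurable_fun setT (fun z => phi kap m (f1 z) (f2 z) (Q1 z) (Q2 z) (g1 z) (g2 z)
    (fun i => A i z) (fun i => B i z) (fun i => a i z) (fun i => b i z)).
Proof.
move=> mf1 mf2 mQ1 mQ2 mg1 mg2 mA mB ma mb.
have msep : measurable_fun setT (fun z => sep m (fun i => A i z) (fun i => B i z)).
  apply: measurable_sum => i; apply: measurable_funM => //; apply: measurable_funX; exact: measurable_funB.
have msep' : measurable_fun setT (fun z => sep' m (fun i => A i z) (fun i => B i z) (fun i => a i z) (fun i => b i z)).
  apply: measurable_sum => i; apply: measurable_funM => //.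
  apply: measurable_funM; last exact: measurable_funB.
  by apply: measurable_funM => //; exact: measurable_funB.
have mell : measurable_fun setT (@ell R).
  apply: continuous_measurable_fun => u; apply: differentiable_continuous; apply/derivable1_diffP.
  by case: (is_derive_ell u).
have mell' : measurable_fun setT (@ell' R) by apply: continuous_measurable_fun; exact: continuous_ell'.
apply: measurable_funD.
  by apply: measurableT_comp => //; exact: measurable_funD.
apply: measurable_funM => //; apply: measurable_funD.
  apply: measurable_funM; last exact: (measurableT_comp mell msep).
  by apply: measurable_funD; apply: measurable_funM.
apply: measurable_funM; first exact: measurable_funM.
by apply: measurable_funM => //; exact: (measurableT_comp mell' msep).
Qed.

End potentials.

(** * A Chebyshev inequality for the functional *)

Section measure_bound.
Context {R : realType} {n : nat} (n0 : (0 < n)%N) (T t : R) (t0 : 0 <= t) (tT : t < T).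
Local Notation E := 'rV[R]_n.
Local Notation leb := (@lebesgue_rV R n).
Local Notation mu1 := (@lebesgue_measure R).
Local Notation mu := (@spacetime_measure R n).
Context (c c1 c2 X Y : R -> E -> E) (L : R).
Context (mc : measurable_field T c) (gc : growth_decomposition T c c1 c2)
  (fX : regular_lagrangian_flow T c t X) (cX : compression_constant T t X L).
Context (mY : measurable_fun (setT : set (measurableTypeR R * E)) (fun z => Y z.1 z.2))
  (YX : forall s, s \in `[t, T] -> {ae leb, forall x, Y s x = X s x}).
Context (b b1 b2 X' Y' : R -> E -> E) (L' : R).
Context (mb : measurable_field T b) (gb : growth_decomposition T b b1 b2)
  (fX' : regular_lagrangian_flow T b t X') (cX' : compression_constant T t X' L').
Context (mY' : measurable_fun (setT : set (measurableTypeR R * E)) (fun z => Y' z.1 z.2))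
  (YX' : forall s, s \in `[t, T] -> {ae leb, forall x, Y' s x = X' s x}).
Let D : set (measurableTypeR R * E) := slab t T.
Let D0 : set (measurableTypeR R * E) := slab 0 T.
Let mD : measurable D. Proof. exact: measurable_slab. Qed.
Let mD0 : measurable D0. Proof. exact: measurable_slab. Qed.

Context (lam kap r a : R) (m : nat) (l0 : 0 < lam) (k0 : 0 <= kap).
Context (hr : forall x : E, eball r x -> lsq x <= lam) (ha : leb (eball r) = a%:E).
Context (W : R -> E -> R) (W0 : forall s x, 0 <= W s x)
  (mW : measurable_fun setT (fun z : measurableTypeR R * E => W z.1 z.2))
  (hW : {ae mu1, forall s, s \in `]0, T[ -> forall x y,
     enorm (b s x - b s y) <= (`|x - y| + 2 ^- m) * (W s x + W s y)}).
Let Lam : R := expR (2 * lam) + 1.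
Let IB : E -> R := \1_(eball r).
Let IL : E -> R := \1_[set x : E | `|x| < Lam].

(** One index for all the functions followed along the flows: [None] for the cutoff at level [lam],
    [Some None] for the one at level [2 * lam], [Some (Some i)] for a cut coordinate. The index set
    being countable, one null set serves for all. *)
Let fam (o : option (option 'I_n)) : E -> R :=
  if o is Some o' then (if o' is Some i then cutcoord (4 * lam) i else logcut (2 * lam)) else logcut lam.

Let fam_cutoff o : exists M K, cutoff (fam o) M K.
Proof.
have l2 : 0 < 2 * lam by rewrite mulr_gt0.
have l4 : 0 < 4 * lam by rewrite mulr_gt0.
by case: o => [[i|]|] /=; [exists (expR (4 * lam) + 1 + cutC / (4 * lam)), (expR (4 * lam) + 1); exact: cutcoord_cutoff
  |exists (1 + cutC / (2 * lam)), (expR (2 * lam) + 1); exact: cut_cutoff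
  |exists (1 + cutC / lam), (expR lam + 1); exact: cut_cutoff].
Qed.

Let rd1 o := rate_density T t c Y (fam o).
Let rd2 o := rate_density T t b Y' (fam o).
Let P1 o := potential t (fam o) (rd1 o).
Let P2 o := potential t (fam o) (rd2 o).

Let ird1 o : mu.-integrable setT (EFin \o (fun z => rd1 o z.1 z.2)).
Proof. have [M [K h]] := fam_cutoff o; exact: (rate_density_integrable t0 mc gc fX cX mY YX h). Qed.
Let ird2 o : mu.-integrable setT (EFin \o (fun z => rd2 o z.1 z.2)).
Proof. have [M [K h]] := fam_cutoff o; exact: (rate_density_integrable t0 mb gb fX' cX' mY' YX' h). Qed.

Let mrd1 o : measurable_fun setT (fun z : measurableTypeR R * E => rd1 o z.1 z.2).
Proof. exact: (integrable_measurable (ird1 o)). Qed.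
Let mrd2 o : measurable_fun setT (fun z : measurableTypeR R * E => rd2 o z.1 z.2).
Proof. exact: (integrable_measurable (ird2 o)). Qed.
Let mfam o : measurable_fun setT (fam o).
Proof. have [M [K h]] := fam_cutoff o; exact: cutoff_measurable h. Qed.
Let mP1 o : measurable_fun setT (fun z : measurableTypeR R * E => P1 o z.1 z.2).
Proof. exact: (measurable_potential t (mfam o) (mrd1 o)). Qed.
Let mP2 o : measurable_fun setT (fun z : measurableTypeR R * E => P2 o z.1 z.2).
Proof. exact: (measurable_potential t (mfam o) (mrd2 o)). Qed.

Let q : option (option 'I_n) := Some None.
Let p (i : 'I_n) : option (option 'I_n) := Some (Some i).

(** The derivative of the functional, written with potentials and rate densities so as to be jointly
    measurable. *)
Let speed s x : R := phi kap m (rd1 None s x) (rd2 None s x) (P1 q s x) (P2 q s x) (rd1 q s x) (rd2 q s x)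
  (fun i => P1 (p i) s x) (fun i => P2 (p i) s x) (fun i => rd1 (p i) s x) (fun i => rd2 (p i) s x).

Let mspeed : measurable_fun setT (fun z : measurableTypeR R * E => speed z.1 z.2).
Proof.
apply: (@measurable_phi R n _ (measurableTypeR R * E)%type kap m (fun z => rd1 None z.1 z.2) (fun z => rd2 None z.1 z.2)
  (fun z => P1 q z.1 z.2) (fun z => P2 q z.1 z.2) (fun z => rd1 q z.1 z.2) (fun z => rd2 q z.1 z.2)
  (fun i z => P1 (p i) z.1 z.2) (fun i z => P2 (p i) z.1 z.2) (fun i z => rd1 (p i) z.1 z.2) (fun i z => rd2 (p i) z.1 z.2)) => //.
Qed.

Let slice s : t < s -> s < T -> {ae leb, forall x, forall o, P1 o s x = fam o (Y s x) /\ P2 o s x = fam o (Y' s x)}.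
Proof.
move=> ts sT; apply: ae_countable => o; have [M [K h]] := fam_cutoff o.
have h1 := flow_pointwise n0 t0 tT mc gc fX cX mY YX h ts sT.
have h2 := flow_pointwise n0 t0 tT mb gb fX' cX' mY' YX' h ts sT.
by apply: (ae_imp (ae_and h1 h2)) => x [e1 e2]; split; rewrite ?e1 ?e2.
Qed.

Let K1 : R := cutC / lam * (1 + kap * ellmax lam m).
Let g s z : R := enorm (c s z - b s z) * IL z.
Let W1 s z : R := IL z * W s z.
(** Majorant of the speed over the ball: relative speeds of both flows, the distance of the two
    fields along the first flow only, and [W] along both. In the application the first flow is the
    approximating one. *)
Let H (z : R * E) : R := K1 * (relative_speed c z.1 (Y z.1 z.2) * IB z.2 + relative_speed b z.1 (Y' z.1 z.2) * IB z.2) +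
  8 * kap * (2 ^+ m * g z.1 (Y z.1 z.2) + (W1 z.1 (Y z.1 z.2) + W1 z.1 (Y' z.1 z.2))).

Let IB0 x : 0 <= IB x. Proof. by []. Qed.
Let IL0 x : 0 <= IL x. Proof. by []. Qed.
Let K10 : 0 <= K1.
Proof.
apply: mulr_ge0; first by apply: divr_ge0; [exact: cutC_ge0|exact: ltW].
by apply: addr_ge0 => //; apply: mulr_ge0 => //; exact: ellmax_ge0.
Qed.
Let g0 s z : 0 <= g s z. Proof. by apply: mulr_ge0 => //; exact: enorm_ge0. Qed.
Let W10 s z : 0 <= W1 s z. Proof. exact: mulr_ge0. Qed.
Let k80 : 0 <= 8 * kap. Proof. exact: mulr_ge0. Qed.

Let IL_small z : logcut (2 * lam) z != 0 -> IL z = 1.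
Proof.
move=> hz; rewrite /IL indicE mem_set//= /Lam.
have h : lsq z <= 2 * (2 * lam) by apply: ltW; have := q_small l0 hz; rewrite mulrA -(natrM R 2 2).
by apply: le_lt_trans (norm_le_enorm z) _; have := lsq_bound h; lra.
Qed.

Let speed_le : {ae mu1, forall s, s \in `]t, T[ -> {ae leb, forall x, `|speed s x| * IB x <= H (s, x)}}.
Proof.
apply: (ae_imp hW) => s hs st.
have sT : s \in `]0, T[ by move: st; rewrite !in_itv/= => /andP[h ->]; rewrite (le_lt_trans t0 h).
have {}hs := hs sT.
have sl : {ae leb, forall x, forall o, P1 o s x = fam o (Y s x) /\ P2 o s x = fam o (Y' s x)}.
  by move: st; rewrite in_itv/= => /andP[ts sT']; exact: slice.
apply: (ae_imp sl) => x hx.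
have rE1 o : rd1 o s x = dotp (grad (fam o) (Y s x)) (c s (Y s x)) by rewrite /rd1 /rate_density slab_patch.
have rE2 o : rd2 o s x = dotp (grad (fam o) (Y' s x)) (b s (Y' s x)) by rewrite /rd2 /rate_density slab_patch.
have H0 : 0 <= H (s, x).
  apply: addr_ge0; apply: mulr_ge0 => //.
    by apply: addr_ge0; apply: mulr_ge0 => //; exact: relative_speed_ge0.
  apply: addr_ge0; first by apply: mulr_ge0 => //; exact: exprn_ge0.
  exact: addr_ge0.
have [xB|xB] := boolP (x \in eball r); last by rewrite /IB indicE (negbTE xB) mulr0.
have e1 : IB x = 1 by rewrite /IB indicE xB.
have := phi_le m l0 k0 (Y s x) (Y' s x) (c s (Y s x)) (b s (Y' s x)).
have -> : speed s x = phi kap m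
  (dotp (grad (logcut lam) (Y s x)) (c s (Y s x))) (dotp (grad (logcut lam) (Y' s x)) (b s (Y' s x)))
  (logcut (2 * lam) (Y s x)) (logcut (2 * lam) (Y' s x))
  (dotp (grad (logcut (2 * lam)) (Y s x)) (c s (Y s x))) (dotp (grad (logcut (2 * lam)) (Y' s x)) (b s (Y' s x)))
  (fun i => cutcoord (4 * lam) i (Y s x)) (fun i => cutcoord (4 * lam) i (Y' s x))
  (fun i => dotp (grad (cutcoord (4 * lam) i) (Y s x)) (c s (Y s x)))
  (fun i => dotp (grad (cutcoord (4 * lam) i) (Y' s x)) (b s (Y' s x))).
  have eA : (fun i => P1 (p i) s x) = (fun i => cutcoord (4 * lam) i (Y s x)).
    by apply/funext => i; exact: (hx (p i)).1.
  have eB : (fun i => P2 (p i) s x) = (fun i => cutcoord (4 * lam) i (Y' s x)).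
    by apply/funext => i; exact: (hx (p i)).2.
  have ea : (fun i => rd1 (p i) s x) = (fun i => dotp (grad (cutcoord (4 * lam) i) (Y s x)) (c s (Y s x))).
    by apply/funext => i; exact: rE1.
  have eb : (fun i => rd2 (p i) s x) = (fun i => dotp (grad (cutcoord (4 * lam) i) (Y' s x)) (b s (Y' s x))).
    by apply/funext => i; exact: rE2.
  by rewrite /speed eA eB ea eb (rE1 None) (rE2 None) (hx q).1 (hx q).2 (rE1 q) (rE2 q).
move=> hphi; rewrite e1 mulr1; apply: le_trans hphi _; rewrite /H /= e1 !mulr1.
apply: lerD; first by rewrite /relative_speed.
apply: ler_wpM2l => //.
have nn : 0 <= 2 ^+ m * g s (Y s x) + (W1 s (Y s x) + W1 s (Y' s x)).
  apply: addr_ge0; first by apply: mulr_ge0 => //; exact: exprn_ge0.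
  exact: addr_ge0.
case: ifPn => // /andP[h1 h2].
have i1 := IL_small h1; have i2 := IL_small h2.
rewrite /g /W1 i1 i2 !mul1r mulr1.
have dd : 0 < 2 ^- m :> R by rewrite invr_gt0 exprn_gt0.
have D0' := enorm_ge0 (Y s x - Y' s x).
have den : 0 < enorm (Y s x - Y' s x) + 2 ^- m by rewrite ltr_wpDl.
rewrite ler_pdivrMr//.
(* The fields are compared with each other at the first point, and then [b] with itself between the
   two points, so that the logarithmic estimate is applied to the limit field alone. The denominator
   is at least [2^-m], whence the factor [2^m] in front of [g]. *)
have tri : enorm (c s (Y s x) - b s (Y' s x)) <= enorm (c s (Y s x) - b s (Y s x)) + enorm (b s (Y s x) - b s (Y' s x)).
  by rewrite (_ : c s (Y s x) - b s (Y' s x) = (c s (Y s x) - b s (Y s x)) + (b s (Y s x) - b s (Y' s x))) ?enormD// addrA subrK.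
apply: le_trans tri _; rewrite mulrDl; apply: lerD.
  have e0 := enorm_ge0 (c s (Y s x) - b s (Y s x)).
  rewrite -[X in X <= _](mulKf (_ : 2 ^+ m != 0 :> R)); last by rewrite expf_neq0.
  rewrite mulrC; apply: ler_wpM2l; first by apply: mulr_ge0 => //; exact: exprn_ge0.
  by rewrite lerDr.
apply: le_trans (hs _ _) _; rewrite mulrC; apply: ler_wpM2l; first exact: addr_ge0.
by rewrite lerD2r; exact: norm_le_enorm.
Qed.

Let S1 : \bar R := (L%:E * norm_L1L1 T c1 + a%:E * norm_L1Linfty T c2)%E.
Let S2 : \bar R := (L'%:E * norm_L1L1 T b1 + a%:E * norm_L1Linfty T b2)%E.

Let mrel (v : R -> E -> E) : measurable_field T v ->
  measurable_fun D0 (fun z => relative_speed v z.1 z.2).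
Proof.
move=> mv; apply: measurable_funM; first by apply: (measurableT_comp measurable_enorm).
apply: measurable_funTS; apply: measurable_fun_invr_gt0; first by move=> z; exact: enorm1_gt0.
by apply: measurable_funD => //; apply: (measurableT_comp measurable_enorm); exact: measurable_snd.
Qed.

Let mIB : measurable_fun D (fun z => IB z.2).
Proof.
apply: measurable_funTS; apply: (measurableT_comp (f := IB)); last exact: measurable_snd.
by apply: measurable_indic; exact: measurable_eball.
Qed.

Let mIL : measurable_fun D0 (fun z => IL z.2).
Proof. by apply: measurable_funTS; exact: measurable_indic_snd. Qed.

Let mg : measurable_fun D0 (fun z => g z.1 z.2).
Proof.
apply: measurable_funM => //.
have -> : (fun z : R * E => enorm (c z.1 z.2 - b z.1 z.2)) =
    Num.sqrt \o (fun z : R * E => \sum_i (c z.1 z.2 ord0 i - b z.1 z.2 ord0 i) * (c z.1 z.2 ord0 i - b z.1 z.2 ord0 i)).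
  by apply/funext => z; rewrite /enorm /dotp /=; congr Num.sqrt; apply: eq_bigr => i _; rewrite !mxE.
apply: measurableT_comp; first by apply: continuous_measurable_fun; exact: sqrt_continuous.
have mB i : measurable_fun D0 (fun z => c z.1 z.2 ord0 i - b z.1 z.2 ord0 i).
  by apply: measurable_funB; [exact: (measurableT_comp (measurable_coord i) mc)|exact: (measurableT_comp (measurable_coord i) mb)].
by apply: measurable_sum => i; exact: measurable_funM.
Qed.

Let mW1 : measurable_fun D0 (fun z => W1 z.1 z.2).
Proof. by apply: measurable_funM => //; exact: measurable_funTS. Qed.

Let A1 (z : R * E) := relative_speed c z.1 (Y z.1 z.2) * IB z.2.
Let A2 (z : R * E) := relative_speed b z.1 (Y' z.1 z.2) * IB z.2.
Let A3 (z : R * E) := g z.1 (Y z.1 z.2).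
Let A4 (z : R * E) := W1 z.1 (Y z.1 z.2).
Let A5 (z : R * E) := W1 z.1 (Y' z.1 z.2).
Let mA1 : measurable_fun D A1.
Proof. by apply: measurable_funM => //; exact: (slab_measurable_flow t0 (mrel mc) mY). Qed.
Let mA2 : measurable_fun D A2.
Proof. by apply: measurable_funM => //; exact: (slab_measurable_flow t0 (mrel mb) mY'). Qed.
Let mA3 : measurable_fun D A3. Proof. exact: (slab_measurable_flow t0 mg mY). Qed.
Let mA4 : measurable_fun D A4. Proof. exact: (slab_measurable_flow t0 mW1 mY). Qed.
Let mA5 : measurable_fun D A5. Proof. exact: (slab_measurable_flow t0 mW1 mY'). Qed.
Let A10 z : 0 <= A1 z. Proof. by apply: mulr_ge0 => //; exact: relative_speed_ge0. Qed.
Let A20 z : 0 <= A2 z. Proof. by apply: mulr_ge0 => //; exact: relative_speed_ge0. Qed.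
Let A30 z : 0 <= A3 z. Proof. exact: g0. Qed.
Let A40 z : 0 <= A4 z. Proof. exact: W10. Qed.
Let A50 z : 0 <= A5 z. Proof. exact: W10. Qed.

Let HE : H = (fun z => K1 * (1 * A1 z + 1 * A2 z) + 8 * kap * (2 ^+ m * A3 z + 1 * (1 * A4 z + 1 * A5 z))).
Proof. by apply/funext => z; rewrite !mul1r. Qed.

Let mlin (k1 k2 : R) (f1 f2 : R * E -> R) : measurable_fun D f1 -> measurable_fun D f2 ->
  measurable_fun D (fun z => k1 * f1 z + k2 * f2 z).
Proof. by move=> m1 m2; apply: measurable_funD; exact: measurable_funM. Qed.

Let lin (k1 k2 : R) (f1 f2 : R * E -> R) : 0 <= k1 -> 0 <= k2 ->
  measurable_fun D f1 -> measurable_fun D f2 -> (forall z, 0 <= f1 z) -> (forall z, 0 <= f2 z) ->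
  (\int[mu]_(z in D) (k1 * f1 z + k2 * f2 z)%:E =
   k1%:E * \int[mu]_(z in D) (f1 z)%:E + k2%:E * \int[mu]_(z in D) (f2 z)%:E)%E.
Proof.
move=> h1 h2 m1 m2 p1 p2.
rewrite -ge0_integralZl//; [|exact/measurable_EFinP|by move=> z _; rewrite lee_fin].
rewrite -ge0_integralZl//; [|exact/measurable_EFinP|by move=> z _; rewrite lee_fin].
rewrite -ge0_integralD//.
- by move=> z _; rewrite mule_ge0// lee_fin.
- by apply: measurable_funeM; exact/measurable_EFinP.
- by move=> z _; rewrite mule_ge0// lee_fin.
- by apply: measurable_funeM; exact/measurable_EFinP.
Qed.

Let linp (k1 k2 : R) (f1 f2 : R * E -> R) : 0 <= k1 -> 0 <= k2 ->
  (forall z, 0 <= f1 z) -> (forall z, 0 <= f2 z) -> forall z, 0 <= k1 * f1 z + k2 * f2 z.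
Proof. by move=> h1 h2 p1 p2 z; apply: addr_ge0; exact: mulr_ge0. Qed.

Let m20 : 0 <= 2 ^+ m :> R. Proof. exact: exprn_ge0. Qed.

Let mH : measurable_fun D H.
Proof. by rewrite HE; apply: mlin; apply: mlin => //; exact: mlin. Qed.

Let int_H : (\int[mu]_(z in D) (H z)%:E <= K1%:E * (S1 + S2) + (8 * kap)%:E *
   ((2 ^+ m * L)%:E * \int[mu]_(z in D0) (g z.1 z.2)%:E + (L + L')%:E * \int[mu]_(z in D0) (W1 z.1 z.2)%:E))%E.
Proof.
have [L0 _] := cX; have [L0' _] := cX'.
have p12 := linp ler01 ler01 A10 A20; have p45 := linp ler01 ler01 A40 A50.
have p345 := linp m20 ler01 A30 p45.
have m12 := mlin 1 1 mA1 mA2; have m45 := mlin 1 1 mA4 mA5; have m345 := mlin (2 ^+ m) 1 mA3 m45.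
rewrite HE (lin K10 k80 m12 m345 p12 p345) (lin ler01 ler01 mA1 mA2 A10 A20).
rewrite (lin m20 ler01 mA3 m45 A30 p45) (lin ler01 ler01 mA4 mA5 A40 A50) !mul1e.
have oc s : s \in `]t, T[ -> s \in `[t, T] by rewrite !in_itv/= => /andP[/ltW -> /ltW ->].
apply: leeD; apply: lee_wpmul2l; rewrite ?lee_fin//.
  apply: leeD.
    apply: (flow_speed_bound t0 L0 mc gc mY) => //; last exact: measurable_eball.
    by move=> s st; apply: (flow_compressive fX cX mY YX); exact: oc.
  apply: (flow_speed_bound t0 L0' mb gb mY') => //; last exact: measurable_eball.
  by move=> s st; apply: (flow_compressive fX' cX' mY' YX'); exact: oc.
apply: leeD.
  rewrite EFinM -muleA; apply: lee_wpmul2l; first by rewrite lee_fin.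
  exact: (flow_integral_le t0 fX cX mY YX mg g0).
rewrite EFinD ge0_muleDl ?lee_fin//; apply: leeD.
  exact: (flow_integral_le t0 fX cX mY YX mW1 W10).
exact: (flow_integral_le t0 fX' cX' mY' YX' mW1 W10).
Qed.

(** For almost every [x] in the ball the functional is zero at time [t], both potentials starting
    from [x] within the level [lam], and at least one at time [tau] if the flows are then more than
    [gam] apart. On the exceptional set the integral of the absolute speed is thus at least one, so
    the measure of this set is at most the integral of [H]. *)
Lemma measure_bound (tau gam : R) : t < tau -> tau < T -> 0 <= gam ->
  1 <= kap * ell ((2 ^- m) ^- 2 * gam ^+ 2) ->
  (leb (exceeds_in r gam (X tau) (X' tau)) <= K1%:E * (S1 + S2) + (8 * kap)%:E *
   ((2 ^+ m * L)%:E * \int[mu]_(z in D0) (g z.1 z.2)%:E + (L + L')%:E * \int[mu]_(z in D0) (W1 z.1 z.2)%:E))%E.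
Proof.
move=> tt tauT g0' hk; apply: le_trans int_H.
have tau1 : tau \in `[t, T] by rewrite in_itv/= !ltW.
have [[mX _] _ _ X0 _] := fX; have [[mX' _] _ _ X0' _] := fX'.
have mS : measurable (exceeds_in r gam (X tau) (X' tau)) by apply: measurable_exceeds_in; [exact: mX|exact: mX'].
pose J x := (\int[mu1]_s (`|speed s x| * \1_(`]t, T[%classic : set R) s * IB x)%:E)%E.
have FJ0 s x : (0 <= (`|speed s x| * \1_(`]t, T[%classic : set R) s * IB x)%:E)%E.
  by rewrite lee_fin; apply: mulr_ge0 => //; exact: mulr_ge0.
pose F (z : measurableTypeR R * E) := (`|speed z.1 z.2| * \1_(`]t, T[%classic : set R) z.1 * IB z.2)%:E.
have mF : measurable_fun setT F.
  apply/measurable_EFinP; apply: measurable_funM.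
    apply: measurable_funM; first exact: measurableT_comp.
    by apply: (measurableT_comp (f := \1_(`]t, T[%classic : set R) : R -> R)) => //; exact: measurable_fst.
  apply: (measurableT_comp (f := IB)); last exact: measurable_snd.
  by apply: measurable_indic; exact: measurable_eball.
have F0 z : (0 <= F z)%E by exact: FJ0.
apply: (@le_trans _ _ (\int[leb]_x J x)%E).
  rewrite -[X in leb X]setIT -integral_indic//.
  have a1 : {ae leb, forall x, forall o, ac t tau (fun s => P1 o s x) (fun s => rd1 o s x) /\
      ac t tau (fun s => P2 o s x) (fun s => rd2 o s x)}.
    apply: ae_countable => o; apply: ae_and; apply: potential_ac; [exact: ird1|exact: ird2].
  have a2 := slice tt tauT.
  have a3 := ae_and (YX tau1) (YX' tau1).
  have [N [mN N0 hN]] := ae_and a1 (ae_and a2 a3).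
  apply: (@le_integral_off_null _ _ _ leb N) => //.
  - by move=> x _; apply: integral_ge0 => s _; exact: FJ0.
  move=> x _ xN.
  have [hac [hsl [yx yx']]] : (forall o, ac t tau (fun s => P1 o s x) (fun s => rd1 o s x) /\
      ac t tau (fun s => P2 o s x) (fun s => rd2 o s x)) /\
      ((forall o, P1 o tau x = fam o (Y tau x) /\ P2 o tau x = fam o (Y' tau x)) /\
       (Y tau x = X tau x /\ Y' tau x = X' tau x)).
    by apply: contra_notP xN => h; exact: hN.
  rewrite indicE; have [xS|xS] := boolP (x \in exceeds_in r gam (X tau) (X' tau)); last first.
    by apply: integral_ge0 => s _; exact: FJ0.
  have [xB xg] := set_mem xS.
  have hA := Phi_ac kap m (ltW tt) (hac None).1 (hac None).2 (hac q).1 (hac q).2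
    (fun i => (hac (p i)).1) (fun i => (hac (p i)).2).
  have [iph hph] := hA.
  have ttau : tau \in `[t, tau] by rewrite in_itv/= lexx ltW.
  have st0 : Phi kap m (P1 None t x) (P2 None t x) (P1 q t x) (P2 q t x) (fun i => P1 (p i) t x) (fun i => P2 (p i) t x) = 0.
    have e1 o : P1 o t x = fam o x by rewrite /P1 /potential set_itv1 Rintegral_set1 addr0.
    have e2 o : P2 o t x = fam o x by rewrite /P2 /potential set_itv1 Rintegral_set1 addr0.
    have eA : (fun i => P1 (p i) t x) = (fun i => cutcoord (4 * lam) i x) by apply/funext => i; exact: e1.
    have eB : (fun i => P2 (p i) t x) = (fun i => cutcoord (4 * lam) i x) by apply/funext => i; exact: e2.
    by rewrite eA eB (e1 None) (e2 None) (e1 q) (e2 q); exact: (Phi_start kap m l0 (hr xB)).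
  have := hph tau ttau; rewrite /= st0 add0r => hPhi.
  have hge : 1 <= \int[mu1]_(s in `[t, tau]) speed s x.
    rewrite -[X in _ <= X]hPhi.
    have xg' : gam < enorm (Y tau x - Y' tau x) by rewrite yx yx'.
    have := Phi_ge1 l0 k0 g0' hk xg'.
    have eA : (fun i => P1 (p i) tau x) = (fun i => cutcoord (4 * lam) i (Y tau x)).
      by apply/funext => i; exact: (hsl (p i)).1.
    have eB : (fun i => P2 (p i) tau x) = (fun i => cutcoord (4 * lam) i (Y' tau x)).
      by apply/funext => i; exact: (hsl (p i)).2.
    by rewrite eA eB (hsl None).1 (hsl None).2 (hsl q).1 (hsl q).2.
  have mtt : measurable (`[t, tau]%classic : set (measurableTypeR R)) by exact: measurable_itv.
  apply: (@le_trans _ _ (\int[mu1]_(s in `[t, tau]) speed s x)%:E); first by rewrite lee_fin.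
  rewrite /Rintegral fineK; last exact: integrable_fin_num.
  apply: le_trans (lee_abs _) _; apply: le_trans (le_abse_integral _ _ _) _ => //; first exact: measurable_int iph.
  (* The interval [[t, tau]] leaves []t, T[] at the single time [t]. *)
  have mt : mu1 [set t] = 0%E by exact: lebesgue_measure_set1.
  apply: (@le_integral_off_null _ _ _ mu1 [set t]) => //.
  move=> s /= st nst; have i1 : IB x = 1 by rewrite /IB indicE mem_set.
  have i2 : \1_(`]t, T[%classic : set R) s = 1 :> R.
    rewrite indicE mem_set//=; move: st; rewrite !in_itv/= => /andP[h1 h2].
    rewrite (le_lt_trans h2 tauT) andbT lt_neqAle h1 andbT.
    by apply/eqP => h; apply: nst; rewrite h.
  by rewrite i1 i2 !mulr1.
have -> : (\int[leb]_x J x = \int[mu]_z F z)%E by rewrite (fubini_tonelli2 F mF F0).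
have -> : (\int[mu]_z F z = \int[mu]_(z in D) (`|speed z.1 z.2| * IB z.2)%:E)%E.
  rewrite [RHS]integral_mkcond; apply: eq_integral => -[s x] _; rewrite patchE /F /= indicE.
  rewrite (_ : ((s, x) \in D) = (s \in `]t, T[%classic)); first by case: (s \in _); rewrite ?mulr1 ?mulr0 ?mul0r.
  by apply/idP/idP => /set_mem; [move=> [h _]; exact: mem_set|move=> h; apply: mem_set; split].
have msi : measurable_fun D (fun z => `|speed z.1 z.2| * IB z.2).
  apply: measurable_funTS; apply: measurable_funM; first exact: measurableT_comp.
  apply: (measurableT_comp (f := IB)); last exact: measurable_snd.
  by apply: measurable_indic; exact: measurable_eball.
have H0 z : 0 <= H z.
  apply: addr_ge0; apply: mulr_ge0 => //.
    by apply: addr_ge0; apply: mulr_ge0 => //; exact: relative_speed_ge0.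
  apply: addr_ge0; first by apply: mulr_ge0 => //; exact: exprn_ge0.
  exact: addr_ge0.
rewrite slab_Tonelli; [|exact/measurable_EFinP|by move=> z _; rewrite lee_fin; apply: mulr_ge0].
rewrite slab_Tonelli; [|exact/measurable_EFinP|by move=> z _; rewrite lee_fin].
have [N [mN N0 hN]] := speed_le.
apply: (@le_integral_off_null _ _ _ mu1 N) => //.
- by move=> s _; apply: integral_ge0 => x _; rewrite lee_fin; apply: mulr_ge0.
- by move=> s _; apply: integral_ge0 => x _; rewrite lee_fin.
move=> s st sN.
have [N' [mN' N'0 hN']] : {ae leb, forall x, `|speed s x| * IB x <= H (s, x)}.
  by apply: contra_notP sN => h; apply: hN => /= /(_ st).
apply: (@le_integral_off_null _ _ _ leb N') => //.
- by move=> x _; rewrite lee_fin; apply: mulr_ge0.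
- by move=> x _; rewrite lee_fin.
by move=> x _ xN; rewrite lee_fin; apply: contra_notP xN => h; exact: hN'.
Qed.

End measure_bound.

(** * Stability *)

Section quotients.
Context {R : realFieldType}.

Lemma mul_quotient_le (u e : R) : 0 <= u -> 0 <= e -> u * (e / (u + 1)) <= e.
Proof.
move=> u0 e0; have u1 : 0 < u + 1 by rewrite ltr_wpDl.
by rewrite mulrA ler_pdivrMr// mulrC ler_wpM2l// lerDl.
Qed.

Lemma quotient_swap_le (z e x : R) : 0 < e -> 0 < x -> z / e <= x -> z / x <= e.
Proof. by move=> e0 x0; rewrite !ler_pdivrMr// mulrC. Qed.

End quotients.

(** * Choice of the parameters *)

Section stability.
Context {R : realType} {n : nat} (n0 : (0 < n)%N) (T : R) (T0 : 0 < T).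
Local Notation E := 'rV[R]_n.
Local Notation leb := (@lebesgue_rV R n).
Local Notation mu := (@spacetime_measure R n).

Lemma norm_L1L1_ge0 (v : R -> E -> E) : (0 <= norm_L1L1 T v)%E.
Proof. by apply: integral_ge0 => s _; apply: integral_ge0 => x _; rewrite lee_fin enorm_ge0. Qed.

Lemma norm_L1Linfty_ge0 (v : R -> E -> E) : (0 <= norm_L1Linfty T v)%E.
Proof.
apply: integral_ge0 => s _; apply: ess_sup_gee; first exact: leb_setT_gt0.
by apply: aeW => y; rewrite lee_fin enorm_ge0.
Qed.

Lemma eball_finite (r : R) : 0 < r -> exists2 a : R, 0 <= a & leb (eball r) = a%:E.
Proof.
move=> r0; exists (fine (leb (eball r))); first by rewrite fine_ge0// measure_ge0.
rewrite fineK// ge0_fin_numE ?measure_ge0//.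
apply: (@le_lt_trans _ _ (leb [set x : E | `|x| < r])).
  apply: le_measure; rewrite ?inE; [exact: measurable_eball|exact: measurable_lt_norm|].
  by move=> x /=; exact: le_lt_trans (norm_le_enorm x).
by rewrite (lebesgue_cube n r0) ltry.
Qed.

Lemma lsq_eball (r : R) (x : E) : eball r x -> lsq x <= ln (1 + r ^+ 2).
Proof.
move=> xr; rewrite /lsq ler_ln ?posrE.
- rewrite lerD2l -enorm_sq; have x0 := enorm_ge0 x; have {}xr : enorm x < r := xr.
  by rewrite ler_pXn2r ?nnegrE// ltW// (le_lt_trans x0 xr).
- by rewrite ltr_pwDl// dotpp_ge0.
- by rewrite ltr_pwDl// sqr_ge0.
Qed.

(* [ln (1 + (2^(2m) gam^2)^2)] grows linearly in [m], which beats the [eps * m] of the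
   logarithmic estimate. *)
Lemma ell_lower (gam : R) (m : nat) : 0 < gam -> - 4 * ln gam <= m%:R * (ln 16 / 2) ->
  m%:R * (ln 16 / 2) <= ell ((2 ^- m) ^- 2 * gam ^+ 2).
Proof.
move=> g0 h.
have e : ((2 ^- m) ^- 2 * gam ^+ 2) ^+ 2 = 16 ^+ m * gam ^+ 4.
  have -> : (2 ^- m) ^- 2 = (2 ^+ m) ^+ 2 :> R by rewrite exprVn invrK.
  have -> : 16 ^+ m = (2 ^+ m) ^+ 4 :> R by rewrite -exprM mulnC exprM; congr (_ ^+ _); rewrite -natrX.
  ring.
apply: (@le_trans _ _ (ln (16 ^+ m * gam ^+ 4))).
  have p16 : 0 < 16 :> R by [].
  have -> : ln (16 ^+ m * gam ^+ 4) = m%:R * ln 16 + 4 * ln gam.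
    rewrite lnM; [|by rewrite posrE exprn_gt0|by rewrite posrE exprn_gt0].
    by rewrite (lnXn m p16) (lnXn 4 g0) -[ln 16 *+ m]mulr_natl -[ln gam *+ 4]mulr_natl.
  move: h; rewrite mulrA; set u := m%:R * ln 16; set v := ln gam; clearbody u v => h; lra.
rewrite /ell e ler_ln ?posrE ?mulr_gt0 ?exprn_gt0//; last first.
  by rewrite ltr_pwDl// ltW// mulr_gt0// exprn_gt0.
by rewrite lerDr.
Qed.

Context (bn bn1 bn2 : nat -> R -> E -> E) (b b1 b2 : R -> E -> E) (A : set R)
  (Xn : nat -> R -> R -> E -> E) (X : R -> R -> E -> E) (Ln : nat -> R) (L : R).
Context (bn_meas : forall k, measurable_field T (bn k)) (b_meas : measurable_field T b)
  (gb : growth_decomposition T b b1 b2) (b_R2 : cond_R2 T b) (bn_cvg : cvg_L1loc T bn b)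
  (A_neq0 : A !=set0) (A_sub : A `<=` `[0, T[)
  (Xn_flow : forall k t, A t -> regular_lagrangian_flow T (bn k) t (Xn k t))
  (X_flow : forall t, A t -> regular_lagrangian_flow T b t (X t))
  (Xn_compr : forall k t, A t -> compression_constant T t (Xn k t) (Ln k))
  (X_compr : forall t, A t -> compression_constant T t (X t) L)
  (gn : forall k, growth_decomposition T (bn k) (bn1 k) (bn2 k)).
Context (M ML : R) (hM : forall k, (norm_L1L1 T (bn1 k) + norm_L1Linfty T (bn2 k) <= M%:E)%E)
  (hML : forall k, Ln k <= ML).

Let At t : A t -> 0 <= t /\ t < T.
Proof. by move=> /A_sub /=; rewrite in_itv/= => /andP[]. Qed.

Let Ln0 k : 0 <= Ln k.
Proof. by have [t At'] := A_neq0; have [] := Xn_compr k At'. Qed.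

Let L0 : 0 <= L.
Proof. by have [t At'] := A_neq0; have [] := X_compr At'. Qed.

Let ML0 : 0 <= ML. Proof. exact: le_trans (Ln0 0) (hML 0). Qed.

Let M0 : 0 <= M.
Proof. by rewrite -lee_fin; apply: le_trans (hM 0); apply: adde_ge0; [exact: norm_L1L1_ge0|exact: norm_L1Linfty_ge0]. Qed.

(** Both equi-boundedness assumptions enter here: the total relative speed along the flows is
    bounded independently of [k] and of the initial time. *)
Let growth_bound (a : R) : 0 <= a -> exists2 Mt : R, 0 <= Mt & forall k,
  ((Ln k)%:E * norm_L1L1 T (bn1 k) + a%:E * norm_L1Linfty T (bn2 k) +
   (L%:E * norm_L1L1 T b1 + a%:E * norm_L1Linfty T b2) <= Mt%:E)%E.
Proof.
move=> a0; have [_ f1 _ f2 _] := gb.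
have g1 := norm_L1L1_ge0 b1; have g2 := norm_L1Linfty_ge0 b2.
have e1 : norm_L1L1 T b1 = (fine (norm_L1L1 T b1))%:E by rewrite fineK// ge0_fin_numE.
have e2 : norm_L1Linfty T b2 = (fine (norm_L1Linfty T b2))%:E by rewrite fineK// ge0_fin_numE.
exists (ML * M + a * M + (L * fine (norm_L1L1 T b1) + a * fine (norm_L1Linfty T b2))).
  by rewrite !addr_ge0// mulr_ge0// fine_ge0.
move=> k; rewrite !EFinD !EFinM -e1 -e2; apply: leeD => //.
have h1 : (norm_L1L1 T (bn1 k) <= M%:E)%E.
  exact: le_trans (leeDl _ (norm_L1Linfty_ge0 _)) (hM k).
have h2 : (norm_L1Linfty T (bn2 k) <= M%:E)%E.
  exact: le_trans (leeDr _ (norm_L1L1_ge0 _)) (hM k).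
apply: leeD.
  apply: lee_pmul.
  - by rewrite lee_fin; exact: Ln0.
  - exact: norm_L1L1_ge0.
  - by rewrite lee_fin; exact: hML.
  - exact: h1.
by apply: lee_wpmul2l; [rewrite lee_fin|exact: h2].
Qed.

Let cube_cvg (Lam eps : R) : 0 < Lam -> 0 < eps -> exists N : nat, forall k, (N <= k)%N ->
  (\int[mu]_(z in slab 0 T) (enorm (bn k z.1 z.2 - b z.1 z.2) * \1_[set x : E | (`|x| < Lam)%R] z.2)%:E <= eps%:E)%E.
Proof.
move=> Lam0 e0; have r0 : 0 < n%:R * Lam by rewrite mulr_gt0// ltr0n.
have /fine_cvgP[h1 h2] := bn_cvg r0.
have [N1 _ hN1] := h1; have [N2 _ hN2] := (cvgrPdist_le _ _).1 h2 eps e0.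
exists (maxn N1 N2) => k; rewrite geq_max => /andP[k1 k2].
have f1 := hN1 k k1; have f2 := hN2 k k2; rewrite /= sub0r normrN in f2.
apply: (@le_trans _ _ (\int[mu]_(z in (`]0%R, T[ `*` eball (n%:R * Lam))) (enorm (bn k z.1 z.2 - b z.1 z.2))%:E)%E).
  rewrite integral_mkcond [leRHS]integral_mkcond.
  apply: (@le_integral_off_null _ _ _ mu set0) => //.
  - move=> z _; rewrite patchE; case: ifP => // _; rewrite lee_fin; apply: mulr_ge0 => //; exact: enorm_ge0.
  - by move=> z _; rewrite patchE; case: ifP => // _; rewrite lee_fin enorm_ge0.
  move=> [s x] _ _; rewrite !patchE; case: ifPn => [/set_mem[/= hs _]|_]; last first.
    by case: ifP => // _; rewrite lee_fin enorm_ge0.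
  rewrite indicE; have [xL|xL] := ltP `|x| Lam.
    rewrite (mem_set (_ : [set x0 : E | `|x0| < Lam] x))// mulr1 mem_set//; split => //=.
    by rewrite /eball/=; apply: le_lt_trans (enorm_le_norm _) _; rewrite ltr_pM2l// ltr0n.
  rewrite memNset/=; last by apply/negP; rewrite -leNgt.
  by rewrite mulr0; case: ifP => // _; rewrite lee_fin enorm_ge0.
by rewrite -(fineK f1) lee_fin; exact: le_trans (ler_norm _) f2.
Qed.

(** Four errors, [eps / 4] each, and parameters chosen in this order: [lam] against the relative
    speeds, [e1] and with it the constant [Ce] of the logarithmic estimate, [m] against [gam], [lam]
    and [Ce], then [kap] as the inverse of the weight at distance [gam], and at last the rank [N]
    against [2^m]. All of them precede the choice of [t] and [tau], whence the uniformity. *)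
Lemma interior_stability (r gam eps : R) : 0 < r -> 0 < gam -> 0 < eps ->
  exists N : nat, forall k, (N <= k)%N -> forall t tau, A t -> t < tau -> tau < T ->
    (leb (exceeds_in r gam (Xn k t tau) (X t tau)) <= eps%:E)%E.
Proof.
move=> r0 gam0 eps0.
have [a a0 ha] := eball_finite r0; have [Mt Mt0 hMt] := growth_bound a0.
have l16 : 0 < ln 16 :> R by apply: ln_gt0; rewrite ltr1n.
(* By [ell_lower] the weight at distance [gam] is at least [m / c0] for large [m], so that
   [kap * m <= c0]. *)
pose c0 : R := 2 / ln 16; have c00 : 0 < c0 by rewrite divr_gt0.
have C0 := @cutC_ge0 R.
pose lr : R := ln (1 + r ^+ 2).
have lr0 : 0 <= lr by apply: ln_ge0; rewrite lerDl sqr_ge0.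
have e40 : 0 < eps / 4 by rewrite divr_gt0.
pose Z1 : R := cutC * (2 + 4 * c0) * Mt.
have Z10 : 0 <= Z1 by apply: mulr_ge0 => //; apply: mulr_ge0 => //; rewrite addr_ge0// mulr_ge0// ltW.
pose B1 : R := Z1 / (eps / 4).
have B10 : 0 <= B1 by apply: divr_ge0 => //; exact: ltW.
(* [lr] covers the starting points in the ball, [1] makes the level positive, and [B1] brings the
   contribution of the relative speeds down to [eps / 4]. *)
pose lam : R := lr + 1 + B1.
have lB : B1 <= lam by rewrite /lam lerDr addr_ge0.
have ll : lr <= lam by rewrite /lam -addrA lerDl addr_ge0.
have l0 : 0 < lam by rewrite /lam ltr_wpDr// ltr_wpDl.
have hr (x : E) : eball r x -> lsq x <= lam by move=> xr; exact: le_trans (lsq_eball xr) ll.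
pose Lam : R := expR (2 * lam) + 1.
have Lam0 : 0 < Lam by rewrite ltr_wpDl// expR_ge0.
pose LL : R := ML + L; have LL0 : 0 <= LL by rewrite addr_ge0.
pose V : R := 8 * LL * c0.
have V0 : 0 <= V by apply: mulr_ge0; [exact: mulr_ge0|exact: ltW].
pose e1 : R := eps / 4 / (V + 1).
have e10 : 0 < e1 by apply: divr_gt0 => //; rewrite ltr_wpDl.
have lb i : slab_locally_integrable T (fun z => b z.1 z.2 ord0 i).
  exact: (growth_locally_integrable _ b_meas gb).
have [Ce Ce0 hCe] := log_lipschitz T0 Lam0 b_meas b_R2 lb e10.
pose Z3 : R := 8 * c0 * (LL * Ce).
have B2b : 0 <= Z3 / (eps / 4).
  apply: divr_ge0; last exact: ltW.
  by apply: mulr_ge0; [apply: mulr_ge0 => //; exact: ltW|exact: mulr_ge0].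
have B2a : 0 <= 4 * `|ln gam| * c0 by apply: mulr_ge0; [exact: mulr_ge0|exact: ltW].
have B2c : 0 <= c0 * (5 + 8 * lam).
  by apply: mulr_ge0; [exact: ltW|rewrite addr_ge0// mulr_ge0// ltW].
(* The summands provide, in order, the hypothesis of [ell_lower], the bound
   [kap * (5 + 8 * lam) <= 1], and the smallness of [Ce / m]. The second keeps [1 + kap * ellmax]
   below [2 + 4 * c0], a constant free of [lam] and [m], which is what allowed [lam] to be fixed
   before [m]. *)
pose B2 : R := 4 * `|ln gam| * c0 + c0 * (5 + 8 * lam) + Z3 / (eps / 4).
pose m := (Num.truncn B2).+1.
have mB : B2 <= m%:R by apply: ltW; exact: truncnS_gt.
have mBa : 4 * `|ln gam| * c0 <= m%:R by move: mB; rewrite /B2; lra.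
have mBc : c0 * (5 + 8 * lam) <= m%:R by move: mB; rewrite /B2; lra.
have mBb : Z3 / (eps / 4) <= m%:R by move: mB; rewrite /B2; lra.
clearbody m; clear mB.
have [W [W0 mW iW hW]] := hCe m.
have m0 : 0 < m%:R :> R.
  by apply: lt_le_trans mBc; apply: mulr_gt0 => //; rewrite ltr_wpDr// mulr_ge0// ltW.
pose l := ell ((2 ^- m) ^- 2 * gam ^+ 2).
have c0E : m%:R * (ln 16 / 2) = m%:R / c0 by rewrite /c0 invf_div.
have hl : m%:R / c0 <= l.
  rewrite -c0E; apply: ell_lower => //; rewrite c0E ler_pdivlMr//.
  apply: le_trans mBa; apply: ler_wpM2r; first exact: ltW.
  by rewrite mulNr -mulrN; apply: ler_wpM2l => //; rewrite -normrN ler_norm.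
have mc0 : 0 < m%:R / c0 by rewrite divr_gt0.
have l00 : 0 < l by exact: lt_le_trans hl.
pose kap : R := l^-1; have k0 : 0 <= kap by rewrite invr_ge0 ltW.
have hk : 1 <= kap * l by rewrite mulVf// gt_eqF.
have kle : kap <= c0 / m%:R.
  rewrite /kap -[X in _ <= X]invf_div lef_pV2//; by rewrite posrE.
have km : kap * m%:R <= c0 by rewrite -ler_pdivlMr.
have h5 : kap * (5 + 8 * lam) <= 1.
  apply: (@le_trans _ _ (c0 / m%:R * (5 + 8 * lam))).
    by apply: ler_wpM2r => //; rewrite addr_ge0// mulr_ge0// ltW.
  by rewrite mulrAC ler_pdivrMr// mul1r.
clearbody kap.
pose U : R := 8 * kap * (2 ^+ m * ML).
have m20 : 0 <= 2 ^+ m :> R by exact: exprn_ge0.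
have k80 : 0 <= 8 * kap by exact: mulr_ge0.
have U0 : 0 <= U by apply: mulr_ge0 => //; exact: mulr_ge0.
pose eta : R := eps / 4 / (U + 1).
have eta0 : 0 < eta by apply: divr_gt0 => //; rewrite ltr_wpDl.
have [N hN] := cube_cvg Lam0 eta0.
exists N => k Nk t tau At' ttau tauT.
have [t0 tT] := At At'.
have fn := Xn_flow k At'; have fb := X_flow At'.
have [cn _ _ _ _] := fn; have [cb _ _ _ _] := fb.
have [Y [mY YX]] := joint_representative (ltW tT) cn.
have [Y' [mY' YX']] := joint_representative (ltW tT) cb.
have mb := measure_bound n0 t0 tT (bn_meas k) (gn k) fn (Xn_compr k At') mY YX
  b_meas gb fb (X_compr At') mY' YX' l0 k0 hr ha W0 mW hW ttau tauT (ltW gam0) hk.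
apply: le_trans mb _.
pose K1 : R := cutC / lam * (1 + kap * ellmax lam m).
have Cl : 0 <= cutC / lam by apply: divr_ge0 => //; exact: ltW.
have ke : 1 + kap * ellmax lam m <= 2 + 4 * c0.
  rewrite (_ : kap * ellmax lam m = kap * (5 + 8 * lam) + 4 * (kap * m%:R)); last by rewrite /ellmax; ring.
  lra.
have K10 : 0 <= K1.
  by apply: mulr_ge0 => //; apply: addr_ge0 => //; apply: mulr_ge0 => //; exact: ellmax_ge0.
have K1le : K1 * Mt <= eps / 4.
  apply: (@le_trans _ _ (Z1 / lam)); last exact: quotient_swap_le.
  rewrite (_ : Z1 / lam = cutC / lam * (2 + 4 * c0) * Mt); last by rewrite /Z1; ring.
  by apply: ler_wpM2r => //; apply: ler_wpM2l.
apply: (@le_trans _ _ (K1%:E * Mt%:E + (8 * kap)%:E * ((2 ^+ m * ML)%:E * eta%:E + LL%:E * (e1 * m%:R + Ce)%:E))%E).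
  apply: leeD; first by apply: lee_wpmul2l; [rewrite lee_fin|exact: hMt].
  apply: lee_wpmul2l; first by rewrite lee_fin.
  apply: leeD.
    apply: lee_pmul.
    - by rewrite lee_fin; apply: mulr_ge0.
    - apply: integral_ge0 => z _; rewrite lee_fin; apply: mulr_ge0 => //; exact: enorm_ge0.
    - by rewrite lee_fin; apply: ler_wpM2l.
    - exact: hN.
  apply: lee_pmul.
  - by rewrite lee_fin; apply: addr_ge0.
  - by apply: integral_ge0 => z _; rewrite lee_fin; apply: mulr_ge0.
  - by rewrite lee_fin lerD2r.
  - exact: iW.
rewrite -(EFinM K1) -(EFinM _ eta) -(EFinM LL) -(EFinD (2 ^+ m * ML * eta)%R).
rewrite -(EFinM (8 * kap)%R) -(EFinD (K1 * Mt)%R) lee_fin.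
have t1 : 8 * kap * (2 ^+ m * ML * eta) <= eps / 4.
  by rewrite mulrA; apply: mul_quotient_le => //; exact: ltW.
have t2 : 8 * kap * (LL * (e1 * m%:R)) <= eps / 4.
  rewrite (_ : 8 * kap * (LL * (e1 * m%:R)) = 8 * LL * e1 * (kap * m%:R)); last by ring.
  apply: (@le_trans _ _ (8 * LL * e1 * c0)).
    by apply: ler_wpM2l => //; apply: mulr_ge0; [exact: mulr_ge0|exact: ltW].
  rewrite (_ : 8 * LL * e1 * c0 = V * e1); last by rewrite /V; ring.
  by apply: mul_quotient_le => //; exact: ltW.
have t3 : 8 * kap * (LL * Ce) <= eps / 4.
  apply: (@le_trans _ _ (8 * (c0 / m%:R) * (LL * Ce))).
    by apply: ler_wpM2r; [exact: mulr_ge0|exact: ler_wpM2l].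
  rewrite (_ : 8 * (c0 / m%:R) * (LL * Ce) = Z3 / m%:R); last by rewrite /Z3; ring.
  exact: quotient_swap_le.
rewrite mulrDr [LL * _]mulrDr mulrDr; lra.
Qed.

(** The endpoints [t] and [T] are reached by continuity in measure, comparing [s] with an interior
    time [tau]. How close [tau] must be depends on [k], [t] and [s], which is harmless since the
    interior estimate holds for all [tau] from the same rank on. *)
Lemma stability (r gam eps : R) : 0 < r -> 0 < gam -> 0 < eps ->
  exists N : nat, forall k, (N <= k)%N -> forall t s, A t -> s \in `[t, T] ->
    (leb (exceeds_in r gam (Xn k t s) (X t s)) <= eps%:E)%E.
Proof.
move=> r0 g0 e0.
have g20 : 0 < gam / 2 by lra.
have g40 : 0 < gam / 2 / 2 by lra.
have e30 : 0 < eps / 3 by lra.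
have [N hN] := interior_stability r0 g40 e30.
exists N => k Nk t s At' sT; have [t0 tT] := At At'.
have [cn _ _ _ _] := Xn_flow k At'; have [cb _ _ _ _] := X_flow At'.
have [d1 d10 h1] := continuous_L0loc_near cn sT r0 g20 e30.
have [d2 d20 h2] := continuous_L0loc_near cb sT r0 g40 e30.
have [mXn _] := cn; have [mX _] := cb.
have [tau [ttau tauT taus]] : exists tau, [/\ t < tau, tau < T & `|tau - s| < Num.min d1 d2].
  have d0 : 0 < Num.min d1 d2 by rewrite lt_min d10.
  move: sT; rewrite in_itv/= => /andP[ts sT'].
  (* From the first half of the interval the time is moved to the right, from the second half to the
     left, by at most a third of the length, so that it stays strictly inside. *)
  set d := Num.min d1 d2 in d0 *; pose h := Num.min (d / 2) ((T - t) / 3).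
  have hd : h <= d / 2 by rewrite /h ge_min lexx.
  have hT : h <= (T - t) / 3 by rewrite /h ge_min lexx orbT.
  have h0 : 0 < h by rewrite /h lt_min; apply/andP; split; lra.
  have [sm|sm] := leP s ((t + T) / 2).
    exists (s + h); split; [lra|lra|].
    by rewrite addrAC subrr add0r gtr0_norm//; lra.
  exists (s - h); split; [lra|lra|].
  by rewrite addrAC subrr add0r normrN gtr0_norm//; lra.
move: taus; rewrite lt_min => /andP[ts1 ts2].
have tauI : tau \in `[t, T] by rewrite in_itv/= !ltW.
apply: le_trans (exceeds_in_measure_triangle r gam (mXn s sT) (mX s sT) (mXn tau tauI)) _.
have -> : eps%:E = ((eps / 3)%:E + ((eps / 3)%:E + (eps / 3)%:E))%E by rewrite -!EFinD; congr EFin; lra.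
apply: leeD; first by rewrite exceeds_in_sym; exact: h1.
apply: le_trans (exceeds_in_measure_triangle r (gam / 2) (mXn tau tauI) (mX s sT) (mX tau tauI)) _.
by apply: leeD; [exact: hN|exact: h2].
Qed.

End stability.

Theorem theorem6p2 (R : realType) (N : nat) (T : R)
  (bn bn1 bn2 : nat -> R -> 'rV[R]_N -> 'rV[R]_N)
  (b : R -> 'rV[R]_N -> 'rV[R]_N)
  (A : set R)
  (* [X t s x] is the position at time [s] of the flow started at time [t] *)
  (Xn : nat -> R -> R -> 'rV[R]_N -> 'rV[R]_N)
  (X : R -> R -> 'rV[R]_N -> 'rV[R]_N)
  (Ln : nat -> R) (L : R)
  (N_gt0 : (0 < N)%N) (T_gt0 : 0 < T)
  (bn_meas : forall k, measurable_field T (bn k))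
  (bn_R1 : forall k, cond_R1 T (bn k))
  (b_meas : measurable_field T b)
  (b_R1 : cond_R1 T b) (b_R2 : cond_R2 T b) (b_R3 : cond_R3 T b)
  (bn_cvg : cvg_L1loc T bn b)
  (A_neq0 : A !=set0) (A_sub : A `<=` `[0, T[)
  (Xn_flow : forall k t, A t -> regular_lagrangian_flow T (bn k) t (Xn k t))
  (X_flow : forall t, A t -> regular_lagrangian_flow T b t (X t))
  (Xn_compr : forall k t, A t -> compression_constant T t (Xn k t) (Ln k))
  (X_compr : forall t, A t -> compression_constant T t (X t) L)
  (bn_decomp : forall k, growth_decomposition T (bn k) (bn1 k) (bn2 k))
  (bn_bound : exists M : R, forall k,
     (norm_L1L1 T (bn1 k) + norm_L1Linfty T (bn2 k) <= M%:E)%E)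
  (Ln_bound : exists M : R, forall k, Ln k <= M) :
  forall r gamma : R, 0 < r -> 0 < gamma ->
    ereal_sup [set ereal_sup
      [set lebesgue_rV N [set x | eball r x /\
                            gamma < enorm (Xn k t s x - X t s x)]
         | s in `[t, T]]
      | t in A] @[k --> \oo] --> 0%E.
Proof.
move=> r gamma r0 g0; have [b1 [b2 gb]] := b_R1.
have [M hM] := bn_bound; have [ML hML] := Ln_bound.
set v := (fun k : nat => ereal_sup _).
(* The supremum of the empty set is [-oo], so nonnegativity of the outer supremum relies on the
   existence of an initial time. *)
have v0 k : (0 <= v k)%E.
  have [t At'] := A_neq0; have /A_sub/= := At'; rewrite in_itv/= => /andP[t0 tT].
  apply: (@le_trans _ _ (lebesgue_rV N (exceeds_in r gamma (Xn k t t) (X t t)))); first exact: measure_ge0.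
  apply: (@le_trans _ _ (ereal_sup [set lebesgue_rV N [set x | eball r x /\
      gamma < enorm (Xn k t s x - X t s x)] | s in `[t, T]])).
    by apply: ereal_sup_ubound; exists t => //=; rewrite in_itv/= lexx ltW.
  by apply: ereal_sup_ubound; exists t.
have key (e : R) : 0 < e -> exists K : nat, forall k, (K <= k)%N -> (v k <= e%:E)%E.
  move=> e0; have [K hK] := stability N_gt0 T_gt0 bn_meas b_meas gb b_R2 bn_cvg A_neq0 A_sub
    Xn_flow X_flow Xn_compr X_compr bn_decomp hM hML r0 g0 e0.
  exists K => k Kk; apply: ge_ereal_sup => _ [t At' <-]; apply: ge_ereal_sup => _ [s sT <-].
  exact: hK.
have fin k e : (v k <= e%:E)%E -> v k \is a fin_num.
  by move=> h; rewrite ge0_fin_numE//; apply: le_lt_trans h _; exact: ltry.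
apply/fine_cvgP; split.
  have [K hK] := key 1 ltr01; exists K => // k Kk; exact: fin (hK k Kk).
apply/cvgrPdist_le => e e0; have [K hK] := key e e0; exists K => // k Kk.
rewrite /= sub0r normrN ger0_norm; last exact: fine_ge0.
by rewrite -lee_fin fineK; [exact: hK|exact: fin (hK k Kk)].
Qed.
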